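(* Let $n\ge 2$, $s\in(0,1)$, let $B_1$ be the open unit ball of $\mathbb{R}^n$, and let $f:\mathbb{R}\to(0,\infty)$ be smooth, nondecreasing, with $\lim_{t\to+\infty} f(t)/t=+\infty$. Let $u^*$ be the extremal solution of $$(-\Delta)^s u=\lambda f(u)\ \text{ in } B_1,\qquad u=0\ \text{ on }\partial B_1 .$$ Then: (a) If $n<2\bigl(s+2+\sqrt{2(s+1)}\bigr)$, then $u^*\in L^\infty(B_1)$. (b) If $n\ge 2\bigl(s+2+\sqrt{2(s+1)}\bigr)$, then for any $\mu>\frac n2-1-\sqrt{n-1}-s$ there exists a constant $C>0$ such that $u^*(x)\le C|x|^{-\mu}$ for all $x\in B_1$ (with $|0|^{-\mu}=+\infty$; note that $\mu>0$ here).
   Context: Spectral fractional Laplacian: let $\{\varphi_k\}_{k\ge1}$ be an orthonormal basis of $L^2(B_1)$ of eigenfunctions of $-\Delta$ in $B_1$ with homogeneous Dirichlet boundary conditions, with eigenvalues $0<\mu_1<\mu_2\le\mu_3\le\dots\to+\infty$, $\varphi_1>0$. For $u\in L^2(B_1)$ put $u_k=\int_{B_1}u\varphi_k\,dx$. Let $H=\{u\in L^2(B_1):\|u\|_H^2=\sum_k\mu_k^s|u_k|^2<\infty\}$ and $(-\Delta)^su=\sum_k\mu_k^su_k\varphi_k$, an isometric isomorphism from $H$ onto its dual $H'$; $(-\Delta)^{-s}:H'\to H$ is its inverse. Weak solution: a measurable $u$ on $B_1$ with $\int_{B_1}|u|\varphi_1\,dx<\infty$ and $\int_{B_1}f(u)\varphi_1\,dx<\infty$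 is a weak solution of the problem if $\int_{B_1}u\psi\,dx=\lambda\int_{B_1}f(u)(-\Delta)^{-s}\psi\,dx$ for all $\psi\in C_c^\infty(B_1)$. Extremal solution: let $\lambda^*=\sup\{\lambda>0:\text{the problem has a solution in }H\cap L^\infty(B_1)\}$, which satisfies $0<\lambda^*<\infty$. For $0<\lambda<\lambda^*$ the problem has a minimal solution $u_\lambda\in H\cap L^\infty(B_1)$ (i.e. $u_\lambda\le u$ for every weak solution $u$ for the same $\lambda$), which is continuous on $\overline{B_1}$, and $u_\lambda$ increases with $\lambda$. The extremal solution is the pointwise limit $u^*=\lim_{\lambda\nearrow\lambda^*}u_\lambda$ (a weak solution for $\lambda=\lambda^*$). *)

(* Defs.v *)
From HB Require Import structures.
From mathcomp Require Import all_boot all_order all_algebra.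
From mathcomp Require Import all_classical all_reals all_analysis.
From mathcomp Require Import measurable_realfun.

Set Implicit Arguments.
Unset Strict Implicit.
Unset Printing Implicit Defensive.

Import Order.TTheory GRing.Theory Num.Theory.
Import numFieldNormedType.Exports.

Local Open Scope classical_set_scope.
Local Open Scope ring_scope.

Definition measure_rV_display : measure_display -> measure_display.
Proof. exact. Qed.

Section measurable_rV.
Context {d} {T : measurableType d}.
Variable n : nat.

(* The product sigma-algebra, as the library does for n.-tuple T; for T the
   real line these are the Borel sets. *)
Let coors : 'I_n -> 'rV[T]_n -> T := fun i x => x ord0 i.

Let rV_set0 : g_sigma_preimage coors set0.
Proof. exact: sigma_algebra0. Qed.

Let rV_setC A : g_sigma_preimage coors A -> g_sigma_preimage coors (~` A).
Proof. exact: sigma_algebraC. Qed.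

Let rV_bigcup (F : _^nat) : (forall i, g_sigma_preimage coors (F i)) ->
  g_sigma_preimage coors (\bigcup_i (F i)).
Proof. exact: sigma_algebra_bigcup. Qed.

HB.instance Definition _ := @isMeasurable.Build (measure_rV_display d)
  'rV[T]_n (g_sigma_preimage coors) rV_set0 rV_setC rV_bigcup.

End measurable_rV.

Lemma measurable_rV_coord d (T : measurableType d) n (i : 'I_n) :
  measurable_fun [set: 'rV[T]_n] (fun x : 'rV[T]_n => x ord0 i).
Proof.
move=> _ Y mY; rewrite setTI; apply: sub_sigma_algebra => /=.
rewrite -bigcup_seq/=; exists i => /=; first by rewrite mem_index_enum.
by exists Y => //; rewrite setTI.
Qed.

Lemma measurable_fun_rVP d d' (S : measurableType d) (T : measurableType d') n
    (f : S -> 'rV[T]_n) :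
  (forall i, measurable_fun [set: S] (fun x => f x ord0 i)) ->
  measurable_fun [set: S] f.
Proof.
move=> mf _ A; rewrite setTI /measurable/= => mA.
pose G : set (set 'rV[T]_n) := [set B | measurable (f @^-1` B)].
suff : G A by [].
move: A mA; apply: smallest_sub.
  split; first by rewrite /G/= preimage_set0.
    move=> B; rewrite /G/= => mB.
    by rewrite setTD preimage_setC; exact: measurableC.
  by move=> F mF; rewrite /G/= preimage_bigcup; exact: bigcupT_measurable.
rewrite -bigcup_seq/= => B [i _ [C mC <-]].
by rewrite /G/= setTI; have := mf i measurableT C mC; rewrite setTI.
Qed.

Section lebesgue_rV.
Variable R : realType.
Local Open Scope ereal_scope.

Definition cons_rV n (p : measurableTypeR R * 'rV[R]_n) : 'rV[R]_n.+1 :=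
  \row_i oapp (p.2 ord0) p.1 (unlift ord0 i).

Definition uncons_rV n (x : 'rV[R]_n.+1) :
    measurableTypeR R * 'rV[R]_n :=
  (x ord0 ord0, \row_i x ord0 (lift ord0 i)).

Lemma cons_rVK n : cancel (@cons_rV n) (@uncons_rV n).
Proof.
move=> [a v]; rewrite /uncons_rV /cons_rV; congr pair.
  by rewrite mxE unlift_none.
by apply/rowP => i; rewrite !mxE liftK.
Qed.

Lemma measurable_cons_rV n : measurable_fun setT (@cons_rV n).
Proof.
apply: measurable_fun_rVP => i; rewrite /cons_rV.
under eq_fun do rewrite mxE.
case: (unlift ord0 i) => [j|] /=; last exact: measurable_fst.
exact: (measurableT_comp (measurable_rV_coord j) measurable_snd).
Qed.

Lemma measurable_uncons_rV n : measurable_fun setT (@uncons_rV n).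
Proof.
apply: measurable_fun_pair; first exact: measurable_rV_coord.
apply: measurable_fun_rVP => i; under eq_fun do rewrite mxE.
exact: measurable_rV_coord.
Qed.

Section step.
Variables (n : nat) (m : {sigma_finite_measure set 'rV[R]_n -> \bar R}).

Definition lebesgue_rV_step : set 'rV[R]_n.+1 -> \bar R :=
  pushforward (@lebesgue_measure R \x m) (@cons_rV n).

Let mcons A : measurable A -> measurable (@cons_rV n @^-1` A).
Proof.
by move=> mA; rewrite -[X in measurable X]setTI; exact: measurable_cons_rV.
Qed.

Let step0 : lebesgue_rV_step set0 = 0.
Proof. by rewrite /lebesgue_rV_step /pushforward preimage_set0 measure0. Qed.

Let step_ge0 A : 0 <= lebesgue_rV_step A.
Proof. by rewrite /lebesgue_rV_step /pushforward. Qed.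

Let step_sigma_additive : semi_sigma_additive lebesgue_rV_step.
Proof.
move=> F mF tF mUF; rewrite /lebesgue_rV_step /pushforward preimage_bigcup.
apply: measure_semi_sigma_additive.
- by move=> k; exact: mcons.
- apply/trivIsetP => /= i j _ _ ij; rewrite -preimage_setI.
  by move/trivIsetP : tF => /(_ _ _ _ _ ij) ->//; rewrite preimage_set0.
- by rewrite -preimage_bigcup; exact: mcons.
Qed.

HB.instance Definition _ := isMeasure.Build _ _ _ lebesgue_rV_step
  step0 step_ge0 step_sigma_additive.

Let sigma_finite_step : sigma_finite setT lebesgue_rV_step.
Proof.
have /sigma_finiteP[F [FT ndF Foo]] := sigma_finiteT (@lebesgue_measure R).
have /sigma_finiteP[G [GT ndG Goo]] := sigma_finiteT m.
exists (fun k => @uncons_rV n @^-1` (F k `*` G k)).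
  rewrite -preimage_bigcup (_ : \bigcup_k _ = setT) ?preimage_setT//.
  apply/seteqP; split=> // -[x y] _.
  have [i _ Fx] : (\bigcup_i F i) x by rewrite -FT.
  have [j _ Gy] : (\bigcup_i G i) y by rewrite -GT.
  exists (maxn i j) => //; split => /=.
    by move: x Fx; exact/subsetPset/ndF/leq_maxl.
  by move: y Gy; exact/subsetPset/ndG/leq_maxr.
move=> k; have [? ?] := Foo k; have [? ?] := Goo k.
have mFG : measurable (F k `*` G k) by exact: measurableX.
split; first by rewrite -[X in measurable X]setTI; exact: measurable_uncons_rV.
rewrite /lebesgue_rV_step /pushforward -comp_preimage.
rewrite (_ : _ \o _ = id); last by apply/funext => p; exact: cons_rVK.
by rewrite preimage_id product_measure1E// lte_mul_pinfty// ge0_fin_numE.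
Qed.

HB.instance Definition _ :=
  Measure_isSigmaFinite.Build _ _ _ lebesgue_rV_step sigma_finite_step.

End step.

(* n-dimensional Lebesgue measure; R^0 is a point, of measure 1. *)
Fixpoint lebesgue_rV n : {sigma_finite_measure set 'rV[R]_n -> \bar R} :=
  match n with
  | 0 => [the {sigma_finite_measure set 'rV[R]_0 -> \bar R} of
           dirac (0%R : 'rV[R]_0)]
  | n'.+1 => [the {sigma_finite_measure set 'rV[R]_n'.+1 -> \bar R} of
               lebesgue_rV_step (lebesgue_rV n')]
  end.

End lebesgue_rV.

Lemma lebesgue_rV_box (R : realType) n (a : 'I_n -> set R) :
  (forall i, measurable (a i)) ->
  lebesgue_rV R n [set x | forall i, a i (x ord0 i)] =
  (\prod_(i < n) lebesgue_measure (a i))%E.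
Proof.
elim: n a => [|n IH] a ma.
  rewrite big_ord0 /= /dirac/= indicE mem_set//= => -[].
  by [].
have mb : measurable [set x : 'rV[R]_n | forall i, a (lift ord0 i) (x ord0 i)].
  rewrite (_ : mkset _ = \bigcap_(i in [set: 'I_n])
      ((fun x : 'rV[R]_n => x ord0 i) @^-1` a (lift ord0 i))).
    apply: fin_bigcap_measurable; first exact: finite_finset.
    move=> i _; rewrite -[X in measurable X]setTI.
    exact: measurable_rV_coord.
  by apply/seteqP; split => x /= h i; [move=> _; exact: h|exact: h].
rewrite big_ord_recl -IH// /=.
rewrite /lebesgue_rV_step /pushforward /= -product_measure1E//.
congr (product_measure1 _ _ _); apply/seteqP; split => -[x v] /=.
  move=> h; split => [|i].
    by have := h ord0; rewrite mxE unlift_none.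
  by have := h (lift ord0 i); rewrite mxE liftK.
move=> [h1 h2] i; rewrite mxE.
by case: (unliftP ord0 i) => [j|] ->/=.
exact: ma.
Qed.

Section defs.
Variables (R : realType) (n : nat).
Implicit Types (u g psi : 'rV[R]_n -> R) (U : set 'rV[R]_n) (f : R -> R).
Implicit Types (phi : nat -> 'rV[R]_n -> R) (m : nat -> R) (s lam : R).

Local Notation leb := (lebesgue_rV R n).

(* The library's norm on 'rV[R]_n is the sup norm. *)
Definition enorm (x : 'rV[R]_n) : R := Num.sqrt (\sum_(i < n) x ord0 i ^+ 2).

Definition B1 : set 'rV[R]_n := [set x | enorm x < 1].

Definition cB1 : set 'rV[R]_n := [set x | enorm x <= 1].

Definition partial (i : 'I_n) g : 'rV[R]_n -> R := 'D_(delta_mx ord0 i) g.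

Definition laplacian g (x : 'rV[R]_n) : R :=
  \sum_(i < n) partial i (partial i g) x.

Fixpoint Ck (k : nat) U g : Prop :=
  (forall x, U x -> {for x, continuous g}) /\
  match k with
  | 0 => True
  | k'.+1 => forall i : 'I_n,
      (forall x, U x -> derivable g x (delta_mx ord0 i)) /\
      Ck k' U (partial i g)
  end.

Definition smooth U g : Prop := forall k, Ck k U g.

Definition test_fun psi : Prop :=
  smooth setT psi /\
  exists K : set 'rV[R]_n,
    [/\ compact K, K `<=` B1 & forall x, ~ K x -> psi x = 0].

Definition L2 u : Prop :=
  measurable_fun B1 u /\ (\int[leb]_(x in B1) (u x ^+ 2)%:E < +oo)%E.

Definition Linf (u : 'rV[R]_n -> \bar R) : Prop :=
  measurable_fun B1 u /\
  exists M : R, {ae leb, forall x, B1 x -> (`|u x| <= M%:E)%E}.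

Definition dirichlet_eigenfun g (mu : R) : Prop :=
  [/\ Ck 2 B1 g, {within cB1, continuous g},
      forall x, enorm x = 1 -> g x = 0 &
      forall x, B1 x -> - laplacian g x = mu * g x].

(* The coefficient of u on phi k. *)
Definition coef phi u (k : nat) : R := \int[leb]_(x in B1) (u x * phi k x).

Definition orthonormal_basis phi : Prop :=
  [/\ forall k, L2 (phi k),
      forall j k, coef phi (phi j) k = (j == k)%:R &
      forall u, L2 u ->
        (fun N => \int[leb]_(x in B1)
           ((u x - \sum_(k < N) coef phi u k * phi k x) ^+ 2)%:E)%E
          @ \oo --> 0%E].

(* phi and m are indexed from 0. *)
Definition dirichlet_basis phi m : Prop :=
  [/\ forall k, dirichlet_eigenfun (phi k) (m k),
      orthonormal_basis phi,
      [/\ 0 < m 0%N, m 0%N < m 1%N,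
          forall k, (0 < k)%N -> m k <= m k.+1 & m k @[k --> \oo] --> +oo] &
      forall x, B1 x -> 0 < phi 0%N x].

Definition Hs phi m s u : Prop :=
  L2 u /\
  (\sum_(0 <= k <oo) (m k `^ s * coef phi u k ^+ 2)%:E < +oo)%E.

(* An element of H' is given by its coefficients on the basis phi. *)
Definition frac_lap phi m s u : nat -> R := fun k => m k `^ s * coef phi u k.

(* g = (-Delta)^{-s} psi, for psi in L^2 seen as an element of H'; g exists
   and is unique up to a.e. equality. *)
Definition inv_frac_lap phi m s psi g : Prop :=
  Hs phi m s g /\ frac_lap phi m s g = coef phi psi.

Definition weak_solution phi m s f lam u : Prop :=
  [/\ measurable_fun B1 u,
      (\int[leb]_(x in B1) (`|u x| * phi 0%N x)%:E < +oo)%E,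
      (\int[leb]_(x in B1) (f (u x) * phi 0%N x)%:E < +oo)%E &
      forall psi g, test_fun psi -> inv_frac_lap phi m s psi g ->
        \int[leb]_(x in B1) (u x * psi x) =
        lam * \int[leb]_(x in B1) (f (u x) * g x)].

Definition bounded_solution phi m s f lam u : Prop :=
  [/\ Hs phi m s u, Linf (EFin \o u) & weak_solution phi m s f lam u].

Definition extremal_parameter phi m s f lams : Prop :=
  lams%:E = ereal_sup [set lam%:E | lam in
    [set lam | 0 < lam /\ exists u, bounded_solution phi m s f lam u]].

(* Minimality only determines u up to a.e. equality; its continuity makes the
   pointwise limit in extremal_solution meaningful. *)
Definition minimal_solution phi m s f lam u : Prop :=
  [/\ bounded_solution phi m s f lam u, {within cB1, continuous u} &
      forall v, weak_solution phi m s f lam v ->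
        {ae leb, forall x, B1 x -> u x <= v x}].

(* The increasing pointwise limit may be +oo. *)
Definition extremal_solution phi m s f (us : 'rV[R]_n -> \bar R) : Prop :=
  exists lams (ul : R -> 'rV[R]_n -> R),
    [/\ extremal_parameter phi m s f lams,
        forall lam, 0 < lam < lams -> minimal_solution phi m s f lam (ul lam) &
        forall x, B1 x -> (ul lam x)%:E @[lam --> lams^'-] --> us x].

End defs.

Definition smooth_fun (R : realType) (f : R -> R) : Prop :=
  forall k x, derivable (derive1n k f) x 1.

Lemma measurable_enorm (R : realType) n :
  measurable_fun setT (@enorm R n).
Proof.
apply: (measurableT_comp (f := @Num.sqrt R)).
  exact: continuous_measurable_fun (@sqrt_continuous R).
apply: measurable_sum => i; apply: (measurable_funX 2).
exact: measurable_rV_coord.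
Qed.

Lemma measurable_B1 (R : realType) n :
  measurable (@B1 R n).
Proof.
rewrite (_ : @B1 R n = @enorm R n @^-1` [set` `]-oo, 1[%R]).
  rewrite -[X in measurable X]setTI; exact: measurable_enorm.
by apply/seteqP; split=> x /=; rewrite in_itv.
Qed.

(* Main.v *)
(* A radial nonincreasing solution is a superposition over s = e^x of the
   resolvents (1 - Laplacian/s)^-1 of F = lam f(U), which are explicit
   quadratures on radial functions. The Picard iterates for a parameter lam
   below Lam stay under u_Lam, because the fractional inverse is positive, and
   increase to a radial weak solution U for lam, so u_lam <= U by minimality.
   The gap between U and its iterates yields the stability inequality in a dual
   form involving resolvents only. Tested with -F' zeta it gives, resolvent by
   resolvent, (n-1) int y^2 zeta^2 / r^2 <= int y^2 zeta'^2, y being minus the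
   radial derivative of the resolvent. Taking zeta close to r^-b with b^2 < n-1
   bounds F(r) by a multiple of r^-k, k = n/2 - 1 + s - b, uniformly in lam;
   reinserting this in the resolvents bounds U by r^-(k - 2s), or by a
   constant when k < 2s. Finally lam tends to lam*. *)
From HB Require Import structures.
From mathcomp Require Import all_boot all_order all_algebra.
From mathcomp Require Import all_classical all_reals all_analysis.
From mathcomp Require Import measurable_realfun.
From mathcomp Require Import ring lra.
Require Import Defs.
Set Implicit Arguments.
Unset Strict Implicit.
Unset Printing Implicit Defensive.
Import Order.TTheory GRing.Theory Num.Theory.
Import numFieldNormedType.Exports.
Local Open Scope classical_set_scope.
Local Open Scope ring_scope.

(** The integral of s^(-sg)/(s + m) over s > 0 is K m^(-sg), so the superposition is K times the
    fractional inverse and the parameter is divided by K throughout. The dimension is N + 1: the N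
    of the weighted inequality is the coefficient of y/r^2 in the differentiated radial equation.
    Stability uses no spectral theory of the linearised operator: the Picard parameter grows
    strictly, so the gap between U and an iterate is a positive supersolution for the difference
    quotient of f, and Cauchy-Schwarz in the positive kernel of each resolvent does the rest. The
    main obstacle is uniformity in s: slopes of resolvents must be bounded independently of s, which
    is why Lipschitz bounds, degenerating like (1 - r)^(-2) at the sphere, are propagated along the
    iteration. All test functions live in r <= 1/2, and the constants depend on F only through
    U(1/2), which the first eigenfunction and the superlinearity of f control. As b tends to sqrt N,
    the requirement k < 2 sg becomes (sqrt N - 1)^2 < 2 (sg + 1), the dimension bound of (a). *)

Lemma eq_leW d (T : porderType d) (x y : T) : x = y -> (x <= y)%O.
Proof. by move->. Qed.

Lemma contW (T U : topologicalType) (A : set T) (f : T -> U) : continuous f -> {within A, continuous f}.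
Proof. exact: continuous_subspaceT. Qed.

(** * Entire power series with factorially small coefficients *)

Section power_series.
Variables (R : realType).
Implicit Types (c : nat -> R) (x : R).

Definition psum c x : R := limn (pseries c x).

(** Such coefficients define entire functions. Formal differentiation preserves the class, so
    termwise differentiation can be iterated with no radius of convergence to track. *)
Definition fact_bounded c := exists A : R, forall k, `|c k| <= A / k`!%:R.

Lemma fact_bounded_diffs c : fact_bounded c -> fact_bounded (pseries_diffs c).
Proof.
move=> [A cA]; exists A => k; rewrite /pseries_diffs normrM ger0_norm//.
rewrite (le_trans (ler_wpM2l _ (cA k.+1)))// factS natrM invfM mulrCA mulrA.
by rewrite -mulrA mulVKf ?pnatr_eq0.
Qed.

Lemma is_cvg_psum c x : fact_bounded c -> cvgn (pseries c x).
Proof.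
move=> [A cA].
apply: normed_cvg.
have A0 : 0 <= A by have := cA 0%N; rewrite fact0 divr1; exact: le_trans.
apply: (@series_le_cvg _ _ (fun k => A * exp_coeff `|x| k)).
- by move=> n /=.
- by move=> n /=; rewrite mulr_ge0// /exp_coeff /= divr_ge0// exprn_ge0.
- move=> n /=; rewrite /exp_coeff /= normrM normrX.
  by rewrite (le_trans (ler_wpM2r _ (cA n)))// mulrAC mulrA.
- rewrite (_ : (fun k => _) = A *: (exp_coeff `|x|)); last by apply/funext.
  by apply: is_cvg_seriesZ; exact: is_cvg_series_exp_coeff.
Qed.

Lemma is_derive_psum c x : fact_bounded c ->
  is_derive x 1 (psum c) (psum (pseries_diffs c) x).
Proof.
move=> hc; apply: (@pseries_snd_diffs _ c (`|x| + 1)).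
- exact: is_cvg_psum.
- exact/is_cvg_psum/fact_bounded_diffs.
- exact/is_cvg_psum/fact_bounded_diffs/fact_bounded_diffs.
- by rewrite [X in _ < X]ger0_norm ?ltrDl// addr_ge0.
Qed.

Lemma psum_ge_coef c x k : fact_bounded c -> (forall k, 0 <= c k) -> 0 <= x ->
  c k * x ^+ k <= psum c x.
Proof.
move=> hc c0 x0; have cv := is_cvg_psum (x := x) hc.
have nd : nondecreasing_seq (pseries c x).
  by apply/nondecreasing_series => n _ _; rewrite mulr_ge0// exprn_ge0.
apply: le_trans (nondecreasing_cvgn_le nd cv k.+1).
rewrite /pseries /series /= big_nat_recr//= lerDr sumr_ge0// => i _.
by rewrite mulr_ge0// exprn_ge0.
Qed.

Lemma psum0 c : psum c 0 = c 0%N.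
Proof.
rewrite /psum; apply: cvg_lim => //.
rewrite -(cvg_shiftS _) (_ : [sequence _]_n = cst (c 0%N)); first exact: cvg_cst.
apply/funext => n /=; rewrite /pseries /series /= big_nat_recl//= expr0 mulr1.
by rewrite big1 ?addr0// => i _; rewrite expr0n mulr0.
Qed.

(** The left series enters through its limit only, so it may be a shifted and rescaled series, as in
    [J1_ratio]. *)
Lemma psum_le c d x y A lc :
  pseries c x @ \oo --> lc -> fact_bounded d ->
  (forall k, c k * x ^+ k <= A * (d k * y ^+ k)) -> lc <= A * psum d y.
Proof.
move=> hc hd cd; have dv := is_cvg_psum (x := y) hd.
have hl : A *: pseries d y @ \oo --> A * psum d y by exact: cvgZl_tmp.
apply: ler_cvg_to hc hl _; apply: nearW => n.
change (pseries c x n <= A * pseries d y n).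
by rewrite /pseries /series /= mulr_sumr; apply: ler_sum => i _; exact: cd.
Qed.

Lemma cvg_psum_mulX c x : fact_bounded c ->
  pseries (fun k => if k is k'.+1 then c k' else 0) x @ \oo --> x * psum c x.
Proof.
move=> hc; have cv := is_cvg_psum (x := x) hc.
rewrite -(cvg_shiftS _) (_ : [sequence _]_n = x *: pseries c x).
  exact: cvgZl_tmp.
apply/funext => n; change (pseries (fun k => if k is k'.+1 then c k' else 0) x n.+1
  = x * pseries c x n).
rewrite /pseries /series /= big_nat_recl//= mul0r add0r mulr_sumr.
by apply: eq_bigr => i _; rewrite exprS; ring.
Qed.

Lemma cvg_psum_lin c d a b x lc ld :
  pseries c x @ \oo --> lc -> pseries d x @ \oo --> ld ->
  pseries (fun k => a * c k + b * d k) x @ \oo --> a * lc + b * ld.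
Proof.
move=> hc hd.
rewrite (_ : pseries _ x = a *: pseries c x \+ b *: pseries d x).
  by apply: cvgD; exact: cvgZl_tmp.
apply/funext => n; change (pseries (fun k => a * c k + b * d k) x n =
  a * pseries c x n + b * pseries d x n).
rewrite /pseries /series /= !mulr_sumr -big_split; apply: eq_bigr => i _ /=.
by ring.
Qed.

End power_series.

(** * The radial Bessel-type series and its growth *)

Section radial_series.
Variables (R : realType) (N : nat).
Implicit Types x z q : R.

(** Coefficients, in powers of |x|^2, of the radial solution of laplacian u = u with u(0) = 1 in
    dimension N + 1: the Laplacian of |x|^(2j+2) is 2(j+1)(2j+N+1) |x|^(2j). *)
Definition Jcoef k : R := \prod_(j < k) ((2 * j.+1 * (2 * j + N).+1)%:R)^-1.

Let Jcoef_gt0 k : 0 < Jcoef k.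
Proof. by apply: prodr_gt0 => i _; rewrite invr_gt0 ltr0n !muln_gt0. Qed.

Let JcoefS k :
  Jcoef k = 2 * (k%:R + 1) * (2 * k%:R + N%:R + 1) * Jcoef k.+1.
Proof.
have -> : 2 * (k%:R + 1) * (2 * k%:R + N%:R + 1) =
    (2 * k.+1 * (2 * k + N).+1)%:R :> R.
  by rewrite !natrM -(natr1 k) -(natr1 (2 * k + N)) natrD natrM.
by rewrite /Jcoef big_ord_recr/= mulrCA divff ?mulr1// pnatr_eq0 -lt0n !muln_gt0.
Qed.

Let Jcoef_bounded : fact_bounded Jcoef.
Proof.
exists 1 => k; rewrite ger0_norm; last exact/ltW/Jcoef_gt0.
rewrite div1r; elim: k => [|k IH]; first by rewrite /Jcoef big_ord0 fact0 invr1.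
rewrite /Jcoef big_ord_recr/= -/(Jcoef k) factS [in leRHS]natrM invfM [leRHS]mulrC.
apply: ler_pM => //; first exact/ltW/Jcoef_gt0.
rewrite lef_pV2 ?posrE ?ltr0n ?muln_gt0// ler_nat.
by rewrite mulnAC leq_pmull// muln_gt0.
Qed.

(* The radial Bessel-type function: x |-> J0 (|x|^2 / tau) solves
   tau * laplacian u = u in dimension N + 1. *)
Definition J0 z := psum Jcoef z.
Definition J1 z := psum (pseries_diffs Jcoef) z.
Definition J2 z := psum (pseries_diffs (pseries_diffs Jcoef)) z.

Let b1 : fact_bounded (pseries_diffs Jcoef).
Proof. exact: fact_bounded_diffs. Qed.
Let b2 : fact_bounded (pseries_diffs (pseries_diffs Jcoef)).
Proof. exact: fact_bounded_diffs. Qed.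

Lemma is_derive_J0 z : is_derive z 1 J0 (J1 z).
Proof. exact: is_derive_psum. Qed.

Lemma is_derive_J1 z : is_derive z 1 J1 (J2 z).
Proof. exact: is_derive_psum. Qed.

Lemma J0_0 : J0 0 = 1.
Proof. by rewrite /J0 psum0 /Jcoef big_ord0. Qed.

Lemma J0_ge1 z : 0 <= z -> 1 <= J0 z.
Proof.
move=> z0; have := psum_ge_coef 0 Jcoef_bounded (fun k => ltW (Jcoef_gt0 k)) z0.
by rewrite expr0 mulr1 /Jcoef big_ord0.
Qed.

Lemma J0_gt0 z : 0 <= z -> 0 < J0 z.
Proof. by move=> /J0_ge1; exact: lt_le_trans. Qed.

Let d_ge0 k : 0 <= pseries_diffs Jcoef k.
Proof. by rewrite mulr_ge0// ltW. Qed.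

Lemma J1_gt0 z : 0 <= z -> 0 < J1 z.
Proof.
move=> z0; have := psum_ge_coef 0 b1 d_ge0 z0.
by apply: lt_le_trans; rewrite expr0 mulr1 /pseries_diffs mulr_gt0.
Qed.

Lemma J2_ge0 z : 0 <= z -> 0 <= J2 z.
Proof.
move=> z0; have := psum_ge_coef 0 b2 (fun k => mulr_ge0 (ler0n _ _) (d_ge0 _)) z0.
by apply: le_trans; rewrite expr0 mulr1 mulr_ge0.
Qed.

Lemma J0_ge_lin z : 0 <= z -> ((2 * N.+1)%:R)^-1 * z <= J0 z.
Proof.
move=> z0; have := psum_ge_coef 1 Jcoef_bounded (fun k => ltW (Jcoef_gt0 k)) z0.
by rewrite expr1 /Jcoef big_ord1 muln0 add0n muln1.
Qed.

(** Coefficientwise this is the recursion of [Jcoef]; in the variable z = s r^2 it becomes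
    [rI_ode]. *)
Lemma J_ode z : 4 * (z * J2 z) + 2 * N.+1%:R * J1 z = J0 z.
Proof.
have h := cvg_psum_lin (a := 4) (b := 2 * N.+1%:R)
  (cvg_psum_mulX (x := z) b2) (is_cvg_psum (x := z) b1).
rewrite -[LHS](cvg_lim _ h)//; congr (psum _ z); apply/funext => k.
rewrite JcoefS /pseries_diffs.
case: k => [|k]; first by rewrite -(natr1 N); ring.
by rewrite -(natr1 N) -(natr1 k.+1) -(natr1 k); ring.
Qed.

Let nat_pred_ge0 m : 0 <= m%:R * (m%:R - 1) :> R.
Proof. by case: m => [|k]; rewrite ?mul0r// mulr_ge0// -natr1 addrK. Qed.

Let bernoulli2 (p : R) m : 0 <= p ->
  1 + m%:R * p + m%:R * (m%:R - 1) / 2 * p ^+ 2 <= (1 + p) ^+ m.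
Proof.
move=> p0; elim: m => [|m IH]; first by rewrite expr0; lra.
have /= h := ler_wpM2r (addr_ge0 ler01 p0) IH; rewrite [leRHS]exprSr.
apply: (le_trans _ h).
rewrite -natr1 -subr_ge0 (_ : _ - _ = m%:R * (m%:R - 1) / 2 * p ^+ 3); last by field.
by apply: mulr_ge0; [apply: mulr_ge0 => //; exact: nat_pred_ge0|exact: exprn_ge0].
Qed.

(** With p = 1 - q, second-order Bernoulli gives ((m+1) p)^2 <= 3 (1+p)^m, and (1+p) q <= 1 makes
    the right side bounded after multiplication by q^m. *)
Let geometric_square q m : 0 <= q < 1 ->
  m.+1%:R ^+ 2 * q ^+ m <= 3 / (1 - q) ^+ 2.
Proof.
move=> /andP[q0 q1]; have p0 : 0 < 1 - q by rewrite subr_gt0.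
rewrite ler_pdivlMr ?exprn_gt0//.
have h : (m.+1%:R * (1 - q)) ^+ 2 <= 3 * (1 + (1 - q)) ^+ m.
  have /= b := ler_wpM2l (ler0n R 3) (bernoulli2 m (ltW p0)).
  apply: (le_trans _ b).
  rewrite -natr1; set p := 1 - q; set a : R := m%:R.
  have ap : 0 <= a * p by rewrite mulr_ge0// ltW.
  have p1 : p ^+ 2 <= 1 by rewrite exprn_ile1 ?(ltW p0)// lerBlDr lerDl.
  have aa : 0 <= a * (a - 1) by exact: nat_pred_ge0.
  have pp : 0 <= p ^+ 2 by exact: sqr_ge0.
  have app : a * p ^+ 2 <= a * p.
    by rewrite expr2 mulrA ler_piMr// lerBlDr lerDl.
  have aap : 0 <= a * (a - 1) * p ^+ 2 by rewrite mulr_ge0.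
  nra.
rewrite mulrAC -exprMn.
have q1q : (1 + (1 - q)) * q <= 1 by nra.
apply: le_trans (ler_wpM2r (exprn_ge0 m q0) h) _.
rewrite -mulrA -exprMn ler_piMr// exprn_ile1//.
by rewrite mulr_ge0//; lra.
Qed.

(** Comparison of coefficients: multiplication by z shifts the index by one, consecutive
    coefficients of [J1] have a ratio of order k^2, and q^k absorbs it through [geometric_square].
    In terms of [rI1], moving inward by a fixed distance gains a factor 1/s, whatever s is. *)
Lemma J1_ratio z q : 0 <= z -> 0 <= q < 1 ->
  z * J1 (q * z) <= 6 * (N%:R + 3) / (1 - q) ^+ 2 * J1 z.
Proof.
move=> z0 q01; have /andP[q0 q1] := q01.
have h : pseries (fun k => if k is k'.+1 then pseries_diffs Jcoef k' * q ^+ k' else 0) z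
    @ \oo --> z * J1 (q * z).
  have := cvg_psum_mulX (x := z) (c := fun k => pseries_diffs Jcoef k * q ^+ k).
  rewrite (_ : psum _ z = J1 (q * z)); last first.
    rewrite /J1 /psum; congr (limn _); apply/funext => n.
    rewrite /pseries /series /=.
    by apply: eq_bigr => i _; rewrite exprMn mulrA.
  apply; have [A hA] := b1; exists A => k; rewrite normrM.
  rewrite -[leRHS]mulr1; apply: ler_pM => //.
  by rewrite ger0_norm ?exprn_ge0// exprn_ile1// ltW.
apply: psum_le h b1 _ => -[|k].
  by rewrite mul0r expr0 mulr1 mulr_ge0// ?divr_ge0 ?sqr_ge0 ?mulr_ge0 ?addr_ge0.
rewrite [leRHS]mulrA; apply: ler_wpM2r; first exact: exprn_ge0.
rewrite /pseries_diffs (JcoefS k.+1) [leRHS]mulrCA.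
have gs := geometric_square k q01.
have -> : k.+1%:R * (2 * (k.+1%:R + 1) * (2 * k.+1%:R + N%:R + 1) * Jcoef k.+2) * q ^+ k =
  (k.+1%:R * (2 * k.+1%:R + N%:R + 1) * q ^+ k * 2) * (k.+2%:R * Jcoef k.+2) :> R.
  by rewrite -(natr1 k.+1); ring.
rewrite mulrCA; apply: ler_wpM2r; first by rewrite mulr_ge0// ltW.
have qk : 0 <= q ^+ k by exact: exprn_ge0.
have -> : 6 * (N%:R + 3) / (1 - q) ^+ 2 = (N%:R + 3) * 2 * (3 / (1 - q) ^+ 2) by ring.
have N0 : 0 <= (N%:R + 3) * 2 :> R by rewrite mulr_ge0// addr_ge0.
have /= h' := ler_wpM2l N0 gs; apply: (le_trans _ h').
rewrite -subr_ge0 (_ : _ - _ = 2 * q ^+ k * k.+1%:R * ((N%:R + 1) * (k.+1%:R - 1))); last by ring.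
by rewrite !mulr_ge0// ?addr_ge0// -natr1 addrK.
Qed.

End radial_series.

(** * One-variable calculus and integrals over segments *)

Section calculus1.
Variable R : realType.
Implicit Types (f g : R -> R) (a b c x : R).
Local Notation mu := (@lebesgue_measure R).

Lemma is_derive1D f g x a b : is_derive x 1 f a -> is_derive x 1 g b ->
  is_derive x 1 (fun y => f y + g y) (a + b).
Proof. by move=> fa gb; exact: is_deriveD. Qed.

Lemma is_derive1N f x a : is_derive x 1 f a -> is_derive x 1 (fun y => - f y) (- a).
Proof. by move=> fa; exact: is_deriveN. Qed.

Lemma is_derive1M f g x a b : is_derive x 1 f a -> is_derive x 1 g b ->
  is_derive x 1 (fun y => f y * g y) (a * g x + f x * b).
Proof.
move=> fa gb; have h := is_deriveM fa gb.
by apply: is_derive_eq; rewrite -[LHS]/(f x * b + g x * a); ring.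
Qed.

Lemma is_derive1Z f c x a : is_derive x 1 f a ->
  is_derive x 1 (fun y => c * f y) (c * a).
Proof.
move=> fa; have h := is_derive1M (is_derive_cst c x 1) fa.
by apply: is_derive_eq h _; rewrite mul0r add0r.
Qed.

Lemma is_derive1V f x a : f x != 0 -> is_derive x 1 f a ->
  is_derive x 1 (fun y => (f y)^-1) (- a / f x ^+ 2).
Proof.
move=> f0 fa; have h := is_deriveV f0 fa.
by apply: is_derive_eq h _; rewrite -[LHS]/(- f x ^- 2 * a) mulNr mulrC mulNr.
Qed.

Lemma is_derive1X x n : is_derive x (1 : R) (fun y : R => y ^+ n) (n%:R * x ^+ n.-1).
Proof.
have h := is_deriveX n (is_derive_id x (1 : R)).
rewrite (_ : (fun y => y ^+ n) = id ^+ n).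
  by apply: is_derive_eq h _; rewrite -[LHS]/(_ * 1) mulr1.
by rewrite exprfctE.
Qed.

Lemma is_derive1_compE f g x a b : is_derive (g x) 1 f a -> is_derive x 1 g b ->
  is_derive x 1 (fun y => f (g y)) (a * b).
Proof. by move=> fa gb; exact: is_derive1_comp. Qed.

Lemma derive_cont f x a : is_derive x 1 f a -> {for x, continuous f}.
Proof.
move=> h; apply: differentiable_continuous.
by apply/derivable1_diffP; case: h.
Qed.

Lemma is_derive_near f g x a : (\near x, f x = g x) -> is_derive x 1 f a ->
  is_derive x 1 g a.
Proof.
move=> fg h; apply: DeriveDef.
  by apply: (@near_eq_derivable _ _ _ f g x 1) => //; rewrite ?oner_neq0//; case: h.
by rewrite -(@near_eq_derive _ _ _ f g x 1)// derive_val.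
Qed.

(** Not an oriented integral: the value is 0 as soon as b <= a, see [itg_gt]. *)
Definition itg a b f := \int[mu]_(t in `[a, b]) f t.

Lemma within_integrable a b f : {within `[a, b], continuous f} ->
  mu.-integrable `[a, b] (EFin \o f).
Proof.
by move=> cf; apply: continuous_compact_integrable => //; exact: segment_compact.
Qed.

Lemma cont_integrable a b f : continuous f ->
  mu.-integrable `[a, b] (EFin \o f).
Proof. by move=> cf; apply/within_integrable/contW. Qed.

Lemma itg_le a b f g : {within `[a, b], continuous f} ->
  {within `[a, b], continuous g} -> (forall x, a <= x <= b -> f x <= g x) ->
  itg a b f <= itg a b g.
Proof.
move=> cf cg fg; apply: le_Rintegral.
- exact: measurable_itv.
- exact: within_integrable.
- exact: within_integrable.
by move=> x /=; rewrite in_itv/=; exact: fg.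
Qed.

Lemma itg_ge0 a b f : (forall x, a <= x <= b -> 0 <= f x) -> 0 <= itg a b f.
Proof. by move=> f0; apply: Rintegral_ge0 => x /=; rewrite in_itv/=; exact: f0. Qed.

Lemma eq_itg a b f g : (forall x, a <= x <= b -> f x = g x) -> itg a b f = itg a b g.
Proof.
move=> fg; apply: eq_Rintegral => x; rewrite inE/= in_itv/=; exact: fg.
Qed.

Lemma itgZ a b c f : {within `[a, b], continuous f} ->
  itg a b (fun x => c * f x) = c * itg a b f.
Proof. by move=> cf; apply: RintegralZl => //; exact: within_integrable. Qed.

Lemma itgD a b f g : {within `[a, b], continuous f} ->
  {within `[a, b], continuous g} ->
  itg a b (fun x => f x + g x) = itg a b f + itg a b g.
Proof. by move=> cf cg; apply: RintegralD => //; exact: within_integrable. Qed.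

Lemma itgB a b f g : {within `[a, b], continuous f} ->
  {within `[a, b], continuous g} ->
  itg a b (fun x => f x - g x) = itg a b f - itg a b g.
Proof. by move=> cf cg; apply: RintegralB => //; exact: within_integrable. Qed.

Lemma itg_cst a b c : a <= b -> itg a b (fun=> c) = c * (b - a).
Proof.
move=> ab; rewrite /itg Rintegral_cst//= lebesgue_measure_itv/= lte_fin.
case: ltP => [_|ba]; first by rewrite -EFinD.
by rewrite (_ : b = a) ?subrr//; apply/eqP; rewrite eq_le ab ba.
Qed.

Lemma itgxx a f : itg a a f = 0.
Proof. by rewrite /itg set_itv1 Rintegral_set1. Qed.

Lemma itg_gt a b f : b <= a -> itg a b f = 0.
Proof.
rewrite le_eqVlt => /orP[/eqP ->|ba]; first exact: itgxx.
by rewrite /itg set_itv_ge ?Rintegral_set0// bnd_simp -ltNge.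
Qed.

Lemma itg_split a b c f : a <= b -> b <= c -> continuous f ->
  itg a c f = itg a b f + itg b c f.
Proof.
move=> ab bc cf; rewrite /itg.
have := @Rintegral_itvB _ f (BLeft a) (BRight c) b (cont_integrable a c cf).
rewrite !bnd_simp => /(_ ab bc) /eqP; rewrite subr_eq => /eqP ->.
rewrite addrC; congr (_ + _); apply: Rintegral_itv_obnd_cbnd.
apply: integrableS (cont_integrable b c cf) => //.
by apply: subset_itvr; rewrite bnd_simp.
Qed.

Lemma is_derive_itg a x f : continuous f -> a < x ->
  is_derive x 1 (fun y => itg a y f) (f x).
Proof.
move=> cf ax.
have [] := @continuous_FTC1_closed _ f a x (x + 1) _ (cont_integrable a _ cf) ax (cf x).
  by rewrite ltrDl.
by move=> d; rewrite derive1E => e; apply: DeriveDef.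
Qed.

Lemma itg_FTC a b f F : a <= b -> {within `[a, b], continuous f} ->
  {within `[a, b], continuous F} ->
  (forall x, a < x < b -> is_derive x 1 F (f x)) -> itg a b f = F b - F a.
Proof.
rewrite le_eqVlt => /orP[/eqP ->|ab] cf cF dF; first by rewrite itgxx subrr.
have [cF1 cF2 cF3] := (continuous_within_itvP F ab).1 cF.
rewrite /itg /Rintegral (@continuous_FTC2 _ f F a b)//.
- split => // x; rewrite in_itv/= => /dF h; by case: h.
- by move=> x; rewrite in_itv/= => /dF h; rewrite derive1E derive_val.
Qed.

Lemma mono_derive a b (F dF : R -> R) : a <= b -> {within `[a, b], continuous F} ->
  (forall x, a < x < b -> is_derive x 1 F (dF x)) ->
  (forall x, a < x < b -> 0 <= dF x) -> F a <= F b.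
Proof.
rewrite le_eqVlt => /orP[/eqP ->//|ab] cF dFx dF0.
have dF' x : x \in `]a, b[ -> is_derive x 1 F (dF x) by rewrite in_itv; exact: dFx.
have [c cab] := MVT ab dF' cF.
rewrite -subr_ge0 => ->; apply: mulr_ge0; last by rewrite subr_ge0 ltW.
by apply: dF0; move: cab; rewrite in_itv.
Qed.

Lemma cont_itg a f : continuous f -> continuous (fun y => itg a y f).
Proof.
move=> cf x.
(* The base point is moved strictly below both a and x, so that the fundamental theorem applies at
   x; the integral from a is recovered through [Num.max a y]. *)
pose G y := itg (Num.min a x - 1) y f.
have xG y : Num.min a x - 1 < y -> {for y, continuous G}.
  by move=> xy; exact: derive_cont (is_derive_itg cf xy).
have ax : Num.min a x - 1 < a by rewrite ltrBlDr ltr_pwDr// ge_min lexx.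
have xx : Num.min a x - 1 < x by rewrite ltrBlDr ltr_pwDr// ge_min lexx orbT.
have mx : Num.min a x - 1 < Num.max a x by rewrite (lt_le_trans ax)// le_max lexx.
have h : {for x, continuous (fun y => G (Num.max a y) - G a)}.
  apply: cvgB; last exact: cvg_cst.
  have cm : {for x, continuous (fun y : R => Num.max a y)}.
    by apply: continuous_max; [exact: cvg_cst|exact: cvg_id].
  exact: (continuous_comp cm (xG _ mx)).
apply: (@cvg_trans _ ((fun y => G (Num.max a y) - G a) @ x)); last first.
  rewrite /= (_ : itg a x f = G (Num.max a x) - G a)//.
  have [xa|ax'] := leP x a; first by rewrite itg_gt// subrr.
  by rewrite /G (itg_split (ltW ax) (ltW ax') cf) addrC addKr.
apply: near_eq_cvg; near=> y.
have [ya|ay] := leP y a; first by rewrite itg_gt// subrr.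
by rewrite /G (itg_split (ltW ax) (ltW ay) cf) addrC addKr.
Unshelve. all: by end_near. Qed.

(** Only the monotonicity of the integral minus H is used, so h may be unbounded near the end points
    and no integral of h is formed. *)
Lemma itg_ge_of a b f (H h : R -> R) : a < b -> {within `[a, b], continuous f} ->
  {within `[a, b], continuous H} ->
  (forall x, a < x < b -> is_derive x 1 H (h x)) ->
  (forall x, a < x < b -> h x <= f x) -> H b - H a <= itg a b f.
Proof.
move=> ab cf cH dH hf; have intf := within_integrable cf.
have cI := @parameterized_integral_continuous _ a b f (ltW ab) intf.
have : itg a a f - H a <= itg a b f - H b.
  apply: (@mono_derive a b (fun x => itg a x f - H x) (fun x => f x - h x)).
  - exact: ltW.
  - by move=> x; apply: cvgB; [exact: cI|exact: cH].
  - move=> x /andP[ax xb].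
    have cx : {for x, continuous f}.
      by have [+ _ _] := (continuous_within_itvP f ab).1 cf; apply; rewrite in_itv/= ax.
    have [d e] := @continuous_FTC1_closed _ f a x b xb intf ax cx.
    apply: is_derive1D; first by apply: DeriveDef; rewrite -?derive1E.
    by apply: is_derive1N; apply: dH; rewrite ax.
  - by move=> x xab; rewrite subr_ge0 hf.
by rewrite itgxx; lra.
Qed.

Lemma itg_gt0 a b f : a < b -> {within `[a, b], continuous f} ->
  (forall x, a <= x <= b -> 0 < f x) -> 0 < itg a b f.
Proof.
move=> ab cf f0.
have [c cab hc] := EVT_min (ltW ab) cf.
have fc : 0 < f c by apply: f0; move: cab; rewrite in_itv.
rewrite (@lt_le_trans _ _ (itg a b (fun=> f c)))//.
  by rewrite itg_cst ?(ltW ab)// mulr_gt0// subr_gt0.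
apply: itg_le; [by apply: contW => z; exact: cvg_cst|by []|].
by move=> x xab; apply: hc; rewrite in_itv.
Qed.

End calculus1.

(** * Closure properties of continuous functions *)

Section continuity_tools.
Variables (R : realType) (T : topologicalType).
Implicit Types (f g : T -> R).

Lemma contC (c : R) : continuous (fun _ : T => c).
Proof. by move=> ?; exact: cvg_cst. Qed.

Lemma contD f g : continuous f -> continuous g ->
  continuous (fun x => f x + g x).
Proof. by move=> cf cg x; apply: cvgD; [exact: cf|exact: cg]. Qed.

Lemma contB f g : continuous f -> continuous g ->
  continuous (fun x => f x - g x).
Proof. by move=> cf cg x; apply: cvgB; [exact: cf|exact: cg]. Qed.

Lemma contN f : continuous f -> continuous (fun x => - f x).
Proof. by move=> cf x; apply: cvgN; exact: cf. Qed.

Lemma contM f g : continuous f -> continuous g ->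
  continuous (fun x => f x * g x).
Proof. by move=> cf cg x; apply: cvgM; [exact: cf|exact: cg]. Qed.

Lemma cont_exp f n : continuous f -> continuous (fun x => f x ^+ n).
Proof.
move=> cf; elim: n => [|n IH].
  by under eq_fun do rewrite expr0; move=> x; exact: cvg_cst.
by under eq_fun do rewrite exprS; exact: contM.
Qed.

Lemma contV f : (forall x, f x != 0) -> continuous f ->
  continuous (fun x => (f x)^-1).
Proof. by move=> f0 cf x; apply: cvgV => //; exact: cf. Qed.

Lemma cont_comp (S : topologicalType) (h : S -> T) (f : T -> R) :
  continuous h -> continuous f -> continuous (fun x => f (h x)).
Proof. by move=> ch cf x; apply: continuous_comp; [exact: ch|exact: cf]. Qed.

End continuity_tools.

(** * The radial resolvent: formula, derivative, maximum principles *)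

Section resolvent.
Variables (R : realType) (N : nat).
Hypothesis N_gt0 : (0 < N)%N.
Implicit Types (s r t : R) (F : R -> R).

(* For u radial, (u - s^-1 laplacian u) = F in the unit ball of dimension N + 1,
   u = 0 on the boundary, is solved by u = resolvent s F. *)
Definition rI s r := J0 N (s * r ^+ 2).
Definition rI1 s r := 2 * s * r * J1 N (s * r ^+ 2).
Definition rI2 s r :=
  2 * s * J1 N (s * r ^+ 2) + 4 * s ^+ 2 * r ^+ 2 * J2 N (s * r ^+ 2).
(** Reduction of order: with u = [rI] h the equation becomes (r^N rI^2 h')' = - s r^N rI F. Thus
    [wint] integrates the source, [slope] is -h', [tail] is h normalised by h(1) = 0, and [drop] is
    -u'. The absolute value in [tail] makes u even. *)
Definition wint s F t := itg 0 t (fun p => p ^+ N * rI s p * F p).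
Definition slope s F t := s * wint s F t / (t ^+ N * rI s t ^+ 2).
Definition tail s F r := itg `|r| 1 (slope s F).
Definition resolvent s F r := rI s r * tail s F r.
Definition drop s F r := s * wint s F r / (r ^+ N * rI s r) - rI1 s r * tail s F r.

Section fixed_s.
Variables (s : R).
Hypothesis s_gt0 : 0 < s.

Let sr_ge0 r : 0 <= s * r ^+ 2. Proof. exact: mulr_ge0 (ltW s_gt0) (sqr_ge0 r). Qed.

Lemma rI_ge1 r : 1 <= rI s r.
Proof. exact/J0_ge1/sr_ge0. Qed.

Lemma rI_gt0 r : 0 < rI s r.
Proof. exact: lt_le_trans (rI_ge1 r). Qed.

Lemma rI1_ge0 r : 0 <= r -> 0 <= rI1 s r.
Proof. by move=> r0; rewrite !mulr_ge0// ?ltW//; exact/J1_gt0/sr_ge0. Qed.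

Lemma rI1_gt0 r : 0 < r -> 0 < rI1 s r.
Proof. by move=> r0; rewrite !mulr_gt0//; exact/J1_gt0/sr_ge0. Qed.

Lemma rI2_ge0 r : 0 <= rI2 s r.
Proof.
have a := J1_gt0 N (sr_ge0 r); have b := J2_ge0 N (sr_ge0 r).
rewrite addr_ge0//; first by rewrite mulr_ge0 ?(ltW a)// mulr_ge0// ltW.
exact: mulr_ge0 (mulr_ge0 (mulr_ge0 (ler0n _ _) (sqr_ge0 s)) (sqr_ge0 r)) b.
Qed.

Lemma is_derive_rI r : is_derive r 1 (rI s) (rI1 s r).
Proof.
have h := is_derive1_compE (g := fun y => s * y ^+ 2)
  (is_derive_J0 N (s * r ^+ 2))
  (is_derive1Z s (is_derive1X r 2)).
by apply: is_derive_eq h _; rewrite /rI1 expr1; ring.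
Qed.

Lemma is_derive_rI1 r : is_derive r 1 (rI1 s) (rI2 s r).
Proof.
have h := is_derive1_compE (g := fun y => s * y ^+ 2)
  (is_derive_J1 N (s * r ^+ 2))
  (is_derive1Z s (is_derive1X r 2)).
have h' := is_derive1M (is_derive1Z (2 * s) (is_derive_id r (1 : R))) h.
by apply: is_derive_eq h' _; rewrite /rI2 expr1; ring.
Qed.

Lemma rI_ode r : r * rI2 s r + N%:R * rI1 s r = s * r * rI s r.
Proof.
have h := J_ode N (s * r ^+ 2); rewrite /rI2 /rI1 /rI -h -(natr1 N).
by ring.
Qed.

Lemma cont_rI : continuous (rI s).
Proof. by move=> r; exact: derive_cont (is_derive_rI r). Qed.

Lemma cont_rI1 : continuous (rI1 s).
Proof. by move=> r; exact: derive_cont (is_derive_rI1 r). Qed.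

Lemma rI_mono a b : 0 <= a -> a <= b -> rI s a <= rI s b.
Proof.
move=> a0 ab; apply: (@mono_derive _ a b (rI s) (rI1 s)) => //.
- exact/contW/cont_rI.
- by move=> x _; exact: is_derive_rI.
- by move=> x /andP[ax _]; apply: rI1_ge0; rewrite ltW// (le_lt_trans a0).
Qed.

Lemma rI1_mono a b : a <= b -> rI1 s a <= rI1 s b.
Proof.
move=> ab; apply: (@mono_derive _ a b (rI1 s) (rI2 s) ab).
- exact/contW/cont_rI1.
- by move=> x _; exact: is_derive_rI1.
- by move=> x _; exact: rI2_ge0.
Qed.

Lemma rI1_le r : 0 <= r -> rI1 s r <= s * r * rI s r.
Proof.
move=> r0; rewrite -rI_ode ler_wpDl ?mulr_ge0 ?rI2_ge0//.
by rewrite ler_peMl ?rI1_ge0// ler1n.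
Qed.

(** The equation of [rI] in divergence form. *)
Lemma is_derive_powrI1 r :
  is_derive r 1 (fun t => t ^+ N * rI1 s t) (s * r ^+ N * rI s r).
Proof.
apply: is_derive_eq (is_derive1M (is_derive1X r N) (is_derive_rI1 r)) _.
have h := rI_ode r; case: N N_gt0 h => // m _ h /=.
have -> : s * r ^+ m.+1 * rI s r = r ^+ m * (s * r * rI s r) by rewrite exprS; ring.
by rewrite -h exprS; ring.
Qed.

Lemma powrI1_mono a b : 0 <= a -> a <= b -> a ^+ N * rI1 s a <= b ^+ N * rI1 s b.
Proof.
move=> a0 ab; apply: ler_pM; rewrite ?exprn_ge0 ?rI1_ge0 ?rI1_mono//.
by rewrite lerXn2r// nnegrE (le_trans a0).
Qed.

Lemma contX : continuous (fun t : R => t ^+ N).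
Proof. by move=> r; exact: derive_cont (is_derive1X r N). Qed.

(** Consequently s [wint] F t / (t^N [rI1] t) is a weighted mean of F over [0, t]; most bounds on F
    are passed to [wint] in this normalisation. *)
Lemma wint1 t : 0 <= t -> wint s (fun=> 1) t = t ^+ N * rI1 s t / s.
Proof.
move=> t0; pose G t := s^-1 * (t ^+ N * rI1 s t).
have -> : t ^+ N * rI1 s t / s = G t - G 0.
  by rewrite /G expr0n gtn_eqF// mul0r mulr0 subr0 mulrC.
apply: itg_FTC => //.
- apply: contW; under eq_fun do rewrite mulr1.
  exact: contM contX cont_rI.
- apply: contW => x.
  exact: derive_cont (is_derive1Z _ (is_derive_powrI1 x)).
- move=> x _; apply: is_derive_eq (is_derive1Z _ (is_derive_powrI1 x)) _.
  by rewrite mulr1 !mulrA mulVf ?gt_eqF// mul1r.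
Qed.

Section continuousF.
Variable F : R -> R.
Hypothesis cF : continuous F.

Let cG : continuous (fun p : R => p ^+ N * rI s p * F p).
Proof. exact: contM (contM contX cont_rI) cF. Qed.

Lemma cont_wint : continuous (wint s F).
Proof. exact: cont_itg. Qed.

Lemma is_derive_wint t : 0 < t -> is_derive t 1 (wint s F) (t ^+ N * rI s t * F t).
Proof. by move=> t0; exact: is_derive_itg. Qed.

Lemma wint_le0 t : t <= 0 -> wint s F t = 0.
Proof. exact: itg_gt. Qed.

Lemma wint_bound M t : 0 <= t -> (forall p, 0 <= p <= t -> F p <= M) ->
  wint s F t <= M * (t ^+ N * rI1 s t / s).
Proof.
move=> t0 FM; rewrite -wint1// /wint -itgZ; last first.
  apply: contW; under eq_fun do rewrite mulr1.
  exact: contM contX cont_rI.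
apply: itg_le.
- exact: contW.
- apply: contW; under eq_fun do rewrite mulr1.
  apply: contM; first by exact: contC.
  exact: contM contX cont_rI.
- move=> p /andP[p0 pt]; rewrite mulr1 mulrC; apply: ler_wpM2r.
    by rewrite mulr_ge0 ?exprn_ge0// ltW// rI_gt0.
  by apply: FM; rewrite p0.
Qed.

Lemma wint_ge M t : 0 <= t -> (forall p, 0 <= p <= t -> M <= F p) ->
  M * (t ^+ N * rI1 s t / s) <= wint s F t.
Proof.
move=> t0 FM; rewrite -wint1// /wint -itgZ; last first.
  apply: contW; under eq_fun do rewrite mulr1.
  exact: contM contX cont_rI.
apply: itg_le.
- apply: contW; under eq_fun do rewrite mulr1.
  apply: contM; first by exact: contC.
  exact: contM contX cont_rI.
- exact: contW.
- move=> p /andP[p0 pt]; rewrite mulr1 [leRHS]mulrC; apply: ler_wpM2r.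
    by rewrite mulr_ge0 ?exprn_ge0// ltW// rI_gt0.
  by apply: FM; rewrite p0.
Qed.

Lemma wint_ge0 t : t <= 1 -> (forall p, 0 <= p <= 1 -> 0 <= F p) -> 0 <= wint s F t.
Proof.
move=> t1 F0; have [t0|t0] := leP 0 t; last by rewrite wint_le0// ltW.
apply: itg_ge0 => p /andP[p0 pt]; rewrite !mulr_ge0 ?exprn_ge0//.
  by rewrite ltW// rI_gt0.
by apply: F0; rewrite p0 (le_trans pt).
Qed.

Lemma slope_le0 t : t <= 0 -> slope s F t = 0.
Proof. by move=> t0; rewrite /slope wint_le0// mulr0 mul0r. Qed.

Lemma normF_bounded b : exists2 M, 0 < M & forall p, 0 <= p <= b -> `|F p| <= M.
Proof.
have [b0|b0] := ltP b 0.
  by exists 1 => // p /andP[p0 pb]; have := lt_le_trans (le_lt_trans (le_trans p0 pb) b0) (lexx 0); rewrite ltxx.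
have cn : {within `[0, b], continuous (fun p => `|F p|)}.
  by apply: contW => x; apply: cvg_norm; exact: cF.
have [c _ hc] := EVT_max b0 cn; exists (`|F c| + 1) => [|p pb].
  by rewrite ltr_pwDr.
by rewrite (le_trans (hc p _)) ?in_itv// lerDl.
Qed.

(** The linear bound yields the continuity of [slope] at 0, where the quotient defining it
    degenerates. *)
Lemma slope_norm_le M t : 0 <= t -> (forall p, 0 <= p <= t -> `|F p| <= M) ->
  `|slope s F t| <= M * s * t.
Proof.
move=> t0 FM; have [->|tn0] := eqVneq t 0; first by rewrite slope_le0// normr0 mulr0.
have {tn0}t0' : 0 < t by rewrite lt_def tn0.
have D0 : 0 < t ^+ N * rI s t ^+ 2 by rewrite mulr_gt0 ?exprn_gt0 ?rI_gt0.
rewrite /slope normrM normfV (gtr0_norm D0) ler_pdivrMr//.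
have M0 : 0 <= M by apply: le_trans (FM 0 _); rewrite ?lexx.
have w : `|wint s F t| <= M * (t ^+ N * rI1 s t / s).
  rewrite ler_norml -mulNr wint_ge//= ?wint_bound// => p pt.
    by have := FM _ pt; rewrite ler_norml => /andP[].
  by have := FM _ pt; rewrite ler_norml => /andP[].
rewrite normrM (gtr0_norm s_gt0) (le_trans (ler_wpM2l (ltW s_gt0) w))//.
have -> : s * (M * (t ^+ N * rI1 s t / s)) = M * t ^+ N * rI1 s t.
  by field; rewrite gt_eqF.
have -> : M * s * t * (t ^+ N * rI s t ^+ 2) =
  M * t ^+ N * (s * t * rI s t * rI s t) by ring.
rewrite ler_wpM2l ?mulr_ge0 ?exprn_ge0// (le_trans (rI1_le t0))//.
by rewrite ler_peMr ?rI_ge1// !mulr_ge0 ?ltW// rI_gt0.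
Qed.

Lemma cont_slope : continuous (slope s F).
Proof.
move=> t; have [t0|t0|->] := ltgtP t 0.
- rewrite /continuous_at slope_le0 ?ltW//; apply: cvg_near_cst; near=> x.
  rewrite slope_le0// ltW//; near: x; exact: lt_nbhsl.
- apply: cvgM; last first.
    apply: cvgV; first by rewrite mulf_neq0// ?expf_neq0 ?gt_eqF ?rI_gt0.
    apply: cvgM; first exact: contX.
    exact: (cont_exp cont_rI).
  apply: cvgM; first exact: cvg_cst.
  exact: cont_wint.
- have [M M0 hM] := normF_bounded 1.
  rewrite /continuous_at slope_le0//.
  apply/cvgr0Pnorm_le => e e0.
  have near1 : \forall x \near (0 : R), `|x| < Num.min 1 (e / (M * s)).
    by apply: nbhs0_lt; rewrite lt_min ltr01 divr_gt0// mulr_gt0.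
  near=> x.
  have x1 : `|x| < Num.min 1 (e / (M * s)) by near: x.
  have [x0|x0] := leP x 0; first by rewrite slope_le0// normr0 ltW.
  move: x1; rewrite lt_min gtr0_norm// => /andP[x1 xe].
  rewrite (le_trans (slope_norm_le (ltW x0) (M := M) _))//.
    by move=> p /andP[p0 px]; apply: hM; rewrite p0 (le_trans px)// ltW.
  by rewrite mulrC -ler_pdivlMr ?mulr_gt0// ltW.
Unshelve. all: by end_near. Qed.

Lemma cont_tail : continuous (tail s F).
Proof.
have -> : tail s F = fun r => itg 0 1 (slope s F) - itg 0 (Num.min `|r| 1) (slope s F).
  apply/funext => r; rewrite /tail; have [r1|r1] := leP `|r| 1.
    rewrite (itg_split (normr_ge0 r) r1 cont_slope).
    by rewrite addrAC subrr add0r.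
  by rewrite itg_gt ?ltW// subrr.
move=> r; apply: cvgB; first exact: cvg_cst.
have cm : {for r, continuous (fun r : R => Num.min `|r| 1)}.
  apply: continuous_min; last exact: cvg_cst.
  by apply: cvg_norm; exact: cvg_id.
apply: (@continuous_comp _ _ _ (fun r : R => Num.min `|r| 1)
  (fun y => itg 0 y (slope s F))); first exact: cm.
exact: cont_itg cont_slope _.
Qed.

Lemma is_derive_tail r : 0 < r < 1 -> is_derive r 1 (tail s F) (- slope s F r).
Proof.
move=> /andP[r0 r1].
have h := is_derive1D (is_derive_cst (itg 0 1 (slope s F)) r 1)
  (is_derive1N (is_derive_itg cont_slope r0)).
apply: is_derive_near (is_derive_eq h (add0r _)); near=> x.
have x0 : 0 < x by near: x; exact: lt_nbhsr.
have x1 : x < 1 by near: x; exact: lt_nbhsl.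
rewrite /tail gtr0_norm// (itg_split (ltW x0) (ltW x1) cont_slope).
by rewrite /cst/= addrAC subrr add0r.
Unshelve. all: by end_near. Qed.

Lemma tail_ge1 r : 1 <= `|r| -> tail s F r = 0.
Proof. exact: itg_gt. Qed.

Lemma cont_resolvent : continuous (resolvent s F).
Proof. exact: contM cont_rI cont_tail. Qed.

Lemma resolvent_ge1 r : 1 <= `|r| -> resolvent s F r = 0.
Proof. by move=> r1; rewrite /resolvent tail_ge1// mulr0. Qed.

Lemma is_derive_resolvent r : 0 < r < 1 ->
  is_derive r 1 (resolvent s F) (- drop s F r).
Proof.
move=> r01; have /andP[r0 _] := r01.
apply: is_derive_eq (is_derive1M (is_derive_rI r) (is_derive_tail r01)) _.
rewrite /drop /slope; field.
by rewrite !gt_eqF ?rI_gt0// exprn_gt0.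
Qed.

Lemma drop_mulr r : 0 < r ->
  r ^+ N * drop s F r = s * wint s F r / rI s r - r ^+ N * rI1 s r * tail s F r.
Proof. by move=> r0; rewrite /drop; field; rewrite !gt_eqF ?rI_gt0// exprn_gt0. Qed.

Let K t := s * wint s F t / rI s t - t ^+ N * rI1 s t * tail s F t.

Let dK r : 0 < r < 1 ->
  is_derive r 1 K (r ^+ N * (s * (F r - resolvent s F r))).
Proof.
move=> r01; have /andP[r0 _] := r01.
have h1 := is_derive1M (is_derive1Z s (is_derive_wint r0))
  (is_derive1V (lt0r_neq0 (rI_gt0 r)) (is_derive_rI r)).
have h2 := is_derive1M (is_derive_powrI1 r) (is_derive_tail r01).
apply: is_derive_eq (is_derive1D h1 (is_derive1N h2)) _.
rewrite /resolvent /slope; field.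
by rewrite !gt_eqF ?rI_gt0// exprn_gt0.
Qed.

Lemma is_derive_drop_mulr r : 0 < r < 1 ->
  is_derive r 1 (fun t => t ^+ N * drop s F t)
   (r ^+ N * (s * (F r - resolvent s F r))).
Proof.
move=> r01; have /andP[r0 _] := r01; apply: is_derive_near (dK r01).
near=> x; rewrite drop_mulr//; near: x; exact: lt_nbhsr.
Unshelve. all: by end_near. Qed.

Lemma drop0 : drop s F 0 = 0.
Proof. by rewrite /drop wint_le0// mulr0 mul0r /rI1 mulr0 !mul0r subrr. Qed.

Let cK : continuous K.
Proof.
apply: contB; last first.
  exact: contM (contM contX cont_rI1) cont_tail.
apply: contM; first by apply: contM cont_wint => ?; exact: cvg_cst.
by apply: contV cont_rI => x; rewrite gt_eqF// rI_gt0.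
Qed.

(** The equation integrated in divergence form. The formula of [drop] divides by r^N, so the
    argument runs on K, which is r^N [drop] and continuous up to 0. *)
Lemma drop_itg r : 0 <= r <= 1 ->
  r ^+ N * drop s F r = s * itg 0 r (fun t => t ^+ N * (F t - resolvent s F t)).
Proof.
move=> /andP[r0 r1].
have cFV : continuous (fun t => t ^+ N * (F t - resolvent s F t)).
  exact: contM contX (contB cF cont_resolvent).
have K0 : K 0 = 0.
  by rewrite /K wint_le0// mulr0 mul0r expr0n gtn_eqF// !mul0r subrr.
have -> : r ^+ N * drop s F r = K r - K 0.
  rewrite K0 subr0; move: r0; rewrite le_eqVlt => /orP[/eqP <-|r0]; last exact: drop_mulr.
  by rewrite K0 expr0n gtn_eqF// mul0r.
rewrite -itgZ; last exact: contW.
symmetry; apply: itg_FTC => //.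
- apply: contW; apply: contM cFV => ?; exact: cvg_cst.
- exact: contW.
- move=> x /andP[x0 xr]; apply: is_derive_eq (dK _) _.
    by rewrite x0 (lt_le_trans xr).
  by rewrite mulrCA.
Qed.

Lemma is_derive_drop r : 0 < r < 1 -> is_derive r 1 (drop s F)
  (s * (F r - resolvent s F r) - N%:R * drop s F r / r).
Proof.
move=> r01; have /andP[r0 _] := r01.
have rN : r ^+ N != 0 by rewrite gt_eqF// exprn_gt0.
have h := is_derive1M (is_derive1V (f := fun t => t ^+ N) rN (is_derive1X r N)) (is_derive_drop_mulr r01).
apply: (is_derive_near (f := fun t => (t ^+ N)^-1 * (t ^+ N * drop s F t))).
  near=> x; rewrite mulKf// gt_eqF// exprn_gt0//.
  by near: x; exact: lt_nbhsr.
have e : r ^+ N = r * r ^+ N.-1 by rewrite -exprS prednK.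
have a0 : r ^+ N.-1 != 0 by rewrite gt_eqF// exprn_gt0.
by apply: is_derive_eq h _; rewrite e; field; rewrite a0 gt_eqF.
Unshelve. all: by end_near. Qed.

(** Since [rI1]/[rI]^2 is the derivative of -1/[rI], a bound K0 on the weighted means over [0, t],
    for t between r and 1, integrates explicitly. *)
Lemma tail_le_of r K0 : 0 <= r <= 1 ->
  (forall t, r <= t <= 1 -> wint s F t <= K0 * (t ^+ N * rI1 s t / s)) ->
  tail s F r <= K0 * ((rI s r)^-1 - (rI s 1)^-1).
Proof.
move=> /andP[r0 r1] hK; rewrite /tail ger0_norm//.
have c1 : {within `[r, 1], continuous (fun t => rI1 s t / rI s t ^+ 2)}.
  apply: contW; apply: contM cont_rI1 _.
  apply: contV; last exact: cont_exp cont_rI.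
  by move=> x; rewrite expf_neq0// gt_eqF// rI_gt0.
have -> : (rI s r)^-1 - (rI s 1)^-1 = itg r 1 (fun t => rI1 s t / rI s t ^+ 2).
  have -> : (rI s r)^-1 - (rI s 1)^-1 = - (rI s 1)^-1 - - (rI s r)^-1 by ring.
  symmetry; apply: (@itg_FTC _ r 1 _ (fun t => - (rI s t)^-1)) => //.
    apply: contW; apply: contN; apply: contV.
      by move=> x; rewrite gt_eqF// rI_gt0.
    exact: cont_rI.
  move=> x _.
  have h := is_derive1N (is_derive1V (lt0r_neq0 (rI_gt0 x)) (is_derive_rI x)).
  by apply: is_derive_eq h _; rewrite mulNr opprK.
rewrite -itgZ//; apply: itg_le.
- exact/contW/cont_slope.
- by move=> x; apply: cvgM; [exact: cvg_cst|exact: c1].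
- move=> t rt1; have /andP[rt _] := rt1; have t0 := le_trans r0 rt.
  move: t0; rewrite le_eqVlt => /orP[/eqP <-|t0].
    by rewrite slope_le0// /rI1 mulr0 !mul0r mulr0.
  have tN : 0 < t ^+ N * rI s t ^+ 2 by rewrite mulr_gt0 ?exprn_gt0// rI_gt0.
  rewrite /slope ler_pdivrMr//.
  rewrite (le_trans (ler_wpM2l (ltW s_gt0) (hK t rt1)))// le_eqVlt.
  by apply/orP; left; apply/eqP; field; rewrite !gt_eqF ?rI_gt0.
Qed.

(** A maximum principle at r in terms of the weighted means over [0, t], t >= r, rather than of the
    supremum of F; it tolerates sources that are large near 0. *)
Lemma resolvent_le_of r K0 : 0 <= r <= 1 -> 0 <= K0 ->
  (forall t, r <= t <= 1 -> wint s F t <= K0 * (t ^+ N * rI1 s t / s)) ->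
  resolvent s F r <= K0.
Proof.
move=> r01 K00 hK; rewrite /resolvent.
rewrite (le_trans (ler_wpM2l (ltW (rI_gt0 r)) (tail_le_of r01 hK)))//.
rewrite mulrCA ler_piMr// mulrBr divff ?gt_eqF ?rI_gt0// gerBl.
by rewrite divr_ge0// ltW// rI_gt0.
Qed.

Hypothesis F_ge0 : forall p, 0 <= p <= 1 -> 0 <= F p.

Lemma slope_ge0 t : t <= 1 -> 0 <= slope s F t.
Proof.
move=> t1; have [t0|t0] := leP t 0; first by rewrite slope_le0.
by rewrite divr_ge0 ?mulr_ge0 ?wint_ge0 ?(ltW s_gt0)// ?exprn_ge0 ?ltW ?rI_gt0.
Qed.

Lemma tail_ge0 r : 0 <= tail s F r.
Proof. by apply: itg_ge0 => x /andP[_]; exact: slope_ge0. Qed.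

Lemma resolvent_ge0 r : 0 <= resolvent s F r.
Proof. by rewrite mulr_ge0 ?tail_ge0// ltW// rI_gt0. Qed.

Section bounded.
Variable M : R.
Hypothesis F_le : forall p, 0 <= p <= 1 -> F p <= M.

Let M_ge0 : 0 <= M.
Proof. by rewrite (le_trans (F_ge0 (p := 0) _) (F_le _)) ?lexx ?ler01. Qed.

Lemma tail_le r : 0 <= r <= 1 -> tail s F r <= M * ((rI s r)^-1 - (rI s 1)^-1).
Proof.
move=> r01; have /andP[r0 _] := r01; apply: tail_le_of => // t /andP[rt t1].
apply: wint_bound; first exact: le_trans rt.
by move=> p /andP[p0 pt]; apply: F_le; rewrite p0 (le_trans pt).
Qed.

Lemma resolvent_le1 r : 0 <= r <= 1 -> resolvent s F r <= M * (1 - rI s r / rI s 1).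
Proof.
move=> r01; rewrite /resolvent (le_trans (ler_wpM2l (ltW (rI_gt0 r)) (tail_le r01)))//.
apply: eq_leW; field.
by rewrite !gt_eqF ?rI_gt0.
Qed.

Lemma resolventN r : resolvent s F (- r) = resolvent s F r.
Proof. by rewrite /resolvent /tail /rI normrN sqrrN. Qed.

Lemma resolvent_norm r : resolvent s F `|r| = resolvent s F r.
Proof.
have [r0|r0] := leP 0 r; first by rewrite ger0_norm.
by rewrite ltr0_norm// resolventN.
Qed.

Lemma resolvent_le r : resolvent s F r <= M.
Proof.
rewrite -resolvent_norm; have [r1|/ltW r1] := leP `|r| 1; last first.
  by rewrite resolvent_ge1// normr_id.
rewrite (le_trans (resolvent_le1 _)) ?normr_ge0// ler_piMr// gerBl divr_ge0//.
  exact/ltW/rI_gt0.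
exact/ltW/rI_gt0.
Qed.

(** On [0, 1] the derivative of [rI] is at most s rI(1), hence 1 - rI(x)/rI(1) <= s. Together with
    [resolvent_le] this gives the factor min(1, s) that makes the integrals over s converge. *)
Lemma resolvent_le_s r : resolvent s F r <= M * s.
Proof.
rewrite -resolvent_norm; have [r1|/ltW r1] := leP `|r| 1; last first.
  by rewrite resolvent_ge1 ?normr_id// mulr_ge0// ltW.
rewrite (le_trans (resolvent_le1 _)) ?normr_ge0// ler_wpM2l//.
set x := `|r|; have x0 : 0 <= x by exact: normr_ge0.
have -> : 1 - rI s x / rI s 1 = (rI s 1 - rI s x) / rI s 1.
  by field; rewrite gt_eqF ?rI_gt0.
rewrite ler_pdivrMr ?rI_gt0//.
suff : s * rI s 1 * x - rI s x <= s * rI s 1 * 1 - rI s 1.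
  have : 0 <= s * rI s 1 * x by rewrite !mulr_ge0// ltW ?rI_gt0.
  by rewrite mulr1; lra.
apply: (@mono_derive _ x 1 (fun t => s * rI s 1 * t - rI s t) (fun t => s * rI s 1 - rI1 s t) r1).
- apply: contW; apply: contB cont_rI => t.
  by apply: cvgM; [exact: cvg_cst|exact: cvg_id].
- move=> t _; have h := is_derive1D (is_derive1Z (s * rI s 1) (is_derive_id t (1 : R)))
    (is_derive1N (is_derive_rI t)).
  by apply: is_derive_eq h _; rewrite mulr1.
- move=> t /andP[xt t1]; rewrite subr_ge0; have t0 := le_trans x0 (ltW xt).
  rewrite (le_trans (rI1_le t0))// -mulrA ler_wpM2l ?(ltW s_gt0)//.
  rewrite (le_trans _ (rI_mono t0 (ltW t1)))// ler_piMl ?ltW//.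
  exact: rI_gt0.
Qed.

Lemma drop_le r : 0 <= r <= 1 -> drop s F r <= M * s * r.
Proof.
move=> r01; have /andP[r0 r1] := r01.
move: r0; rewrite le_eqVlt => /orP[/eqP <-|r0]; first by rewrite drop0 mulr0.
have rN : 0 < r ^+ N by rewrite exprn_gt0.
rewrite -(ler_pM2l rN) drop_itg// mulrCA -!mulrA mulrCA ler_wpM2l ?(ltW s_gt0)//.
have -> : M * (r ^+ N * r) = itg 0 r (fun=> M * r ^+ N).
  by rewrite itg_cst ?ltW// subr0 mulrA.
apply: itg_le.
- apply: contW.
  exact: contM contX (contB cF cont_resolvent).
- by apply: contW => ?; exact: cvg_cst.
- move=> x /andP[x0 xr]; rewrite [leRHS]mulrC.
  have xN : x ^+ N <= r ^+ N by rewrite lerXn2r// nnegrE// ltW.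
  have h : F x - resolvent s F x <= M.
    by rewrite lerBlDr ler_wpDr ?resolvent_ge0// F_le// x0 (le_trans xr).
  by rewrite (le_trans (ler_wpM2l _ h)) ?exprn_ge0// ler_wpM2r.
Qed.

End bounded.

(** If the weighted mean over [0, r] dominates all later ones, [tail_le_of] bounds the second term
    of [drop] by the first. Besides nonincreasing sources this covers sources that vanish beyond
    r. *)
Lemma drop_ge0_of r : 0 < r <= 1 ->
  (forall t, r <= t <= 1 ->
    wint s F t * (r ^+ N * rI1 s r) <= wint s F r * (t ^+ N * rI1 s t)) ->
  0 <= drop s F r.
Proof.
move=> /andP[r0 r1] hm; set W := r ^+ N * rI1 s r.
have W0 : 0 < W by rewrite mulr_gt0 ?exprn_gt0 ?rI1_gt0.
have w0 : 0 <= wint s F r by exact: wint_ge0.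
have h : tail s F r <= s * wint s F r / W * ((rI s r)^-1 - (rI s 1)^-1).
  apply: tail_le_of; first by rewrite (ltW r0).
  move=> t rt1; rewrite (_ : _ * _ = wint s F r * (t ^+ N * rI1 s t) / W).
    by rewrite ler_pdivlMr// hm.
  by field; rewrite !gt_eqF.
have h' : tail s F r <= s * wint s F r / W / rI s r.
  rewrite (le_trans h)//; apply: ler_wpM2l.
    exact: divr_ge0 (mulr_ge0 (ltW s_gt0) w0) (ltW W0).
  by rewrite gerBl invr_ge0 ltW// rI_gt0.
rewrite /drop subr_ge0 (le_trans (ler_wpM2l (rI1_ge0 (ltW r0)) h'))//.
apply: eq_leW; rewrite /W; field.
by rewrite !gt_eqF ?rI_gt0 ?rI1_gt0// exprn_gt0.
Qed.

Hypothesis F_ni : forall p q, 0 <= p -> p <= q -> q <= 1 -> F q <= F p.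

(** The weighted means of a nonincreasing source decrease: the mean over [0, r] is at least F(r),
    and the mass added between r and t is at most F(r) times the added weight. *)
Lemma drop_ge0 r : 0 <= r <= 1 -> 0 <= drop s F r.
Proof.
move=> /andP[]; rewrite le_eqVlt => /orP[/eqP <-|r0] r1; first by rewrite drop0.
apply: drop_ge0_of; first by rewrite r0.
move=> t /andP[rt t1].
have cI : continuous (fun p : R => p ^+ N * rI s p * 1).
  under eq_fun do rewrite mulr1; exact: contM contX cont_rI.
set Wr := r ^+ N * rI1 s r; set Wt := t ^+ N * rI1 s t.
have Wr0 : 0 <= Wr by rewrite mulr_ge0 ?exprn_ge0 ?rI1_ge0 ?ltW.
have h1 : F r * Wr <= s * wint s F r.
  rewrite [leRHS]mulrC -ler_pdivrMr// -mulrA; apply: wint_ge; first exact: ltW.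
  by move=> p /andP[p0 pr]; exact: F_ni.
have h2 : s * wint s F t <= s * wint s F r + F r * (Wt - Wr).
  have -> : wint s F t = wint s F r + itg r t (fun p => p ^+ N * rI s p * F p).
    exact: (itg_split (ltW r0) rt cG).
  rewrite mulrDr lerD2l.
  have e : Wt - Wr = s * itg r t (fun p => p ^+ N * rI s p * 1).
    have := itg_split (ltW r0) rt cI; rewrite -!/(wint s (fun=> 1) _).
    rewrite !wint1 ?(ltW r0)//; last by rewrite (le_trans (ltW r0)).
    rewrite -/Wr -/Wt => e; have -> : itg r t (fun p => p ^+ N * rI s p * 1) = Wt / s - Wr / s.
      by rewrite e addrAC subrr add0r.
    by field; rewrite gt_eqF.
  rewrite e mulrCA ler_wpM2l ?(ltW s_gt0)// -itgZ; last exact: contW.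
  apply: itg_le.
  - exact: contW.
  - apply: contW; apply: contM cI => ?; exact: cvg_cst.
  - move=> p /andP[rp pt]; rewrite mulr1 mulrC ler_wpM2r//.
      by rewrite mulr_ge0 ?exprn_ge0 ?(le_trans (ltW r0) rp)// ltW// rI_gt0.
    by apply: F_ni => //; [exact: ltW|exact: le_trans t1].
have Wrt : Wr <= Wt.
  exact: powrI1_mono (ltW r0) rt.
rewrite -(ler_pM2l s_gt0) mulrA (le_trans (ler_wpM2r Wr0 h2))//.
have : F r * Wr * (Wt - Wr) <= s * wint s F r * (Wt - Wr) by rewrite ler_wpM2r// subr_ge0.
by lra.
Qed.

End continuousF.
End fixed_s.
End resolvent.

Lemma resolvent_gt0 (R : realType) (N : nat) (s : R) (F : R -> R) q : (0 < N)%N -> 0 < s ->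
  continuous F -> (forall p, 0 <= p <= 1 -> 0 < F p) -> 0 <= q < 1 -> 0 < resolvent N s F q.
Proof.
move=> N_gt0 s_gt0 cF F_gt0 /andP[q0 q1].
have F_ge0 p : 0 <= p <= 1 -> 0 <= F p by move=> /F_gt0/ltW.
rewrite /resolvent mulr_gt0 ?rI_gt0// /tail ger0_norm//.
(* Only the outer half of the interval is used, because [slope] vanishes at 0, which matters when q
   = 0. *)
rewrite (@itg_split _ q ((q + 1) / 2) 1); first last.
- exact: cont_slope.
- by lra.
- by lra.
rewrite ltr_wpDl//.
  apply: itg_ge0 => t /andP[_ t1]; apply: slope_ge0 => //; lra.
apply: itg_gt0; first lra.
  by apply: contW; exact: cont_slope.
move=> t /andP[qt t1]; have t0 : 0 < t by lra.
rewrite /slope divr_gt0// ?mulr_gt0 ?exprn_gt0 ?rI_gt0//.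
rewrite /wint (@itg_split _ 0 (t / 2) t); first last.
- apply: contM cF; apply: contM; first exact: contX.
  exact: cont_rI.
- by lra.
- by lra.
rewrite ltr_wpDl//.
  apply: itg_ge0 => p /andP[p0 pt].
  by rewrite !mulr_ge0 ?exprn_ge0 ?(ltW (rI_gt0 _ _ _))// F_ge0// p0; lra.
apply: itg_gt0; first lra.
  apply: contW.
  apply: contM cF; apply: contM; first exact: contX.
  exact: cont_rI.
move=> p /andP[tp pt]; have p0 : 0 < p by lra.
by rewrite !mulr_gt0 ?exprn_gt0 ?rI_gt0// F_gt0// (ltW p0); lra.
Qed.

(** * Slope bounds uniform in s, and positivity of the resolvent kernel *)

Section resolvent_estimates.
Variables (R : realType) (N : nat).
Hypothesis N_gt0 : (0 < N)%N.
Variable s : R.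
Hypothesis s_gt0 : 0 < s.
Implicit Types (a b r t : R) (F G : R -> R).

Let cpow := @contX R N.
Let cI := @cont_rI R N s.
Let cI1 := @cont_rI1 R N s.
Let I_gt0 := @rI_gt0 R N s s_gt0.

Let cpI : continuous (fun p : R => p ^+ N * rI N s p).
Proof. exact: contM. Qed.

Lemma wint_lin a b F G t : continuous F -> continuous G ->
  wint N s (fun p => a * F p + b * G p) t = a * wint N s F t + b * wint N s G t.
Proof.
move=> cF cG; have cF' := contM cpI cF; have cG' := contM cpI cG.
rewrite /wint -!itgZ; try exact: contW.
rewrite -itgD; try (apply: contW; apply: contM => // ?; exact: cvg_cst).
by apply: eq_itg => p _; ring.
Qed.

Lemma resolvent_lin a b F G r : continuous F -> continuous G ->
  resolvent N s (fun p => a * F p + b * G p) r =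
  a * resolvent N s F r + b * resolvent N s G r.
Proof.
move=> cF cG; rewrite /resolvent [in RHS]mulrCA [X in _ + X]mulrCA -mulrDr.
congr (_ * _); rewrite /tail.
have cF' := @cont_slope R N N_gt0 s s_gt0 F cF.
have cG' := @cont_slope R N N_gt0 s s_gt0 G cG.
rewrite -!itgZ; try exact: contW.
rewrite -itgD; try (apply: contW; apply: contM => // ?; exact: cvg_cst).
by apply: eq_itg => p _; rewrite /slope wint_lin//; ring.
Qed.

Lemma resolvent_mono F G r : continuous F -> continuous G ->
  (forall p, 0 <= p <= 1 -> F p <= G p) -> resolvent N s F r <= resolvent N s G r.
Proof.
move=> cF cG FG; rewrite -subr_ge0.
have -> : resolvent N s G r - resolvent N s F r =
    resolvent N s (fun p => 1 * G p + (-1) * F p) r.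
  by rewrite (resolvent_lin 1 (-1) r cG cF) mul1r mulN1r.
by apply: resolvent_ge0 => // p p01; rewrite mul1r mulN1r subr_ge0 FG.
Qed.

Section one.
Variable F : R -> R.
Hypothesis cF : continuous F.

(** In this quotient [tail] appears without a factor and its derivative is explicit. What remains is
    s/[rI1] times the difference between F(r) and its weighted mean over [0, r]. *)
Lemma is_derive_drop_ratio r : 0 < r < 1 ->
  is_derive r 1 (fun t => drop N s F t / rI1 N s t)
   (s * (F r * (r ^+ N * rI1 N s r) - s * wint N s F r) / (r ^+ N * rI1 N s r ^+ 2)).
Proof.
move=> r01; have /andP[r0 r1] := r01.
have h := is_derive1M (is_derive_drop N_gt0 s_gt0 cF r01)
  (is_derive1V (lt0r_neq0 (rI1_gt0 N s_gt0 r0)) (is_derive_rI1 N s r)).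
apply: is_derive_eq h _.
have -> : rI2 N s r = s * rI N s r - N%:R * rI1 N s r / r.
  by apply: (mulfI (lt0r_neq0 r0)); rewrite mulrBr -[LHS](addrK (N%:R * rI1 N s r)) rI_ode; field; rewrite gt_eqF.
rewrite /drop /resolvent; field.
by rewrite !gt_eqF ?I_gt0 ?(rI1_gt0 N s_gt0 r0)// exprn_gt0.
Qed.

(** The left side is the oscillation integral of [wint_osc] for the source of slope -1. Hence, for a
    source with Lipschitz constant L, the quotient (drop - L)/rI1 is nondecreasing. *)
Lemma wint_dist r : 0 < r ->
  s ^+ 2 * itg 0 r (fun p => p ^+ N * rI N s p * (r - p)) <= r ^+ N * rI2 N s r.
Proof.
move=> r0; set w1 := fun x => itg 0 x (fun p => p ^+ N * rI N s p * 1).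
set w2 := fun x => itg 0 x (fun p => p ^+ N * rI N s p * p).
have cid : continuous (fun p : R => p) by move=> ?; exact: cvg_id.
have c1 : continuous (fun p : R => p ^+ N * rI N s p * 1).
  by apply: contM => // ?; exact: cvg_cst.
have c2 : continuous (fun p : R => p ^+ N * rI N s p * p) by exact: contM.
have -> : itg 0 r (fun p => p ^+ N * rI N s p * (r - p)) = r * w1 r - w2 r.
  rewrite -itgZ; last exact: contW.
  rewrite -itgB; [|apply: contW|exact: contW].
    by apply: eq_itg => p _; ring.
  by apply: contM c1 => ?; exact: cvg_cst.
(* This is x^N [rI2], rewritten by the equation of [rI] so that it can be differentiated once more,
   minus the left side; its derivative is N x^(N-2) [rI1]. *)
pose G x := s * (x ^+ N * rI N s x) - N%:R * (x ^+ N.-1 * rI1 N s x) -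
  s ^+ 2 * (x * w1 x - w2 x).
suff : G 0 <= G r.
  rewrite /G /w1 /w2 !itgxx expr0n gtn_eqF// /rI1 !(mulr0, mul0r, subr0) -/(rI1 N s r).
  have -> : r ^+ N * rI2 N s r = r ^+ N.-1 * (r * rI2 N s r).
    by rewrite mulrA -exprSr prednK.
  have -> : r * rI2 N s r = s * r * rI N s r - N%:R * rI1 N s r.
    by rewrite -rI_ode addrK.
  have -> : r ^+ N = r ^+ N.-1 * r by rewrite -exprSr prednK.
  by lra.
apply: (@mono_derive _ 0 r G (fun x => N%:R * x ^+ N * rI1 N s x / x ^+ 2)).
- exact: ltW.
- apply: contW; apply: contB.
    apply: contB; apply: contM => //; try by exact: contC.
    apply: contM => //; exact: contX.
  apply: contM; first by exact: contC.
  apply: contB; last exact: cont_itg.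
  by apply: contM => //; exact: cont_itg.
- move=> x /andP[x0 xr].
  have d1 := is_derive1Z s (is_derive1M (is_derive1X x N) (is_derive_rI N s x)).
  have d2 := is_derive1Z N%:R (is_derive1M (is_derive1X x N.-1) (is_derive_rI1 N s x)).
  have d3 := is_derive1M (is_derive_id x (1 : R)) (is_derive_itg c1 x0).
  have d4 := is_derive1Z (s ^+ 2) (is_derive1D d3 (is_derive1N (is_derive_itg c2 x0))).
  have d := is_derive1D (is_derive1D d1 (is_derive1N d2)) (is_derive1N d4).
  apply: is_derive_eq d _.
  have -> : itg 0 x (fun p => p ^+ N * rI N s p * 1) = x ^+ N * rI1 N s x / s.
    exact: (wint1 N_gt0 s_gt0 (ltW x0)).
  have -> : rI2 N s x = s * rI N s x - N%:R * rI1 N s x / x.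
    by apply: (mulfI (lt0r_neq0 x0)); rewrite mulrBr -[LHS](addrK (N%:R * rI1 N s x)) rI_ode; field; rewrite gt_eqF.
  have eN : x ^+ N = x ^+ N.-1 * x by rewrite -exprSr prednK.
  have eN' : N.-1%:R * x ^+ N.-2 = (N%:R - 1) * x ^+ N.-1 / x :> R.
    case: N N_gt0 => // -[|m] _ /=; first by rewrite subrr !mul0r.
    by rewrite -(natr1 m.+1) addrK exprSr -mulrA mulrK// unitfE gt_eqF.
  rewrite eN' eN; field.
  by rewrite !gt_eqF.
- move=> x /andP[x0 _]; apply: divr_ge0; last exact: sqr_ge0.
  apply: mulr_ge0; last exact/(rI1_ge0 N s_gt0)/ltW.
  by rewrite mulr_ge0// exprn_ge0// ltW.
Qed.

Lemma wint_osc r : 0 <= r ->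
  s * wint N s F r - F r * (r ^+ N * rI1 N s r) =
  s * itg 0 r (fun p => p ^+ N * rI N s p * (F p - F r)).
Proof.
move=> r0; have c1 : continuous (fun p : R => p ^+ N * rI N s p * 1).
  by apply: contM => // ?; exact: cvg_cst.
have e : r ^+ N * rI1 N s r = s * itg 0 r (fun p => p ^+ N * rI N s p * 1).
  by rewrite -/(wint N s (fun=> 1) r) wint1//; field; rewrite gt_eqF.
rewrite e mulrCA -mulrBr; congr (_ * _); rewrite -itgZ; last exact: contW.
rewrite /wint -itgB; [|apply: contW; exact: contM|apply: contW].
  by apply: eq_itg => p _; ring.
by apply: contM c1 => ?; exact: cvg_cst.
Qed.

Lemma cont_drop_ratio_in r r1 c : 0 < r -> r1 < 1 ->
  {within `[r, r1], continuous (fun t => (drop N s F t - c) / rI1 N s t)}.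
Proof.
move=> r0 r11; apply: continuous_in_subspaceT => x; rewrite inE/= in_itv/= => /andP[rx xr].
have x0 : 0 < x by exact: lt_le_trans rx.
apply: cvgM; last by apply: cvgV; [rewrite gt_eqF// rI1_gt0|exact: cI1].
apply: cvgB; last exact: cvg_cst.
apply: derive_cont (is_derive_drop N_gt0 s_gt0 cF _).
by rewrite x0 (le_lt_trans xr).
Qed.

Section nonincreasing.
Hypothesis F_ge0 : forall p, 0 <= p <= 1 -> 0 <= F p.
Hypothesis F_ni : forall p q, 0 <= p -> p <= q -> q <= 1 -> F q <= F p.

Let F_le p : 0 <= p <= 1 -> F p <= F 0.
Proof. by move=> /andP[p0 p1]; exact: F_ni. Qed.

Lemma rI1_ratio r r1 : 0 < r -> r < r1 ->
  s * rI1 N s r <= 6 * (N%:R + 3) / (r1 - r) ^+ 2 * rI1 N s r1.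
Proof.
move=> r0 rr1; have r10 := lt_trans r0 rr1.
have q1 : 0 <= r ^+ 2 / r1 ^+ 2 < 1.
  by rewrite divr_ge0 ?sqr_ge0//= ltr_pdivrMr ?exprn_gt0// mul1r ltr_pXn2r// nnegrE ltW.
have z0 : 0 <= s * r1 ^+ 2 by rewrite mulr_ge0 ?sqr_ge0// ltW.
have := J1_ratio N z0 q1; rewrite /rI1.
have -> : r ^+ 2 / r1 ^+ 2 * (s * r1 ^+ 2) = s * r ^+ 2 by field; rewrite gt_eqF.
have := J1_gt0 N z0; set a := J1 N (s * r ^+ 2); set b := J1 N (s * r1 ^+ 2) => b0 hab.
have d0 : 0 < r1 - r by rewrite subr_gt0.
have e0 : 0 < r1 + r by rewrite addr_gt0.
set C := 6 * (N%:R + 3) in hab *; have C0 : 0 <= C by rewrite mulr_ge0// addr_ge0.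
have -> : C / (r1 - r) ^+ 2 * (2 * s * r1 * b) =
    2 * s / r1 * ((1 + r / r1) ^+ 2 * (C / (1 - r ^+ 2 / r1 ^+ 2) ^+ 2 * b)).
  have -> : 1 - r ^+ 2 / r1 ^+ 2 = (r1 - r) * (r1 + r) / r1 ^+ 2.
    by field; rewrite gt_eqF.
  by field; rewrite !gt_eqF.
have h1 : s * r1 ^+ 2 * a <= (1 + r / r1) ^+ 2 * (C / (1 - r ^+ 2 / r1 ^+ 2) ^+ 2 * b).
  rewrite (le_trans hab)// ler_peMl//.
    by rewrite mulr_ge0 ?(ltW b0)// divr_ge0 ?sqr_ge0.
  by rewrite exprn_ege1// lerDl divr_ge0// ltW.
have c0 : 0 <= 2 * s / r1 by rewrite divr_ge0 ?(ltW r10)// mulr_ge0// ltW.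
rewrite (le_trans _ (ler_wpM2l c0 h1))//.
have -> : 2 * s / r1 * (s * r1 ^+ 2 * a) = s * (2 * s * r1 * a) by field; rewrite gt_eqF.
have a0 : 0 < a by apply: J1_gt0; rewrite mulr_ge0 ?sqr_ge0// ltW.
rewrite ler_wpM2l ?(ltW s_gt0)// ler_wpM2r ?(ltW a0)// ler_wpM2l ?(ltW rr1)//.
by rewrite mulr_ge0// ltW.
Qed.

(** The quotient (drop - L)/rI1 is nondecreasing on [r, r1]. At r1 the crude bound drop <= F(0) s
    costs a factor s, which [rI1_ratio] recovers in passing from r1 to r; the result is uniform in
    s. *)
Lemma drop_le_lip L r r1 : 0 < r -> r < r1 -> r1 < 1 -> 0 <= L ->
  (forall p q, 0 <= p -> p <= q -> q <= r1 -> F p - F q <= L * (q - p)) ->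
  drop N s F r <= L + 6 * (N%:R + 3) / (r1 - r) ^+ 2 * F 0.
Proof.
move=> r0 rr1 r11 L0 hL.
have r10 := lt_trans r0 rr1.
have h : (drop N s F r - L) / rI1 N s r <= (drop N s F r1 - L) / rI1 N s r1.
  apply: (@mono_derive _ r r1 (fun x => (drop N s F x - L) / rI1 N s x)
   (fun x => s * (F x * (x ^+ N * rI1 N s x) - s * wint N s F x) / (x ^+ N * rI1 N s x ^+ 2)
     + L * rI2 N s x / rI1 N s x ^+ 2)).
  - exact: ltW.
  - exact: cont_drop_ratio_in.
  - move=> x /andP[rx xr1].
    have x01 : 0 < x < 1 by rewrite (lt_trans r0 rx) (lt_trans xr1).
    have x0 : 0 < x by exact: lt_trans rx.
    have h := is_derive1D (is_derive_drop_ratio x01) (is_derive1Z (- L)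
      (is_derive1V (lt0r_neq0 (rI1_gt0 N s_gt0 x0)) (is_derive_rI1 N s x))).
    rewrite (_ : (fun t => _) = (fun t => drop N s F t / rI1 N s t + (- L) * (rI1 N s t)^-1)).
      by apply: is_derive_eq h _; ring.
    by apply/funext => t; rewrite mulrBl mulNr.
  - move=> x /andP[rx xr1]; have x0 : 0 < x by exact: lt_trans rx.
    have I0 := rI1_gt0 N s_gt0 x0.
    have -> : s * (F x * (x ^+ N * rI1 N s x) - s * wint N s F x) / (x ^+ N * rI1 N s x ^+ 2)
     + L * rI2 N s x / rI1 N s x ^+ 2 =
     (L * (x ^+ N * rI2 N s x) - s * (s * wint N s F x - F x * (x ^+ N * rI1 N s x))) / (x ^+ N * rI1 N s x ^+ 2).
      by field; rewrite !gt_eqF// exprn_gt0.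
    apply: divr_ge0; last by rewrite mulr_ge0 ?sqr_ge0// exprn_ge0// ltW.
    rewrite subr_ge0 wint_osc ?(ltW x0)// mulrA -expr2.
    rewrite (le_trans _ (ler_wpM2l L0 (wint_dist x0)))// mulrCA ler_wpM2l ?sqr_ge0//.
    have cc : continuous (fun p : R => p ^+ N * rI N s p * (x - p)).
      apply: contM => //; apply: contB => ?; [exact: cvg_cst|exact: cvg_id].
    rewrite -itgZ; last exact: contW.
    apply: itg_le.
    + apply: contW; apply: contM => //.
      by apply: contB => // ?; exact: cvg_cst.
    + by apply: contW; apply: contM => // ?; exact: cvg_cst.
    + move=> p /andP[p0 px]; rewrite mulrCA ler_wpM2l ?mulr_ge0 ?exprn_ge0 ?(ltW (I_gt0 _))//.
      by apply: hL => //; exact: ltW.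
have I0 := rI1_gt0 N s_gt0 r0; have I10 := rI1_gt0 N s_gt0 r10.
have hd : drop N s F r1 <= F 0 * s.
  have := drop_le N_gt0 s_gt0 cF F_ge0 F_le; move=> /(_ r1) hh.
  rewrite (le_trans (hh _)) ?(ltW r10) ?(ltW r11)// ler_piMr ?(ltW r11)//.
  by rewrite mulr_ge0 ?(ltW s_gt0)// F_ge0// lexx ler01.
have F00 : 0 <= F 0 by rewrite F_ge0// lexx ler01.
have hr := rI1_ratio r0 rr1; set K := 6 * (N%:R + 3) / (r1 - r) ^+ 2 in hr *.
have h1 : (drop N s F r - L) / rI1 N s r <= F 0 * s / rI1 N s r1.
  by rewrite (le_trans h)// ler_pM2r ?invr_gt0// lerBlDr ler_wpDr.
move: h1; rewrite ler_pdivrMr// => h1; rewrite -lerBlDl (le_trans h1)//.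
rewrite (_ : _ * rI1 N s r = F 0 * (s * rI1 N s r / rI1 N s r1)); last by ring.
by rewrite [leRHS]mulrC ler_wpM2l// ler_pdivrMr.
Qed.

Definition drop_const : R := J1 N 0 / (16 * N.+1%:R * 4 ^+ N * J1 N 16 ^+ 2).

Lemma drop_const_gt0 : 0 < drop_const.
Proof.
by rewrite divr_gt0 ?J1_gt0// mulr_gt0 ?exprn_gt0 ?J1_gt0// mulr_gt0 ?exprn_gt0.
Qed.

(** The quotient drop/rI1 is nonincreasing, nonnegative at 4t, and falls at a definite rate on
    [2t, 4t], because the oscillation integral there contains at least D t^(N+1)/(N+1) coming from
    [0, t]. The condition s t^2 <= 1 keeps s (4t)^2 below 16, hence [rI1] comparable to s t; this is
    the origin of [drop_const]. *)
Lemma drop_lower t r : 0 < t -> t <= r -> r <= 2 * t -> 4 * t < 1 ->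
  s * t ^+ 2 <= 1 ->
  drop_const * (s * t * (F t - F (2 * t))) <= drop N s F r.
Proof.
move=> t0 tr r2 t4 st; set D := F t - F (2 * t).
have D0 : 0 <= D by rewrite subr_ge0; apply: F_ni; lra.
have r0 : 0 < r by exact: lt_le_trans tr.
pose osc x := itg 0 x (fun p => p ^+ N * rI N s p * (F p - F x)).
have osc_ge0 x : 0 <= x <= 1 -> 0 <= osc x.
  move=> /andP[x0 x1]; apply: itg_ge0 => p /andP[p0 px].
  by rewrite !mulr_ge0 ?exprn_ge0 ?(ltW (I_gt0 _))// subr_ge0 F_ni.
have osc_ge x : 2 * t <= x -> x <= 1 -> D * (t ^+ N.+1 / N.+1%:R) <= osc x.
  move=> tx x1; rewrite /osc (@itg_split _ 0 t x)//; first last.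
  - by apply: contM => //; apply: contB => // ?; exact: cvg_cst.
  - by lra.
  - exact: ltW.
  have -> : t ^+ N.+1 / N.+1%:R = itg 0 t (fun p => p ^+ N).
    have -> : t ^+ N.+1 / N.+1%:R = N.+1%:R^-1 * t ^+ N.+1 - N.+1%:R^-1 * 0 ^+ N.+1.
      by rewrite expr0n mulr0 subr0 mulrC.
    symmetry; apply: (@itg_FTC _ 0 t _ (fun x => N.+1%:R^-1 * x ^+ N.+1)); first exact: ltW.
    - exact: contW.
    - apply: contW; apply: contM; last exact: contX.
      by exact: contC.
    - move=> y _; apply: is_derive_eq (is_derive1Z _ (is_derive1X y N.+1)) _.
      by rewrite mulrA mulVf ?mul1r.
  rewrite -itgZ; last exact: contW.
  rewrite ler_wpDr//.
    apply: itg_ge0 => p /andP[tp px].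
    rewrite !mulr_ge0 ?exprn_ge0 ?(ltW (I_gt0 _))//; first exact: le_trans (ltW t0) tp.
    by rewrite subr_ge0 F_ni//; exact: le_trans (ltW t0) tp.
  apply: itg_le.
  - by apply: contW; apply: contM => // ?; exact: cvg_cst.
  - apply: contW; apply: contM => //.
    by apply: contB => // ?; exact: cvg_cst.
  - move=> p /andP[p0 pt].
    have h1 : D <= F p - F x by rewrite lerB// F_ni//; lra.
    have pN : 0 <= p ^+ N by rewrite exprn_ge0.
    rewrite mulrC -mulrA ler_wpM2l//.
    by rewrite (le_trans h1)// ler_peMl ?rI_ge1// (le_trans D0).
pose g x := (drop N s F x - 0) / rI1 N s x.
have dg (x : R) : 0 < x < 1 -> is_derive x 1 g (- (s ^+ 2 * osc x / (x ^+ N * rI1 N s x ^+ 2))).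
  move=> x01; have /andP[x0 x1] := x01.
  have h := is_derive_drop_ratio x01.
  have -> : g = fun t => drop N s F t / rI1 N s t by apply/funext => y; rewrite /g subr0.
  apply: is_derive_eq h _; have := wint_osc (ltW x0); rewrite -/(osc x) => e.
  have -> : s * wint N s F x = s * osc x + F x * (x ^+ N * rI1 N s x) by rewrite -e subrK.
  by field; rewrite !gt_eqF ?(rI1_gt0 N s_gt0 x0)// exprn_gt0.
have cg a b : 0 < a -> b < 1 -> {within `[a, b], continuous g}.
  by move=> a0 b1; exact: cont_drop_ratio_in.
have t20 : 0 < 2 * t by rewrite mulr_gt0.
have t40 : 0 < 4 * t by rewrite mulr_gt0.
have I40 := rI1_gt0 N s_gt0 t40.
pose c0 := s ^+ 2 * (D * (t ^+ N.+1 / N.+1%:R)) / ((4 * t) ^+ N * rI1 N s (4 * t) ^+ 2).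
have c0t : 0 <= c0 * (2 * t).
  rewrite mulr_ge0 ?(ltW t20)// divr_ge0//.
    by rewrite mulr_ge0 ?sqr_ge0// mulr_ge0// divr_ge0// exprn_ge0// ltW.
  by rewrite mulr_ge0 ?sqr_ge0// exprn_ge0// ltW.
have g1 : g (2 * t) <= g r.
  rewrite -lerN2; apply: (@mono_derive _ r (2 * t) (fun x => - g x)
    (fun x => s ^+ 2 * osc x / (x ^+ N * rI1 N s x ^+ 2)) r2).
  - by move=> x; apply: cvgN; apply: cg => //; lra.
  - move=> x /andP[rx xt]; rewrite -[_ / _]opprK; apply: is_derive1N; apply: dg.
    by rewrite (lt_trans r0 rx); lra.
  - move=> x /andP[rx xt]; have x0 := lt_trans r0 rx.
    apply: divr_ge0; last by rewrite mulr_ge0 ?sqr_ge0// exprn_ge0// ltW.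
    by rewrite mulr_ge0 ?sqr_ge0// osc_ge0// (ltW x0); lra.
have g2 : c0 * (2 * t) <= g (2 * t).
  have : - g (2 * t) - c0 * (2 * t) <= - g (4 * t) - c0 * (4 * t).
    apply: (@mono_derive _ (2 * t) (4 * t) (fun x => - g x - c0 * x)
      (fun x => s ^+ 2 * osc x / (x ^+ N * rI1 N s x ^+ 2) - c0)).
    - by lra.
    - move=> x; apply: cvgB; first by apply: cvgN; apply: cg.
      by apply: cvgM; [exact: cvg_cst|apply: contW => ?; exact: cvg_id].
    - move=> x /andP[tx xt]; apply: is_derive1D.
        rewrite -[_ / _]opprK; apply: is_derive1N; apply: dg.
        by rewrite (lt_trans t20 tx) (lt_trans xt).
      rewrite -[c0 in X in is_derive _ _ _ X]mulr1.
      exact: is_derive1N (is_derive1Z c0 (is_derive_id x (1 : R))).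
    - move=> x /andP[tx xt]; have x0 := lt_trans t20 tx.
      have Ix0 := rI1_gt0 N s_gt0 x0.
      have h1 : D * (t ^+ N.+1 / N.+1%:R) <= osc x by apply: osc_ge; lra.
      have h0 : 0 <= D * (t ^+ N.+1 / N.+1%:R) by rewrite mulr_ge0// divr_ge0// exprn_ge0// ltW.
      rewrite subr_ge0 /c0; apply: ler_pM.
      + by rewrite mulr_ge0// sqr_ge0.
      + by rewrite invr_ge0 mulr_ge0 ?sqr_ge0// exprn_ge0// ltW.
      + by rewrite ler_wpM2l// sqr_ge0.
      have P1 : 0 < (4 * t) ^+ N * rI1 N s (4 * t) ^+ 2 by rewrite mulr_gt0// exprn_gt0.
      have P2 : 0 < x ^+ N * rI1 N s x ^+ 2 by rewrite mulr_gt0// exprn_gt0.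
      rewrite lef_pV2 ?posrE//.
      apply: ler_pM; rewrite ?exprn_ge0 ?(ltW x0) ?(ltW Ix0)//.
        by rewrite lerXn2r// ?nnegrE ?(ltW x0) ?(ltW t40) ?(ltW xt).
      by rewrite lerXn2r// ?nnegrE ?(ltW Ix0) ?(ltW I40)// rI1_mono// ltW.
  have : 0 <= g (4 * t).
    rewrite /g subr0 divr_ge0 ?(ltW I40)//; apply: drop_ge0 => //; lra.
  have := c0t.
  by lra.
have Ir0 := rI1_gt0 N s_gt0 r0.
have : c0 * (2 * t) <= drop N s F r / rI1 N s r by rewrite (le_trans g2)// (le_trans g1)// /g subr0.
rewrite ler_pdivlMr//; apply: le_trans.
have j0 : J1 N 0 <= J1 N (s * r ^+ 2).
  apply: (@mono_derive _ 0 (s * r ^+ 2) (J1 N) (J2 N)).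
  - by rewrite mulr_ge0 ?sqr_ge0// ltW.
  - by apply: contW => x; exact: derive_cont (is_derive_J1 N x).
  - by move=> x _; exact: is_derive_J1.
  - by move=> x /andP[x0 _]; exact/J2_ge0/ltW.
have j16 : J1 N (s * (4 * t) ^+ 2) <= J1 N 16.
  apply: (@mono_derive _ (s * (4 * t) ^+ 2) 16 (J1 N) (J2 N)).
  - have -> : s * (4 * t) ^+ 2 = 16 * (s * t ^+ 2) by ring.
    by lra.
  - by apply: contW => x; exact: derive_cont (is_derive_J1 N x).
  - by move=> x _; exact: is_derive_J1.
  - move=> x /andP[x0 _]; apply: J2_ge0; apply: le_trans (ltW x0).
    by rewrite mulr_ge0 ?sqr_ge0// ltW.
have J00 := J1_gt0 N (lexx 0 : (0 : R) <= 0).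
have J40 : 0 < J1 N (s * (4 * t) ^+ 2) by apply: J1_gt0; rewrite mulr_ge0 ?sqr_ge0// ltW.
have Ir : 2 * s * t * J1 N 0 <= rI1 N s r.
  rewrite /rI1; apply: ler_pM => //; rewrite ?mulr_ge0 ?(ltW t0) ?(ltW s_gt0) ?(ltW J00)//.
  by rewrite ler_wpM2l// mulr_ge0// ltW.
have c00 := c0t.
rewrite (le_trans _ (ler_wpM2l c00 Ir))// /c0 /rI1 /drop_const.
set A := J1 N (s * (4 * t) ^+ 2) in j16 J40 *.
set B := J1 N 16 in j16 *.
have B0 : 0 < B by exact: lt_le_trans j16.
have -> : s ^+ 2 * (D * (t ^+ N.+1 / N.+1%:R)) / ((4 * t) ^+ N * (2 * s * (4 * t) * A) ^+ 2) *
   (2 * t) * (2 * s * t * J1 N 0) = J1 N 0 / (16 * N.+1%:R * 4 ^+ N) * (s * t * D) * (A ^+ 2)^-1.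
  rewrite (exprMn N 4 t) (exprS t N).
  have : (4 : R) ^+ N != 0 by rewrite expf_neq0.
  have : t ^+ N != 0 by rewrite expf_neq0// gt_eqF.
  have : N.+1%:R != 0 :> R by rewrite pnatr_eq0.
  move: (N.+1%:R) (t ^+ N) (4 ^+ N) => n1 T E n0 T0 E0; field.
  by rewrite n0 E0 T0 !gt_eqF.
have -> : J1 N 0 / (16 * N.+1%:R * 4 ^+ N * B ^+ 2) * (s * t * D) =
  J1 N 0 / (16 * N.+1%:R * 4 ^+ N) * (s * t * D) * (B ^+ 2)^-1.
  by rewrite (invfM (16 * N.+1%:R * 4 ^+ N)); ring.
apply: ler_wpM2l.
  by rewrite !mulr_ge0 ?(ltW s_gt0) ?(ltW t0) ?(ltW J00)// invr_ge0 !mulr_ge0 ?exprn_ge0.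
by rewrite lef_pV2 ?posrE ?exprn_gt0// lerXn2r// nnegrE ltW.
Qed.

End nonincreasing.

(** Integration by parts, with [wint] a times [tail] F as primitive. The integrand becomes s [wint]
    F [wint] a / (t^N [rI]^2), which displays the resolvent as a superposition of nonnegative forms
    of rank one. *)
Lemma itg_resolvent (a : R -> R) : continuous a ->
  itg 0 1 (fun r => r ^+ N * a r * resolvent N s F r) =
  itg 0 1 (fun t => slope N s F t * wint N s a t).
Proof.
move=> ca.
have cV := cont_resolvent N_gt0 s_gt0 cF.
have cS := cont_slope N_gt0 s_gt0 cF.
have cw := @cont_wint R N s a ca.
have c1 : continuous (fun r => r ^+ N * a r * resolvent N s F r).
  exact: contM (contM cpow ca) cV.
have c2 : continuous (fun t => slope N s F t * wint N s a t) by exact: contM.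
apply/eqP; rewrite -subr_eq0 -itgB; try exact: contW.
apply/eqP; pose G x := wint N s a x * tail N s F x.
transitivity (G 1 - G 0); last first.
  by rewrite /G (tail_ge1 _ _ _ (r := 1)) ?normr1// mulr0 wint_le0// mul0r subrr.
apply: itg_FTC => //.
- by apply: contW; exact: contB.
- apply: contW; exact: contM (cont_tail N_gt0 s_gt0 cF).
- move=> x x01; have /andP[x0 _] := x01.
  have h := is_derive1M (is_derive_wint N s ca x0) (is_derive_tail N_gt0 s_gt0 cF x01).
  by apply: is_derive_eq h _; rewrite /resolvent; ring.
Qed.

End one.

Lemma wint_CS (p b c : R -> R) t : continuous p -> continuous b -> continuous c -> t <= 1 ->
  (forall x, 0 <= x <= 1 -> 0 <= p x) -> (forall x, 0 <= x <= 1 -> 0 <= c x) ->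
  (forall x, 0 <= x <= 1 -> b x ^+ 2 <= p x * c x) ->
  wint N s b t ^+ 2 <= wint N s p t * wint N s c t.
Proof.
move=> cp cb cc t1 p0 c0 hb.
have [t0|t0] := leP t 0; first by rewrite !wint_le0// expr0n mul0r.
have key x : 2 * x * wint N s b t <= x ^+ 2 * wint N s p t + wint N s c t.
  have -> : 2 * x * wint N s b t = wint N s (fun y => 2 * x * b y + 0 * b y) t.
    by rewrite wint_lin// mul0r addr0.
  have -> : x ^+ 2 * wint N s p t + wint N s c t = wint N s (fun y => x ^+ 2 * p y + 1 * c y) t.
    by rewrite wint_lin// mul1r.
  apply: itg_le.
  - apply: contW; apply: contM => //.
    by apply: contD; apply: contM => // ?; exact: cvg_cst.
  - apply: contW; apply: contM => //.
    by apply: contD; apply: contM => // ?; exact: cvg_cst.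
  - move=> y /andP[y0 yt]; have y01 : 0 <= y <= 1 by rewrite y0 (le_trans yt).
    rewrite ler_wpM2l ?mulr_ge0 ?exprn_ge0 ?(ltW (I_gt0 _))// mul0r addr0 mul1r.
    have A0 : 0 <= x ^+ 2 * p y + c y by rewrite addr_ge0 ?c0// mulr_ge0 ?sqr_ge0 ?p0.
    have [B0|B0] := leP (2 * x * b y) 0; first exact: le_trans A0.
    rewrite -(@ler_pXn2r _ 2)// ?nnegrE ?(ltW B0)//.
    have := hb _ y01; have : 0 <= x ^+ 2 by exact: sqr_ge0.
    have := sqr_ge0 (x ^+ 2 * p y - c y).
    move=> h1 h2 h3; have h4 := ler_wpM2l h2 h3.
    have -> : (2 * x * b y) ^+ 2 = 4 * (x ^+ 2 * b y ^+ 2) by ring.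
    rewrite (le_trans (ler_wpM2l _ h4))//; move: h1; rewrite -subr_ge0 => h1.
    rewrite -subr_ge0; apply: le_trans h1 _; rewrite le_eqVlt; apply/orP; left.
    by apply/eqP; ring.
have wp := wint_ge0 N s_gt0 t1 p0.
move: wp; rewrite le_eqVlt => /orP[/eqP wp|wp].
  (* Degenerate case: [wint] p vanishes, and [key] at a suitable argument forces [wint] b to vanish
     too. *)
  have [->|b0] := eqVneq (wint N s b t) 0; first by rewrite expr0n -wp mul0r.
  have := key ((wint N s c t + 1) / wint N s b t); rewrite -wp mulr0 add0r.
  rewrite -mulrA mulfVK// => h; exfalso.
  have := wint_ge0 N s_gt0 t1 c0; lra.
have := key (wint N s b t / wint N s p t).
set A := wint N s p t in wp *; set B := wint N s b t; set C := wint N s c t.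
rewrite -(ler_pM2l wp).
have -> : A * (2 * (B / A) * B) = 2 * B ^+ 2 by field; rewrite gt_eqF.
have -> : A * ((B / A) ^+ 2 * A + C) = B ^+ 2 + A * C by field; rewrite gt_eqF.
by lra.
Qed.

(** Cauchy-Schwarz at each t for the rank-one forms of [itg_resolvent]. This acts as a Schur test:
    it will be used with p a gap of sources, b = p xi and c = p xi^2 for a quotient xi. *)
Lemma resolvent_schur (p b c : R -> R) : continuous p -> continuous b -> continuous c ->
  (forall x, 0 <= x <= 1 -> 0 <= p x) -> (forall x, 0 <= x <= 1 -> 0 <= c x) ->
  (forall x, 0 <= x <= 1 -> b x ^+ 2 <= p x * c x) ->
  itg 0 1 (fun r => r ^+ N * b r * resolvent N s b r) <=
  itg 0 1 (fun r => r ^+ N * c r * resolvent N s p r).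
Proof.
move=> cp cb cc p0 c0 hb; rewrite [leLHS](itg_resolvent cb cb) [leRHS](itg_resolvent cp cc); apply: itg_le.
- apply: contW; apply: contM (cont_wint cb).
  exact: cont_slope.
- apply: contW; apply: contM (cont_wint cc).
  exact: cont_slope.
- move=> t /andP[t0 t1]; move: t0; rewrite le_eqVlt => /orP[/eqP <-|t0].
    by rewrite !slope_le0// !mul0r.
  have := wint_CS cp cb cc t1 p0 c0 hb; rewrite /slope => h.
  have -> : s * wint N s b t / (t ^+ N * rI N s t ^+ 2) * wint N s b t =
    s / (t ^+ N * rI N s t ^+ 2) * wint N s b t ^+ 2 by ring.
  have -> : s * wint N s p t / (t ^+ N * rI N s t ^+ 2) * wint N s c t =
    s / (t ^+ N * rI N s t ^+ 2) * (wint N s p t * wint N s c t) by ring.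
  apply: ler_wpM2l => //; rewrite divr_ge0 ?(ltW s_gt0)// mulr_ge0 ?sqr_ge0//.
  by rewrite exprn_ge0// ltW.
Qed.

End resolvent_estimates.

(** * Integrals dominated by powers *)

Section power_integrals.
Variable R : realType.
Implicit Types (a b e r x : R) (f : R -> R).

Lemma cont_powR e : 0 < e -> {within `[0, +oo[, continuous (fun x : R => x `^ e)}.
Proof.
move=> e0; apply/continuous_within_itvcyP; split.
  move=> x; rewrite in_itv/= andbT => x0.
  exact: derive_cont (is_derive1_powR e x0).
rewrite powR0 ?gt_eqF//; exact: powR_cvg0.
Qed.

(** The majorant may blow up at 0, so the comparison is made with its primitive A x^e/e, which is
    continuous there. *)
Lemma itg_le_pow b e A f : 0 < b -> 0 < e -> {within `[0, b], continuous f} ->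
  (forall x, 0 < x < b -> f x <= A * x `^ (e - 1)) -> itg 0 b f <= A / e * b `^ e.
Proof.
move=> b0 e0 cf fA.
have h : itg 0 b (fun x => - f x) >= - (A / e * b `^ e) - - (A / e * 0 `^ e).
  apply: (@itg_ge_of _ 0 b _ (fun x => - (A / e * x `^ e)) (fun x => - (A * x `^ (e - 1))) b0).
  - by move=> x; apply: cvgN; exact: cf.
  - move=> x; apply: cvgN; apply: cvgM; first exact: cvg_cst.
    apply: (@continuous_subspaceW _ _ `[0, b]%classic `[0, +oo[%classic) (cont_powR e0) x.
    exact: subset_itvl.
  - move=> x /andP[x0 _]; apply: is_derive1N.
    by apply: is_derive_eq (is_derive1Z (A / e) (is_derive1_powR e x0)) _; field; rewrite gt_eqF.
  - by move=> x x0b; rewrite lerN2 fA.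
move: h; rewrite powR0 ?gt_eqF// mulr0 oppr0 subr0.
have -> : itg 0 b (fun x => - f x) = itg 0 b (fun x => -1 * f x).
  by apply: eq_itg => x _; rewrite mulN1r.
by rewrite itgZ// mulN1r lerN2.
Qed.

Lemma itg_le_npow r b e A f : 0 < r -> r <= b -> 0 < e -> 0 <= A ->
  {within `[r, b], continuous f} ->
  (forall x, r <= x <= b -> f x <= A * x `^ (- e - 1)) -> itg r b f <= A / e * r `^ (- e).
Proof.
move=> r0 rb e0 A0 cf fA.
have cp : {within `[r, b], continuous (fun x => A * x `^ (- e - 1))}.
  apply: continuous_in_subspaceT => x; rewrite inE/= in_itv/= => /andP[rx _].
  apply: cvgM; first exact: cvg_cst.
  exact: derive_cont (is_derive1_powR _ (lt_le_trans r0 rx)).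
rewrite (le_trans (itg_le cf cp fA))//.
have -> : itg r b (fun x => A * x `^ (- e - 1)) = - A / e * b `^ (- e) - - A / e * r `^ (- e).
  apply: (@itg_FTC _ r b _ (fun x => - A / e * x `^ (- e)) rb cp).
  - apply: continuous_in_subspaceT => x; rewrite inE/= in_itv/= => /andP[rx _].
    apply: cvgM; first exact: cvg_cst.
    exact: derive_cont (is_derive1_powR _ (lt_le_trans r0 rx)).
  - move=> x /andP[rx _]; have x0 := lt_trans r0 rx.
    by apply: is_derive_eq (is_derive1Z (- A / e) (is_derive1_powR (- e) x0)) _; field; rewrite gt_eqF.
have : 0 <= A / e * b `^ (- e) by rewrite mulr_ge0 ?powR_ge0// divr_ge0// ltW.
by lra.
Qed.

End power_integrals.

(** * Resolvents of sources controlled by their mass or by a power *)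

Section resolvent_bounds.
Variables (R : realType) (N : nat).
Hypothesis N_gt0 : (0 < N)%N.
Variable s : R.
Hypothesis s_gt0 : 0 < s.
Variable F : R -> R.
Hypothesis cF : continuous F.
Hypothesis F_ge0 : forall p, 0 <= p <= 1 -> 0 <= F p.
Implicit Types (a b r t : R).

Let cpow := @contX R N.
Let cI := @cont_rI R N s.
Let I_gt0 := @rI_gt0 R N s s_gt0.
Let I_ge1 := @rI_ge1 R N s s_gt0.
Let cpF : continuous (fun p : R => p ^+ N * F p).
Proof. exact: contM. Qed.

Lemma wint_ge_mass t : 0 <= t -> t <= 1 -> itg 0 t (fun p => p ^+ N * F p) <= wint N s F t.
Proof.
move=> t0 t1; apply: itg_le.
- exact: contW.
- apply: contW; exact: contM (contM cpow cI) cF.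
- move=> p /andP[p0 pt]; have Fp : 0 <= F p by rewrite F_ge0// p0 (le_trans pt).
  by rewrite mulrAC ler_peMr// mulr_ge0// exprn_ge0.
Qed.

Lemma wint_le_mass t : 0 <= t -> t <= 1 ->
  wint N s F t <= rI N s t * itg 0 t (fun p => p ^+ N * F p).
Proof.
move=> t0 t1; rewrite -itgZ; last exact: contW.
apply: itg_le.
- apply: contW; exact: contM (contM cpow cI) cF.
- by apply: contW; apply: contM => // ?; exact: cvg_cst.
- move=> p /andP[p0 pt]; have Fp : 0 <= F p by rewrite F_ge0// p0 (le_trans pt).
  rewrite mulrAC [leRHS]mulrC ler_wpM2l//; first by rewrite mulr_ge0// exprn_ge0.
  exact: rI_mono.
Qed.

(** [resolvent_le_of] for means over [0, t], t >= r. The mass below r/2 is compared with the weight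
    of [r/2, r], which is at least rI(r/2) (r/2)^(N+1), and beyond r/2 the source is at most F(r/2).
    The bound is uniform in s. *)
Lemma resolvent_split r : 0 < r -> r <= 1 ->
  (forall p q, 0 <= p -> p <= q -> q <= 1 -> F q <= F p) ->
  resolvent N s F r <=
  F (r / 2) + (2 / r) ^+ N.+1 * itg 0 (r / 2) (fun p => p ^+ N * F p).
Proof.
move=> r0 r1 F_ni; set h := r / 2; set m0 := itg 0 h _.
have h0 : 0 < h by rewrite divr_gt0.
have h1 : h <= 1 by rewrite /h; lra.
have m00 : 0 <= m0.
  apply: itg_ge0 => p /andP[p0 ph]; rewrite mulr_ge0 ?exprn_ge0// F_ge0// p0.
  exact: le_trans h1.
have Fh : 0 <= F h by rewrite F_ge0// (ltW h0).
have K0 : 0 <= (2 / r) ^+ N.+1 * m0 by rewrite mulr_ge0// exprn_ge0// divr_ge0// ltW.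
apply: (resolvent_le_of N_gt0 s_gt0 cF); [by rewrite (ltW r0)|by rewrite addr_ge0|].
move=> t /andP[rt t1]; have ht : h <= t by rewrite /h; lra.
have t0 : 0 < t by exact: lt_le_trans rt.
have c1 : continuous (fun p : R => p ^+ N * rI N s p * 1).
  by apply: contM => [|?]; [exact: contM|exact: cvg_cst].
have cG : continuous (fun p : R => p ^+ N * rI N s p * F p).
  exact: contM (contM cpow cI) cF.
pose M1 := itg h t (fun p => p ^+ N * rI N s p * 1).
have M1le : M1 <= t ^+ N * rI1 N s t / s.
  rewrite -(wint1 N_gt0 s_gt0 (ltW t0)) /wint (itg_split (ltW h0) ht c1) lerDr.
  apply: itg_ge0 => p /andP[p0 _].
  by rewrite mulr1 mulr_ge0 ?exprn_ge0// ltW.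
have M1ge : rI N s h * h ^+ N.+1 <= M1.
  have e : rI N s h * h ^+ N.+1 = itg h r (fun=> h ^+ N * rI N s h * 1).
    rewrite itg_cst; last by rewrite /h; lra.
    by rewrite (_ : r - h = h); [rewrite exprSr; ring|rewrite /h; field].
  have hr : h <= r by rewrite /h; lra.
  rewrite e /M1 (itg_split hr rt c1) ler_wpDr//.
    apply: itg_ge0 => p /andP[rp _]; have p0 := le_trans (ltW r0) rp.
    by rewrite mulr1 mulr_ge0 ?exprn_ge0// ltW.
  apply: itg_le.
  - by apply: contW => ?; exact: cvg_cst.
  - exact: contW.
  - move=> p /andP[hp _]; rewrite !mulr1; apply: ler_pM.
    + by rewrite exprn_ge0// ltW.
    + exact: ltW.
    + by rewrite lerXn2r// nnegrE ?(le_trans (ltW h0)) ?(ltW h0).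
    + by apply: rI_mono => //; exact: ltW.
have w1 : wint N s F t <= rI N s h * m0 + F h * M1.
  rewrite /wint (itg_split (ltW h0) ht cG) lerD//; first exact: wint_le_mass (ltW h0) h1.
  rewrite -itgZ; last exact: contW.
  apply: itg_le.
  - exact: contW.
  - by apply: contW; apply: contM => // ?; exact: cvg_cst.
  - move=> p /andP[hp pt]; have p0 := le_trans (ltW h0) hp.
    rewrite mulr1 mulrC ler_wpM2r//; first by rewrite mulr_ge0 ?exprn_ge0// ltW.
    by apply: F_ni => //; [exact: ltW|exact: le_trans t1].
rewrite (le_trans w1)//.
have w2 : rI N s h * m0 <= (2 / r) ^+ N.+1 * m0 * M1.
  rewrite mulrAC ler_wpM2r//.
  have hh : (2 / r) ^+ N.+1 * (rI N s h * h ^+ N.+1) = rI N s h.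
    rewrite mulrCA -exprMn (_ : 2 / r * h = 1) ?expr1n ?mulr1//.
    by rewrite /h; field; rewrite gt_eqF.
  by rewrite -[leLHS]hh ler_wpM2l// exprn_ge0// divr_ge0// ltW.
have M10 : 0 <= M1 by apply: le_trans M1ge; rewrite mulr_ge0 ?exprn_ge0 ?(ltW h0)// ltW.
rewrite (@le_trans _ _ ((F h + (2 / r) ^+ N.+1 * m0) * M1))//.
  by rewrite mulrDl addrC lerD2l.
by rewrite ler_wpM2l// addr_ge0.
Qed.

(** The mass below 1/2 is contained in [wint] t for every t >= 1/2, and for s <= 1 the factors [rI]
    in the denominator are bounded by J0(1). *)
Lemma resolvent_lower : s <= 1 ->
  s / (2 * J0 N 1 ^+ 2) * itg 0 (2^-1) (fun p => p ^+ N * F p) <= resolvent N s F (2^-1).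
Proof.
move=> s1; set m0 := itg 0 _ _.
have h0 : 0 < 2^-1 :> R by rewrite invr_gt0.
have h1 : 2^-1 <= 1 :> R by rewrite invf_le1// ler1n.
have J01 : 0 < J0 N (1 : R) by apply: J0_gt0.
have m00 : 0 <= m0.
  apply: itg_ge0 => p /andP[p0 ph]; rewrite mulr_ge0 ?exprn_ge0// F_ge0// p0.
  exact: le_trans h1.
have tg : s / (2 * J0 N 1 ^+ 2) * m0 <= tail N s F (2^-1).
  have -> : s / (2 * J0 N 1 ^+ 2) * m0 = itg (2^-1) 1 (fun=> s * m0 / J0 N 1 ^+ 2).
    by rewrite itg_cst//; field; rewrite gt_eqF.
  rewrite /tail gtr0_norm//; apply: itg_le.
  - by apply: contW => ?; exact: cvg_cst.
  - exact/contW/cont_slope.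
  - move=> t /andP[ht t1]; have t0 := lt_le_trans h0 ht.
    rewrite /slope; apply: ler_pM.
    + by rewrite mulr_ge0// ltW.
    + by rewrite invr_ge0 exprn_ge0// ltW.
    + rewrite ler_wpM2l ?(ltW s_gt0)// (le_trans _ (wint_ge_mass (ltW t0) t1))//.
      rewrite (itg_split (ltW h0) ht cpF) lerDl; apply: itg_ge0 => p /andP[hp pt].
      have p0 := le_trans (ltW h0) hp.
      by rewrite mulr_ge0 ?exprn_ge0// F_ge0// p0 (le_trans pt).
    + have P1 : 0 < t ^+ N * rI N s t ^+ 2 by rewrite mulr_gt0// exprn_gt0.
      rewrite lef_pV2 ?posrE ?exprn_gt0//.
      rewrite (@le_trans _ _ (1 * rI N s t ^+ 2))// ?mul1r.
        by rewrite ler_piMl ?sqr_ge0// exprn_ile1// ltW.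
      rewrite lerXn2r// ?nnegrE ?(ltW J01) ?(ltW (I_gt0 t))//.
      have -> : J0 N 1 = rI N 1 (1 : R) by rewrite /rI expr1n mulr1.
      rewrite (le_trans (rI_mono N s_gt0 (ltW t0) t1))//.
      rewrite /rI expr1n !mulr1.
      apply: (@mono_derive _ s 1 (J0 N) (J1 N)) => //.
      * by apply: contW => x; exact: derive_cont (is_derive_J0 N x).
      * by move=> x _; exact: is_derive_J0.
      * by move=> x /andP[sx _]; apply/ltW/J1_gt0/ltW/(lt_trans s_gt0).
rewrite (le_trans tg)// /resolvent ler_peMl//; exact: tail_ge0.
Qed.

Section power.
Variables (K kap a : R).
Hypotheses (K_ge0 : 0 <= K) (kap_gt0 : 0 < kap) (kapN : kap < N.+1%:R).
Hypothesis a01 : 0 <= a <= 1.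
Hypothesis F_pow : forall p, 0 < p <= 1 -> F p <= K * p `^ (- kap).

Definition pow_const : R := K / (N.+1%:R - kap) * (2 * N.+1%:R) `^ a.

Let e_gt0 : 0 < N.+1%:R - kap. Proof. by rewrite subr_gt0. Qed.

(** Of the two factors 1/[rI] in [slope], one is spent on [wint_le_mass]; on the other, the bounds 1
    and 2(N+1)/(s t^2) are interpolated with exponent a. The freedom in a later makes the integrals
    in s and in t converge together. *)
Lemma slope_pow t : 0 < t -> t <= 1 ->
  slope N s F t <= pow_const * s `^ (1 - a) * t `^ (1 - kap - 2 * a).
Proof.
move=> t0 t1; have It := I_gt0 t.
have mt : itg 0 t (fun p => p ^+ N * F p) <= K / (N.+1%:R - kap) * t `^ (N.+1%:R - kap).
  apply: itg_le_pow => //; first exact: contW.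
  move=> x /andP[x0 xt].
  have -> : N.+1%:R - kap - 1 = N%:R + (- kap) by rewrite -natr1; ring.
  rewrite powRD; last by rewrite (gt_eqF x0) implybT.
  rewrite powR_mulrn ?(ltW x0)// mulrCA ler_wpM2l ?exprn_ge0 ?(ltW x0)//.
  by rewrite F_pow// x0 (le_trans (ltW xt)).
have invI : (rI N s t)^-1 <= (2 * N.+1%:R) `^ a * (s `^ (- a) * t `^ (- (2 * a))).
  have [a0 a1] := andP a01.
  pose X := s * t ^+ 2 / (2 * N.+1%:R).
  have X0 : 0 < X by rewrite divr_gt0 ?mulr_gt0 ?exprn_gt0.
  have XI : X <= rI N s t.
    rewrite /X mulrC; have := @J0_ge_lin R N (s * t ^+ 2) _; rewrite natrM; apply.
    by rewrite mulr_ge0 ?sqr_ge0// ltW.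
  have -> : (2 * N.+1%:R) `^ a * (s `^ (- a) * t `^ (- (2 * a))) = X `^ (- a).
    have n10 : 0 < 2 * N.+1%:R :> R by rewrite mulr_gt0.
    rewrite /X; move: (2 * N.+1%:R) n10 => n1 n10.
    have st : 0 <= s * t ^+ 2 by rewrite mulr_ge0 ?sqr_ge0// ltW.
    rewrite (powRM (- a) st) ?invr_ge0 ?(ltW n10)//.
    rewrite (powRM (- a) (ltW s_gt0)) ?sqr_ge0//.
    rewrite -(powR_inv1 (ltW n10)) -powRrM mulN1r opprK.
    rewrite -(powR_mulrn 2 (ltW t0)) -powRrM mulrN; ring.
  rewrite powRN lef_pV2 ?posrE ?powR_gt0//.
  have [X1|/ltW X1] := leP X 1.
    rewrite (@le_trans _ _ 1)//.
    by rewrite -[leRHS](powRr0 X) ger_powR// X0.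
  by rewrite (le_trans _ XI)// ler1_powR.
have tN : 0 < t ^+ N by rewrite exprn_gt0.
have -> : slope N s F t = s / t ^+ N * (wint N s F t / rI N s t) * (rI N s t)^-1.
  by rewrite /slope; field; rewrite !gt_eqF.
have w : wint N s F t / rI N s t <= K / (N.+1%:R - kap) * t `^ (N.+1%:R - kap).
  by rewrite ler_pdivrMr// (le_trans (wint_le_mass (ltW t0) t1))// mulrC ler_wpM2r// ltW.
have w0 : 0 <= wint N s F t / rI N s t.
  by rewrite divr_ge0 ?(ltW It)//; apply: wint_ge0.
have sN : 0 <= s / t ^+ N by rewrite divr_ge0 ?(ltW s_gt0) ?(ltW tN).
apply: (@le_trans _ _ (s / t ^+ N * (K / (N.+1%:R - kap) * t `^ (N.+1%:R - kap)) *
   ((2 * N.+1%:R) `^ a * (s `^ (- a) * t `^ (- (2 * a)))))).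
  apply: ler_pM => //; first by rewrite mulr_ge0.
  - by rewrite invr_ge0 ltW.
  - by rewrite ler_wpM2l.
apply: eq_leW.
have -> : t `^ (1 - kap - 2 * a) = t `^ (N.+1%:R - kap) / t ^+ N * t `^ (- (2 * a)).
  rewrite -powR_mulrn ?(ltW t0)// -powRB ?(gt_eqF t0) ?implybT//.
  rewrite -powRD ?(gt_eqF t0) ?implybT//; congr (_ `^ _).
  by rewrite -natr1; ring.
have -> : s `^ (1 - a) = s * s `^ (- a).
  by rewrite powRD ?(gt_eqF s_gt0) ?implybT// powRr1// ltW.
by rewrite /pow_const; ring.
Qed.

Lemma resolvent0_pow : 0 < 2 - kap - 2 * a ->
  resolvent N s F 0 <= pow_const * s `^ (1 - a) / (2 - kap - 2 * a).
Proof.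
move=> e0; rewrite /resolvent /rI expr0n mulr0 J0_0 mul1r /tail normr0.
have h := @itg_le_pow R 1 (2 - kap - 2 * a) (pow_const * s `^ (1 - a)) (slope N s F) ltr01 e0.
rewrite powR1 mulr1 in h; apply: h; first exact/contW/cont_slope.
move=> x /andP[x0 x1]; rewrite (le_trans (slope_pow x0 (ltW x1)))//.
by apply: eq_leW; congr (_ * _ `^ _); ring.
Qed.

Lemma resolvent_pow r : 0 < r -> r <= 1 -> s * r ^+ 2 <= 1 -> 0 < kap + 2 * a - 2 ->
  resolvent N s F r <=
  J0 N 1 * (pow_const * s `^ (1 - a) / (kap + 2 * a - 2) * r `^ (2 - kap - 2 * a)).
Proof.
move=> r0 r1 sr e0; rewrite /resolvent.
have A0 : 0 <= pow_const * s `^ (1 - a).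
  by rewrite !mulr_ge0 ?powR_ge0// invr_ge0 ltW.
have -> : 2 - kap - 2 * a = - (kap + 2 * a - 2) by ring.
apply: ler_pM.
- exact: ltW.
- exact: tail_ge0.
- rewrite /rI.
  apply: (@mono_derive _ (s * r ^+ 2) 1 (J0 N) (J1 N)) => //.
  + by apply: contW => x; exact: derive_cont (is_derive_J0 N x).
  + by move=> x _; exact: is_derive_J0.
  + move=> x /andP[sx _]; apply/ltW/J1_gt0/(le_trans _ (ltW sx)).
    by rewrite mulr_ge0 ?sqr_ge0// ltW.
- rewrite /tail gtr0_norm//; apply: itg_le_npow => //.
    exact/contW/cont_slope.
  move=> x /andP[rx x1]; rewrite (le_trans (slope_pow (lt_le_trans r0 rx) x1))//.
  by apply: eq_leW; congr (_ * _ `^ _); ring.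
Qed.

End power.

End resolvent_bounds.

(** * Averages near the origin *)

Section weighted_average.
Variable R : realType.

Lemma itg_pow (N : nat) (t : R) : 0 <= t ->
  itg 0 t (fun p => p ^+ N) = t ^+ N.+1 / N.+1%:R.
Proof.
move=> t0; transitivity (N.+1%:R^-1 * t ^+ N.+1 - N.+1%:R^-1 * 0 ^+ N.+1).
  apply: (@itg_FTC _ 0 t _ (fun x => N.+1%:R^-1 * x ^+ N.+1)) => //.
  - exact/contW/contX.
  - apply: contW; apply: contM; last exact: contX.
    by exact: contC.
  - move=> y _; apply: is_derive_eq (is_derive1Z _ (is_derive1X y N.+1)) _.
    by rewrite mulrA mulVf ?mul1r.
by rewrite expr0n mulr0 subr0 mulrC.
Qed.

(** Applied to F minus its resolvent, this identifies the limit of drop/r at 0 through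
    [drop_itg]. *)
Lemma cvg_weighted_average (N : nat) (g : R -> R) : continuous g ->
  itg 0 r (fun p => p ^+ N * g p) / r ^+ N.+1 @[r --> 0^'+] --> g 0 / N.+1%:R.
Proof.
move=> cg; apply/cvgrPdist_le => e e0.
have : \forall x \near (0 : R), `|g 0 - g x| <= e.
  by have /cvgrPdist_le := cg 0; exact.
move=> [d /= d0 hd].
near=> r.
have r0 : 0 < r by near: r; exact: nbhs_right_gt.
have rd : r < d by near: r; exact: nbhs_right_lt.
have rN : 0 < r ^+ N.+1 by rewrite exprn_gt0.
have cpow := @contX R N.
have c1 : continuous (fun p : R => p ^+ N * g p) by exact: contM.
have hg p : 0 <= p <= r -> `|g 0 - g p| <= e.
  move=> /andP[p0 pr]; apply: hd => /=.
  by rewrite sub0r normrN ger0_norm// (le_lt_trans pr).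
have cc c : {within `[0, r], continuous (fun p : R => c * p ^+ N)}.
  by apply: contW; apply: contM => // ?; exact: cvg_cst.
have ub : itg 0 r (fun p => p ^+ N * g p) <= (g 0 + e) * (r ^+ N.+1 / N.+1%:R).
  rewrite -itg_pow ?(ltW r0)// -itgZ; last exact: contW.
  apply: itg_le => //; first exact: contW.
  move=> p p0r; have /andP[p0 _] := p0r; rewrite mulrC ler_wpM2r ?exprn_ge0//.
  by have := hg p p0r; rewrite ler_norml; lra.
have lb : (g 0 - e) * (r ^+ N.+1 / N.+1%:R) <= itg 0 r (fun p => p ^+ N * g p).
  rewrite -itg_pow ?(ltW r0)// -itgZ; last exact: contW.
  apply: itg_le => //; first exact: contW.
  move=> p p0r; have /andP[p0 _] := p0r; rewrite [leRHS]mulrC ler_wpM2r ?exprn_ge0//.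
  by have := hg p p0r; rewrite ler_norml; lra.
set I := itg 0 r _ in ub lb *; set A := r ^+ N.+1 in rN ub lb *.
have n0 : 0 < N.+1%:R :> R by [].
have ub' : I / A <= (g 0 + e) / N.+1%:R by rewrite ler_pdivrMr// -mulrA (mulrC _ A).
have lb' : (g 0 - e) / N.+1%:R <= I / A by rewrite ler_pdivlMr// -mulrA (mulrC _ A).
have eN : e / N.+1%:R <= e by rewrite ler_pdivrMr// ler_peMr ?(ltW e0)// ler1n.
move: ub' lb'; rewrite !mulrDl mulNr; move: eN.
move: (g 0 / _) (e / _) (I / _) => x1 x2 x3 h1 h2 h3.
by rewrite ler_norml; apply/andP; split; lra.
Unshelve. all: by end_near. Qed.

End weighted_average.

(** * The test inequality for a single resolvent *)

Section test_inequality.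
Variables (R : realType) (N : nat).
Hypothesis N_gt0 : (0 < N)%N.
Variable s : R.
Hypothesis s_gt0 : 0 < s.

(** The value at 0 is the limit of the quotient, which makes the function continuous up to the
    origin. *)
Definition dropr (F : R -> R) r :=
  if r == 0 then s * (F 0 - resolvent N s F 0) / N.+1%:R else drop N s F r / r.

Lemma dropE F r : drop N s F r = r * dropr F r.
Proof.
rewrite /dropr; case: ifPn => [/eqP ->|r0]; first by rewrite drop0 mul0r.
by rewrite mulrC mulfVK.
Qed.

Lemma dropr_continuous F b : continuous F -> b < 1 ->
  {within `[0, b], continuous (dropr F)}.
Proof.
move=> cF b1.
have [b0|b0] := ltP 0 b; last first.
  have : `[0, b]%classic `<=` [set (0 : R)].
    move=> x /=; rewrite in_itv/= => /andP[x0 xb]; apply/eqP.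
    by rewrite eq_le x0 (le_trans xb).
  by move=> /continuous_subspaceW; apply; exact: continuous_subspace1.
have cx x : 0 < x < 1 -> {for x, continuous (dropr F)}.
  move=> x01; have /andP[x0 _] := x01.
  have h : drop N s F y / y @[y --> x] --> drop N s F x / x.
    apply: cvgM; last by apply: cvgV; [rewrite gt_eqF|exact: cvg_id].
    exact: derive_cont (is_derive_drop N_gt0 s_gt0 cF x01).
  have e : dropr F x = drop N s F x / x by rewrite /dropr gt_eqF.
  suff : dropr F y @[y --> x] --> dropr F x by [].
  rewrite e; apply: cvg_trans h.
  apply: near_eq_cvg; near=> y; rewrite /dropr gt_eqF//.
  by near: y; exact: lt_nbhsr.
apply/continuous_within_itvP => //; split.
- by move=> x; rewrite in_itv/= => /andP[x0 xb]; apply: cx; rewrite x0 (lt_trans xb).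
- rewrite {2}/dropr eqxx.
  have cV := cont_resolvent N_gt0 s_gt0 cF.
  have h0 := @cvg_weighted_average R N _ (contB cF cV).
  have h : s * (itg 0 r (fun p => p ^+ N * (F p - resolvent N s F p)) / r ^+ N.+1)
      @[r --> 0^'+] --> s * (F 0 - resolvent N s F 0) / N.+1%:R.
    by rewrite -mulrA; apply: cvgM; [exact: cvg_cst|exact: h0].
  apply: cvg_trans h; apply: near_eq_cvg; near=> r.
  have r0 : 0 < r by near: r; exact: nbhs_right_gt.
  have rb : r < b by near: r; exact: nbhs_right_lt.
  rewrite /dropr gt_eqF//.
  have rN : r ^+ N != 0 by rewrite gt_eqF// exprn_gt0.
  have r01 : 0 <= r <= 1 by rewrite (ltW r0) (ltW (lt_trans rb b1)).
  have := drop_itg N_gt0 s_gt0 cF r01.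
  set I := itg 0 r _ => e.
  have -> : drop N s F r = s * I / r ^+ N by rewrite -e mulrAC mulfV ?mul1r.
  by rewrite exprSr; field; rewrite rN gt_eqF.
- apply: cvg_at_left_filter; apply: cx; rewrite b0 b1//.
Unshelve. all: by end_near. Qed.

Lemma drop_continuous F b : continuous F -> b < 1 ->
  {within `[0, b], continuous (drop N s F)}.
Proof.
move=> cF b1; rewrite (_ : drop N s F = fun r => r * dropr F r); last first.
  by apply/funext => r; rewrite dropE.
move=> x; apply: cvgM; last exact: dropr_continuous.
by apply: contW => ?; exact: cvg_id.
Qed.

Variables (F G zeta dzeta theta : R -> R) (b : R).
Hypotheses (b_gt0 : 0 < b) (b_lt1 : b < 1).
Hypothesis cF : continuous F.
Hypothesis dF : forall x, 0 < x < b -> is_derive x 1 F (- G x).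
Hypothesis cG : {within `[0, b], continuous G}.
Hypothesis dz : forall x, 0 < x < b -> is_derive x 1 zeta (dzeta x).
Hypothesis cz : {within `[0, b], continuous zeta}.
Hypothesis cdz : {within `[0, b], continuous dzeta}.
Hypothesis zb : zeta b = 0.
Hypothesis ct : continuous theta.
Hypothesis tGz : forall x, 0 <= x <= b -> theta x = G x * zeta x.
Hypothesis t0 : forall x, b <= x <= 1 -> theta x = 0.
Hypothesis t_ge0 : forall x, 0 <= x <= 1 -> 0 <= theta x.

(** Beyond b the source vanishes, so [wint] is constant there while t^N [rI1] grows: the weighted
    means decrease and [drop_ge0_of] applies. *)
Lemma drop_supported : 0 <= drop N s theta b.
Proof.
have b01 : 0 < b <= 1 by rewrite b_gt0 ltW.
apply: (drop_ge0_of N_gt0 s_gt0 ct t_ge0 b01).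
move=> t /andP[bt t1].
have cg : continuous (fun p : R => p ^+ N * rI N s p * theta p).
  apply: contM ct; apply: contM; first exact: contX.
  exact: cont_rI.
have -> : wint N s theta t = wint N s theta b.
  rewrite /wint (itg_split (ltW b_gt0) bt cg) (@eq_itg _ b t _ (fun=> 0)).
    by rewrite itg_cst// mul0r addr0.
  by move=> x /andP[bx xt]; rewrite t0 ?mulr0// bx (le_trans xt).
apply: ler_wpM2l; first by apply: wint_ge0 => //; exact: ltW.
by apply: powrI1_mono => //; exact: ltW.
Qed.

(* The resolvent P of theta competes with zeta * y, y = drop F: the difference
   of the two sides is (P - zeta y)^2 + s^-1 (P' - (zeta y)')^2 up to the exact
   derivative of the function H below. *)
Lemma test_inequality :
  itg 0 b (fun r => r ^+ N * (G r * zeta r ^+ 2 * drop N s F r)) +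
  N%:R / s * itg 0 b (fun r => r ^+ N * (dropr F r ^+ 2 * zeta r ^+ 2)) <=
  itg 0 1 (fun r => r ^+ N * theta r * resolvent N s theta r) +
  s^-1 * itg 0 b (fun r => r ^+ N * (drop N s F r ^+ 2 * dzeta r ^+ 2)).
Proof.
set y := drop N s F; set k := dropr F; set P := resolvent N s theta.
set p := drop N s theta; set V := resolvent N s F.
have wM (f g : R -> R) : {within `[0, b], continuous f} -> {within `[0, b], continuous g} ->
    {within `[0, b], continuous (fun x => f x * g x)}.
  by move=> cf cg x; apply: cvgM; [exact: cf|exact: cg].
have wB (f g : R -> R) : {within `[0, b], continuous f} -> {within `[0, b], continuous g} ->
    {within `[0, b], continuous (fun x => f x - g x)}.
  by move=> cf cg x; apply: cvgB; [exact: cf|exact: cg].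
have wX (f : R -> R) : {within `[0, b], continuous f} ->
    {within `[0, b], continuous (fun x => f x ^+ 2)}.
  move=> cf; rewrite (_ : (fun x => f x ^+ 2) = fun x => f x * f x); first exact: wM.
  by apply/funext => x; rewrite expr2.
have wC (c : R) : {within `[0, b], continuous (fun=> c)}.
  by apply: contW => ?; exact: cvg_cst.
have cpow : {within `[0, b], continuous (fun x : R => x ^+ N)}.
  exact/contW/contX.
have cP : continuous P := cont_resolvent N_gt0 s_gt0 ct.
have cV : continuous V := cont_resolvent N_gt0 s_gt0 cF.
have cy : {within `[0, b], continuous y} := drop_continuous cF b_lt1.
have cp : {within `[0, b], continuous p} := drop_continuous ct b_lt1.
have ck : {within `[0, b], continuous k} := dropr_continuous cF b_lt1.
have cP' : {within `[0, b], continuous P} := contW cP.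
have ct' : {within `[0, b], continuous theta} := contW ct.
have cFV : {within `[0, b], continuous (fun x => F x - V x)} :=
  contW (contB cF cV).
have cA : continuous (fun r : R => r ^+ N * theta r * P r).
  by apply: contM cP; exact: contM (@contX _ _) ct.
have -> : itg 0 1 (fun r => r ^+ N * theta r * P r) =
    itg 0 b (fun r => r ^+ N * theta r * P r).
  rewrite (itg_split (ltW b_gt0) (ltW b_lt1) cA) (@eq_itg _ b 1 _ (fun=> 0)).
    by rewrite itg_cst ?(ltW b_lt1)// mul0r addr0.
  by move=> x bx; rewrite t0// mulr0 mul0r.
set a1 := fun r => r ^+ N * (G r * zeta r ^+ 2 * y r).
set a2 := fun r => r ^+ N * (k r ^+ 2 * zeta r ^+ 2).
set a3 := fun r => r ^+ N * theta r * P r.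
set a4 := fun r => r ^+ N * (y r ^+ 2 * dzeta r ^+ 2).
have c1 : {within `[0, b], continuous a1} := wM _ _ cpow (wM _ _ (wM _ _ cG (wX _ cz)) cy).
have c2 : {within `[0, b], continuous a2} := wM _ _ cpow (wM _ _ (wX _ ck) (wX _ cz)).
have c3 : {within `[0, b], continuous a3} := wM _ _ (wM _ _ cpow ct') cP'.
have c4 : {within `[0, b], continuous a4} := wM _ _ cpow (wM _ _ (wX _ cy) (wX _ cdz)).
have D4 := wM _ _ (wC s^-1) c4; have D2 := wM _ _ (wC (N%:R / s)) c2.
have D43 : {within `[0, b], continuous (fun x => a3 x + s^-1 * a4 x)}.
  by move=> x; apply: cvgD; [exact: c3|exact: D4].
have D12 : {within `[0, b], continuous (fun x => a1 x + N%:R / s * a2 x)}.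
  by move=> x; apply: cvgD; [exact: c1|exact: D2].
rewrite -(itgZ _ c2) -(itgZ _ c4) -(itgD c1 D2) -(itgD c3 D4) -subr_ge0 -(itgB D43 D12).
pose H r := s^-1 * (P r * (r ^+ N * p r) - 2 * (zeta r * y r * (r ^+ N * p r)) -
  zeta r ^+ 2 * y r * (r ^+ N * (s * (F r - V r)) - N%:R * (r ^+ N * k r))).
have H0 : H 0 = 0 by rewrite /H expr0n gtn_eqF// !(mul0r, mulr0, subr0).
(* At b only P times r^N p survives, because zeta vanishes there; its sign comes from
   [drop_supported]. *)
have Hb : 0 <= H b.
  rewrite /H zb expr0n/= !(mul0r, mulr0, subr0).
  rewrite mulr_ge0 ?invr_ge0 ?(ltW s_gt0)// mulr_ge0 ?resolvent_ge0//.
  by rewrite mulr_ge0 ?drop_supported// exprn_ge0// ltW.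
have cNp := wM _ _ cpow cp.
have cH1 := wM _ _ cP' cNp.
have cH2 := wM _ _ (wC 2) (wM _ _ (wM _ _ cz cy) cNp).
have cH3 := wB _ _ (wM _ _ cpow (wM _ _ (wC s) cFV)) (wM _ _ (wC N%:R) (wM _ _ cpow ck)).
have cH : {within `[0, b], continuous H} :=
  wM _ _ (wC s^-1) (wB _ _ (wB _ _ cH1 cH2) (wM _ _ (wM _ _ (wX _ cz) cy) cH3)).
(* The derivative of y. Differentiating once more, with G = -F', produces N y/r^2, which is the
   origin of the integral of [dropr]^2. *)
pose y' r := s * (F r - V r) - N%:R * y r / r.
pose h r := s^-1 * (- p r * (r ^+ N * p r) + P r * (r ^+ N * (s * (theta r - P r)))
  - 2 * ((dzeta r * y r + zeta r * y' r) * (r ^+ N * p r) +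
      zeta r * y r * (r ^+ N * (s * (theta r - P r))))
  - ((2 * zeta r * dzeta r * y r + zeta r ^+ 2 * y' r) * (r ^+ N * y' r) +
      zeta r ^+ 2 * y r * (r ^+ N * (s * (y r - G r)) + N%:R * (r ^+ N * y r) / r ^+ 2))).
rewrite (@le_trans _ _ (H b - H 0))//; first by rewrite H0 subr0.
apply: (@itg_ge_of _ 0 b _ H h b_gt0 _ cH); first exact: (wB _ _ D43 D12).
- move=> x xb; have /andP[x0 xb'] := xb.
  have x01 : 0 < x < 1 by rewrite x0 (lt_trans xb').
  have dP := is_derive_resolvent N_gt0 s_gt0 ct x01.
  have dV := is_derive_resolvent N_gt0 s_gt0 cF x01.
  have dp := is_derive_drop_mulr N_gt0 s_gt0 ct x01.
  have dy := is_derive_drop N_gt0 s_gt0 cF x01.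
  have dz2 := is_derive1M (dz xb) (dz xb).
  have dE := is_derive_drop_mulr N_gt0 s_gt0 cF x01.
  have t1 := is_derive1M dP dp.
  have t2 := is_derive1Z 2 (is_derive1M (is_derive1M (dz xb) dy) dp).
  have dFV := is_derive1Z s (is_derive1D (dF xb) (is_derive1N dV)).
  have dx := is_derive1V (lt0r_neq0 x0) (is_derive_id x (1 : R)).
  have t3 := is_derive1D (is_derive1M (is_derive1X x N) dFV)
    (is_derive1N (is_derive1Z N%:R (is_derive1M dE dx))).
  have t4 := is_derive1M (is_derive1M dz2 dy) t3.
  have t5 := is_derive1Z s^-1 (is_derive1D (is_derive1D t1 (is_derive1N t2)) (is_derive1N t4)).
  apply: is_derive_near (is_derive_eq t5 _).
    near=> r; rewrite /H /k /dropr gt_eqF; last by near: r; exact: lt_nbhsr.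
    by rewrite /y /P /p /V expr2 !mulrA.
  have eN : N%:R * x ^+ N.-1 = N%:R * x ^+ N / x.
    have e : x ^+ N = x ^+ N.-1 * x by rewrite -exprSr prednK.
    by rewrite e mulrA mulfK ?gt_eqF.
  rewrite /h /y' -/P -/V -/y -/p eN.
  move: (P x) (V x) (y x) (p x) (theta x) (G x) (F x) (zeta x) (dzeta x) (x ^+ N).
  by move=> *; field; rewrite !gt_eqF.
- move=> x xb; have /andP[x0 xb'] := xb.
  have et : theta x = G x * zeta x by apply: tGz; rewrite (ltW x0) (ltW xb').
  rewrite -subr_ge0 /a1 /a2 /a3 /a4 /k /dropr gt_eqF// -/y.
  rewrite (_ : _ - _ = x ^+ N * ((P x - zeta x * y x) ^+ 2 +
      s^-1 * (p x + dzeta x * y x + zeta x * y' x) ^+ 2)).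
    rewrite mulr_ge0 ?exprn_ge0 ?(ltW x0)// addr_ge0 ?sqr_ge0//.
    by rewrite mulr_ge0 ?sqr_ge0// invr_ge0 ltW.
  rewrite /h et.
  move: (P x) (y x) (p x) (G x) (zeta x) (dzeta x) (y' x) (x ^+ N).
  by move=> *; field; rewrite !gt_eqF.
Unshelve. all: by end_near. Qed.

End test_inequality.

(** * Measure-theoretic tools and the weight in the resolvent parameter *)

Section measure_tools.
Variable R : realType.
Local Notation mu := (@lebesgue_measure R).

Lemma cvg_floor_grid (r : R) :
  (Num.floor (r * n.+1%:R))%:~R / n.+1%:R @[n --> \oo] --> r.
Proof.
apply/cvgrPdist_le => e e0; near=> n.
have n0 : 0 < n.+1%:R :> R by [].
have /andP[h1 h2] := floor_itv (r * n.+1%:R).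
rewrite ger0_norm; last by rewrite subr_ge0 ler_pdivrMr.
rewrite lerBlDr -lerBlDl ler_pdivlMr// mulrBl.
have h3 : e * n.+1%:R >= 1.
  rewrite mulrC -ler_pdivrMr// div1r; near: n.
  have [k hk] := ltr_add_invr e0 (y := 0); exists k => // m /= km.
  rewrite (@le_trans _ _ (k.+1%:R))//; last by rewrite ler_nat.
  by move: hk; rewrite add0r -ltf_pV2 ?posrE ?invr_gt0// invrK => /ltW.
by move: h2; rewrite intrD; lra.
Unshelve. all: by end_near. Qed.

(** Freezing r at the grid points of mesh 1/(n+1) gives functions whose preimages are countable
    unions of rectangles; continuity in r gives pointwise convergence. *)
Lemma measurable_caratheodory d (T : measurableType d)
    (f : measurableTypeR R * T -> R) :
  (forall t, continuous (fun r : R => f (r, t))) ->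
  (forall r, measurable_fun setT (fun t => f (r, t))) -> measurable_fun setT f.
Proof.
move=> cf mf.
pose g n (p : measurableTypeR R * T) :=
  f ((Num.floor (p.1 * n.+1%:R))%:~R / n.+1%:R, p.2).
apply: (@measurable_fun_cvg _ _ _ _ g) => [n|[r t] _]; last first.
  rewrite /g /=; apply: (@cvg_comp _ _ _ _ (fun r => f (r, t)) _ (nbhs r)).
    exact: cvg_floor_grid.
  exact: cf.
move=> _ Y mY; rewrite setTI.
have -> : g n @^-1` Y = \bigcup_(z in [set: int])
    ([set r : R | z%:~R / n.+1%:R <= r < (z + 1)%:~R / n.+1%:R] `*`
     ((fun t => f (z%:~R / n.+1%:R, t)) @^-1` Y)).
  apply/seteqP; split => [[r t]|[r t]] /=.
    rewrite /g /= => Yg; exists (Num.floor (r * n.+1%:R)) => //=; split => //=.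
    by have := floor_itv (r * n.+1%:R); rewrite ler_pdivrMr// ltr_pdivlMr.
  move=> [z _ /= [/= /andP[h1 h2] Yz]]; rewrite /g /=.
  have -> : Num.floor (r * n.+1%:R) = z.
    apply: floor_def; rewrite -ler_pdivrMr// h1/=.
    by rewrite -ltr_pdivlMr.
  exact: Yz.
apply: countable_bigcupT_measurable => [|z]; first exact: countableP.
apply: measurableX.
  rewrite (_ : [set r : R | _] = `[z%:~R / n.+1%:R, (z + 1)%:~R / n.+1%:R[%classic).
    exact: measurable_itv.
  by apply/seteqP; split => x /=; rewrite in_itv.
by have := mf (z%:~R / n.+1%:R) measurableT Y mY; rewrite setTI.
Qed.

Lemma integrable_fin_mul d (T : measurableType d) (m : {measure set T -> \bar R})
    (D : set T) (f : T -> R) (M : R) : measurable D -> (m D < +oo)%E ->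
  measurable_fun D f -> (forall x, D x -> `|f x| <= M) -> m.-integrable D (EFin \o f).
Proof.
move=> mD Doo mf fM; apply: (@le_integrable _ _ _ _ _ mD _ (cst M%:E)).
- exact/measurable_EFinP.
- by move=> x Dx /=; rewrite lee_fin (le_trans (fM x Dx))// ler_norm.
- apply/integrableP; split; first exact: measurable_cst.
  rewrite integral_cst//=; exact: lte_mul_pinfty.
Qed.

(** The majorant is an integrable function of x on a set of finite measure in y: the shape met
    whenever the integral over the resolvent parameter is exchanged with one over space. *)
Lemma fubini_dominated d (T : measurableType d)
    (m : {sigma_finite_measure set T -> \bar R}) (B : set T)
    (f : measurableTypeR R -> T -> R) (D : measurableTypeR R -> R) (M : R) :
  measurable B -> (m B < +oo)%E ->
  measurable_fun setT (fun p : measurableTypeR R * T => f p.1 p.2) ->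
  mu.-integrable setT (EFin \o D) -> 0 <= M -> (forall x, 0 <= D x) ->
  (forall x y, B y -> `|f x y| <= M * D x) ->
  \int[mu]_x (\int[m]_(y in B) f x y) = \int[m]_(y in B) (\int[mu]_x f x y).
Proof.
move=> mB Boo mf iD M0 D0 fD.
pose g (p : measurableTypeR R * T) := (f p.1 p.2 * \1_B p.2)%:E.
have mg : measurable_fun setT g.
  apply/measurable_EFinP; apply: measurable_funM => //.
  exact: (measurableT_comp (measurable_indic mB) measurable_snd).
have mfx x : measurable_fun setT (f x).
  exact: (measurableT_comp mf (measurable_pair1 x)).
have mfy y : measurable_fun setT (f ^~ y).
  exact: (measurableT_comp mf (measurable_pair2 y)).
have gB x y : (`|g (x, y)| <= (M * D x * \1_B y)%:E)%E.
  rewrite /g /= lee_fin normrM (ger0_norm (x := \1_B y)); last by rewrite indicE; case: (_ \in _).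
  rewrite indicE; have [yB|yB] := boolP (y \in B); rewrite ?mulr1 ?mulr0//.
  by apply: fD; rewrite inE in yB.
have mBfin : (m B) \is a fin_num by rewrite ge0_fin_numE.
have ig : (mu \x m)%E.-integrable setT g.
  apply/integrable12ltyP => //.
  apply: (@le_lt_trans _ _ (\int[mu]_x ((M * D x)%:E * m B))%E).
    apply: ge0_le_integral => //.
    - by move=> x _; exact: integral_ge0.
    - apply: (@measurable_fun_fubini_tonelli_F _ _ _ _ _ m (fun p => `|g p|%E)) => //.
      exact: measurableT_comp.
    - apply: emeasurable_funM; last exact: measurable_cst.
      apply/measurable_EFinP; apply: measurable_funM; first exact: measurable_cst.
      by have /integrableP[/measurable_EFinP] := iD.
    - move=> x _.
      apply: (@le_trans _ _ (\int[m]_y (M * D x * \1_B y)%:E)%E).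
        apply: ge0_le_integral => //.
        + apply: measurableT_comp => //; apply: (measurableT_comp mg).
          exact: measurable_pair1.
        + apply/measurable_EFinP; apply: measurable_funM; first exact: measurable_cst.
          exact: measurable_indic.
      under eq_integral do rewrite EFinM.
      rewrite ge0_integralZl//; first by rewrite integral_indic// setIT.
        exact/measurable_EFinP/measurable_indic.
      by rewrite lee_fin mulr_ge0.
  under eq_integral => x _ do rewrite -(fineK mBfin) -EFinM mulrAC EFinM.
  have /integrableP[_ iDl] := iD.
  rewrite ge0_integralZl//.
  - apply: lte_mul_pinfty => //; first by rewrite lee_fin mulr_ge0// fine_ge0.
    rewrite (eq_integral (fun x => `|(EFin \o D) x|%E))// => x _ /=.
    by rewrite ger0_norm.
  - by have := measurable_int _ iD.
  - by move=> x _; rewrite lee_fin.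
  - by rewrite lee_fin mulr_ge0// fine_ge0.
have F1 := Fubini ig.
have eB x : (\int[m]_(y in B) (f x y)%:E = \int[m]_y g (x, y))%E.
  rewrite integral_mkcond; apply: eq_integral => y _.
  by rewrite /g /patch /= indicE; case: ifPn => yB; rewrite ?mulr1 ?mulr0.
rewrite {1}/Rintegral [in RHS]/Rintegral; congr fine.
have fin1 x : (\int[m]_(y in B) (f x y)%:E)%E \is a fin_num.
  apply: integrable_fin_num => //.
  apply: (@integrable_fin_mul _ _ m B (f x) (M * D x)) => //.
    exact: measurable_funTS.
  by move=> y By; exact: fD.
have fin2 y : B y -> (\int[mu]_x (f x y)%:E)%E \is a fin_num.
  move=> By; apply: integrable_fin_num => //.
  apply: (@le_integrable _ _ _ _ _ _ _ (fun x => (M * D x)%:E)) => //.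
  - exact/measurable_EFinP.
  - by move=> x _ /=; rewrite lee_fin (le_trans (fD _ _ By))// ler_norm.
  - under eq_fun do rewrite EFinM; exact: integrableZl.
transitivity (\int[mu]_x \int[m]_y g (x, y))%E.
  by apply: eq_integral => x _; rewrite /Rintegral fineK ?fin1// eB.
rewrite F1 [RHS]integral_mkcond; apply: eq_integral => y _.
rewrite /patch; case: ifPn => yB.
  rewrite inE in yB; rewrite /Rintegral fineK ?fin2//; apply: eq_integral => x _.
  by rewrite /g /= indicE mem_set// mulr1.
apply: integral0_eq => x _.
by rewrite /g /= indicE (negbTE yB) mulr0.
Qed.

Lemma cvg_Rintegral d (T : measurableType d) (m : {measure set T -> \bar R})
    (D : set T) (f_ : nat -> T -> R) (f g : T -> R) : measurable D ->
  (forall n, measurable_fun D (f_ n)) -> (forall x, D x -> f_ n x @[n --> \oo] --> f x) ->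
  m.-integrable D (EFin \o g) -> (forall n x, D x -> `|f_ n x| <= g x) ->
  \int[m]_(x in D) f_ n x @[n --> \oo] --> \int[m]_(x in D) f x.
Proof.
move=> mD mf cf ig fg.
have mf' : measurable_fun D f by exact: (measurable_fun_cvg mf cf).
have intf n : m.-integrable D (EFin \o f_ n).
  apply: (le_integrable mD) ig; first exact/measurable_EFinP.
  by move=> x Dx /=; rewrite lee_fin (le_trans (fg n x Dx))// ler_norm.
have h := @dominated_cvg _ _ _ m D mD (fun n => EFin \o f_ n) (EFin \o f) (EFin \o g).
have if' : m.-integrable D (EFin \o f).
  have [] // := @dominated_convergence _ _ _ m D mD (fun n => EFin \o f_ n) (EFin \o f) (EFin \o g).
  - by move=> n; exact/measurable_EFinP.
  - exact/measurable_EFinP.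
  - by apply: aeW => x Dx; apply: cvg_EFin; [exact: nearW|exact: cf].
  - by apply: aeW => x n Dx /=; rewrite lee_fin fg.
rewrite /Rintegral; apply: fine_cvg; rewrite fineK; last exact: integrable_fin_num.
apply: h => //.
- by move=> n; exact/measurable_EFinP.
- by move=> x Dx; apply: cvg_EFin; [exact: nearW|exact: cf].
Qed.

Section weight.
Variable sg : R.
Hypothesis sg01 : 0 < sg < 1.

(** With s = e^x, [weight] dx is s^(-sg) ds/s; in the variable x, scaling of s becomes translation.
    The companion [dom] adds the factor min(1, s) and is integrable because both sg and 1 - sg are
    positive. *)
Definition weight (x : R) := expR (- sg * x).
Definition dom (x : R) := weight x * Num.min 1 (expR x).

Lemma weight_gt0 x : 0 < weight x. Proof. exact: expR_gt0. Qed.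

Lemma dom_ge0 x : 0 <= dom x.
Proof. by rewrite mulr_ge0 ?(ltW (weight_gt0 _))// le_min ler01 expR_ge0. Qed.

Lemma cont_weight : continuous weight.
Proof.
move=> x; apply: continuous_comp; last exact: continuous_expR.
by apply: cvgM; [exact: cvg_cst|exact: cvg_id].
Qed.

Lemma measurable_dom : measurable_fun setT dom.
Proof.
apply: continuous_measurable_fun => x; apply: cvgM; first exact: cont_weight.
by apply: continuous_min; [exact: cvg_cst|exact: continuous_expR].
Qed.

Lemma integrable_exp_norm (c : R) : 0 < c ->
  mu.-integrable setT (EFin \o (fun x => expR (- c * `|x|))).
Proof.
move=> c0; have cf : continuous (fun x : R => expR (- c * `|x|)).
  move=> x; apply: continuous_comp; last exact: continuous_expR.
  by apply: cvgM; [exact: cvg_cst|apply: cvg_norm; exact: cvg_id].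
apply/integrableP; split; first by apply/measurable_EFinP; exact: continuous_measurable_fun.
under eq_integral => x _ do rewrite /= ger0_norm ?expR_ge0//.
rewrite ge0_symfun_integralT//; last by move=> x /=; rewrite normrN.
have -> : [set x : R | (0 <= x)] = `[0, +oo[%classic.
  by apply/seteqP; split => x /=; rewrite in_itv/= andbT.
rewrite (@ge0_continuous_FTC2y _ _ (fun x => - c^-1 * expR (- c * x)) 0 0).
- by rewrite -EFinB -EFinM ltry.
- by move=> x _; exact: expR_ge0.
- exact: contW.
- rewrite -[X in _ --> X](mulr0 (- c^-1)); apply: cvgM; first exact: cvg_cst.
  have : expR (- (c * x)) @[x --> +oo] --> 0.
    apply: (@cvg_comp _ _ _ (fun x => c * x) (fun x => expR (- x)) _ +oo).
      apply: gt0_cvgMry => //; exact: cvg_id.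
    exact: cvgr_expR.
  by under eq_fun do rewrite -mulNr.
- by move=> x _; exact: ex_derive.
- apply: cvg_at_right_filter; apply: cvgM; first exact: cvg_cst.
  apply: continuous_comp; last exact: continuous_expR.
  by apply: cvgM; [exact: cvg_cst|exact: cvg_id].
- move=> x; rewrite in_itv/= andbT => x0; rewrite derive1E.
  have h := is_derive1Z (- c^-1) (is_derive1_compE (is_derive_expR (- c * x))
    (is_derive1Z (- c) (is_derive_id x (1 : R)))).
  rewrite derive_val gtr0_norm//; field; exact: lt0r_neq0.
Qed.

Lemma integrable_dom : mu.-integrable setT (EFin \o dom).
Proof.
have /andP[s0 s1] := sg01.
pose c := Num.min sg (1 - sg); have c0 : 0 < c by rewrite lt_min s0 subr_gt0.
apply: (le_integrable _ _ _ (integrable_exp_norm c0)) => //.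
  by apply/measurable_EFinP; exact: measurable_dom.
move=> x _ /=; rewrite lee_fin ger0_norm ?dom_ge0// ger0_norm ?expR_ge0//.
rewrite /dom /weight; have [x0|x0] := leP 0 x.
  rewrite ger0_norm// (@le_trans _ _ (expR (- sg * x)))//.
    by rewrite ler_piMr ?expR_ge0// ge_min lexx.
  by rewrite ler_expR !mulNr lerN2 ler_wpM2r// ge_min lexx.
rewrite ltr0_norm// (@le_trans _ _ (expR (- sg * x) * expR x))//.
  by rewrite ler_wpM2l ?expR_ge0// ge_min lexx orbT.
rewrite -expRD ler_expR mulrNN.
have -> : - sg * x + x = (1 - sg) * x by ring.
by rewrite ler_wnM2r ?(ltW x0)// ge_min lexx orbT.
Qed.

End weight.

End measure_tools.

(** * Integrals depending on a parameter *)

Section parameter.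
Variable R : realType.
Local Notation mu := (@lebesgue_measure R).

Lemma cont_itg_param a b (f : R -> R -> R) :
  (forall x, {within `[a, b], continuous (f x)}) ->
  (forall r, a <= r <= b -> continuous (f ^~ r)) ->
  (forall x0, exists M, forall x r, x0 - 1 < x < x0 + 1 -> a <= r <= b -> `|f x r| <= M) ->
  continuous (fun x => itg a b (f x)).
Proof.
move=> cf1 cf2 bf x0; have [M hM] := bf x0.
apply: (@continuity_under_integral _ _ _ mu f `[a, b] _ (x0 - 1) (x0 + 1) _ _ (fun=> M)).
- exact: measurable_itv.
- by move=> x _; exact: within_integrable.
- apply: aeW => r /=; rewrite in_itv/= => rab x _; exact: cf2.
- by apply: within_integrable; apply: contW => ?; exact: cvg_cst.
- move=> x /=; rewrite in_itv/= => xI; apply: aeW => r /=; rewrite in_itv/=; exact: hM.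
- by rewrite inE/= in_itv/= ltrBlDr ltrDl ltr01.
Qed.

Lemma J0_mono N (a b : R) : 0 <= a -> a <= b -> J0 N a <= J0 N b.
Proof.
move=> a0 ab; apply: (@mono_derive _ a b (J0 N) (J1 N)) => //.
- by apply: contW => x; exact: derive_cont (is_derive_J0 N x).
- by move=> x _; exact: is_derive_J0.
- by move=> x /andP[ax _]; apply/ltW/J1_gt0/(le_trans a0)/ltW.
Qed.

Lemma integrableZ c (h : R -> R) : mu.-integrable setT (EFin \o h) ->
  mu.-integrable setT (EFin \o (fun x => c * h x)).
Proof.
move=> ih; have -> : EFin \o (fun x => c * h x) = (fun x => c%:E * (EFin \o h) x)%E.
  by apply/funext => x /=; rewrite EFinM.
exact: (integrableZl _ _ ih).
Qed.

Lemma integrable_dominated (g h : R -> R) : continuous g ->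
  mu.-integrable setT (EFin \o h) -> (forall x, `|g x| <= h x) ->
  mu.-integrable setT (EFin \o g).
Proof.
move=> cg ih gh; apply: (le_integrable measurableT _ _ ih).
  by apply/measurable_EFinP; exact: continuous_measurable_fun.
by move=> x _ /=; rewrite lee_fin (le_trans (gh x))// ler_norm.
Qed.

Lemma itg_le_Rintegral a b (g : R -> R) : (forall x, 0 <= g x) ->
  mu.-integrable setT (EFin \o g) -> itg a b g <= \int[mu]_x g x.
Proof.
move=> g0 ig; have mg := measurable_int _ ig.
have ig' : mu.-integrable `[a, b] (EFin \o g).
  exact: (integrableS measurableT _ _ ig).
apply: fine_le; [exact: integrable_fin_num|exact: integrable_fin_num|].
by apply: ge0_subset_integral => // x _; rewrite lee_fin.
Qed.

End parameter.

(** * The fractional inverse as a superposition of resolvents *)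

Section fractional_inverse.
Variables (R : realType) (N : nat).
Hypothesis N_gt0 : (0 < N)%N.
Variable sg : R.
Hypothesis sg01 : 0 < sg < 1.
Local Notation mu := (@lebesgue_measure R).
Implicit Types (r x : R) (F G : R -> R).

Let e0 x : 0 < expR x := expR_gt0 x.

Lemma cont_J0 : continuous (J0 N : R -> R).
Proof. by move=> x; exact: derive_cont (is_derive_J0 N x). Qed.

Lemma cont_J1 : continuous (J1 N : R -> R).
Proof. by move=> x; exact: derive_cont (is_derive_J1 N x). Qed.

Lemma cont_expM (c : R) : continuous (fun x : R => expR x * c).
Proof. by apply: contM => x; [exact: continuous_expR|exact: cvg_cst]. Qed.

Lemma cont_rI_exp r : continuous (fun x => rI N (expR x) r).
Proof.
by apply: (@cont_comp _ _ _ (fun x : R => expR x * r ^+ 2) (J0 N)); [exact: cont_expM|exact: cont_J0].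
Qed.

Lemma cont_rI1_exp r : continuous (fun x => rI1 N (expR x) r).
Proof.
apply: contM; last by apply: (@cont_comp _ _ _ (fun x : R => expR x * r ^+ 2) (J1 N)); [exact: cont_expM|exact: cont_J1].
apply: contM; last by exact: contC.
by apply: contM => x; [exact: cvg_cst|exact: continuous_expR].
Qed.

Section oneF.
Variable F : R -> R.
Hypothesis cF : continuous F.

Lemma cont_wint_exp t : continuous (fun x => wint N (expR x) F t).
Proof.
have [t0|t0] := leP t 0.
  by under eq_fun do rewrite wint_le0//; move=> ?; exact: cvg_cst.
have [M M0 hM] := normF_bounded cF t.
apply: cont_itg_param.
- move=> x; apply: contW; apply: contM cF.
  by apply: contM; [exact: contX|exact: cont_rI].
- move=> r _; apply: contM; last by exact: contC.
  by apply: contM; first (by exact: contC); exact: cont_rI_exp r.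
- move=> x0; exists (t ^+ N * J0 N (expR (x0 + 1) * t ^+ 2) * M) => x r /andP[_ xx0] r0t.
  have /andP[r0 rt] := r0t.
  rewrite !normrM; apply: ler_pM => //; last exact: hM.
  apply: ler_pM => //; first by rewrite ger0_norm ?exprn_ge0// lerXn2r// nnegrE// ltW.
  rewrite ger0_norm ?(ltW (rI_gt0 N (e0 x) r))//; apply: J0_mono.
    by rewrite mulr_ge0 ?sqr_ge0// ltW.
  apply: ler_pM; rewrite ?sqr_ge0 ?expR_ge0//; first by rewrite ler_expR ltW.
  by rewrite lerXn2r// nnegrE// ltW.
Qed.

Lemma cont_slope_exp t : continuous (fun x => slope N (expR x) F t).
Proof.
have [t0|t0] := leP t 0.
  by under eq_fun do rewrite slope_le0//; move=> ?; exact: cvg_cst.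
apply: contM.
  by apply: contM; [exact: continuous_expR|exact: cont_wint_exp].
apply: contV.
  by move=> x; rewrite gt_eqF// mulr_gt0 ?exprn_gt0// rI_gt0.
apply: contM; first by exact: contC.
by apply: cont_exp; exact: cont_rI_exp.
Qed.

Lemma cont_tail_exp r : continuous (fun x => tail N (expR x) F r).
Proof.
have [M M0 hM] := normF_bounded cF 1.
apply: cont_itg_param.
- by move=> x; apply: contW; exact: cont_slope.
- by move=> t _; exact: cont_slope_exp.
- move=> x0; exists (M * expR (x0 + 1)) => x t /andP[_ xx0] /andP[rt t1].
  have t0 : 0 <= t by exact: le_trans rt.
  rewrite (le_trans (slope_norm_le N_gt0 (e0 x) cF t0 (M := M) _))//.
    by move=> p /andP[p0 pt]; apply: hM; rewrite p0 (le_trans pt).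
  rewrite -mulrA ler_wpM2l ?(ltW M0)// (@le_trans _ _ (expR x))//.
    by rewrite ler_piMr// expR_ge0.
  by rewrite ler_expR ltW.
Qed.

Lemma cont_resolvent_exp r : continuous (fun x => resolvent N (expR x) F r).
Proof.
apply: (@contM _ _ (fun x => rI N (expR x) r) (fun x => tail N (expR x) F r)).
  exact: cont_rI_exp.
exact: cont_tail_exp.
Qed.

Lemma cont_drop_exp r : 0 < r -> continuous (fun x => drop N (expR x) F r).
Proof.
move=> r0; apply: (@contB _ _
  (fun x => expR x * wint N (expR x) F r / (r ^+ N * rI N (expR x) r))
  (fun x => rI1 N (expR x) r * tail N (expR x) F r)); last first.
  apply: (@contM _ _ (fun x => rI1 N (expR x) r) (fun x => tail N (expR x) F r)).
    exact: cont_rI1_exp.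
  exact: cont_tail_exp.
apply: contM.
  by apply: contM; [exact: continuous_expR|exact: cont_wint_exp].
apply: contV; first by move=> x; rewrite gt_eqF// mulr_gt0 ?exprn_gt0// rI_gt0.
by apply: contM; first (by exact: contC); exact: cont_rI_exp r.
Qed.

Lemma cont_dropr_exp r : 0 <= r -> continuous (fun x => dropr N (expR x) F r).
Proof.
move=> r0; have [->|rn0] := eqVneq r 0.
  rewrite /dropr eqxx; apply: contM; last by exact: contC.
  apply: contM; first exact: continuous_expR.
  by apply: contB; first (by exact: contC); exact: cont_resolvent_exp 0.
have {}r0 : 0 < r by rewrite lt_def rn0.
rewrite /dropr (negbTE rn0); apply: contM; last by exact: contC.
exact: cont_drop_exp.
Qed.

Lemma measurable_resolvent_exp :
  measurable_fun setT (fun p : measurableTypeR R * measurableTypeR R =>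
    resolvent N (expR p.1) F p.2).
Proof.
apply: measurable_caratheodory => [r|x].
  exact: cont_resolvent_exp.
exact: (@continuous_measurable_fun R (resolvent N (expR x) F) (cont_resolvent N_gt0 (e0 x) cF)).
Qed.

(** On radial sources this is [frac_const] times the inverse of the fractional Laplacian of order
    sg, see [frac_inv_coef]; [frac_drop] is minus its radial derivative. *)
Definition frac_inv r := \int[mu]_x (weight sg x * resolvent N (expR x) F r).
Definition frac_drop r := \int[mu]_x (weight sg x * drop N (expR x) F r).

Hypothesis F_ge0 : forall p, 0 <= p <= 1 -> 0 <= F p.

Section bound.
Variable M : R.
Hypothesis F_le : forall p, 0 <= p <= 1 -> F p <= M.

Lemma resolvent_dom x r : `|weight sg x * resolvent N (expR x) F r| <= M * dom sg x.
Proof.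
have V0 := resolvent_ge0 N (e0 x) F_ge0 r.
have w0 : 0 <= weight sg x by exact/ltW/weight_gt0.
rewrite ger0_norm; last exact: mulr_ge0.
rewrite /dom [M * _]mulrCA; apply: ler_wpM2l => //.
have [_|_] := leP 1 (expR x).
  by rewrite mulr1; exact: (resolvent_le N_gt0 (e0 x) cF).
exact: (resolvent_le_s N_gt0 (e0 x) cF).
Qed.

Lemma integrable_resolvent r :
  mu.-integrable setT (EFin \o (fun x => weight sg x * resolvent N (expR x) F r)).
Proof.
apply: (integrable_dominated _ (integrableZ M (integrable_dom sg01)) (resolvent_dom ^~ r)).
apply: (@contM _ _ (weight sg) (fun x => resolvent N (expR x) F r)); [exact: (@cont_weight R sg)|exact: cont_resolvent_exp].
Qed.

Lemma cont_frac_inv : continuous frac_inv.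
Proof.
move=> r0.
apply: (@continuity_under_integral _ _ _ mu
  (fun r x => weight sg x * resolvent N (expR x) F r) setT _ (r0 - 1) (r0 + 1) _ _
  (fun x => M * dom sg x)) => //.
- by move=> r _; exact: integrable_resolvent.
- apply: aeW => x _ r _; apply: cvgM; first exact: cvg_cst.
  exact: cont_resolvent.
- by apply: integrableZ; exact: integrable_dom.
- by move=> r _; apply: aeW => x _; exact: resolvent_dom.
- by rewrite inE/= in_itv/= ltrBlDr ltrDl ltr01.
Qed.

End bound.

Lemma F_bounded : exists M, forall p, 0 <= p <= 1 -> F p <= M.
Proof.
have [M M0 hM] := normF_bounded cF 1; exists M => p p01.
by rewrite (le_trans (ler_norm _))// hM.
Qed.

Lemma frac_inv_ge0 r : 0 <= frac_inv r.
Proof.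
apply: Rintegral_ge0 => x _; apply: mulr_ge0; [exact/ltW/weight_gt0|exact: resolvent_ge0].
Qed.

Lemma frac_inv_norm r : frac_inv `|r| = frac_inv r.
Proof. by apply: eq_Rintegral => x _; rewrite resolvent_norm. Qed.

Lemma frac_inv_ge1 r : 1 <= `|r| -> frac_inv r = 0.
Proof.
move=> r1; rewrite /frac_inv (_ : (fun x => _) = cst 0) ?Rintegral_cst//= ?mul0r//.
by apply/funext => x /=; rewrite resolvent_ge1// mulr0.
Qed.

Hypothesis F_ni : forall p q, 0 <= p -> p <= q -> q <= 1 -> F q <= F p.

Lemma resolvent_ni x p q : 0 <= p -> p <= q ->
  resolvent N (expR x) F q <= resolvent N (expR x) F p.
Proof.
move=> p0 pq; have [q1|/ltW q1] := leP q 1; last first.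
  rewrite (resolvent_ge1 N (expR x) F (r := q))//; first exact: resolvent_ge0.
  by rewrite ger0_norm// (le_trans p0).
rewrite -lerN2; apply: (@mono_derive _ p q (fun r => - resolvent N (expR x) F r)
  (drop N (expR x) F)) => //.
- apply: contW; apply: contN; exact: cont_resolvent.
- move=> r /andP[pr rq]; rewrite -[drop _ _ _ _]opprK; apply: is_derive1N.
  by apply: is_derive_resolvent => //; rewrite (le_lt_trans p0 pr) (lt_le_trans rq).
- move=> r /andP[pr rq]; apply: (drop_ge0 N_gt0 (e0 x) cF F_ge0 F_ni).
  by rewrite (ltW (le_lt_trans p0 pr)) (ltW (lt_le_trans rq q1)).
Qed.

Lemma frac_inv_ni p q : 0 <= p -> p <= q -> frac_inv q <= frac_inv p.
Proof.
move=> p0 pq; have [M hM] := F_bounded; apply: le_Rintegral => //.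
- exact: (integrable_resolvent hM).
- exact: (integrable_resolvent hM).
- move=> x _; apply: ler_wpM2l; first exact/ltW/weight_gt0; exact: resolvent_ni.
Qed.

Section gradient.
Variables (u v C : R).
Hypotheses (u_ge0 : 0 <= u) (v_le1 : v <= 1) (C_ge0 : 0 <= C).
Hypothesis dropC : forall x r, u < r < v -> drop N (expR x) F r <= C.

Let M := Num.max C (F 0).

(** For s < 1 the general bound F(0) s is used; for s >= 1 the bound C, uniform in s, supplies the
    majorant that allows differentiation under the integral. *)
Lemma drop_dom x r : u < r < v -> `|weight sg x * drop N (expR x) F r| <= M * dom sg x.
Proof.
move=> ruv; have /andP[ur rv] := ruv.
have r01 : 0 <= r <= 1.
  by rewrite (le_trans u_ge0 (ltW ur)) (le_trans (ltW rv)).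
have V0 := drop_ge0 N_gt0 (e0 x) cF F_ge0 F_ni r01.
have w0 : 0 <= weight sg x by exact/ltW/weight_gt0.
rewrite ger0_norm; last exact: mulr_ge0.
rewrite /dom [M * _]mulrCA; apply: ler_wpM2l => //.
have [_|_] := leP 1 (expR x).
  by rewrite mulr1 (le_trans (dropC x ruv))// le_max lexx.
have FF p : 0 <= p <= 1 -> F p <= F 0 by move=> /andP[p0 p1]; exact: F_ni.
have := drop_le N_gt0 (e0 x) cF F_ge0 FF r01.
move=> /le_trans; apply; have /andP[r0 r1] := r01.
have F00 : 0 <= F 0 by apply: F_ge0; rewrite lexx ler01.
rewrite (@le_trans _ _ (F 0 * expR x))//.
  by rewrite ler_piMr// mulr_ge0// expR_ge0.
by rewrite ler_wpM2r ?expR_ge0// le_max lexx orbT.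
Qed.

Let M_ge0 : 0 <= M. Proof. by rewrite le_max C_ge0. Qed.

Let iMD : mu.-integrable setT (EFin \o (fun x => M * dom sg x)).
Proof.
by apply: integrableZ; exact: integrable_dom.
Qed.

Lemma integrable_drop r : u < r < v ->
  mu.-integrable setT (EFin \o (fun x => weight sg x * drop N (expR x) F r)).
Proof.
move=> ruv; apply: (integrable_dominated _ iMD (fun x => drop_dom x ruv)).
apply: contM; first exact: (@cont_weight R sg).
by apply: cont_drop_exp; have /andP[ur _] := ruv; exact: le_lt_trans ur.
Qed.

Lemma is_derive_frac_inv r : u < r < v -> is_derive r 1 frac_inv (- frac_drop r).
Proof.
move=> ruv; have [M' hM'] := F_bounded.
have Ir : `]u, v[%classic r by rewrite /= in_itv.
pose f r x := weight sg x * resolvent N (expR x) F r.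
have df r' x : `]u, v[%classic r' -> is_derive r' 1 (f ^~ x) (weight sg x * - drop N (expR x) F r').
  rewrite /= in_itv/= => /andP[ur' r'v]; apply: is_derive1Z.
  by apply: is_derive_resolvent => //; rewrite (le_lt_trans u_ge0 ur') (lt_le_trans r'v).
have i1 r' : `]u, v[%classic r' -> mu.-integrable setT (EFin \o f r').
  by move=> _; exact: (integrable_resolvent hM').
have i2 r' x : `]u, v[%classic r' -> setT x -> derivable (f ^~ x) r' 1.
  by move=> /(df r' x) h _; case: h.
have MD0 x : 0 <= M * dom sg x by rewrite mulr_ge0// dom_ge0.
have i3 r' x : `]u, v[%classic r' -> setT x -> `|partial1of2 f r' x| <= M * dom sg x.
  move=> Ir' _; rewrite partial1of2E; have h := df r' x Ir'.
  rewrite derive_val mulrN normrN; apply: drop_dom.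
  by move: Ir'; rewrite /= in_itv.
have d := derivable_under_integral measurableT Ir i1 i2 MD0 iMD i3.
have e := differentiation_under_integral measurableT Ir i1 i2 MD0 iMD i3.
apply: DeriveDef => //; rewrite -derive1E e.
rewrite /frac_drop -[RHS]mulN1r -RintegralZl//; last exact: integrable_drop.
apply: eq_Rintegral => x _; rewrite partial1of2E; have h := df r x Ir.
by rewrite derive_val mulrN mulN1r.
Qed.

Lemma cont_frac_drop r : u < r < v -> {for r, continuous frac_drop}.
Proof.
move=> ruv.
apply: (@continuity_under_integral _ _ _ mu
  (fun r x => weight sg x * drop N (expR x) F r) setT _ u v _ _ (fun x => M * dom sg x)) => //.
- by move=> r'; rewrite /= in_itv; exact: integrable_drop.
- apply: aeW => x _ r'; rewrite inE/= in_itv/= => /andP[ur' r'v].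
  apply: cvgM; first exact: cvg_cst.
  apply: derive_cont (is_derive_drop N_gt0 (e0 x) cF _).
  by rewrite (le_lt_trans u_ge0 ur') (lt_le_trans r'v).
- by move=> r'; rewrite /= in_itv/= => r'uv; apply: aeW => x _; exact: drop_dom.
- by rewrite inE/= in_itv.
Qed.

End gradient.

End oneF.

Lemma frac_inv_lin a b F G r : continuous F -> continuous G ->
  (forall p, 0 <= p <= 1 -> 0 <= F p) -> (forall p, 0 <= p <= 1 -> 0 <= G p) ->
  frac_inv (fun p => a * F p + b * G p) r = a * frac_inv F r + b * frac_inv G r.
Proof.
move=> cF cG F0 G0.
have [MF hF] := F_bounded cF; have [MG hG] := F_bounded cG.
have iF := integrable_resolvent cF F0 hF r; have iG := integrable_resolvent cG G0 hG r.
rewrite /frac_inv.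
transitivity (\int[mu]_x (a * (weight sg x * resolvent N (expR x) F r) +
    b * (weight sg x * resolvent N (expR x) G r))).
  by apply: eq_Rintegral => x _; rewrite (resolvent_lin N_gt0 (e0 x) a b r cF cG);
    move: (weight _ _) (resolvent _ _ F _) (resolvent _ _ G _) => *; ring.
rewrite (RintegralD measurableT (integrableZ a iF) (integrableZ b iG)).
by congr (_ + _); [exact: (RintegralZl a measurableT iF)|exact: (RintegralZl b measurableT iG)].
Qed.

Lemma frac_inv_mono F G r : continuous F -> continuous G ->
  (forall p, 0 <= p <= 1 -> 0 <= F p) -> (forall p, 0 <= p <= 1 -> F p <= G p) ->
  frac_inv F r <= frac_inv G r.
Proof.
move=> cF cG F0 FG.
have G0 p : 0 <= p <= 1 -> 0 <= G p by move=> p01; rewrite (le_trans (F0 p p01))// FG.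
have [MF hF] := F_bounded cF; have [MG hG] := F_bounded cG.
apply: (le_Rintegral measurableT (integrable_resolvent cF F0 hF r) (integrable_resolvent cG G0 hG r)).
move=> x _; apply: ler_wpM2l; first exact/ltW/weight_gt0.
exact: resolvent_mono.
Qed.

Lemma frac_inv_gt0 F r : continuous F -> (forall p, 0 <= p <= 1 -> 0 < F p) ->
  `|r| < 1 -> 0 < frac_inv F r.
Proof.
move=> cF F0 r1; have F0' p (p01 : 0 <= p <= 1) := ltW (F0 p p01).
rewrite -frac_inv_norm; set q := `|r| in r1 *; have q0 : 0 <= q := normr_ge0 r.
have [MF hF] := F_bounded cF.
pose g x := weight sg x * resolvent N (expR x) F q.
have g0 x : 0 <= g x by apply: mulr_ge0; [exact/ltW/weight_gt0|exact: resolvent_ge0].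
have cg : continuous g.
  apply: (@contM _ _ (weight sg) (fun x => resolvent N (expR x) F q)); [exact: (@cont_weight R sg)|exact: cont_resolvent_exp].
have ig : mu.-integrable setT (EFin \o g) := integrable_resolvent cF F0' hF q.
apply: (@lt_le_trans _ _ (itg 0 1 g)).
  apply: itg_gt0 => //; first exact: contW.
  have q01 : 0 <= q < 1 by rewrite q0.
  by move=> x _; exact: mulr_gt0 (weight_gt0 _ _) (resolvent_gt0 N_gt0 (expR_gt0 x) cF F0 q01).
exact: itg_le_Rintegral.
Qed.

Lemma swap_frac_inv a F : continuous a -> continuous F ->
  (forall p, 0 <= p <= 1 -> 0 <= F p) ->
  itg 0 1 (fun r => r ^+ N * a r * frac_inv F r) =
  \int[mu]_x (weight sg x * itg 0 1 (fun r => r ^+ N * a r * resolvent N (expR x) F r)).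
Proof.
move=> ca cF F0; have [M hM] := F_bounded cF.
have cpa : continuous (fun r : R => r ^+ N * a r) by exact: contM (@contX _ _) ca.
have [A A0 hA] := normF_bounded cpa 1.
have M0 : 0 <= M by rewrite (le_trans (F0 0 _) (hM 0 _))// lexx ler01.
have := @fubini_dominated R _ _ mu `[0, 1]%classic
  (fun x r => (r ^+ N * a r) * (weight sg x * resolvent N (expR x) F r)) (dom sg) (A * M).
move=> fub; transitivity (\int[mu]_(r in `[0, 1]) \int[mu]_x
    ((r ^+ N * a r) * (weight sg x * resolvent N (expR x) F r))).
  apply: eq_Rintegral => r _; by rewrite (RintegralZl _ measurableT (integrable_resolvent cF F0 hM r)).
rewrite -fub.
- apply: eq_Rintegral => x _; rewrite -itgZ; first by apply: eq_itg => r _; ring.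
  apply: contW; apply: contM cpa _.
  exact: cont_resolvent.
- exact: measurable_itv.
- by rewrite /= lebesgue_measure_itv/= lte_fin ltr01 -EFinD ltry.
- apply: measurable_funM.
    apply: (@measurableT_comp _ _ _ _ _ _ (fun r : measurableTypeR R => r ^+ N * a r)).
      exact: continuous_measurable_fun.
    exact: measurable_snd.
  apply: measurable_funM; last exact: measurable_resolvent_exp.
  apply: (@measurableT_comp _ _ _ _ _ _ (weight sg : measurableTypeR R -> R)).
    by apply: continuous_measurable_fun; exact: cont_weight.
  exact: measurable_fst.
- exact: integrable_dom.
- exact: mulr_ge0 (ltW A0) M0.
- exact: dom_ge0.
- move=> x r /=; rewrite in_itv/= => r01; rewrite (normrM (r ^+ N * a r)) -mulrA.
  apply: ler_pM; [exact: normr_ge0|exact: normr_ge0|exact: hA|].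
  exact: (resolvent_dom cF F0 hM).
Qed.

End fractional_inverse.

(** * Lipschitz bounds for the fractional inverse *)

Section lipschitz_step.
Variables (R : realType) (N : nat).
Hypothesis N_gt0 : (0 < N)%N.
Variable sg : R.
Hypothesis sg01 : 0 < sg < 1.
Local Notation mu := (@lebesgue_measure R).

Let e0 (x : R) : 0 < expR x := expR_gt0 x.

Definition mass (c : R) : R := \int[mu]_x dom c x.

Lemma mass_ge0 c : 0 <= mass c.
Proof. by apply: Rintegral_ge0 => x _; exact: dom_ge0. Qed.

Let sg2 : 0 < sg / 2 < 1.
Proof. by have /andP[s0 s1] := sg01; apply/andP; split; lra. Qed.

Section oneF.
Variable F : R -> R.
Hypothesis cF : continuous F.
Hypothesis F_ge0 : forall p, 0 <= p <= 1 -> 0 <= F p.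
Hypothesis F_ni : forall p q, 0 <= p -> p <= q -> q <= 1 -> F q <= F p.

(* Splitting at [s = e^X]: below it [drop <= A s], above it [drop <= K], and the
   weight is then small. *)
Lemma frac_drop_le r A K X : 0 < r <= 1 -> 0 <= A -> 0 <= K -> 0 <= X ->
  (forall x, drop N (expR x) F r <= A * expR x) -> (forall x, drop N (expR x) F r <= K) ->
  frac_drop N sg F r <= A * expR X * mass sg + K * expR (- (sg / 2) * X) * mass (sg / 2).
Proof.
move=> /andP[r0 r1] A0 K0 X0 hA hK; have /andP[s0 s1] := sg01.
have iD := integrable_dom sg01; have iD2 := integrable_dom sg2.
have iDD := integrableD measurableT (integrableZ (A * expR X) iD)
  (integrableZ (K * expR (- (sg / 2) * X)) iD2).
have d0 x : 0 <= drop N (expR x) F r.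
  by apply: (drop_ge0 N_gt0 (e0 x) cF F_ge0 F_ni); rewrite (ltW r0).
have key x : weight sg x * drop N (expR x) F r <=
    A * expR X * dom sg x + K * expR (- (sg / 2) * X) * dom (sg / 2) x.
  have w0 := weight_gt0 sg x; have w20 := weight_gt0 (sg / 2) x.
  have d1 := dom_ge0 sg x; have d2 := dom_ge0 (sg / 2) x.
  have E2 := expR_ge0 (- (sg / 2) * X).
  have [xX|xX] := leP x X.
    rewrite -[leLHS]addr0; apply: lerD; last by rewrite mulr_ge0// mulr_ge0.
    rewrite /dom mulrCA; apply: ler_wpM2l; first exact: ltW.
    apply: (le_trans (hA x)); rewrite -mulrA; apply: ler_wpM2l => //.
    have [_|_] := leP 1 (expR x); first by rewrite mulr1 ler_expR.
    by rewrite ler_peMl ?expR_ge0// -expR0 ler_expR.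
  rewrite -[leLHS]add0r; apply: lerD.
    by rewrite mulr_ge0// mulr_ge0// expR_ge0.
  rewrite /dom (min_idPl _); last by rewrite -expR0 ler_expR (le_trans X0)// ltW.
  rewrite mulr1 mulrC -mulrA; apply: ler_pM => //; first exact: ltW.
  rewrite /weight -expRD ler_expR.
  have : 0 <= sg / 2 * (x - X) by rewrite mulr_ge0//; lra.
  lra.
have cg : continuous (fun x => weight sg x * drop N (expR x) F r).
  apply: (@contM _ _ (weight sg) (fun x => drop N (expR x) F r)).
    exact: cont_weight.
  exact: cont_drop_exp.
have kn x : `|weight sg x * drop N (expR x) F r| <=
    A * expR X * dom sg x + K * expR (- (sg / 2) * X) * dom (sg / 2) x.
  rewrite ger0_norm; first exact: key.
  by apply: mulr_ge0 => //; exact/ltW/weight_gt0.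
have ig := integrable_dominated cg iDD kn.
apply: (le_trans (le_Rintegral measurableT ig iDD (fun x _ => key x))).
rewrite (RintegralD measurableT (integrableZ _ iD) (integrableZ _ iD2)).
by rewrite (RintegralZl _ measurableT iD) (RintegralZl _ measurableT iD2).
Qed.

Variables (A M : R).
Hypothesis A_ge0 : 0 <= A.
Hypothesis F_le : F 0 <= M.
Hypothesis F_lip : forall r1 p q, r1 < 1 -> 0 <= p -> p <= q -> q <= r1 ->
  F p - F q <= A / (1 - r1) ^+ 2 * (q - p).

Definition lip_const := 4 * A + 24 * (N%:R + 3) * M.

Let M_ge0 : 0 <= M.
Proof. by apply: le_trans F_le; apply: F_ge0; rewrite lexx ler01. Qed.

Lemma lip_const_ge0 : 0 <= lip_const.
Proof. by rewrite addr_ge0// ?mulr_ge0// addr_ge0. Qed.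

Lemma drop_le_lip_const x r : 0 < r < 1 ->
  drop N (expR x) F r <= lip_const / (1 - r) ^+ 2.
Proof.
move=> /andP[r0 r1].
have h : drop N (expR x) F r <= A / (1 - (1 + r) / 2) ^+ 2 +
    6 * (N%:R + 3) / ((1 + r) / 2 - r) ^+ 2 * F 0.
  apply: (drop_le_lip N_gt0 (e0 x) cF F_ge0 F_ni) => //; try lra.
    by rewrite divr_ge0// sqr_ge0.
  by move=> p q p0 pq q1; apply: F_lip => //; lra.
apply: (le_trans h).
have -> : 1 - (1 + r) / 2 = (1 - r) / 2 by field.
have -> : (1 + r) / 2 - r = (1 - r) / 2 by field.
have d0 : 0 < 1 - r by lra.
have -> : A / ((1 - r) / 2) ^+ 2 + 6 * (N%:R + 3) / ((1 - r) / 2) ^+ 2 * F 0 =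
    (4 * A + 24 * (N%:R + 3) * F 0) / (1 - r) ^+ 2.
  by move: (N%:R) (F 0) => n F0'; field; rewrite gt_eqF//; lra.
apply: ler_wpM2r; first by rewrite invr_ge0 sqr_ge0.
by apply: lerD => //; apply: ler_wpM2l.
Qed.

Lemma drop_le_exp x r : 0 <= r <= 1 -> drop N (expR x) F r <= F 0 * r * expR x.
Proof.
move=> r01; have h := drop_le N_gt0 (e0 x) cF F_ge0 (M := F 0) _ r01.
rewrite -mulrA [r * _]mulrC mulrA; apply: h => p /andP[p0 p1]; exact: F_ni.
Qed.

(** The Lipschitz weight A of the source enters only through [lip_const], with the factor e^(-sg
    X/2) that is small for large X. This gain is what allows a Lipschitz bound to be iterated. *)
Definition step_const X :=
  M * expR X * mass sg + lip_const * expR (- (sg / 2) * X) * mass (sg / 2).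

Lemma frac_drop_le_step X r : 0 <= X -> 0 < r < 1 ->
  frac_drop N sg F r <= step_const X / (1 - r) ^+ 2.
Proof.
move=> X0 /andP[r0 r1].
have d0 : 0 < (1 - r) ^+ 2 by rewrite exprn_gt0//; lra.
have d1 : 1 <= ((1 - r) ^+ 2)^-1.
  rewrite -[leLHS]invr1 lef_pV2 ?posrE ?ltr01//.
  by rewrite expr_le1//; lra.
have h := @frac_drop_le r M (lip_const / (1 - r) ^+ 2) X.
apply: (le_trans (h _ M_ge0 _ X0 _ _)).
- by rewrite r0 ltW.
- by rewrite divr_ge0 ?lip_const_ge0// ltW.
- move=> x; apply: (le_trans (drop_le_exp x _)); first by rewrite !ltW.
  apply: ler_wpM2r; first exact: expR_ge0.
  by apply: (le_trans _ F_le); rewrite ler_piMr ?(ltW r1)// F_ge0// lexx ler01.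
- by move=> x; apply: drop_le_lip_const; rewrite r0.
rewrite /step_const [leRHS]mulrDl; apply: lerD.
  rewrite ler_peMr// mulr_ge0 ?mass_ge0// mulr_ge0// expR_ge0.
by apply: eq_leW; move: lip_const (expR _) (mass _) => *; ring.
Qed.

Lemma frac_inv_lip X r1 p q : 0 <= X -> r1 < 1 -> 0 <= p -> p <= q -> q <= r1 ->
  frac_inv N sg F p - frac_inv N sg F q <= step_const X / (1 - r1) ^+ 2 * (q - p).
Proof.
move=> X0 r11 p0 pq qr1; have q1 : q < 1 by exact: le_lt_trans r11.
have d0 : 0 < (1 - r1) ^+ 2 by rewrite exprn_gt0//; lra.
have dle r : 0 < r -> r < q -> ((1 - r) ^+ 2)^-1 <= ((1 - r1) ^+ 2)^-1.
  move=> r0 rq; rewrite lef_pV2 ?posrE//; last by rewrite exprn_gt0//; lra.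
  by rewrite lerXn2r// ?nnegrE; lra.
set C := step_const X / _.
have [MF hM] := F_bounded cF.
suff : C * p + frac_inv N sg F p <= C * q + frac_inv N sg F q.
  by move: (frac_inv _ _ _ p) (frac_inv _ _ _ q) C => *; lra.
have dd r : p < r < q -> is_derive r 1 (fun r => C * r + frac_inv N sg F r) (C - frac_drop N sg F r).
  move=> prq; apply: is_derive1D.
    rewrite -[X in is_derive _ _ _ X]mulr1; apply: is_derive1Z; exact: is_derive_id.
  apply: (@is_derive_frac_inv _ _ N_gt0 _ sg01 _ cF F_ge0 F_ni p q (lip_const / (1 - r1) ^+ 2)) => //.
  - exact: ltW.
  - by rewrite divr_ge0 ?lip_const_ge0// ltW.
  - move=> x t /andP[pt tq]; have t0 : 0 < t by exact: le_lt_trans pt.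
    apply: (le_trans (drop_le_lip_const x _)); first by rewrite t0 (lt_trans tq).
    by apply: ler_wpM2l; [exact: lip_const_ge0|exact: dle].
apply: (mono_derive pq _ dd).
  apply: contW; apply: contD.
    by apply: contM => ?; [exact: cvg_cst|exact: cvg_id].
  exact: (cont_frac_inv N_gt0 sg01 cF F_ge0 hM).
move=> r /andP[pr rq]; have r0 : 0 < r by exact: le_lt_trans pr.
rewrite subr_ge0; apply: (le_trans (frac_drop_le_step X0 _)).
  by rewrite r0 (lt_trans rq).
apply: ler_wpM2l; last exact: dle.
rewrite addr_ge0// mulr_ge0 ?mass_ge0// mulr_ge0 ?expR_ge0//.
exact: lip_const_ge0.
Qed.

End oneF.

End lipschitz_step.

(** * Passage to the limit in the source *)

Section convergence.
Variables (R : realType) (N : nat).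
Hypothesis N_gt0 : (0 < N)%N.
Local Notation mu := (@lebesgue_measure R).

Lemma cvg_itg a b (f_ : nat -> R -> R) (f g : R -> R) :
  (forall n, continuous (f_ n)) -> continuous g ->
  (forall x, a <= x <= b -> f_ n x @[n --> \oo] --> f x) ->
  (forall n x, a <= x <= b -> `|f_ n x| <= g x) ->
  itg a b (f_ n) @[n --> \oo] --> itg a b f.
Proof.
move=> cf cg ff fg; apply: (@cvg_Rintegral _ _ _ mu `[a, b] f_ f g).
- exact: measurable_itv.
- by move=> n; apply: measurable_funTS; exact: continuous_measurable_fun.
- by move=> x /=; rewrite in_itv/=; exact: ff.
- by apply: within_integrable; exact: contW.
- by move=> n x /=; rewrite in_itv/=; exact: fg.
Qed.

Section fixed_s.
Variable s : R.
Hypothesis s_gt0 : 0 < s.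
Variables (F_ : nat -> R -> R) (F : R -> R) (M : R).
Hypothesis cF_ : forall n, continuous (F_ n).
Hypothesis F_le : forall n p, 0 <= p <= 1 -> `|F_ n p| <= M.
Hypothesis F_cvg : forall p, 0 <= p <= 1 -> F_ n p @[n --> \oo] --> F p.

Lemma wint_cvg t : t <= 1 -> wint N s (F_ n) t @[n --> \oo] --> wint N s F t.
Proof.
move=> t1; have c0 : continuous (fun p : R => p ^+ N * rI N s p).
  by apply: contM; [exact: contX|exact: cont_rI].
apply: (@cvg_itg _ _ _ _ (fun p : R => p ^+ N * rI N s p * M)).
- by move=> n; apply: (@contM _ _ (fun p : R => p ^+ N * rI N s p)).
- by apply: (@contM _ _ (fun p : R => p ^+ N * rI N s p)) => // ?; exact: cvg_cst.
- move=> p /andP[p0 pt]; apply: cvgM; first exact: cvg_cst.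
  by apply: F_cvg; rewrite p0 (le_trans pt).
- move=> n p /andP[p0 pt]; rewrite normrM; apply: ler_pM => //.
    by rewrite ger0_norm// mulr_ge0 ?exprn_ge0// ltW// rI_gt0.
  by apply: F_le; rewrite p0 (le_trans pt).
Qed.

Lemma resolvent_cvg r : resolvent N s (F_ n) r @[n --> \oo] --> resolvent N s F r.
Proof.
have [r1|r1] := leP 1 `|r|.
  rewrite resolvent_ge1//; under eq_fun do rewrite resolvent_ge1//.
  exact: cvg_cst.
apply: cvgM; first exact: cvg_cst.
have r0 : 0 <= `|r| by [].
apply: (@cvg_itg _ _ _ _ (fun p => M * s * p)).
- by move=> n; exact: cont_slope.
- by apply: contM => ?; [exact: cvg_cst|exact: cvg_id].
- move=> p /andP[p0 p1]; apply: cvgM; last exact: cvg_cst.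
  by apply: cvgM; [exact: cvg_cst|exact: wint_cvg].
- move=> n p /andP[rp p1]; have p0 := le_trans r0 rp.
  apply: (slope_norm_le N_gt0 s_gt0 (@cF_ n) p0) => q /andP[q0 qp].
  by apply: F_le; rewrite q0 (le_trans qp).
Qed.

End fixed_s.

Variable sg : R.
Hypothesis sg01 : 0 < sg < 1.

Lemma frac_inv_cvg (F_ : nat -> R -> R) (F : R -> R) (M : R) r :
  (forall n, continuous (F_ n)) -> (forall n p, 0 <= p <= 1 -> 0 <= F_ n p <= M) ->
  (forall p, 0 <= p <= 1 -> F_ n p @[n --> \oo] --> F p) ->
  frac_inv N sg (F_ n) r @[n --> \oo] --> frac_inv N sg F r.
Proof.
move=> cF FM FF; have e0 (x : R) : 0 < expR x := expR_gt0 x.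
apply: (@cvg_Rintegral _ _ _ mu setT
  (fun n x => weight sg x * resolvent N (expR x) (F_ n) r)
  (fun x => weight sg x * resolvent N (expR x) F r) (fun x => M * dom sg x)) => //.
- move=> n; apply: continuous_measurable_fun.
  apply: (@contM _ _ (weight sg) (fun x => resolvent N (expR x) (F_ n) r)).
    exact: cont_weight.
  exact: cont_resolvent_exp.
- move=> x _; apply: cvgM; first exact: cvg_cst.
  apply: (resolvent_cvg (e0 x) (M := M) cF _ FF) => n p p01.
  by have /andP[h1 h2] := FM n p p01; rewrite ger0_norm.
- by apply: integrableZ; exact: integrable_dom.
- move=> n x _; apply: (@resolvent_dom _ _ N_gt0 sg (F_ n) (cF n) _ M) => p p01.
    by have /andP[] := FM n p p01.
  by have /andP[] := FM n p p01.
Qed.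

End convergence.

(** * Monotone iteration and its limit *)

Section iteration.
Variables (R : realType) (N : nat).
Hypothesis N_gt0 : (0 < N)%N.
Variable sg : R.
Hypothesis sg01 : 0 < sg < 1.
Variable f : R -> R.
Hypothesis cf : continuous f.
Hypothesis f_gt0 : forall t, 0 < f t.
Hypothesis f_nd : {homo f : x y / x <= y}.
Variables (lam : nat -> R) (Lam : R).
Hypothesis lam_gt0 : forall k, 0 < lam k.
Hypothesis lam_lt : forall k, lam k < lam k.+1.
Hypothesis lam_ltL : forall k, lam k < Lam.

(** The parameter grows strictly from one iterate to the next. This keeps the iterates strictly
    below the limit inside the ball ([picard_lt_lim]), so that difference quotients of f between
    them are defined. *)
Fixpoint picard k : R -> R :=
  if k is k'.+1 then fun r => lam k' * frac_inv N sg (f \o picard k') r else cst 0.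

Let f_ge0 t : 0 <= f t. Proof. exact/ltW/f_gt0. Qed.
Let fp_ge0 (u : R -> R) p : 0 <= p <= 1 -> 0 <= (f \o u) p.
Proof. by move=> _; exact: f_ge0. Qed.
Let lam_ge0 k : 0 <= lam k. Proof. exact/ltW/lam_gt0. Qed.

Lemma picardS k r : picard k.+1 r = lam k * frac_inv N sg (f \o picard k) r.
Proof. by []. Qed.

Lemma picard_ge0 k r : 0 <= picard k r.
Proof.
case: k => [|k]; first exact: lexx.
rewrite picardS; apply: mulr_ge0; first exact: lam_ge0.
by apply: frac_inv_ge0; exact: fp_ge0.
Qed.

Lemma cont_picard k : continuous (picard k).
Proof.
elim: k => [|k IH]; first by exact: contC.
have cfp : continuous (f \o picard k).
  exact: (@cont_comp _ _ _ (picard k) f IH cf).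
have [M hM] := F_bounded cfp.
apply: contM; first by exact: contC.
exact: (cont_frac_inv N_gt0 sg01 cfp (@fp_ge0 _) hM).
Qed.

Lemma cont_f_picard k : continuous (f \o picard k).
Proof.
by apply: (@cont_comp _ _ _ (picard k) f); [exact: cont_picard|exact: cf].
Qed.

Lemma picard_ni k p q : 0 <= p -> p <= q -> picard k q <= picard k p.
Proof.
elim: k p q => [|k IH] p q p0 pq; first exact: lexx.
rewrite !picardS; apply: ler_wpM2l; first exact: lam_ge0.
apply: (@frac_inv_ni _ _ N_gt0 _ sg01 (f \o picard k)) => //.
- exact: cont_f_picard.
- exact: fp_ge0.
by move=> p' q' p'0 p'q' _; apply: f_nd; exact: IH.
Qed.

Lemma picard_norm k r : picard k `|r| = picard k r.
Proof. by case: k => [|k]; [reflexivity|rewrite !picardS frac_inv_norm]. Qed.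

Lemma picard_ge1 k r : 1 <= `|r| -> picard k r = 0.
Proof.
by case: k => [|k] r1; [reflexivity|rewrite picardS frac_inv_ge1// mulr0].
Qed.

Lemma picard_mono k r : picard k r <= picard k.+1 r.
Proof.
elim: k r => [|k IH] r; first exact: picard_ge0.
rewrite (picardS k.+1) (picardS k).
apply: ler_pM; [exact: lam_ge0|exact: frac_inv_ge0 (@fp_ge0 _) _|exact/ltW/lam_lt|].
apply: (@frac_inv_mono _ _ N_gt0 _ sg01 (f \o picard k) (f \o picard k.+1)).
- exact: cont_f_picard.
- exact: cont_f_picard.
- exact: fp_ge0.
by move=> p _; apply: f_nd; exact: IH.
Qed.

Lemma picard_nd k l r : (k <= l)%N -> picard k r <= picard l r.
Proof.
apply: (homo_leq (f := fun k => picard k r) (r := fun x y : R => x <= y)).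
- exact: lexx.
- by move=> ? ? ?; exact: le_trans.
- by move=> i; exact: picard_mono.
Qed.

Variables (Mu Lf : R).
Hypothesis Lf_ge0 : 0 <= Lf.
Hypothesis f_lip : forall a b, 0 <= a -> a <= b -> b <= Mu -> f b - f a <= Lf * (b - a).
Hypothesis picard_le : forall k r, picard k r <= Mu.

Let Mu_ge0 : 0 <= Mu.
Proof. exact: (le_trans (picard_ge0 0 0) (picard_le 0 0)). Qed.

Let Lam_gt0 : 0 < Lam.
Proof. exact: lt_trans (lam_gt0 0) (lam_ltL 0). Qed.

Let C0 (X : R) := expR (- (sg / 2) * X) * mass (sg / 2).

Let small_weight (K : R) : 0 <= K -> exists2 X, 0 <= X & K * C0 X <= 2^-1.
Proof.
move=> K0; have /andP[s0 s1] := sg01; have m0 := mass_ge0 (sg / 2).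
have h0 : 0 <= K * mass (sg / 2) by exact: mulr_ge0.
(* The exponent becomes -2x with x = K [mass], and 1 + 2x <= e^(2x) gives x e^(-2x) <= 1/2. *)
exists (2 * (K * mass (sg / 2)) / (sg / 2)).
  by rewrite divr_ge0// ?mulr_ge0//; lra.
have -> : C0 (2 * (K * mass (sg / 2)) / (sg / 2)) =
    (expR (2 * (K * mass (sg / 2))))^-1 * mass (sg / 2).
  by rewrite /C0 -expRN; congr (expR _ * _); field; rewrite gt_eqF.
rewrite mulrCA mulrC.
move: (K * mass (sg / 2)) h0 => x x0.
have h : 1 + 2 * x <= expR (2 * x) by exact: expR_ge1Dx.
by rewrite ler_pdivrMr ?expR_gt0//; lra.
Qed.

(** Induction with the fixed constant 2 B0, where B0 collects the terms of Lam [step_const] free of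
    the previous Lipschitz constant. X is chosen so that this constant returns with a factor at most
    1/2, and B0 + (2 B0)/2 = 2 B0. The singular weight (1 - r1)^(-2) reproduces itself at each
    step. *)
Lemma picard_lip : exists2 B, 0 <= B & forall k r1 p q, r1 < 1 -> 0 <= p -> p <= q ->
  q <= r1 -> picard k p - picard k q <= B / (1 - r1) ^+ 2 * (q - p).
Proof.
have fM0 := f_ge0 Mu.
have [X X0 hX] := @small_weight (Lam * (4 * Lf)) (mulr_ge0 (ltW Lam_gt0) (mulr_ge0 (ler0n _ 4) Lf_ge0)).
have C00 : 0 <= C0 X by rewrite mulr_ge0 ?expR_ge0// mass_ge0.
pose B0 := Lam * (f Mu * expR X * mass sg + 24 * (N%:R + 3) * f Mu * C0 X).
have B00 : 0 <= B0.
  apply: mulr_ge0; first exact: ltW.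
  apply: addr_ge0; first by rewrite !mulr_ge0 ?expR_ge0 ?mass_ge0.
  have n0 : 0 <= 24 * (N%:R + 3) :> R by rewrite mulr_ge0// addr_ge0.
  exact: mulr_ge0 (mulr_ge0 n0 fM0) C00.
exists (2 * B0); first exact: mulr_ge0.
elim => [|k IH] r1 p q r11 p0 pq qr1.
  rewrite subrr; apply: mulr_ge0; last by lra.
  by rewrite divr_ge0 ?sqr_ge0// mulr_ge0.
have cF : continuous (f \o picard k) := @cont_f_picard k.
have F0 := @fp_ge0 (picard k).
have Fni a b : 0 <= a -> a <= b -> b <= 1 -> (f \o picard k) b <= (f \o picard k) a.
  by move=> a0 ab _; apply: f_nd; exact: picard_ni.
have Fl : (f \o picard k) 0 <= f Mu by apply: f_nd; exact: picard_le.
have Flip s1 a b : s1 < 1 -> 0 <= a -> a <= b -> b <= s1 ->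
    (f \o picard k) a - (f \o picard k) b <= Lf * (2 * B0) / (1 - s1) ^+ 2 * (b - a).
  move=> s11 a0 ab bs1; apply: (le_trans (f_lip _ _ _)).
  - exact: picard_ge0.
  - exact: picard_ni.
  - exact: picard_le.
  - by rewrite -(mulrA Lf) -(mulrA Lf); apply: ler_wpM2l => //; exact: IH.
have A0 : 0 <= Lf * (2 * B0) by rewrite mulr_ge0// mulr_ge0.
have h := frac_inv_lip N_gt0 sg01 cF F0 Fni A0 Fl Flip X0 r11 p0 pq qr1.
rewrite !picardS -mulrBr; apply: (le_trans (ler_wpM2l (ltW (lam_gt0 k)) h)).
rewrite (mulrA (lam k)); apply: ler_wpM2r; first by rewrite subr_ge0.
rewrite (mulrA (lam k)); apply: ler_wpM2r; first by rewrite invr_ge0 sqr_ge0.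
have st0 : 0 <= step_const N sg (Lf * (2 * B0)) (f Mu) X.
  rewrite addr_ge0// mulr_ge0 ?mass_ge0// mulr_ge0 ?expR_ge0//.
  by rewrite /lip_const addr_ge0// mulr_ge0// mulr_ge0// addr_ge0.
apply: (le_trans (ler_wpM2r st0 (ltW (lam_ltL k)))).
rewrite (_ : Lam * step_const _ _ _ _ _ = B0 + 2 * B0 * (Lam * (4 * Lf) * C0 X)); last first.
  by rewrite /step_const /lip_const /B0 /C0; move: (expR _) (expR _) (mass _) (mass _) (f Mu) => *; ring.
have := ler_wpM2l (mulr_ge0 (ler0n _ 2) B00) hX.
rewrite [2 * B0 / 2]mulrC mulKf// => h2; rewrite [leRHS](_ : _ = B0 + B0).
  by rewrite lerD2l.
by rewrite mulrDl mul1r.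
Qed.

Definition picard_lim r := limn (fun k => picard k r).
Local Notation U := picard_lim.

Lemma is_cvg_picard r : cvgn (fun k => picard k r).
Proof.
apply: nondecreasing_is_cvgn; first by move=> k l; exact: picard_nd.
by exists Mu => _ [k _ <-]; exact: picard_le.
Qed.

Lemma picard_cvg r : picard k r @[k --> \oo] --> U r.
Proof. exact: is_cvg_picard. Qed.

Lemma picard_le_lim k r : picard k r <= U r.
Proof.
apply: (cvgr_to_ge (@picard_cvg r)); near=> l; apply: picard_nd; near: l.
exact: nbhs_infty_ge.
Unshelve. all: by end_near.
Qed.

Lemma picard_lim_le r : U r <= Mu.
Proof. by apply: (cvgr_to_le (@picard_cvg r)); apply: nearW => k; exact: picard_le. Qed.

Lemma picard_lim_ge0 r : 0 <= U r.
Proof. exact: le_trans (picard_ge0 0 r) (picard_le_lim 0 r). Qed.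

Lemma picard_lim_ni p q : 0 <= p -> p <= q -> U q <= U p.
Proof.
move=> p0 pq; apply: (ler_cvg_to (@picard_cvg q) (@picard_cvg p)).
by apply: nearW => k; exact: picard_ni.
Qed.

Lemma picard_lim_norm r : U `|r| = U r.
Proof. by rewrite /U; congr (limn _); apply/funext => k; exact: picard_norm. Qed.

Lemma picard_lim_ge1 r : 1 <= `|r| -> U r = 0.
Proof.
move=> r1; rewrite /U (_ : (fun k => _) = cst 0) ?lim_cst//.
by apply/funext => k; exact: picard_ge1.
Qed.

Lemma picard_lim_lip : exists2 B, 0 <= B & forall r1 p q, r1 < 1 -> 0 <= p -> p <= q ->
  q <= r1 -> U p - U q <= B / (1 - r1) ^+ 2 * (q - p).
Proof.
have [B B0 hB] := picard_lip; exists B => // r1 p q r11 p0 pq qr1.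
have h : picard k p - picard k q @[k --> \oo] --> U p - U q.
  by apply: cvgB; exact: picard_cvg.
by apply: (cvgr_to_le h); apply: nearW => k; exact: hB.
Qed.

(** Inside the ball the uniform Lipschitz bound applies. It degenerates at |r| = 1, where U is
    squeezed between 0 and Lam times the fractional inverse of the constant f(Mu). *)
Lemma cont_picard_lim : continuous U.
Proof.
suff H (r0 : R) : {for r0, continuous U} by move=> r0; exact: H.
have [r1|r1] := leP 1 `|r0|.
  have c1 : continuous (fun _ : R => f Mu) by exact: contC.
  have hM (p : R) : 0 <= p <= 1 -> f Mu <= f Mu by [].
  have cB := cont_frac_inv N_gt0 sg01 c1 (fun p _ => f_ge0 Mu) hM.
  have U0 : U r0 = 0 by exact: picard_lim_ge1.
  have hl : cst (0 : R) @ nbhs r0 --> (0 : R) by exact: cvg_cst.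
  have hr : Lam * frac_inv N sg (fun=> f Mu) x @[x --> r0] --> (0 : R).
    rewrite -(mulr0 Lam) -(frac_inv_ge1 N sg (fun=> f Mu) r1).
    by apply: cvgM; [exact: cvg_cst|exact: cB].
  rewrite /prop_for /continuous_at U0; apply: (squeeze_cvgr _ hl hr).
  apply: nearW => r; rewrite picard_lim_ge0/=.
  apply: (cvgr_to_le (@picard_cvg r)).
  apply: nearW => -[|k].
    by apply: mulr_ge0; [exact: ltW|apply: frac_inv_ge0 => p _; exact: f_ge0].
  rewrite picardS; apply: ler_pM; [exact: lam_ge0|exact: frac_inv_ge0 (@fp_ge0 _) _|exact/ltW/lam_ltL|].
  apply: (@frac_inv_mono _ _ N_gt0 _ sg01 (f \o picard k)) => //.
  - exact: cont_f_picard.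
  - exact: fp_ge0.
  - by move=> p _; apply: f_nd; exact: picard_le.
have [B B0 hB] := picard_lim_lip.
pose r2 := (1 + `|r0|) / 2; have r21 : r2 < 1 by rewrite /r2; lra.
have r02 : `|r0| < r2 by rewrite /r2; lra.
pose C := B / (1 - r2) ^+ 2; have C0' : 0 <= C by rewrite divr_ge0// sqr_ge0.
have lip a b : 0 <= a -> a <= r2 -> 0 <= b -> b <= r2 -> `|U a - U b| <= C * `|a - b|.
  move=> a0 a2 b0 b2; have [ab|/ltW ab] := leP a b.
    rewrite ger0_norm ?subr_ge0; last exact: picard_lim_ni.
    by rewrite distrC ger0_norm ?subr_ge0//; exact: hB.
  rewrite distrC ger0_norm ?subr_ge0; last exact: picard_lim_ni.
  by rewrite ger0_norm ?subr_ge0//; exact: hB.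
have Cp : 0 < C + 1 by lra.
apply/cvgrPdist_le => e e1.
have d0 : 0 < e / (C + 1) by exact: divr_gt0.
near=> r; rewrite -picard_lim_norm -(picard_lim_norm r).
have rr2 : `|r| < r2.
  near: r; apply: (@cvgr_lt _ _ (nbhs r0) _ (fun r => `|r|) `|r0|) => //.
  by apply: cvg_norm; exact: cvg_id.
apply: (le_trans (lip _ _ (normr_ge0 _) (ltW r02) (normr_ge0 _) (ltW rr2))).
have h : `|r0 - r| <= e / (C + 1).
  near: r; apply: (@cvgr_dist_le _ _ _ (nbhs r0) _ id r0 _ _ d0); exact: cvg_id.
apply: (@le_trans _ _ (C * (e / (C + 1)))).
  apply: ler_wpM2l => //; apply: le_trans h; exact: ler_dist_dist.
rewrite mulrA ler_pdivrMr// mulrC ler_pM2l//; lra.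
Unshelve. all: by end_near.
Qed.

Lemma cont_f_lim : continuous (f \o U).
Proof.
by apply: (@cont_comp _ _ _ U f); [exact: cont_picard_lim|exact: cf].
Qed.

Hypothesis lam_cvg : lam k @[k --> \oo] --> Lam.

Lemma picard_limE r : U r = Lam * frac_inv N sg (f \o U) r.
Proof.
have h1 : picard k.+1 r @[k --> \oo] --> U r by rewrite (cvg_shiftS (fun k => picard k r)); exact: picard_cvg.
have h2 : picard k.+1 r @[k --> \oo] --> Lam * frac_inv N sg (f \o U) r.
  apply: cvgM; first exact: lam_cvg.
  apply: (@frac_inv_cvg _ _ N_gt0 _ sg01 (fun k => f \o picard k) (f \o U) (f Mu)).
  - exact: cont_f_picard.
  - by move=> k p _; rewrite f_ge0/=; apply: f_nd; exact: picard_le.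
  - move=> p _; apply: (@cvg_comp _ _ _ (fun k => picard k p) f _ (nbhs (U p))).
      exact: picard_cvg.
    exact: cf.
exact: cvg_unique h1 h2.
Qed.

Lemma f_lim_lip : exists2 A, 0 <= A & forall r1 p q, r1 < 1 -> 0 <= p -> p <= q ->
  q <= r1 -> (f \o U) p - (f \o U) q <= A / (1 - r1) ^+ 2 * (q - p).
Proof.
have [B B0 hB] := picard_lim_lip; exists (Lf * B); first exact: mulr_ge0.
move=> r1 p q r11 p0 pq qr1; apply: (le_trans (f_lip _ _ _)).
- exact: picard_lim_ge0.
- exact: picard_lim_ni.
- exact: picard_lim_le.
- by rewrite -(mulrA Lf) -(mulrA Lf); apply: ler_wpM2l => //; exact: hB.
Qed.

Lemma picard_lt_lim k r : `|r| < 1 -> picard k.+1 r < U r.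
Proof.
move=> r1; rewrite picard_limE picardS.
apply: (@lt_le_trans _ _ (Lam * frac_inv N sg (f \o picard k) r)).
  rewrite ltr_pM2r//; apply: (@frac_inv_gt0 _ _ N_gt0 _ sg01 (f \o picard k)).
  - exact: cont_f_picard.
  - by move=> p _; exact: f_gt0.
  - exact: r1.
apply: ler_wpM2l; first exact: ltW.
apply: (@frac_inv_mono _ _ N_gt0 _ sg01 (f \o picard k) (f \o U)).
- exact: cont_f_picard.
- exact: cont_f_lim.
- exact: fp_ge0.
- by move=> p _; apply: f_nd; exact: picard_le_lim.
Qed.

(** The gap between U and an iterate is a supersolution of the linear problem whose potential is the
    difference quotient of f. Lam is lowered to lam k and the source of the iterate is raised by one
    step, so that one and the same gap stands on both sides. *)
Lemma picard_gap k r :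
  lam k * frac_inv N sg (fun p => f (U p) - f (picard k.+1 p)) r <= U r - picard k.+1 r.
Proof.
have cU := cont_f_lim; have c0 := @cont_f_picard k; have c1 := @cont_f_picard k.+1.
have FU p : 0 <= p <= 1 -> 0 <= f (U p) - f (picard k p).
  by move=> _; rewrite subr_ge0; apply: f_nd; exact: picard_le_lim.
have E : frac_inv N sg (f \o U) r =
    1 * frac_inv N sg (f \o picard k) r + 1 * frac_inv N sg (fun p => f (U p) - f (picard k p)) r.
  have -> : f \o U = (fun p => 1 * (f \o picard k) p + 1 * (f (U p) - f (picard k p))).
    by apply/funext => p /=; rewrite !mul1r addrC subrK.
  apply: (@frac_inv_lin _ _ N_gt0 _ sg01) => //; first exact: contB cU c0.
  exact: fp_ge0.
rewrite picard_limE picardS.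
apply: (@le_trans _ _ (lam k * frac_inv N sg (f \o U) r - lam k * frac_inv N sg (f \o picard k) r)).
  have -> : lam k * frac_inv N sg (f \o U) r - lam k * frac_inv N sg (f \o picard k) r =
      lam k * frac_inv N sg (fun p => f (U p) - f (picard k p)) r.
    move: E; move: (frac_inv _ _ (f \o U) r) (frac_inv _ _ (f \o picard k) r).
    by move: (frac_inv _ _ _ r) => a b c ->; ring.
  apply: ler_wpM2l; first exact: lam_ge0.
  apply: (@frac_inv_mono _ _ N_gt0 _ sg01 (fun p => f (U p) - f (picard k.+1 p))
    (fun p => f (U p) - f (picard k p))).
  - exact: contB cU c1.
  - exact: contB cU c0.
  - by move=> p _; rewrite subr_ge0; apply: f_nd; exact: picard_le_lim.
  - by move=> p _; rewrite lerD2l lerN2; apply: f_nd; exact: picard_mono.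
rewrite lerD2r; apply: ler_wpM2r; last exact/ltW/lam_ltL.
by apply: frac_inv_ge0; exact: fp_ge0.
Qed.

End iteration.

(** * Projection onto a segment *)

Section clamp.
Variable R : realType.
Implicit Types (b : R) (g : R -> R).

(** Precomposition with this map turns a function continuous on [0, b] into one continuous on the
    whole line, see [cont_comp_clamp]. *)
Definition clamp b (r : R) : R := Num.min (Num.max r 0) b.

Lemma clamp_itv b r : 0 <= b -> 0 <= clamp b r <= b.
Proof. by move=> b0; rewrite /clamp le_min b0 le_max lexx orbT/= ge_min lexx orbT. Qed.

Lemma clampE b r : 0 <= r <= b -> clamp b r = r.
Proof. by move=> /andP[r0 rb]; rewrite /clamp (max_idPl r0) (min_idPl rb). Qed.

Lemma cont_clamp b : continuous (clamp b).
Proof.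
move=> r; apply: (@continuous_min _ _ (fun r : R => Num.max r 0) (cst b)); last exact: cst_continuous.
by apply: (@continuous_max _ _ id (cst 0)); [exact: cvg_id|exact: cst_continuous].
Qed.

Lemma cont_comp_clamp b g : 0 <= b -> {within `[0, b], continuous g} ->
  continuous (fun r => g (clamp b r)).
Proof.
move=> b0 /subspace_continuousP cg r.
have cr : `[0, b]%classic (clamp b r) by rewrite /= in_itv/=; exact: clamp_itv.
apply: (@cvg_comp _ _ _ (clamp b) g _ (within `[0, b] (nbhs (clamp b r)))); last exact: cg.
move=> V hV; have h : nbhs (clamp b r) (fun y => `[0, b]%classic y -> V y) := hV.
have h2 : nbhs r (fun t => `[0, b]%classic (clamp b t) -> V (clamp b t)) := @cont_clamp b r _ h.
suff : nbhs r (fun t => V (clamp b t)) by [].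
by apply: filterS h2 => t ht; apply: ht; rewrite /= in_itv/=; exact: clamp_itv.
Qed.

End clamp.

(** * Regularity of the derivative of the fractional inverse up to the origin *)

Section frac_drop_theory.
Variables (R : realType) (N : nat).
Hypothesis N_gt0 : (0 < N)%N.
Variable sg : R.
Hypothesis sg01 : 0 < sg < 1.
Local Notation mu := (@lebesgue_measure R).
Let e0 (x : R) : 0 < expR x := expR_gt0 x.

Variable F : R -> R.
Hypothesis cF : continuous F.
Hypothesis F_ge0 : forall p, 0 <= p <= 1 -> 0 <= F p.
Hypothesis F_ni : forall p q, 0 <= p -> p <= q -> q <= 1 -> F q <= F p.
Variable A : R.
Hypothesis A_ge0 : 0 <= A.
Hypothesis F_lip : forall r1 p q, r1 < 1 -> 0 <= p -> p <= q -> q <= r1 ->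
  F p - F q <= A / (1 - r1) ^+ 2 * (q - p).

Let F00 : 0 <= F 0. Proof. by apply: F_ge0; rewrite lexx ler01. Qed.

Definition drop_bound b := lip_const N A (F 0) / (1 - b) ^+ 2.

Lemma drop_bound_ge0 b : 0 <= drop_bound b.
Proof.
rewrite divr_ge0 ?sqr_ge0//.
exact: (lip_const_ge0 N F_ge0 A_ge0 (lexx (F 0))).
Qed.

Lemma drop_le_bound x b r : b < 1 -> 0 <= r <= b -> drop N (expR x) F r <= drop_bound b.
Proof.
move=> b1 /andP[r0 rb]; have [->|rn0] := eqVneq r 0.
  rewrite drop0; exact: drop_bound_ge0.
have {}r0 : 0 < r by rewrite lt_def rn0.
have r01 : 0 < r < 1 by rewrite r0 (le_lt_trans rb).
apply: (le_trans (drop_le_lip_const N_gt0 cF F_ge0 F_ni A_ge0 (lexx _) F_lip x r01)).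
apply: ler_wpM2l; first exact: (lip_const_ge0 N F_ge0 A_ge0 (lexx (F 0))).
rewrite lef_pV2 ?posrE; [|by rewrite exprn_gt0//; lra|by rewrite exprn_gt0//; lra].
by rewrite lerXn2r// ?nnegrE; lra.
Qed.

Lemma drop_F_ge0 x r : 0 <= r <= 1 -> 0 <= drop N (expR x) F r.
Proof. exact: (drop_ge0 N_gt0 (e0 x) cF F_ge0 F_ni). Qed.

Section below.
Variable b : R.
Hypothesis b01 : 0 < b < 1.

(** A radius strictly between b and 1, so that b is an interior point for differentiation. *)
Let b2 := (1 + b) / 2.
Let b2E : b < b2 < 1.
Proof. by rewrite /b2; have /andP[? ?] := b01; apply/andP; split; lra. Qed.

Let dropC x r : 0 < r < b2 -> drop N (expR x) F r <= drop_bound b2.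
Proof.
move=> /andP[r0 rb]; have /andP[_ b21] := b2E.
by apply: drop_le_bound => //; rewrite !ltW.
Qed.

Lemma is_derive_frac_inv_in (r : R) : 0 < r < b -> is_derive r 1 (frac_inv N sg F) (- frac_drop N sg F r).
Proof.
move=> /andP[r0 rb]; have /andP[bb b21] := b2E.
apply: (is_derive_frac_inv N_gt0 sg01 cF F_ge0 F_ni (lexx 0) (ltW b21) (drop_bound_ge0 b2) dropC).
by rewrite r0 (lt_trans rb).
Qed.

Lemma frac_drop0 : frac_drop N sg F 0 = 0.
Proof.
rewrite /frac_drop (_ : (fun x => _) = cst 0) ?Rintegral_cst//= ?mul0r//.
by apply/funext => x /=; rewrite drop0 mulr0.
Qed.

Lemma frac_drop_ge0 r : 0 <= r <= 1 -> 0 <= frac_drop N sg F r.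
Proof.
move=> r01; apply: Rintegral_ge0 => x _; apply: mulr_ge0; first exact/ltW/weight_gt0.
exact: drop_F_ge0.
Qed.

(** Each resolvent has slope 0 at the origin, but not uniformly in s. The bound F(0) r s serves for
    s <= e^X and the bound uniform in s beyond; X is fixed by the tolerance before r tends to 0. *)
Lemma frac_drop_cvg0 : frac_drop N sg F r @[r --> 0^'+] --> (0 : R).
Proof.
have /andP[b0 b1] := b01; have /andP[s0 s1] := sg01.
have K0 := drop_bound_ge0 b; set K := drop_bound b in K0.
have m2 : 0 <= mass (sg / 2) := mass_ge0 _; have m1 : 0 <= mass sg := mass_ge0 _.
apply/cvgrPdist_le => e e1.
pose X := 2 * (K * mass (sg / 2)) / (e * (sg / 2)).
have X0 : 0 <= X.
  apply: divr_ge0; first by apply: mulr_ge0 => //; exact: mulr_ge0.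
  by rewrite ltW// mulr_gt0// divr_gt0.
pose c := F 0 * expR X * mass sg.
have c0 : 0 <= c by rewrite mulr_ge0// mulr_ge0// expR_ge0.
have hX : K * expR (- (sg / 2) * X) * mass (sg / 2) <= e / 2.
  have h : 1 + (sg / 2) * X <= expR ((sg / 2) * X) by exact: expR_ge1Dx.
  have EX : sg / 2 * X = 2 * (K * mass (sg / 2)) / e.
    by rewrite /X; field; rewrite !gt_eqF.
  rewrite mulNr expRN mulrAC ler_pdivrMr ?expR_gt0//.
  apply: (@le_trans _ _ (e / 2 * (1 + sg / 2 * X))); last by apply: ler_wpM2l => //; lra.
  rewrite EX (_ : e / 2 * _ = e / 2 + K * mass (sg / 2)); last by field; rewrite gt_eqF.
  by lra.
have d0 : 0 < e / (2 * (c + 1)) by rewrite divr_gt0// mulr_gt0//; lra.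
near=> r.
have r0 : 0 < r by near: r; exact: nbhs_right_gt.
have rb : r < b by near: r; exact: nbhs_right_lt.
have re : r < e / (2 * (c + 1)) by near: r; exact: nbhs_right_lt.
have r01 : 0 <= r <= 1 by rewrite ltW//= ltW// (lt_trans rb).
rewrite sub0r normrN ger0_norm; last exact: frac_drop_ge0.
have h := @frac_drop_le _ _ N_gt0 _ sg01 F cF F_ge0 F_ni r (F 0 * r) K X.
apply: (le_trans (h _ _ K0 X0 _ _)).
- by rewrite r0; have /andP[] := r01.
- by rewrite mulr_ge0// ltW.
- by move=> x; exact: (drop_le_exp N_gt0 cF F_ge0 F_ni).
- by move=> x; apply: drop_le_bound => //; rewrite !ltW.
rewrite (_ : F 0 * r * expR X * mass sg = r * c); last by rewrite /c; ring.
have h2 : r * c <= e / 2; last by rewrite [leRHS]splitr; exact: lerD h2 hX.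
apply: (@le_trans _ _ (r * (c + 1))); first by apply: ler_wpM2l; [exact: ltW|rewrite lerDl].
move: re; rewrite ltr_pdivlMr; last by rewrite mulr_gt0// ltr_wpDl.
by rewrite ler_pdivlMr// -mulrA [_ * 2]mulrC => /ltW.
Unshelve. all: by end_near.
Qed.

Lemma frac_drop_within : {within `[0, b], continuous (frac_drop N sg F)}.
Proof.
have /andP[b0 b1] := b01; have /andP[bb b21] := b2E.
have cin (r : R) : 0 < r < b2 -> {for r, continuous (frac_drop N sg F)}.
  by move=> rb; apply: (@cont_frac_drop _ _ N_gt0 _ sg01 F cF F_ge0 F_ni 0 b2 (drop_bound b2) (lexx 0) (ltW b21) dropC _ rb).
apply/continuous_within_itvP => //; split.
- move=> r; rewrite in_itv/= => /andP[r0 rb]; apply: cin; rewrite r0; exact: lt_trans bb.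
- rewrite frac_drop0; exact: frac_drop_cvg0.
- by apply: cvg_at_left_filter; apply: cin; rewrite b0.
Qed.

(** r^N [drop] with the division by r^N carried out: continuous in r on the whole line and in the
    parameter, as joint measurability requires. *)
Definition powdrop s r := s * wint N s F r / rI N s r - r ^+ N * rI1 N s r * tail N s F r.

Lemma powdropE s r : 0 < s -> 0 <= r -> powdrop s r = r ^+ N * drop N s F r.
Proof.
move=> s0 r0; have [->|rn0] := eqVneq r 0.
  by rewrite drop0 mulr0 /powdrop wint_le0// mulr0 mul0r expr0n -(prednK N_gt0)/= !mul0r subrr.
rewrite /powdrop /drop mulrBr [r ^+ N * (rI1 _ _ _ * _)]mulrA; congr (_ - _).
rewrite invfM !mulrA [r ^+ N * s]mulrC [s * _ ^+ N * _]mulrAC.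
have rN : r ^+ N != 0 by rewrite expf_neq0.
by rewrite -[_ * r ^+ N * _]mulrA mulfV// mulr1.
Qed.

Lemma cont_powdrop s : 0 < s -> continuous (powdrop s).
Proof.
move=> s0; apply: contB.
  apply: (@contM _ _ (fun r : R => s * wint N s F r) (fun r => (rI N s r)^-1)).
    apply: contM; first by exact: contC.
    exact: cont_wint.
  apply: contV; last exact: cont_rI.
  by move=> r; rewrite gt_eqF// rI_gt0.
apply: (@contM _ _ (fun r : R => r ^+ N * rI1 N s r) (tail N s F)); last exact: cont_tail.
by apply: (@contM _ _ (fun r : R => r ^+ N) (rI1 N s)); [exact: contX|exact: cont_rI1].
Qed.

Lemma cont_powdrop_exp r : continuous (fun x => powdrop (expR x) r).
Proof.
apply: contB.
  apply: (@contM _ _ (fun x => expR x * wint N (expR x) F r) (fun x => (rI N (expR x) r)^-1)).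
    apply: (@contM _ _ expR (fun x => wint N (expR x) F r)); first exact: continuous_expR.
    exact: cont_wint_exp.
  apply: contV; last exact: cont_rI_exp.
  by move=> x; rewrite gt_eqF// rI_gt0.
apply: (@contM _ _ (fun x => r ^+ N * rI1 N (expR x) r) (fun x => tail N (expR x) F r)).
  apply: (@contM _ _ (fun=> r ^+ N) (fun x => rI1 N (expR x) r)); last exact: cont_rI1_exp.
  by exact: contC.
exact: cont_tail_exp.
Qed.

Let K := Num.max (drop_bound b) (F 0).

Lemma powdrop_dom x r : 0 <= r <= b -> `|weight sg x * powdrop (expR x) r| <= K * dom sg x.
Proof.
move=> r0b; have /andP[r0 rb] := r0b; have /andP[b0 b1] := b01.
have r01 : 0 <= r <= 1 by rewrite r0 (le_trans rb)// ltW.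
have w0 : 0 <= weight sg x by exact/ltW/weight_gt0.
have d0 := drop_F_ge0 x r01.
rewrite powdropE// ger0_norm; last by rewrite mulr_ge0// mulr_ge0// exprn_ge0.
apply: (@le_trans _ _ (weight sg x * drop N (expR x) F r)).
  apply: ler_wpM2l => //; rewrite ler_piMl// exprn_ile1//; lra.
rewrite /dom [K * _]mulrCA; apply: ler_wpM2l => //.
have [_|_] := leP 1 (expR x).
  by rewrite mulr1 (le_trans (drop_le_bound x b1 r0b))// le_max lexx.
apply: (le_trans (drop_le_exp N_gt0 cF F_ge0 F_ni x r01)).
apply: ler_wpM2r; first exact: expR_ge0.
by apply: (@le_trans _ _ (F 0)); [rewrite ler_piMr//; have /andP[] := r01|rewrite le_max lexx orbT].
Qed.

Let K0 : 0 <= K. Proof. by rewrite le_max drop_bound_ge0. Qed.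

Lemma swap_frac_drop (a : R -> R) : continuous a ->
  itg 0 b (fun r => a r * (r ^+ N * frac_drop N sg F r)) =
  \int[mu]_x (weight sg x * itg 0 b (fun r => a r * (r ^+ N * drop N (expR x) F r))).
Proof.
move=> ca; have /andP[b0 b1] := b01.
have [M M0 hM] := normF_bounded ca b.
have cpd x : continuous (fun r => weight sg x * powdrop (expR x) r).
  by apply: contM; [move=> ?; exact: cvg_cst|exact: cont_powdrop].
have fub := @fubini_dominated R _ _ mu `[0, b]%classic
  (fun x r => a r * (weight sg x * powdrop (expR x) r)) (dom sg) (M * K).
transitivity (\int[mu]_(r in `[0, b]) \int[mu]_x (a r * (weight sg x * powdrop (expR x) r))).
  apply: eq_Rintegral => r; rewrite inE/= in_itv/= => r0b; have /andP[r0 rb] := r0b.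
  have ip : mu.-integrable setT (EFin \o (fun x => weight sg x * powdrop (expR x) r)).
    apply: (integrable_dominated _ (integrableZ K (integrable_dom sg01)) (fun x => powdrop_dom x r0b)).
    apply: (@contM _ _ (weight sg) (fun x => powdrop (expR x) r)).
      exact: cont_weight.
    exact: cont_powdrop_exp.
  rewrite (RintegralZl _ measurableT ip); congr (_ * _).
  have [->|rn0] := eqVneq r 0.
    transitivity (frac_drop N sg F 0); first by rewrite frac_drop0 mulr0.
    rewrite /frac_drop; apply: eq_Rintegral => x _.
    by rewrite (powdropE (e0 x) (lexx 0)) drop0 (mulr0 (0 ^+ N)).
  have {}r0 : 0 < r by rewrite lt_def rn0.
  have ir : mu.-integrable setT (EFin \o (fun x => weight sg x * drop N (expR x) F r)).
    apply: (integrable_drop N_gt0 sg01 cF F_ge0 F_ni (lexx 0) _ dropC).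
      by have /andP[_ /ltW] := b2E.
    by apply/andP; split; [exact: r0|exact: le_lt_trans rb (proj1 (andP b2E))].
  rewrite /frac_drop -(RintegralZl _ measurableT ir); apply: eq_Rintegral => x _.
  by rewrite (powdropE (e0 x) (ltW r0)) mulrCA.
rewrite -fub.
- apply: eq_Rintegral => x _.
  rewrite (@eq_itg _ 0 b _ (fun r => a r * powdrop (expR x) r)); last first.
    by move=> r /andP[r0 rb]; rewrite powdropE.
  rewrite -itgZ; first by apply: eq_itg => r _; rewrite mulrCA.
  apply: contW; apply: (@contM _ _ a); first exact: ca.
  exact: cont_powdrop.
- exact: measurable_itv.
- by rewrite /= lebesgue_measure_itv/= lte_fin b0 -EFinD ltry.
- apply: measurable_funM.
    apply: (@measurableT_comp _ _ _ _ _ _ (a : measurableTypeR R -> R)).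
      exact: continuous_measurable_fun.
    exact: measurable_snd.
  apply: measurable_funM.
    apply: (@measurableT_comp _ _ _ _ _ _ (weight sg : measurableTypeR R -> R)).
      by apply: continuous_measurable_fun; exact: cont_weight.
    exact: measurable_fst.
  apply: measurable_caratheodory => [r|x]; first exact: cont_powdrop_exp.
  exact: (@continuous_measurable_fun R (powdrop (expR x)) (cont_powdrop (e0 x))).
- exact: integrable_dom.
- exact: mulr_ge0 (ltW M0) K0.
- exact: dom_ge0.
- move=> x r /=; rewrite in_itv/= => r0b; rewrite (normrM (a r)) -mulrA.
  apply: ler_pM; [exact: normr_ge0|exact: normr_ge0|exact: hM|exact: powdrop_dom].
Qed.

End below.

End frac_drop_theory.

(** * Stability in dual form *)

Section energy.
Variables (R : realType) (N : nat).
Hypothesis N_gt0 : (0 < N)%N.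
Variable sg : R.
Hypothesis sg01 : 0 < sg < 1.
Local Notation mu := (@lebesgue_measure R).
Let e0 (x : R) : 0 < expR x := expR_gt0 x.

Lemma itg_norm_le (g : R -> R) M : continuous g ->
  (forall r, 0 <= r <= 1 -> `|g r| <= M) -> `|itg 0 1 g| <= M.
Proof.
move=> cg gM; have cst c : {within `[0, 1], continuous (fun _ : R => c : R)}.
  by apply: contW => ?; exact: cvg_cst.
have cg' : {within `[0, 1], continuous g} by exact: contW.
have M1 : itg 0 1 (fun=> M) = M by rewrite itg_cst// subr0 mulr1.
have M2 : itg 0 1 (fun=> - M) = - M by rewrite itg_cst// subr0 mulr1.
rewrite ler_norml -[in X in X && _]M2 -[in X in _ && X]M1.
apply/andP; split; apply: itg_le => // r r01; have := gM r r01; rewrite ler_norml => /andP[]//.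
Qed.

Definition pairing (a F : R -> R) (x : R) :=
  itg 0 1 (fun r => r ^+ N * a r * resolvent N (expR x) F r).

Section pairing.
Variables (a F : R -> R) (A M : R).
Hypothesis ca : continuous a.
Hypothesis cF : continuous F.
Hypothesis F_ge0 : forall p, 0 <= p <= 1 -> 0 <= F p.
Hypothesis F_le : forall p, 0 <= p <= 1 -> F p <= M.
Hypothesis a_le : forall r, 0 <= r <= 1 -> `|a r| <= A.

Let cpa : continuous (fun r : R => r ^+ N * a r).
Proof. by apply: (@contM _ _ (fun r : R => r ^+ N) a); [exact: contX|exact: ca]. Qed.

Let pa_le r : 0 <= r <= 1 -> `|r ^+ N * a r| <= A.
Proof.
move=> r01; have /andP[r0 r1] := r01.
rewrite normrM (le_trans _ (a_le r01))// ler_piMl// ger0_norm ?exprn_ge0//.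
exact: exprn_ile1.
Qed.

Lemma cont_pairing : continuous (pairing a F).
Proof.
apply: cont_itg_param.
- move=> x; apply: contW.
  apply: (@contM _ _ (fun r : R => r ^+ N * a r)); first exact: cpa.
  exact: cont_resolvent.
- move=> r _; apply: (@contM _ _ (fun=> r ^+ N * a r) (fun x => resolvent N (expR x) F r)).
    by exact: contC.
  exact: cont_resolvent_exp.
- move=> x0; exists (A * M) => x r _ r01; rewrite normrM; apply: ler_pM => //; first exact: pa_le.
  have V0 := resolvent_ge0 N (e0 x) F_ge0 r.
  by rewrite ger0_norm//; exact: (resolvent_le N_gt0 (e0 x) cF F_ge0 F_le).
Qed.

Lemma pairing_dom x : `|weight sg x * pairing a F x| <= A * M * dom sg x.
Proof.
have cg : continuous (fun r : R => r ^+ N * a r * resolvent N (expR x) F r).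
  apply: (@contM _ _ (fun r : R => r ^+ N * a r)); first exact: cpa.
  exact: cont_resolvent.
rewrite -itgZ; last exact: contW.
apply: itg_norm_le; first by apply: contM; [move=> ?; exact: cvg_cst|exact: cg].
move=> r r01; rewrite mulrCA (normrM (r ^+ N * a r)) -(mulrA A); apply: ler_pM.
- exact: normr_ge0.
- exact: normr_ge0.
- exact: pa_le.
- exact: (resolvent_dom N_gt0 sg cF F_ge0 F_le).
Qed.

Lemma integrable_pairing : mu.-integrable setT (EFin \o (fun x => weight sg x * pairing a F x)).
Proof.
apply: (integrable_dominated _ (integrableZ (A * M) (integrable_dom sg01)) pairing_dom).
by apply: (@contM _ _ (weight sg) (pairing a F)); [exact: cont_weight|exact: cont_pairing].
Qed.

End pairing.

Section stability.
Variables (f df : R -> R) (u_ : nat -> R -> R) (U : R -> R) (lam : nat -> R) (Lam Lf b : R).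
Hypothesis cf : continuous f.
Hypothesis f_nd : {homo f : x y / x <= y}.
Hypothesis f_df : forall t, is_derive t (1 : R) f (df t).
Hypothesis cdf : continuous df.
Hypothesis cu : forall k, continuous (u_ k).
Hypothesis cU : continuous U.
Hypothesis u_lt : forall k r, `|r| < 1 -> u_ k r < U r.
Hypothesis u_le : forall k r, u_ k r <= U r.
Hypothesis u_cvg : forall r, u_ k r @[k --> \oo] --> U r.
Hypothesis lam_gt0 : forall k, 0 < lam k.
Hypothesis lam_cvg : lam k @[k --> \oo] --> Lam.
Hypothesis Lf_ge0 : 0 <= Lf.
Hypothesis f_lip : forall k r, f (U r) - f (u_ k r) <= Lf * (U r - u_ k r).
Hypothesis gap : forall k r, lam k * frac_inv N sg (fun p => f (U p) - f (u_ k p)) r <= U r - u_ k r.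
Hypothesis b01 : 0 < b < 1.
Variable eta : R -> R.
Hypothesis ceta : continuous eta.
Hypothesis eta_ge0 : forall r, 0 <= r <= 1 -> 0 <= eta r.
Hypothesis eta0 : forall r, b <= r <= 1 -> eta r = 0.

Local Notation cl := (clamp b).
Let p_ k r := f (U r) - f (u_ k r).
Let W k r := U r - u_ k r.
(** Difference quotient of f between u_k and U. It is evaluated at the projection onto [0, b], where
    u_k < U; the test function vanishes beyond b. *)
Let q k r := p_ k (cl r) / W k (cl r).

Let cl_lt r : `|cl r| < 1.
Proof.
have /andP[b0 b1] := b01; have /andP[c0 cb] := clamp_itv r (ltW b0).
by rewrite ger0_norm// (le_lt_trans cb).
Qed.

Let Wcl k r : 0 < W k (cl r). Proof. by rewrite subr_gt0; exact/u_lt/cl_lt. Qed.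

Let p_ge0 k r : 0 <= p_ k r. Proof. by rewrite subr_ge0; apply: f_nd. Qed.

Let cp k : continuous (p_ k).
Proof.
apply: contB; first exact: (@cont_comp _ _ _ U f).
exact: (@cont_comp _ _ _ (u_ k) f).
Qed.

Let ccl : continuous cl := @cont_clamp R b.

Let cq k : continuous (q k).
Proof.
apply: contM; first exact: (@cont_comp _ _ _ cl (p_ k) ccl (@cp k)).
apply: contV; first by move=> r; rewrite gt_eqF.
by apply: (@cont_comp _ _ _ cl (W k)) => //; exact: contB.
Qed.

Let q_ge0 k r : 0 <= q k r.
Proof. by apply: divr_ge0; [exact: p_ge0|exact/ltW/Wcl]. Qed.

Let q_le k r : q k r <= Lf.
Proof. by rewrite ler_pdivrMr//; exact: f_lip. Qed.

Let q_cvg r : q k r @[k --> \oo] --> df (U (cl r)).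
Proof.
have := f_df (U (cl r)) => -[dd <-].
have h : (fun h => h^-1 *: (f (h + U (cl r)) - f (U (cl r)))) @ 0^' --> 'D_1 f (U (cl r)).
  have := dd; rewrite /derivable => /cvg_ex[l hl].
  have -> : 'D_1 f (U (cl r)) = l by apply: cvg_lim.
  apply: cvg_trans hl; apply: near_eq_cvg; near=> t.
  by have -> : (t%:A : R) = t by rewrite /GRing.scale/= mulr1.
(* The increment tends to 0 without vanishing, hence along the punctured filter in which the
   derivative is defined. *)
have hk : - W k (cl r) @[k --> \oo] --> (0 : R)^'.
  have W0 : - W k (cl r) @[k --> \oo] --> (0 : R).
    rewrite -(subrr (U (cl r))); under eq_fun do rewrite opprB.
    by apply: cvgB; [exact: u_cvg|exact: cvg_cst].
  move=> V hV; have h2 : nbhs (0 : R) (fun y => y != 0 -> V y) := hV.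
  have h3 : \forall k \near \oo, - W k (cl r) != 0 -> V (- W k (cl r)) := W0 _ h2.
  suff : \forall k \near \oo, V (- W k (cl r)) by [].
  by apply: filterS h3 => k; apply; rewrite oppr_eq0 gt_eqF.
have := @cvg_comp _ _ _ (fun k => - W k (cl r)) _ _ _ _ hk h.
apply: cvg_trans; apply: near_eq_cvg; near=> k.
by rewrite /= /q /p_ /W opprB subrK /GRing.scale/= -[u_ _ _ - _]opprB invrN mulNr -mulrN opprB mulrC.
Unshelve. all: by end_near.
Qed.

(** Since p_ = q W on [0, b], these choices satisfy b_^2 = p_ c_ there, the hypothesis of
    [resolvent_schur]; [th] is the limit of b_. *)
Let b_ k r := q k r * eta r.
Let c_ k r := q k r / W k (cl r) * eta r ^+ 2.
Let th r := df (U (cl r)) * eta r.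

Let cb k : continuous (b_ k). Proof. exact: contM (@cq k) ceta. Qed.

Let cc k : continuous (c_ k).
Proof.
apply: contM; last exact: cont_exp.
apply: contM; first exact: cq.
apply: contV; first by move=> r; rewrite gt_eqF.
by apply: (@cont_comp _ _ _ cl (W k)) => //; exact: contB.
Qed.

Let cth : continuous th.
Proof.
apply: contM ceta; apply: (@cont_comp _ _ _ (fun r => U (cl r)) df) => //.
exact: (@cont_comp _ _ _ cl U).
Qed.

Let b_ge0 k r : 0 <= r <= 1 -> 0 <= b_ k r.
Proof. by move=> r01; apply: mulr_ge0; [exact: q_ge0|exact: eta_ge0]. Qed.

Let th_ge0 r : 0 <= r <= 1 -> 0 <= th r.
Proof.
move=> r01; apply: mulr_ge0; last exact: eta_ge0.
by apply: (cvgr_to_ge (@q_cvg r)); apply: nearW => k; exact: q_ge0.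
Qed.

(** The Schur test for each s, then Fubini, then [gap]: the fractional inverse of p_ is at most W /
    lam k, and c_ W = q eta^2. *)
Let itg_bound k : lam k * \int[mu]_x (weight sg x * pairing (b_ k) (b_ k) x) <=
  itg 0 1 (fun r => r ^+ N * (q k r * eta r ^+ 2)).
Proof.
have [M M0 hM] := normF_bounded (@cb k) 1.
have [P P0 hP] := normF_bounded (@cp k) 1.
have [C C0 hC] := normF_bounded (@cc k) 1.
have bM r : 0 <= r <= 1 -> b_ k r <= M by move=> r01; rewrite (le_trans (ler_norm _))// hM.
have pP r : 0 <= r <= 1 -> p_ k r <= P by move=> r01; rewrite (le_trans (ler_norm _))// hP.
have p0 r (r01 : 0 <= r <= 1) := p_ge0 k r.
have c0 r : 0 <= r <= 1 -> 0 <= c_ k r.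
  move=> r01; apply: mulr_ge0; last exact: sqr_ge0.
  by apply: divr_ge0; [exact: q_ge0|exact/ltW/Wcl].
have i1 := integrable_pairing (@cb k) (@cb k) (@b_ge0 k) bM hM.
have i2 := integrable_pairing (@cc k) (@cp k) p0 pP hC.
have schur x : weight sg x * pairing (b_ k) (b_ k) x <= weight sg x * pairing (c_ k) (p_ k) x.
  apply: ler_wpM2l; first exact/ltW/weight_gt0.
  apply: (resolvent_schur N_gt0 (e0 x) (@cp k) (@cb k) (@cc k) p0 c0) => r /andP[r0 r1].
  have [rb|/ltW rb] := leP r b; last first.
    by rewrite /b_ /c_ eta0 ?rb// mulr0 expr2 !mulr0.
  rewrite /b_ /c_ exprMn mulrA; apply: ler_wpM2r; first exact: sqr_ge0.
  have pE : p_ k r = q k r * W k (cl r) by rewrite /q (@clampE _ b r) ?r0// mulfVK// gt_eqF// -(@clampE _ b r) ?r0.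
  by rewrite pE mulrA [_ * _ * q k r]mulrAC mulfK ?gt_eqF.
apply: (le_trans (ler_wpM2l (ltW (lam_gt0 k)) (le_Rintegral measurableT i1 i2 (fun x _ => schur x)))).
rewrite -(swap_frac_inv N_gt0 sg01 (@cc k) (@cp k) p0) -itgZ; last first.
  apply: contW; apply: contM.
    by apply: (@contM _ _ (fun r : R => r ^+ N)); [exact: contX|exact: cc].
  exact: (cont_frac_inv N_gt0 sg01 (@cp k) p0 pP).
apply: itg_le.
- apply: contW; apply: contM; first by exact: contC.
  apply: contM.
    by apply: (@contM _ _ (fun r : R => r ^+ N)); [exact: contX|exact: cc].
  exact: (cont_frac_inv N_gt0 sg01 (@cp k) p0 pP).
- apply: contW; apply: (@contM _ _ (fun r : R => r ^+ N)); first exact: contX.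
  by apply: (@contM _ _ (q k)); [exact: cq|exact: cont_exp].
- move=> r r01; have /andP[r0 r1] := r01; have [rb|/ltW rb] := leP r b; last first.
    by rewrite /c_ eta0 ?rb// expr2 !mulr0 mul0r mulr0.
  rewrite mulrCA -mulrA; apply: ler_wpM2l; first exact: exprn_ge0.
  have Wr : 0 < W k r by rewrite -(@clampE _ b r) ?r0.
  have -> : q k r * eta r ^+ 2 = c_ k r * W k r.
    have clr : cl r = r by apply: clampE; rewrite r0.
    by rewrite -{4}clr /c_ [RHS]mulrAC mulfVK// gt_eqF.
  by apply: ler_wpM2l; [exact: c0|exact: gap].
Qed.

(** Limit of [itg_bound] by dominated convergence. The stability inequality appears in dual form:
    f'(U) eta is paired with its own fractional inverse, so no fractional energy of eta is
    involved. *)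
Lemma stability :
  Lam * \int[mu]_x (weight sg x * pairing th th x) <=
  itg 0 1 (fun r => r ^+ N * (df (U (cl r)) * eta r ^+ 2)).
Proof.
have [E E0 hE] := normF_bounded ceta 1.
have ceta2 : continuous (fun r => eta r ^+ 2) by exact: cont_exp.
have bE k r : 0 <= r <= 1 -> b_ k r <= Lf * E.
  move=> r01; apply: ler_pM; [exact: q_ge0|exact: eta_ge0|exact: q_le|].
  by rewrite (le_trans (ler_norm _))// hE.
have bE' k r : 0 <= r <= 1 -> `|b_ k r| <= Lf * E.
  by move=> r01; rewrite ger0_norm; [exact: bE|exact: b_ge0].
have b_cvg r : 0 <= r <= 1 -> b_ k r @[k --> \oo] --> th r.
  by move=> _; apply: cvgM; [exact: q_cvg|exact: cvg_cst].
have h1 : lam k * \int[mu]_x (weight sg x * pairing (b_ k) (b_ k) x) @[k --> \oo] -->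
    Lam * \int[mu]_x (weight sg x * pairing th th x).
  apply: cvgM; first exact: lam_cvg.
  apply: (@cvg_Rintegral _ _ _ mu setT (fun k x => weight sg x * pairing (b_ k) (b_ k) x)
    (fun x => weight sg x * pairing th th x) (fun x => Lf * E * (Lf * E) * dom sg x)) => //.
  - move=> k; apply: continuous_measurable_fun.
    apply: (@contM _ _ (weight sg) (pairing (b_ k) (b_ k))); first exact: cont_weight.
    exact: (cont_pairing (@cb k) (@cb k) (@b_ge0 k) (bE k) (bE' k)).
  - move=> x _; apply: cvgM; first exact: cvg_cst.
    apply: (@cvg_itg _ _ _ (fun k r => r ^+ N * b_ k r * resolvent N (expR x) (b_ k) r) _ (fun=> Lf * E * (Lf * E))).
    + move=> k; apply: (@contM _ _ (fun r : R => r ^+ N * b_ k r)); last exact: cont_resolvent.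
      by apply: (@contM _ _ (fun r : R => r ^+ N)); [exact: contX|exact: cb].
    + by exact: contC.
    + move=> r r01; apply: cvgM; first by apply: cvgM; [exact: cvg_cst|exact: b_cvg].
      exact: (resolvent_cvg N_gt0 (e0 x) (fun k => @cb k) bE' b_cvg).
    + move=> k r r01; have /andP[r0 r1] := r01; rewrite normrM; apply: ler_pM => //.
        rewrite normrM (le_trans _ (bE' k r r01))// ler_piMl// ger0_norm ?exprn_ge0//.
        exact: exprn_ile1.
      have V0 := resolvent_ge0 N (e0 x) (@b_ge0 k) r.
      by rewrite ger0_norm//; exact: (resolvent_le N_gt0 (e0 x) (@cb k) (@b_ge0 k) (bE k)).
  - by apply: integrableZ; exact: integrable_dom.
  - by move=> k x _; exact: (pairing_dom (@cb k) (@cb k) (@b_ge0 k) (bE k) (bE' k)).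
have h2 : itg 0 1 (fun r => r ^+ N * (q k r * eta r ^+ 2)) @[k --> \oo] -->
    itg 0 1 (fun r => r ^+ N * (df (U (cl r)) * eta r ^+ 2)).
  apply: (@cvg_itg _ _ _ (fun k r => r ^+ N * (q k r * eta r ^+ 2)) _ (fun=> Lf * E ^+ 2)).
  - move=> k; apply: (@contM _ _ (fun r : R => r ^+ N)); first exact: contX.
    by apply: (@contM _ _ (q k)); [exact: cq|exact: ceta2].
  - by exact: contC.
  - move=> r r01; apply: cvgM; first exact: cvg_cst.
    by apply: cvgM; [exact: q_cvg|exact: cvg_cst].
  - move=> k r r01; have /andP[r0 r1] := r01.
    have e1 : eta r <= E by rewrite (le_trans (ler_norm _))// hE.
    rewrite ger0_norm; last by rewrite mulr_ge0 ?exprn_ge0// mulr_ge0 ?sqr_ge0.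
    apply: (@le_trans _ _ (q k r * eta r ^+ 2)).
      by rewrite ler_piMl ?exprn_ile1// mulr_ge0 ?sqr_ge0.
    apply: ler_pM; [exact: q_ge0|exact: sqr_ge0|exact: q_le|].
    by apply: lerXn2r => //; rewrite nnegrE; [exact: eta_ge0|exact: ltW].
by apply: (ler_cvg_to h1 h2); apply: nearW => k; exact: itg_bound.
Qed.

End stability.

End energy.

(** * The test inequality integrated over the resolvent parameter *)

Section weighted_inequality.
Variables (R : realType) (N : nat).
Hypothesis N_gt0 : (0 < N)%N.
Variable sg : R.
Hypothesis sg01 : 0 < sg < 1.
Local Notation mu := (@lebesgue_measure R).
Let e0 (x : R) : 0 < expR x := expR_gt0 x.

Lemma itg_norm_le_within a b (g : R -> R) M : a <= b <= a + 1 -> 0 <= M ->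
  {within `[a, b], continuous g} ->
  (forall r, a <= r <= b -> `|g r| <= M) -> `|itg a b g| <= M.
Proof.
move=> /andP[ab ba] M0 cg gM; have cst c : {within `[a, b], continuous (fun _ : R => c : R)}.
  by apply: contW => ?; exact: cvg_cst.
have d : 0 <= b - a <= 1 by apply/andP; split; lra.
have /andP[d0 d1] := d.
apply: (@le_trans _ _ (M * (b - a))); last by rewrite ler_piMr.
rewrite ler_norml -mulNr -!itg_cst//.
apply/andP; split; apply: itg_le => // r rab; have := gM r rab; rewrite ler_norml => /andP[]//.
Qed.

Variables (g dg U : R -> R).
Local Notation F := (g \o U).
Local Notation y := (frac_drop N sg F).
Hypothesis cg : continuous g.
Hypothesis g_dg : forall t, is_derive t (1 : R) g (dg t).
Hypothesis cdg : continuous dg.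
Hypothesis dg_ge0 : forall t, 0 <= dg t.
Hypothesis cU : continuous U.
Hypothesis F_ge0 : forall p, 0 <= p <= 1 -> 0 <= F p.
Hypothesis F_ni : forall p q, 0 <= p -> p <= q -> q <= 1 -> F q <= F p.
Variable A : R.
Hypothesis A_ge0 : 0 <= A.
Hypothesis F_lip : forall r1 p q, r1 < 1 -> 0 <= p -> p <= q -> q <= r1 ->
  F p - F q <= A / (1 - r1) ^+ 2 * (q - p).
Hypothesis U_eq : forall r, U r = frac_inv N sg F r.

Variables b : R.
Hypothesis b01 : 0 < b < 1.
Local Notation cl := (clamp b).
Hypothesis stable : forall eta : R -> R, continuous eta -> (forall r, 0 <= r <= 1 -> 0 <= eta r) ->
  (forall r, b <= r <= 1 -> eta r = 0) ->
  \int[mu]_x (weight sg x * pairing N (fun r => dg (U (cl r)) * eta r)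
     (fun r => dg (U (cl r)) * eta r) x) <=
  itg 0 1 (fun r => r ^+ N * (dg (U (cl r)) * eta r ^+ 2)).

Variables zeta dzeta : R -> R.
Hypothesis cz : continuous zeta.
Hypothesis cdz : continuous dzeta.
Hypothesis dz : forall r : R, is_derive r 1 zeta (dzeta r).
Hypothesis zb : zeta b = 0.
Hypothesis z_ge0 : forall r, 0 <= r <= b -> 0 <= zeta r.

Let b0 : 0 < b. Proof. by have /andP[] := b01. Qed.
Let b1 : b < 1. Proof. by have /andP[] := b01. Qed.
Let cF : continuous F. Proof. exact: (@cont_comp _ _ _ U g). Qed.
Let F00 : 0 <= F 0. Proof. by apply: F_ge0; rewrite lexx ler01. Qed.
Let bI : 0 <= b <= 0 + 1. Proof. by rewrite add0r !ltW. Qed.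
Let rI1' r : 0 <= r <= b -> 0 <= r <= 1.
Proof. by move=> /andP[-> rb]; rewrite (le_trans rb)// ltW. Qed.

Let cy : continuous (fun r => y (cl r)).
Proof.
apply: cont_comp_clamp; first exact: ltW.
exact: (frac_drop_within N_gt0 sg01 cF F_ge0 F_ni A_ge0 F_lip b01).
Qed.

Let y_ge0 r : 0 <= r <= 1 -> 0 <= y r := @frac_drop_ge0 _ _ N_gt0 sg F cF F_ge0 F_ni r.

(** The test function is y zeta with y minus the derivative of U, so that th = -F' zeta. On [0, b],
    a y equals dg(U) eta^2, hence the right side of [stable] is the pairing of a with r^N y. *)
Let eta r := y (cl r) * zeta (cl r).
Let G r := dg (U (cl r)) * y (cl r).
Let th r := dg (U (cl r)) * eta r.
Let a r := G r * zeta (cl r) ^+ 2.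

Let ccl : continuous cl := @cont_clamp R b.
Let cdU : continuous (fun r => dg (U (cl r))).
Proof.
apply: (@cont_comp _ _ _ (fun r => U (cl r)) dg) => //.
exact: (@cont_comp _ _ _ cl U).
Qed.
Let cG : continuous G. Proof. exact: contM cdU cy. Qed.
Let czc : continuous (fun r => zeta (cl r)).
Proof. exact: (@cont_comp _ _ _ cl zeta). Qed.
Let ca : continuous a.
Proof. by apply: contM; [exact: cG|exact: cont_exp]. Qed.
Let ceta : continuous eta. Proof. exact: contM cy czc. Qed.
Let cth : continuous th. Proof. exact: contM cdU ceta. Qed.

Let clI r : 0 <= cl r <= b. Proof. exact/clamp_itv/ltW. Qed.

Let eta_ge0 r : 0 <= r <= 1 -> 0 <= eta r.
Proof.
by move=> _; apply: mulr_ge0; [exact/y_ge0/rI1'|exact: z_ge0].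
Qed.

Let th_ge0 r : 0 <= r <= 1 -> 0 <= th r.
Proof. by move=> r01; apply: mulr_ge0 => //; exact: eta_ge0. Qed.

Let eta0 r : b <= r <= 1 -> eta r = 0.
Proof.
move=> /andP[br r1]; rewrite /eta (_ : cl r = b) ?zb ?mulr0//.
by rewrite /clamp (max_idPl _) ?(min_idPr br)// (le_trans (ltW b0)).
Qed.

Let s_ x : R := expR x.
Let Gd x := itg 0 b (fun r => a r * (r ^+ N * drop N (s_ x) F r)).
Let T x := pairing N th th x.
Let Q x := itg 0 b (fun r => r ^+ N * (drop N (s_ x) F r ^+ 2 * dzeta r ^+ 2)).
Let B x := itg 0 b (fun r => r ^+ N * (dropr N (s_ x) F r ^+ 2 * zeta r ^+ 2)).

Let test x : Gd x + N%:R / s_ x * B x <= T x + (s_ x)^-1 * Q x.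
Proof.
have := @test_inequality _ _ N_gt0 (s_ x) (e0 x) F G zeta dzeta th b b0 b1 cF _ _ (fun r _ => dz r)
  _ _ zb cth _ _ th_ge0.
have -> : Gd x = itg 0 b (fun r => r ^+ N * (G r * zeta r ^+ 2 * drop N (s_ x) F r)).
  by apply: eq_itg => r rb; rewrite /a (clampE rb) mulrCA.
apply.
- move=> r /andP[r0 rb].
  have dU : is_derive r (1 : R) U (- y r).
    rewrite [X in is_derive _ _ X _](_ : _ = frac_inv N sg F); last exact/funext.
    apply: (is_derive_frac_inv_in N_gt0 sg01 cF F_ge0 F_ni A_ge0 F_lip b01).
    by rewrite r0.
  have := is_derive1_compE (g_dg (U r)) dU.
  by rewrite /G (@clampE _ b r) ?(ltW r0) ?(ltW rb)// mulrN.
- exact: contW.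
- exact: contW.
- exact: contW.
- by move=> r rb; rewrite /th /eta /G (clampE rb) mulrA.
- by move=> r rb; rewrite /th eta0// mulr0.
Qed.

Let dropI x r : 0 <= r <= b -> 0 <= drop N (s_ x) F r <= F 0 * r * s_ x.
Proof.
move=> rb; have r01 := rI1' rb; apply/andP; split; first exact: (drop_F_ge0 N_gt0 cF F_ge0 F_ni).
exact: (drop_le_exp N_gt0 cF F_ge0 F_ni).
Qed.

Let K := Num.max (drop_bound N F A b) (F 0).

Let pdom x r : 0 <= r <= b -> `|weight sg x * (r ^+ N * drop N (s_ x) F r)| <= K * dom sg x.
Proof.
move=> rb; have /andP[r0 _] := rb; rewrite -(powdropE N_gt0 F (e0 x) r0).
have /= h := @powdrop_dom _ _ N_gt0 sg F cF F_ge0 F_ni A A_ge0 F_lip b b01.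
exact: h.
Qed.

Let iGd : mu.-integrable setT (EFin \o (fun x => weight sg x * Gd x)).
Proof.
have [M M0 hM] := normF_bounded ca b.
have GdE x : Gd x = itg 0 b (fun r => a r * powdrop N F (s_ x) r).
  by apply: eq_itg => r /andP[r0 rb]; rewrite powdropE.
have cap x : continuous (fun r => a r * powdrop N F (s_ x) r).
  by apply: (@contM _ _ a); [exact: ca|exact: cont_powdrop].
apply: (integrable_dominated _ (integrableZ (M * K) (integrable_dom sg01))).
  apply: (@contM _ _ (weight sg)); first exact: cont_weight.
  rewrite (_ : Gd = fun x => itg 0 b (fun r => a r * powdrop N F (s_ x) r)); last exact/funext.
  apply: cont_itg_param.
  - by move=> x; apply: contW; exact: cap.
  - move=> r _; apply: contM; first by exact: contC.
    exact: cont_powdrop_exp.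
  - move=> x0; exists (M * (F 0 * expR (x0 + 1))) => x r /andP[_ xx] rb.
    have /andP[r0 rb'] := rb; have /andP[d0 d1] := dropI x rb.
    rewrite normrM; apply: ler_pM => //; first exact: hM.
    rewrite powdropE// ger0_norm; last by rewrite mulr_ge0 ?exprn_ge0.
    have r1 : r <= 1 by have /andP[] := rI1' rb.
    apply: (@le_trans _ _ (drop N (s_ x) F r)); first by rewrite ler_piMl// exprn_ile1.
    apply: (le_trans d1); apply: ler_pM; [exact: mulr_ge0|exact: expR_ge0|by rewrite ler_piMr|].
    by rewrite ler_expR ltW.
move=> x; rewrite GdE -itgZ; last exact: contW.
apply: itg_norm_le_within; first exact: bI.
- by rewrite mulr_ge0 ?dom_ge0// mulr_ge0 ?(ltW M0)// le_max F00 orbT.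
- by apply: contW; apply: contM => //; move=> ?; exact: cvg_cst.
- move=> r rb; have /andP[r0 _] := rb; rewrite mulrCA (normrM (a r)) -(mulrA M).
  apply: ler_pM; [exact: normr_ge0|exact: normr_ge0|exact: hM|].
  by rewrite powdropE//; exact: pdom.
Qed.

Let cdw x : {within `[0, b], continuous (drop N (s_ x) F)}.
Proof. exact: (drop_continuous N_gt0 (e0 x) cF b1). Qed.

Let withinM (f1 f2 : R -> R) : {within `[0, b], continuous f1} ->
  {within `[0, b], continuous f2} -> {within `[0, b], continuous (fun r => f1 r * f2 r)}.
Proof. by move=> h1 h2 x; apply: cvgM; [exact: h1|exact: h2]. Qed.

Let withinX (f1 : R -> R) : {within `[0, b], continuous f1} ->
  {within `[0, b], continuous (fun r => f1 r ^+ 2)}.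
Proof. by move=> h; exact: (withinM h h). Qed.

Let within_pow : {within `[0, b], continuous (fun r : R => r ^+ N)}.
Proof. by apply: contW; exact: contX. Qed.

Let Qint x : {within `[0, b], continuous (fun r => r ^+ N * (drop N (s_ x) F r ^+ 2 * dzeta r ^+ 2))}.
Proof.
apply: withinM; first exact: within_pow.
apply: withinM; last by apply: contW; exact: cont_exp.
by apply: withinX; exact: cdw.
Qed.

(** One factor [drop] is estimated through [pdom], which is integrable in the parameter; the other
    is at most F(0) s and cancels the division by s. *)
Lemma integrable_drop_energy :
  mu.-integrable setT (EFin \o (fun x => weight sg x * ((s_ x)^-1 * Q x))).
Proof.
have [D D0 hD] := normF_bounded cdz b.
apply: (integrable_dominated _ (integrableZ (K * (F 0 * D ^+ 2)) (integrable_dom sg01))).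
  apply: (@contM _ _ (weight sg)); first exact: cont_weight.
  apply: (@contM _ _ (fun x => (s_ x)^-1)).
    by apply: contV; [move=> x; rewrite gt_eqF|exact: continuous_expR].
  apply: cont_itg_param; first exact: Qint.
  - move=> r rb; apply: (@contM _ _ (fun=> r ^+ N)); first by exact: contC.
    apply: (@contM _ _ (fun x => drop N (s_ x) F r ^+ 2)); last by exact: contC.
    apply: (@cont_exp _ _ (fun x => drop N (s_ x) F r)).
    have /andP[r0 _] := rb; have [->|rn0] := eqVneq r 0.
      by under eq_fun do rewrite drop0; move=> ?; exact: cvg_cst.
    by apply: cont_drop_exp => //; rewrite lt_def rn0.
  - move=> x0; exists (1 * ((F 0 * expR (x0 + 1)) ^+ 2 * D ^+ 2)) => x r /andP[_ xx] rb.
    have /andP[r0 rb'] := rb; have /andP[d0 d1] := dropI x rb.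
    have r1 : r <= 1 by have /andP[] := rI1' rb.
    rewrite (normrM (r ^+ N)) (normrM (drop _ _ _ _ ^+ 2)) !normrX; apply: ler_pM => //; first by rewrite exprn_ile1// ger0_norm.
    apply: ler_pM => //; rewrite ?exprn_ge0//; last by apply: lerXn2r; rewrite ?nnegrE ?hD// ltW.
    apply: lerXn2r; rewrite ?nnegrE//; first by rewrite mulr_ge0 ?expR_ge0.
    rewrite ger0_norm//; apply: (le_trans d1); apply: ler_pM; [exact: mulr_ge0|exact: expR_ge0|by rewrite ler_piMr|].
    by rewrite ler_expR ltW.
move=> x; rewrite mulrA -itgZ; last exact: Qint.
apply: itg_norm_le_within; first exact: bI.
- by rewrite mulr_ge0 ?dom_ge0// mulr_ge0 ?le_max ?F00 ?orbT// mulr_ge0// exprn_ge0// ltW.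
- by apply: withinM; [apply: contW => ?; exact: cvg_cst|exact: Qint].
- move=> r rb; have /andP[r0 rb'] := rb; have /andP[d0 d1] := dropI x rb.
  have r1 : r <= 1 by have /andP[] := rI1' rb.
  have -> : weight sg x / s_ x * (r ^+ N * (drop N (s_ x) F r ^+ 2 * dzeta r ^+ 2)) =
      (weight sg x * (r ^+ N * drop N (s_ x) F r)) * (drop N (s_ x) F r / s_ x * dzeta r ^+ 2).
    by move: (weight _ _) (drop _ _ _ _) (s_ x)^-1 (dzeta r) (r ^+ N) => *; ring.
  rewrite normrM [K * _ * _]mulrAC; apply: ler_pM; [exact: normr_ge0|exact: normr_ge0|exact: pdom|].
  rewrite normrM; apply: ler_pM; [exact: normr_ge0|exact: normr_ge0| |].
    rewrite ger0_norm; last by rewrite divr_ge0 ?expR_ge0.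
    rewrite ler_pdivrMr ?e0//; apply: (le_trans d1); apply: ler_wpM2r; first exact: expR_ge0.
    by rewrite ler_piMr.
  by rewrite normrX; apply: lerXn2r; rewrite ?nnegrE ?hD// ltW.
Qed.

Let Bint x : {within `[0, b], continuous (fun r => r ^+ N * (dropr N (s_ x) F r ^+ 2 * zeta r ^+ 2))}.
Proof.
apply: withinM; first exact: within_pow.
apply: withinM; last by apply: contW; exact: cont_exp.
by apply: withinX; exact: (dropr_continuous N_gt0 (e0 x) cF b1).
Qed.

Let droprI x r : 0 <= r <= b -> `|dropr N (s_ x) F r| <= F 0 * s_ x.
Proof.
move=> rb; have /andP[r0 rb'] := rb; have /andP[d0 d1] := dropI x rb.
have s0 : 0 < s_ x := e0 x.
rewrite /dropr; case: ifPn => [_|rn0]; last first.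
  have {}r0 : 0 < r by rewrite lt_def rn0.
  rewrite ger0_norm; last by rewrite divr_ge0// ltW.
  by rewrite ler_pdivrMr// mulrAC.
have V0 := resolvent_ge0 N s0 F_ge0 0.
have VF : resolvent N (s_ x) F 0 <= F 0.
  by apply: (resolvent_le N_gt0 s0 cF F_ge0) => p /andP[p0 p1]; apply: F_ni.
have h0 : 0 <= s_ x * (F 0 - resolvent N (s_ x) F 0).
  by apply: mulr_ge0; [exact: ltW|rewrite subr_ge0].
rewrite ger0_norm; last exact: divr_ge0.
apply: (@le_trans _ _ (s_ x * (F 0 - resolvent N (s_ x) F 0))).
  rewrite ler_pdivrMr// ler_peMr// ler1n//.
by rewrite mulrC; apply: ler_wpM2r; [exact: ltW|rewrite lerBlDr lerDl].
Qed.

Let cB : continuous B.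
Proof.
have [D D0 hD] := normF_bounded cz b.
apply: cont_itg_param; first exact: Bint.
- move=> r rb; apply: (@contM _ _ (fun=> r ^+ N)); first by exact: contC.
  apply: (@contM _ _ (fun x => dropr N (s_ x) F r ^+ 2)); last by exact: contC.
  apply: (@cont_exp _ _ (fun x => dropr N (s_ x) F r)).
  by apply: cont_dropr_exp => //; have /andP[] := rb.
- move=> x0; exists (1 * ((F 0 * expR (x0 + 1)) ^+ 2 * D ^+ 2)) => x r /andP[_ xx] rb.
  have /andP[r0 rb'] := rb; have r1 : r <= 1 by have /andP[] := rI1' rb.
  rewrite (normrM (r ^+ N)) (normrM (dropr _ _ _ _ ^+ 2)) !normrX; apply: ler_pM => //; first by rewrite exprn_ile1// ger0_norm.
  apply: ler_pM => //; rewrite ?exprn_ge0//; last by apply: lerXn2r; rewrite ?nnegrE ?hD// ltW.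
  apply: lerXn2r; rewrite ?nnegrE//; first by rewrite mulr_ge0 ?expR_ge0.
  apply: (le_trans (droprI x rb)); apply: ler_wpM2l => //.
  by rewrite ler_expR ltW.
Qed.

Let B_ge0 x : 0 <= B x.
Proof.
apply: itg_ge0 => r /andP[r0 _]; apply: mulr_ge0; first exact: exprn_ge0.
by apply: mulr_ge0; exact: sqr_ge0.
Qed.

(** [test] is integrated against [weight]. By Fubini the integral of Gd is that of r^N dg(U) eta^2,
    so [stable] says that T is at most Gd in the mean. Both leave the inequality, and only the terms
    with [dropr] and with dzeta remain. *)
Lemma weighted_inequality :
  mu.-integrable setT (EFin \o (fun x => weight sg x * ((expR x)^-1 *
    itg 0 b (fun r => r ^+ N * (dropr N (expR x) F r ^+ 2 * zeta r ^+ 2))))) /\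
  N%:R * \int[mu]_x (weight sg x * ((expR x)^-1 *
    itg 0 b (fun r => r ^+ N * (dropr N (expR x) F r ^+ 2 * zeta r ^+ 2)))) <=
  \int[mu]_x (weight sg x * ((expR x)^-1 *
    itg 0 b (fun r => r ^+ N * (drop N (expR x) F r ^+ 2 * dzeta r ^+ 2)))).
Proof.
have [M M0 hM] := normF_bounded cth 1.
have thM r : 0 <= r <= 1 -> th r <= M by move=> r01; rewrite (le_trans (ler_norm _))// hM.
have iT := integrable_pairing N_gt0 sg01 cth cth th_ge0 thM hM.
have iQ := integrable_drop_energy.
have iTG := integrableB measurableT iT iGd.
have iH := integrableD measurableT iTG iQ.
have w0 x : 0 <= weight sg x by exact/ltW/weight_gt0.
have key x : weight sg x * ((s_ x)^-1 * (N%:R * B x)) <=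
    weight sg x * T x - weight sg x * Gd x + weight sg x * ((s_ x)^-1 * Q x).
  rewrite -mulrBr -mulrDr; apply: ler_wpM2l => //.
  have := test x; rewrite [N%:R / _]mulrC -mulrA.
  by move: ((s_ x)^-1 * (N%:R * B x)) ((s_ x)^-1 * Q x) (Gd x) (T x) => *; lra.
have nB x : 0 <= weight sg x * ((s_ x)^-1 * (N%:R * B x)).
  by apply: mulr_ge0 => //; apply: mulr_ge0; [rewrite invr_ge0 expR_ge0|exact: mulr_ge0].
(* The bound [droprI] alone only gives growth like s^(1-sg), so integrability is read off from the
   integrable majorant in [key]. *)
have iB : mu.-integrable setT (EFin \o (fun x => weight sg x * ((s_ x)^-1 * (N%:R * B x)))).
  apply: (integrable_dominated _ iH).
    apply: (@contM _ _ (weight sg)); first exact: cont_weight.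
    apply: (@contM _ _ (fun x => (s_ x)^-1)).
      by apply: contV; [move=> x; rewrite gt_eqF|exact: continuous_expR].
    by apply: (@contM _ _ (fun=> N%:R) B); [move=> ?; exact: cvg_cst|exact: cB].
  by move=> x; rewrite (ger0_norm (nB x)); exact: key.
have iB' : mu.-integrable setT (EFin \o (fun x => weight sg x * ((expR x)^-1 * B x))).
  have Nn0 : N%:R != 0 :> R by rewrite pnatr_eq0 -lt0n.
  rewrite (_ : (fun x => weight sg x * ((expR x)^-1 * B x)) =
     (fun x => N%:R^-1 * (weight sg x * ((s_ x)^-1 * (N%:R * B x))))); last first.
    apply/funext => x; rewrite /s_; move: (weight _ _) (expR x)^-1 (B x) => u v w.
    by field.
  exact: integrableZ.
split; first exact: iB'.
have h := le_Rintegral measurableT iB iH (fun x _ => key x).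
rewrite (RintegralD measurableT iTG iQ) (RintegralB measurableT iT iGd) in h.
have st : \int[mu]_x (weight sg x * T x) <= \int[mu]_x (weight sg x * Gd x).
  apply: (le_trans (stable ceta eta_ge0 eta0)).
  rewrite /Gd -(swap_frac_drop N_gt0 sg01 cF F_ge0 F_ni A_ge0 F_lip b01 ca).
  rewrite (@itg_split _ 0 b 1); [|exact: ltW|exact: ltW|].
    rewrite [X in _ + X](_ : _ = 0) ?addr0.
      apply: eq_leW; apply: eq_itg => r rb.
      by rewrite /a /G /eta (clampE rb); move: (y r) (zeta r) (dg _) (r ^+ N) => *; ring.
    rewrite (@eq_itg _ b 1 _ (fun=> 0)).
      by rewrite (itg_cst _ (ltW b1)) mul0r.
    by move=> r rb; rewrite eta0// expr2 !mulr0.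
  apply: (@contM _ _ (fun r : R => r ^+ N)); first exact: contX.
  by apply: contM; [exact: cdU|exact: cont_exp].
have -> : N%:R * \int[mu]_x (weight sg x * ((expR x)^-1 * B x)) =
    \int[mu]_x (weight sg x * ((s_ x)^-1 * (N%:R * B x))).
  rewrite -(RintegralZl _ measurableT iB'); apply: eq_Rintegral => x _.
  by rewrite !(mulrCA N%:R).
apply: (le_trans h); rewrite -[leRHS]add0r lerD2r subr_le0; exact: st.
Qed.

End weighted_inequality.

(** * Bounds depending on the mass of F only *)

Section uniform_bounds.
Variables (R : realType) (N : nat).
Hypothesis N_gt0 : (0 < N)%N.
Variable sg : R.
Hypothesis sg01 : 0 < sg < 1.
Local Notation mu := (@lebesgue_measure R).
Let e0 (x : R) : 0 < expR x := expR_gt0 x.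

Definition dropr_energy (F zeta : R -> R) x := weight sg x * ((expR x)^-1 *
  itg 0 2^-1 (fun r => r ^+ N * (dropr N (expR x) F r ^+ 2 * zeta r ^+ 2))).

Definition drop_energy (F dzeta : R -> R) x := weight sg x * ((expR x)^-1 *
  itg 0 2^-1 (fun r => r ^+ N * (drop N (expR x) F r ^+ 2 * dzeta r ^+ 2))).

(** The conclusion of [weighted_inequality] at b = 1/2, turned into a property of F alone so that
    later constants are uniform over all F having it. *)
Definition weighted (F : R -> R) := forall zeta dzeta : R -> R,
  continuous zeta -> continuous dzeta -> (forall r : R, is_derive r 1 zeta (dzeta r)) ->
  zeta 2^-1 = 0 -> (forall r, 0 <= r <= 2^-1 -> 0 <= zeta r) ->
  [/\ mu.-integrable setT (EFin \o dropr_energy F zeta),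
      mu.-integrable setT (EFin \o drop_energy F dzeta) &
      N%:R * \int[mu]_x dropr_energy F zeta x <= \int[mu]_x drop_energy F dzeta x].

Definition half_mass (F : R -> R) := itg 0 2^-1 (fun p => p ^+ N * F p).

Section oneF.
Variable F : R -> R.
Hypothesis cF : continuous F.
Hypothesis F_ge0 : forall p, 0 <= p <= 1 -> 0 <= F p.
Hypothesis F_ni : forall p q, 0 <= p -> p <= q -> q <= 1 -> F q <= F p.

Let cpF : continuous (fun p : R => p ^+ N * F p).
Proof. by apply: (@contM _ _ (fun p : R => p ^+ N) F); [exact: contX|exact: cF]. Qed.

Let pF_ge0 p : 0 <= p <= 1 -> 0 <= p ^+ N * F p.
Proof. by move=> p01; apply: mulr_ge0; [apply: exprn_ge0; case/andP: p01|exact: F_ge0]. Qed.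

Let FM := F_bounded cF.

Lemma half_mass_ge0 : 0 <= half_mass F.
Proof. by apply: itg_ge0 => p /andP[p0 p1]; apply: pF_ge0; rewrite p0; lra. Qed.

Lemma part_mass_le r : 0 <= r <= 2^-1 -> itg 0 r (fun p => p ^+ N * F p) <= half_mass F.
Proof.
move=> /andP[r0 r1]; rewrite /half_mass (itg_split r0 r1 cpF) lerDl.
by apply: itg_ge0 => p /andP[p0 p1]; apply: pF_ge0; apply/andP; split; lra.
Qed.

(** [resolvent_lower] is integrated over s in [e^(-1), 1], where [weight] is at least 1. A bound on
    U(1/2) becomes a bound on the mass of F. *)
Lemma half_mass_le : half_mass F <= 2 * J0 N 1 ^+ 2 * expR 1 * frac_inv N sg F 2^-1.
Proof.
have [M hM] := FM; have m0 := half_mass_ge0.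
have J1 : 0 < J0 N 1 :> R by exact: (lt_le_trans ltr01 (@J0_ge1 _ N 1 ler01)).
have iV := integrable_resolvent N_gt0 sg01 cF F_ge0 hM 2^-1.
have V0 x := resolvent_ge0 N (e0 x) F_ge0 2^-1.
pose c := expR (- 1) / (2 * J0 N 1 ^+ 2) * half_mass F.
have h : c <= frac_inv N sg F 2^-1.
  apply: (@le_trans _ _ (itg (- 1) 0 (fun x => weight sg x * resolvent N (expR x) F 2^-1))).
    have -> : c = itg (- 1) 0 (fun=> c) by rewrite itg_cst ?sub0r ?opprK ?mulr1//; lra.
    apply: itg_le.
    - by apply: contW => ?; exact: cvg_cst.
    - apply: contW.
      apply: (@contM _ _ (weight sg) (fun x => resolvent N (expR x) F 2^-1)).
        exact: cont_weight.
      exact: cont_resolvent_exp.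
    move=> x /andP[x1 x2].
    have s1 : expR x <= 1 by rewrite -expR0 ler_expR.
    have w1 : 1 <= weight sg x.
      rewrite /weight -expR0 ler_expR mulNr oppr_ge0; have /andP[? ?] := sg01.
      by apply: mulr_ge0_le0 => //; exact: ltW.
    have low := resolvent_lower N_gt0 (e0 x) cF F_ge0 s1.
    apply: (@le_trans _ _ (resolvent N (expR x) F 2^-1)); last by rewrite ler_peMl.
    apply: le_trans low; apply: ler_wpM2r => //; apply: ler_wpM2r.
      by rewrite invr_ge0 mulr_ge0// sqr_ge0.
    by rewrite ler_expR.
  apply: itg_le_Rintegral => // x; apply: mulr_ge0; [exact/ltW/weight_gt0|exact: V0].
have -> : half_mass F = 2 * J0 N 1 ^+ 2 * expR 1 * c.
  rewrite /c expRN; have E1 := e0 1; move: (expR 1) (J0 N 1) (half_mass F) E1 J1 => E J H E1 J1.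
  by field; rewrite !gt_eqF.
by apply: ler_wpM2l => //; rewrite mulr_ge0 ?expR_ge0// mulr_ge0// sqr_ge0.
Qed.

Lemma le_half_mass r : 0 < r <= 2^-1 -> F r <= N.+1%:R * (r ^+ N.+1)^-1 * half_mass F.
Proof.
move=> /andP[r0 r1]; have rI : 0 <= r <= 2^-1 by rewrite ltW.
apply: (@le_trans _ _ (N.+1%:R * (r ^+ N.+1)^-1 * itg 0 r (fun p => p ^+ N * F p))); last first.
  apply: ler_wpM2l; last exact: part_mass_le.
  by rewrite mulr_ge0// invr_ge0 exprn_ge0// ltW.
have h : F r * (r ^+ N.+1 / N.+1%:R) <= itg 0 r (fun p => p ^+ N * F p).
  rewrite -(itg_pow N (ltW r0)) -itgZ; last by apply: contW; exact: contX.
  apply: itg_le; try apply: contW.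
  - by apply: contM; [move=> ?; exact: cvg_cst|exact: contX].
  - exact: cpF.
  move=> p /andP[p0 pr]; rewrite mulrC; apply: ler_wpM2l; first exact: exprn_ge0.
  by apply: F_ni => //; lra.
have rN : 0 < r ^+ N.+1 by exact: exprn_gt0.
move: h; move: (itg _ _ _) (r ^+ N.+1) rN => z w w0; rewrite mulrA ler_pdivrMr// => h.
by rewrite mulrAC ler_pdivlMr// mulrC [leRHS]mulrC mulrC.
Qed.

Lemma drop_le_mass x r : 0 < r <= 2^-1 ->
  drop N (expR x) F r <= expR x * ((r ^+ N)^-1 * half_mass F).
Proof.
move=> /andP[r0 r1]; have r01 : r <= 1 by lra.
have rN : 0 < r ^+ N by exact: exprn_gt0.
have Ip := rI_gt0 N (e0 x) r.
apply: (@le_trans _ _ (expR x * wint N (expR x) F r / (r ^+ N * rI N (expR x) r))).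
  rewrite /drop lerBlDr lerDl; apply: mulr_ge0; first by apply: rI1_ge0 => //; exact: ltW.
  exact: tail_ge0.
rewrite -mulrA; apply: ler_wpM2l; first exact: expR_ge0.
rewrite ler_pdivrMr; last exact: mulr_gt0.
apply: (le_trans (wint_le_mass N (e0 x) cF F_ge0 (ltW r0) r01)).
rewrite mulrC mulrA [_ * _ * (r ^+ N)]mulrAC mulVf ?gt_eqF// mul1r.
apply: ler_wpM2r; first exact: ltW.
by apply: part_mass_le; rewrite ltW.
Qed.

Lemma itg_drop x a : 0 < a <= 2^-1 ->
  itg a 2^-1 (drop N (expR x) F) = resolvent N (expR x) F a - resolvent N (expR x) F 2^-1.
Proof.
move=> /andP[a0 a1].
have cd : {within `[a, 2^-1], continuous (drop N (expR x) F)}.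
  apply: continuous_in_subspaceT => r; rewrite inE/= in_itv/= => /andP[ar r1].
  apply: derive_cont (is_derive_drop N_gt0 (e0 x) cF _).
  by apply/andP; split; lra.
have -> : resolvent N (expR x) F a - resolvent N (expR x) F 2^-1 =
    - resolvent N (expR x) F 2^-1 - - resolvent N (expR x) F a by rewrite opprK addrC.
apply: (@itg_FTC _ a 2^-1 _ (fun r => - resolvent N (expR x) F r) a1 cd).
- by apply: contW; apply: contN; exact: cont_resolvent.
- move=> r /andP[ar r1]; rewrite -[drop _ _ _ _]opprK; apply: is_derive1N.
  by apply: is_derive_resolvent => //; apply/andP; split; lra.
Qed.

Lemma resolvent_le_mass x r : 0 < r <= 2^-1 ->
  resolvent N (expR x) F r <=
  resolvent N (expR x) F 2^-1 + expR x * ((r ^+ N)^-1 * half_mass F).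
Proof.
move=> rI; have /andP[r0 r1] := rI.
rewrite -lerBlDl -itg_drop//.
have rN : 0 < r ^+ N by exact: exprn_gt0.
have c0 : 0 <= expR x * ((r ^+ N)^-1 * half_mass F).
  by rewrite mulr_ge0 ?expR_ge0// mulr_ge0 ?half_mass_ge0// invr_ge0 ltW.
apply: (@le_trans _ _ (itg r 2^-1 (fun=> expR x * ((r ^+ N)^-1 * half_mass F)))); last first.
  by rewrite itg_cst// ler_piMr//; lra.
apply: itg_le.
- apply: continuous_in_subspaceT => t; rewrite inE/= in_itv/= => /andP[ar t1].
  apply: derive_cont (is_derive_drop N_gt0 (e0 x) cF _).
  by apply/andP; split; lra.
- by apply: contW => ?; exact: cvg_cst.
- move=> t /andP[rt t1]; have t0 : 0 < t by lra.
  apply: (le_trans (drop_le_mass x _)); first by rewrite t0.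
  apply: ler_wpM2l; first exact: expR_ge0.
  apply: ler_wpM2r; first exact: half_mass_ge0.
  rewrite lef_pV2 ?posrE ?exprn_gt0//.
  by apply: lerXn2r => //; rewrite nnegrE; exact: ltW.
Qed.

(** For s >= 1 [resolvent_split] is uniform in s; for s < 1 the difference of the resolvents at r
    and 1/2 is an integral of [drop], which carries a factor s. Together they produce the integrable
    majorant [dom]. *)
Lemma frac_inv_le_mass r : 0 < r <= 2^-1 ->
  frac_inv N sg F r <= frac_inv N sg F 2^-1 +
    (F (r / 2) + ((2 / r) ^+ N.+1 + (r ^+ N)^-1) * half_mass F) * mass sg.
Proof.
move=> rI; have /andP[r0 r1] := rI; have [M hM] := FM; have m0 := half_mass_ge0.
have rN : 0 < r ^+ N by exact: exprn_gt0.
set C := F (r / 2) + _.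
have F2 : 0 <= F (r / 2) by apply: F_ge0; apply/andP; split; lra.
have q0 : 0 <= (2 / r) ^+ N.+1 by rewrite exprn_ge0// divr_ge0// ltW.
have iN : 0 <= (r ^+ N)^-1 by rewrite invr_ge0 ltW.
have C0 : 0 <= C by rewrite addr_ge0// mulr_ge0// addr_ge0.
have i1 := integrable_resolvent N_gt0 sg01 cF F_ge0 hM r.
have i2 := integrable_resolvent N_gt0 sg01 cF F_ge0 hM 2^-1.
have iD := integrable_dom sg01.
have i3 := integrableD measurableT i2 (integrableZ C iD).
have key x : weight sg x * resolvent N (expR x) F r <=
    weight sg x * resolvent N (expR x) F 2^-1 + C * dom sg x.
  rewrite /dom [C * _]mulrCA -mulrDr; apply: ler_wpM2l; first exact/ltW/weight_gt0.
  have V0 := resolvent_ge0 N (e0 x) F_ge0 2^-1.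
  have [h|h] := leP 1 (expR x).
    rewrite mulr1; apply: ler_wpDl => //.
    apply: (le_trans (resolvent_split N_gt0 (e0 x) cF F_ge0 r0 _ F_ni)); first by lra.
    apply: (@le_trans _ _ (F (r / 2) + (2 / r) ^+ N.+1 * half_mass F)).
      by rewrite lerD2l; apply: ler_wpM2l => //; apply: part_mass_le; apply/andP; split; lra.
    by rewrite /C lerD2l; apply: ler_wpM2r => //; rewrite lerDl.
  apply: (le_trans (resolvent_le_mass x rI)); rewrite lerD2l mulrC.
  apply: ler_wpM2r; first exact: expR_ge0.
  by rewrite /C mulrDl; apply: ler_wpDl => //; rewrite lerDr mulr_ge0.
rewrite /frac_inv; apply: (le_trans (le_Rintegral measurableT i1 i3 (fun x _ => key x))).
by rewrite (RintegralD measurableT i2 (integrableZ C iD)) (RintegralZl _ measurableT iD).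
Qed.

End oneF.

End uniform_bounds.

(** * Regularised power test functions *)

Section cutoff.
Variable R : realType.
Variables beta e : R.
Implicit Types r : R.

(** A substitute for r^(-beta), for which r^2 zeta'^2 is the constant multiple beta^2 of zeta^2.
    Adding e removes the singularity at 0, and the factor 1/4 - r^2 produces the zero at 1/2. *)
Definition cut r := (r ^+ 2 + e) `^ (- (beta / 2)) * (4^-1 - r ^+ 2).
Definition dcut r := (- (beta / 2)) * (r ^+ 2 + e) `^ (- (beta / 2) - 1) * (2 * r) * (4^-1 - r ^+ 2) +
  (r ^+ 2 + e) `^ (- (beta / 2)) * (- (2 * r)).

Lemma cut_half : cut 2^-1 = 0.
Proof. by rewrite /cut (_ : 4^-1 - 2^-1 ^+ 2 = 0) ?mulr0//; field. Qed.

Lemma cut_ge0 r : 0 <= r <= 2^-1 -> 0 <= cut r.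
Proof.
by move=> /andP[r0 r1]; apply: mulr_ge0; [exact: powR_ge0|nra].
Qed.

Hypothesis e_gt0 : 0 < e.

Let pos r : 0 < r ^+ 2 + e. Proof. by apply: ltr_wpDl => //; exact: sqr_ge0. Qed.

Let dsq r : is_derive r (1 : R) (fun r => r ^+ 2 + e) (2 * r).
Proof.
by have := is_derive1D (is_derive1X r 2) (is_derive_cst e r 1); rewrite expr1 addr0.
Qed.

Let dpow a r : is_derive r (1 : R) (fun r => (r ^+ 2 + e) `^ a) (a * (r ^+ 2 + e) `^ (a - 1) * (2 * r)).
Proof.
exact: (is_derive1_compE (f := fun y => y `^ a) (g := fun r => r ^+ 2 + e) (is_derive1_powR a (pos r)) (dsq r)).
Qed.

Lemma is_derive_cut r : is_derive r (1 : R) cut (dcut r).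
Proof.
have d4 : is_derive r (1 : R) (fun r => 4^-1 - r ^+ 2) (- (2 * r)).
  by have := is_derive1D (is_derive_cst (4^-1 : R) r 1) (is_derive1N (is_derive1X r 2)); rewrite expr1 add0r.
exact: (is_derive1M (dpow (- (beta / 2)) r) d4).
Qed.

Lemma cont_cut : continuous cut.
Proof. by move=> r; exact: derive_cont (is_derive_cut r). Qed.

Let cpow a : continuous (fun r => (r ^+ 2 + e) `^ a).
Proof. by move=> r; exact: derive_cont (dpow a r). Qed.

Lemma cont_dcut : continuous dcut.
Proof.
have cid : continuous (fun r : R => r) by move=> ?; exact: cvg_id.
have ccst c : continuous (fun _ : R => c : R) by exact: contC.
have c2 : continuous (fun r : R => 2 * r) by exact: contM.
apply: contD.
  apply: contM; last by apply: contB => //; exact: cont_exp.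
  by apply: contM => //; apply: contM => //; exact: cpow.
by apply: contM; [exact: cpow|exact: contN].
Qed.

Hypothesis beta_ge0 : 0 <= beta.

Lemma dcut_sqr_le r : 0 <= r <= 2^-1 ->
  (r * dcut r) ^+ 2 <= ((r ^+ 2 + e) `^ (- (beta / 2)) * (beta * (4^-1 - r ^+ 2) + 2 * r ^+ 2)) ^+ 2.
Proof.
move=> /andP[r0 r1]; have p0 := pos r.
have P0 : 0 <= (r ^+ 2 + e) `^ (- (beta / 2)) by exact: powR_ge0.
have -> : (r * dcut r) ^+ 2 = ((r ^+ 2 + e) `^ (- (beta / 2)) *
    (beta * (r ^+ 2 / (r ^+ 2 + e)) * (4^-1 - r ^+ 2) + 2 * r ^+ 2)) ^+ 2.
  rewrite /dcut powRD; last by apply/implyP => _; rewrite gt_eqF.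
  rewrite powR_inv1 ?ltW// -[RHS]sqrrN; congr (_ ^+ 2).
  by move: (_ `^ _) ((r ^+ 2 + e)^-1) => P Q; field.
have q1 : r ^+ 2 / (r ^+ 2 + e) <= 1 by rewrite ler_pdivrMr// mul1r lerDl ltW.
have q0 : 0 <= r ^+ 2 / (r ^+ 2 + e) by rewrite divr_ge0 ?sqr_ge0 ?ltW.
have d0 : 0 <= 4^-1 - r ^+ 2 by nra.
have a0 : 0 <= beta * (r ^+ 2 / (r ^+ 2 + e)) * (4^-1 - r ^+ 2) + 2 * r ^+ 2.
  by rewrite addr_ge0// mulr_ge0 ?sqr_ge0// mulr_ge0.
apply: lerXn2r; rewrite ?nnegrE.
- exact: mulr_ge0.
- by apply: mulr_ge0 => //; rewrite addr_ge0// mulr_ge0 ?sqr_ge0.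
- apply: ler_wpM2l => //; rewrite lerD2r; apply: ler_wpM2r => //.
  by rewrite ler_piMr.
Qed.

(** The derivative of the factor 1/4 - r^2 contributes 2 r^2, and the condition on r2 lets the
    margin b' - beta absorb it, whatever e is. *)
Lemma dcut_near b' r2 r : 0 <= r <= r2 -> r2 <= 2^-1 -> beta <= b' ->
  2 * r2 ^+ 2 <= (b' - beta) * (4^-1 - r2 ^+ 2) ->
  (r * dcut r) ^+ 2 <= b' ^+ 2 * cut r ^+ 2.
Proof.
move=> /andP[r0 rr2] r21 bb h.
have rI : 0 <= r <= 2^-1 by rewrite r0 (le_trans rr2).
apply: (le_trans (dcut_sqr_le rI)).
rewrite /cut -exprMn [b' * _]mulrCA.
have P0 : 0 <= (r ^+ 2 + e) `^ (- (beta / 2)) by exact: powR_ge0.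
have d0 : 0 <= 4^-1 - r ^+ 2 by nra.
have hr : 2 * r ^+ 2 <= (b' - beta) * (4^-1 - r ^+ 2).
  have rr : r ^+ 2 <= r2 ^+ 2 by apply: lerXn2r; rewrite ?nnegrE//; lra.
  apply: (@le_trans _ _ (2 * r2 ^+ 2)); first by rewrite ler_pM2l.
  apply: (le_trans h); apply: ler_wpM2l; first by rewrite subr_ge0.
  by lra.
apply: lerXn2r; rewrite ?nnegrE.
- by apply: mulr_ge0 => //; rewrite addr_ge0// mulr_ge0 ?sqr_ge0.
- by apply: mulr_ge0 => //; apply: mulr_ge0 => //; exact: le_trans bb.
- by apply: ler_wpM2l => //; move: hr; rewrite mulrBl; lra.
Qed.

Lemma dcut_far r2 r : 0 < r2 -> r2 <= r <= 2^-1 ->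
  (r * dcut r) ^+ 2 <= ((r2 ^+ 2) `^ (- (beta / 2)) * (beta + 2)) ^+ 2.
Proof.
move=> r20 /andP[rr2 r1]; have r0 : 0 < r by exact: lt_le_trans rr2.
have rI : 0 <= r <= 2^-1 by rewrite ltW.
apply: (le_trans (dcut_sqr_le rI)).
have P0 : 0 <= (r ^+ 2 + e) `^ (- (beta / 2)) by exact: powR_ge0.
have d0 : 0 <= 4^-1 - r ^+ 2 by nra.
have b0 : 0 <= beta * (4^-1 - r ^+ 2) by exact: mulr_ge0.
have r22 : 0 < r2 ^+ 2 by exact: exprn_gt0.
apply: lerXn2r; rewrite ?nnegrE.
- by apply: mulr_ge0 => //; rewrite addr_ge0// mulr_ge0 ?sqr_ge0.
- by apply: mulr_ge0; [exact: powR_ge0|rewrite addr_ge0].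
apply: ler_pM => //; first by rewrite addr_ge0// mulr_ge0 ?sqr_ge0.
- rewrite !powRN lef_pV2 ?posrE ?powR_gt0 ?pos//.
  apply: ge0_ler_powR; rewrite ?nnegrE.
  - by rewrite divr_ge0.
  - exact: ltW.
  - exact/ltW/pos.
  apply: (@le_trans _ _ (r ^+ 2)); last by rewrite lerDl ltW.
  by apply: lerXn2r => //; rewrite nnegrE; exact: ltW.
- apply: lerD; last by nra.
  rewrite ler_piMr//; have := sqr_ge0 r; lra.
Qed.

End cutoff.

(** * From the energy bound to dyadic decrements of F *)

Section power_bound.
Variables (R : realType) (N : nat).
Hypothesis N_gt0 : (0 < N)%N.
Variable sg : R.
Hypothesis sg01 : 0 < sg < 1.
Local Notation mu := (@lebesgue_measure R).
Let e0 (x : R) : 0 < expR x := expR_gt0 x.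

Lemma itg_split_within a b c (f : R -> R) : 0 <= a -> a <= b -> b <= c ->
  {within `[0, c], continuous f} -> itg a c f = itg a b f + itg b c f.
Proof.
move=> a0 ab bc cf; have c0 : 0 <= c by lra.
have := itg_split ab bc (cont_comp_clamp c0 cf).
have E u v : 0 <= u -> v <= c -> itg u v (fun r => f (clamp c r)) = itg u v f.
  by move=> u0 vc; apply: eq_itg => r /andP[ur rv]; rewrite clampE//; apply/andP; split; lra.
by rewrite !E//; lra.
Qed.

Definition admissible (F : R -> R) := [/\ continuous F,
  forall p, 0 <= p <= 1 -> 0 <= F p,
  forall p q, 0 <= p -> p <= q -> q <= 1 -> F q <= F p & weighted N sg F].

Section energy.
Variable F : R -> R.
Hypothesis aF : admissible F.
Variables beta b' r2 e : R.
Hypothesis beta_ge0 : 0 <= beta.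
Hypothesis bb : beta <= b'.
Hypothesis e_gt0 : 0 < e.
Hypothesis r2I : 0 < r2 <= 2^-1.
Hypothesis r2_small : 2 * r2 ^+ 2 <= (b' - beta) * (4^-1 - r2 ^+ 2).

Let C := ((r2 ^+ 2) `^ (- (beta / 2)) * (beta + 2)) ^+ 2 / r2 ^+ 2 / r2 ^+ N.

Let h2 : (2^-1 : R) < 1. Proof. by lra. Qed.

Let wc (f1 f2 : R -> R) : {within `[0, 2^-1], continuous f1} ->
  {within `[0, 2^-1], continuous f2} -> {within `[0, 2^-1], continuous (fun r => f1 r * f2 r)}.
Proof. by move=> k1 k2 x; apply: cvgM; [exact: k1|exact: k2]. Qed.

Let wX (f1 : R -> R) : {within `[0, 2^-1], continuous f1} ->
  {within `[0, 2^-1], continuous (fun r => f1 r ^+ 2)}.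
Proof. by move=> h; exact: (wc h h). Qed.

Let wN : {within `[0, 2^-1], continuous (fun r : R => r ^+ N)}.
Proof. by apply: contW; exact: contX. Qed.

Let wS (f : R -> R) a : 0 <= a -> {within `[0, 2^-1], continuous f} -> {within `[a, 2^-1], continuous f}.
Proof.
move=> a0; apply: continuous_subspaceW => r /=; rewrite !in_itv/= => /andP[ar ->].
by rewrite (le_trans a0).
Qed.

Let wS' (f : R -> R) b : b <= 2^-1 -> {within `[0, 2^-1], continuous f} -> {within `[0, b], continuous f}.
Proof.
move=> b2; apply: continuous_subspaceW => r /=; rewrite !in_itv/= => /andP[-> rb].
by rewrite (le_trans rb).
Qed.

(** Below r2, [drop] is r [dropr] and [dcut_near] applies. Beyond r2, one factor [drop] is at most s
    r2^(-N) times the mass and the other integrates to at most the resolvent at r2; the factor s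
    cancels the division by s. *)
Let drop_energy_le x : drop_energy N sg F (dcut beta e) x <=
  b' ^+ 2 * dropr_energy N sg F (cut beta e) x +
  C * half_mass N F * (weight sg x * resolvent N (expR x) F r2).
Proof.
have [cF F_ge0 F_ni _] := aF; have /andP[r20 r21] := r2I.
have m0 := half_mass_ge0 N F_ge0.
have cd := drop_continuous N_gt0 (e0 x) cF h2.
have ck := dropr_continuous N_gt0 (e0 x) cF h2.
have cdc := @cont_dcut R beta e e_gt0; have cc := @cont_cut R beta e e_gt0.
pose Qi r := r ^+ N * (drop N (expR x) F r ^+ 2 * dcut beta e r ^+ 2).
pose Bi r := r ^+ N * (dropr N (expR x) F r ^+ 2 * cut beta e r ^+ 2).
have cQ : {within `[0, 2^-1], continuous Qi}.
  apply: wc; first exact: wN.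
  by apply: wc; apply: wX => //; apply: contW; exact: cdc.
have cB : {within `[0, 2^-1], continuous Bi}.
  apply: wc; first exact: wN.
  by apply: wc; apply: wX => //; apply: contW; exact: cc.
have cbB : {within `[0, 2^-1], continuous (fun r => b' ^+ 2 * Bi r)}.
  by apply: wc => //; apply: contW => ?; exact: cvg_cst.
have Bi0 r : 0 <= r -> 0 <= Bi r.
  by move=> r0; rewrite mulr_ge0 ?exprn_ge0// mulr_ge0// sqr_ge0.
have QiE r : Qi r = r ^+ N * (dropr N (expR x) F r ^+ 2 * (r * dcut beta e r) ^+ 2).
  by rewrite /Qi dropE; move: (dropr _ _ _ _) (dcut _ _ _) (r ^+ N) => *; ring.
have near : itg 0 r2 Qi <= b' ^+ 2 * itg 0 2^-1 Bi.
  rewrite -itgZ// (itg_split_within (lexx 0) (ltW r20) r21 cbB) -[leLHS]addr0; apply: lerD; last first.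
    by apply: itg_ge0 => r /andP[rr2 _]; rewrite mulr_ge0 ?sqr_ge0// Bi0//; lra.
  apply: itg_le; [exact: wS'|exact: wS'|move=> r rI; have /andP[r0 _] := rI].
  rewrite QiE /Bi [leRHS]mulrCA; apply: ler_wpM2l; first exact: exprn_ge0.
  rewrite [leRHS]mulrCA; apply: ler_wpM2l; first exact: sqr_ge0.
  by apply: (dcut_near _ _ rI r21 bb r2_small).
pose c := C * half_mass N F * expR x.
have C0 : 0 <= C by rewrite !divr_ge0 ?sqr_ge0 ?exprn_ge0// ltW.
have c0 : 0 <= c by rewrite mulr_ge0 ?expR_ge0// mulr_ge0.
have far : itg r2 2^-1 Qi <= c * resolvent N (expR x) F r2.
  apply: (@le_trans _ _ (c * itg r2 2^-1 (drop N (expR x) F))); last first.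
    apply: ler_wpM2l => //; rewrite (itg_drop N_gt0 cF x r2I) lerBlDr lerDl.
    exact: resolvent_ge0.
  rewrite -itgZ; last by apply: wS => //; exact: ltW.
  apply: itg_le; first by apply: wS => //; exact: ltW.
    apply: wS; first exact: ltW.
    by apply: wc => //; apply: contW => ?; exact: cvg_cst.
  move=> r rI; have /andP[r2r r1] := rI; have r0 : 0 < r by lra.
  have d0 : 0 <= drop N (expR x) F r by apply: (drop_F_ge0 N_gt0 cF F_ge0 F_ni); apply/andP; split; lra.
  have d1 : drop N (expR x) F r <= expR x * ((r2 ^+ N)^-1 * half_mass N F).
    apply: (le_trans (drop_le_mass N cF F_ge0 x _)); first by rewrite r0.
    apply: ler_wpM2l; first exact: expR_ge0.
    apply: ler_wpM2r => //; rewrite lef_pV2 ?posrE ?exprn_gt0//.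
    by apply: lerXn2r => //; rewrite nnegrE; exact: ltW.
  have k1 := dcut_far e_gt0 beta_ge0 r20 rI.
  have rn1 : r ^+ N <= 1 by rewrite exprn_ile1//; lra.
  apply: (@le_trans _ _ (drop N (expR x) F r ^+ 2 * (dcut beta e r ^+ 2))).
    by rewrite ler_piMl// mulr_ge0 ?sqr_ge0.
  have k2 : dcut beta e r ^+ 2 <= ((r2 ^+ 2) `^ (- (beta / 2)) * (beta + 2)) ^+ 2 / r2 ^+ 2.
    rewrite ler_pdivlMr ?exprn_gt0//; apply: le_trans k1; rewrite [in leRHS]exprMn mulrC.
    apply: ler_wpM2r; first exact: sqr_ge0.
    by apply: lerXn2r => //; rewrite nnegrE; exact: ltW.
  rewrite expr2 -mulrA [c * _]mulrC; apply: ler_wpM2l => //.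
  apply: (le_trans (ler_pM d0 (sqr_ge0 _) d1 k2)).
  apply: eq_leW; rewrite /c /C.
  by move: (half_mass N F) (expR x) (_ ^+ 2 / _) ((r2 ^+ N)^-1) => *; ring.
have Qle : itg 0 2^-1 Qi <= b' ^+ 2 * itg 0 2^-1 Bi + c * resolvent N (expR x) F r2.
  by rewrite (itg_split_within (lexx 0) (ltW r20) r21 cQ); exact: lerD.
have ws : 0 <= weight sg x / expR x by rewrite divr_ge0 ?expR_ge0// ltW// weight_gt0.
have := ler_wpM2l ws Qle; rewrite /drop_energy /dropr_energy -/Qi -/Bi => h.
rewrite [leLHS]mulrA; apply: (le_trans h); apply: eq_leW; rewrite /c.
have E := e0 x; move: (weight sg x) (expR x) E (itg _ _ _) (resolvent _ _ _ _) (half_mass N F) => w E E0 I V m.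
by field; rewrite gt_eqF.
Qed.

(** The weighted inequality bounds N times the energy of [dropr] by that of [drop], and
    [drop_energy_le] bounds the latter by b'^2 times the former plus a remainder. When b'^2 < N the
    energy is thus controlled independently of e. *)
Lemma energy_le : (N%:R - b' ^+ 2) * \int[mu]_x dropr_energy N sg F (cut beta e) x <=
  C * half_mass N F * frac_inv N sg F r2.
Proof.
have [cF F_ge0 F_ni wF] := aF; have [M hM] := F_bounded cF.
have [iB iQ h] := wF _ _ (@cont_cut R beta e e_gt0) (@cont_dcut R beta e e_gt0)
  (@is_derive_cut R beta e e_gt0) (cut_half beta e) (cut_ge0 beta e).
have iV := integrable_resolvent N_gt0 sg01 cF F_ge0 hM r2.
have iBV := integrableD measurableT (integrableZ (b' ^+ 2) iB)
  (integrableZ (C * half_mass N F) iV).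
have k := le_Rintegral measurableT iQ iBV (fun x _ => drop_energy_le x).
rewrite (RintegralD measurableT (integrableZ _ iB) (integrableZ _ iV)) in k.
rewrite (RintegralZl _ measurableT iB) (RintegralZl _ measurableT iV) in k.
by have := le_trans h k; rewrite mulrBl lerBlDl.
Qed.

End energy.

Section decrement.
Variable F : R -> R.
Hypothesis aF : admissible F.
Variable beta : R.
Hypothesis beta_ge0 : 0 <= beta.
Variable t : R.
Hypothesis tI : 0 < t <= 8^-1.

Local Notation kap := ((N%:R - 1) / 2 + sg - beta).

(** The first factor comes from [dropr], the next two from the cutoff on [t, 2t], the last from the
    variation of s^(1-sg) over a window of length 1 in x. *)
Definition decr_const : R := (drop_const R N / 2) ^+ 2 * (3 / 16) ^+ 2 * 5 `^ (- beta) * expR (- (1 - sg)).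

Lemma decr_const_gt0 : 0 < decr_const.
Proof.
have d := drop_const_gt0 R N; have s5 : 0 < (3 / 16 : R) by lra.
apply: mulr_gt0; last exact: expR_gt0.
apply: mulr_gt0; last exact: powR_gt0.
by apply: mulr_gt0; apply: exprn_gt0 => //; exact: divr_gt0.
Qed.

(** e^x0 = t^(-2) is the largest s allowed by s t^2 <= 1 in [drop_lower], the scale at which the
    resolvent sees the decrement of F between t and 2t. *)
Let x0 := - 2 * ln t.

(** With e = t^2 and r <= 2t <= 1/4, one has r^2 + t^2 <= 5 t^2 and 1/4 - r^2 >= 3/16. *)
Let cut_low r : t <= r <= 2 * t -> (5 * t ^+ 2) `^ (- (beta / 2)) * (3 / 16) <= cut beta (t ^+ 2) r.
Proof.
move=> /andP[tr rt]; have /andP[t0 t8] := tI.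
have t2 : 0 < t ^+ 2 by exact: exprn_gt0.
have r2 : r ^+ 2 <= 4 * t ^+ 2 by nra.
apply: ler_pM; [exact: powR_ge0|by lra| |]; last first.
  have : t ^+ 2 <= 8^-1 ^+ 2 by apply: lerXn2r; rewrite ?nnegrE//; lra.
  lra.
have p0 : 0 < r ^+ 2 + t ^+ 2 by apply: ltr_wpDl => //; exact: sqr_ge0.
have p5 : 0 < 5 * t ^+ 2 by exact: mulr_gt0.
rewrite !powRN lef_pV2 ?posrE ?powR_gt0//.
apply: ge0_ler_powR; rewrite ?nnegrE; [by rewrite divr_ge0|exact: ltW|exact: ltW|].
by lra.
Qed.

Let energy_low x : x0 - 1 <= x <= x0 ->
  decr_const * (t `^ kap * (F t - F (2 * t))) ^+ 2 <= dropr_energy N sg F (cut beta (t ^+ 2)) x.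
Proof.
move=> /andP[xl xr]; have [cF F_ge0 F_ni _] := aF; have /andP[t0 t8] := tI.
have t2 : 0 < t ^+ 2 by exact: exprn_gt0.
have h2 : (2^-1 : R) < 1 by lra.
set D := F t - F (2 * t); have D0 : 0 <= D by rewrite subr_ge0; apply: F_ni; lra.
have tE : t = expR (ln t) by rewrite lnK.
have sE : expR x0 = (t ^+ 2)^-1.
  by rewrite /x0 mulNr expRN {2}tE -expRM_natl.
have st : expR x * t ^+ 2 <= 1.
  by rewrite -ler_pdivlMr// div1r -sE ler_expR.
have dc := drop_const_gt0 R N.
pose q := (5 * t ^+ 2) `^ (- (beta / 2)) * (3 / 16).
have q0 : 0 <= q by apply: mulr_ge0; [exact: powR_ge0|lra].
pose m := t ^+ N * ((drop_const R N * (expR x * D) / 2) ^+ 2 * q ^+ 2).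
have m0 : 0 <= m := mulr_ge0 (exprn_ge0 N (ltW t0)) (mulr_ge0 (sqr_ge0 _) (sqr_ge0 _)).
have cB : {within `[0, 2^-1], continuous (fun r => r ^+ N * (dropr N (expR x) F r ^+ 2 * cut beta (t ^+ 2) r ^+ 2))}.
  have ck := dropr_continuous N_gt0 (e0 x) cF h2.
  have cc : {within `[0, 2^-1], continuous (cut beta (t ^+ 2))}.
    by apply: contW; exact: cont_cut.
  have cN : {within `[0, 2^-1], continuous (fun r : R => r ^+ N)}.
    by apply: contW; exact: contX.
  move=> r; apply: cvgM; first exact: cN.
  by apply: cvgM; apply: cvgM; [exact: ck|exact: ck|exact: cc|exact: cc].
have B0 r : 0 <= r -> 0 <= r ^+ N * (dropr N (expR x) F r ^+ 2 * cut beta (t ^+ 2) r ^+ 2).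
  by move=> r0; rewrite mulr_ge0 ?exprn_ge0// mulr_ge0// sqr_ge0.
have Blow : m * t <= itg 0 2^-1 (fun r => r ^+ N * (dropr N (expR x) F r ^+ 2 * cut beta (t ^+ 2) r ^+ 2)).
  have a1 : t <= 2 * t by lra.
  have a2 : 2 * t <= 2^-1 by lra.
  rewrite (itg_split_within (lexx 0) (ltW t0) (le_trans a1 a2) cB) -[leLHS]add0r.
  apply: lerD; first by apply: itg_ge0 => r /andP[r0 _]; exact: B0.
  rewrite (itg_split_within (ltW t0) a1 a2 cB) -[leLHS]addr0.
  apply: lerD; last by apply: itg_ge0 => r /andP[r0 _]; apply: B0; lra.
  have -> : m * t = itg t (2 * t) (fun=> m) by rewrite itg_cst//; congr (_ * _); ring.
  apply: itg_le; first by apply: contW => ?; exact: cvg_cst.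
    apply: (continuous_subspaceW _ cB) => r /=; rewrite !in_itv/= => /andP[? ?].
    by apply/andP; split; lra.
  move=> r rI; have /andP[tr rt] := rI; have r0 : 0 < r by lra.
  have low := drop_lower N_gt0 (e0 x) cF F_ge0 F_ni t0 tr rt _ st.
  have {}low : drop_const R N * (expR x * t * D) <= drop N (expR x) F r by apply: low; lra.
  apply: ler_pM; [by rewrite exprn_ge0// ltW|by rewrite mulr_ge0 ?sqr_ge0| |].
    by apply: lerXn2r => //; rewrite nnegrE ltW.
  have k0 : 0 <= drop_const R N * (expR x * D) / 2.
    by apply: divr_ge0 => //; exact: mulr_ge0 (ltW dc) (mulr_ge0 (expR_ge0 _) D0).
  have k1 : drop_const R N * (expR x * D) / 2 <= dropr N (expR x) F r.
    rewrite /dropr gt_eqF// ler_pdivlMr//; apply: le_trans low.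
    have -> : drop_const R N * (expR x * t * D) = drop_const R N * (expR x * D) / 2 * (2 * t).
      by move: (drop_const R N) (expR x) => d' E'; field.
    exact: ler_wpM2l.
  apply: ler_pM; [exact: sqr_ge0|exact: sqr_ge0| |].
    by apply: lerXn2r => //; rewrite nnegrE//; exact: le_trans k1.
  have c1 := cut_low rI.
  by apply: lerXn2r => //; rewrite nnegrE//; exact: le_trans c1.
have ws : 0 <= weight sg x / expR x by rewrite divr_ge0 ?expR_ge0// ltW// weight_gt0.
have /= h := ler_wpM2l ws Blow; rewrite /dropr_energy [leRHS]mulrA; apply: le_trans h.
have wE : weight sg x / expR x * (m * t) =
    expR ((1 - sg) * x) * ((drop_const R N / 2) ^+ 2 * (3 / 16) ^+ 2 * D ^+ 2) *
    (t ^+ N.+1 * (5 * t ^+ 2) `^ (- (beta / 2)) ^+ 2).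
  have -> : expR ((1 - sg) * x) = weight sg x * expR x.
    by rewrite /weight -expRD; congr expR; ring.
  rewrite /m /q (exprSr t N); have E := e0 x; move: (weight sg x) (expR x) E (drop_const R N) (_ `^ _) (t ^+ N).
  by move=> w E E0 d P T; field; rewrite gt_eqF.
rewrite wE.
(* Collects the powers of t: since e^x0 = t^(-2), both sides carry t^(N+1-2 beta) = t^(2 kap + 2 - 2
   sg). This is what determines kap. *)
have tp : t ^+ N.+1 * (5 * t ^+ 2) `^ (- (beta / 2)) ^+ 2 = 5 `^ (- beta) * (t `^ kap ^+ 2 * expR (- (1 - sg) * x0)).
  have h5 : (5 * t ^+ 2) `^ (- (beta / 2)) ^+ 2 = 5 `^ (- beta) * t `^ (- 2 * beta).
    rewrite powRM//; last exact: ltW.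
    rewrite exprMn; congr (_ * _).
      by rewrite -(powR_mulrn 2 (powR_ge0 _ _)) -powRrM; congr (_ `^ _); field.
    rewrite -(powR_mulrn 2 (powR_ge0 _ _)) -powRrM -(powR_mulrn 2 (ltW t0)) -powRrM.
    by congr (_ `^ _); field.
  rewrite h5 mulrCA; congr (_ * _).
  rewrite -(powR_mulrn N.+1 (ltW t0)) -(powR_mulrn 2 (powR_ge0 _ _)) -powRrM.
  have tn0 : t != 0 by rewrite gt_eqF.
  rewrite /powR !(negbTE tn0) -!expRD; congr expR; rewrite /x0 -natr1.
  by move: (ln t) (N%:R) => *; field.
rewrite tp.
have -> : decr_const * (t `^ kap * D) ^+ 2 =
  expR (- (1 - sg)) * ((drop_const R N / 2) ^+ 2 * (3 / 16) ^+ 2 * D ^+ 2) * (5 `^ (- beta) * (t `^ kap ^+ 2)).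
  rewrite /decr_const exprMn; move: (expR _) (drop_const R N) (5 `^ _) (t `^ _) => *; ring.
rewrite (mulrA (5 `^ _)) [leRHS]mulrA [leRHS]mulrAC.
rewrite [_ * expR (- (1 - sg) * x0)]mulrAC -expRD.
apply: ler_wpM2r; first by rewrite mulr_ge0 ?powR_ge0// sqr_ge0.
apply: ler_wpM2r; first by rewrite mulr_ge0 ?sqr_ge0// mulr_ge0 ?sqr_ge0.
rewrite ler_expR; have /andP[s0 s1] := sg01.
have : 0 <= (1 - sg) * (x - (x0 - 1)) by rewrite mulr_ge0//; lra.
by move: x0 => y; lra.
Qed.

(** For s of order t^(-2), [drop_lower] bounds [dropr] below on [t, 2t] by a multiple of s D, where
    D = F(t) - F(2t). The energy density in x is then at least of order s^(1-sg) t^(N+1-2 beta) D^2,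
    that is t^(2 kap) D^2, over a window of length 1. *)
Lemma decrement : decr_const * (t `^ kap * (F t - F (2 * t))) ^+ 2 <=
  \int[mu]_x dropr_energy N sg F (cut beta (t ^+ 2)) x.
Proof.
have [cF F_ge0 F_ni wF] := aF; have /andP[t0 t8] := tI.
have t2 : 0 < t ^+ 2 by exact: exprn_gt0.
have [iB _ _] := wF _ _ (@cont_cut R beta _ t2) (@cont_dcut R beta _ t2)
  (@is_derive_cut R beta _ t2) (cut_half beta _) (cut_ge0 beta _).
have B0 x : 0 <= dropr_energy N sg F (cut beta (t ^+ 2)) x.
  apply: mulr_ge0; first exact/ltW/weight_gt0.
  apply: mulr_ge0; first by rewrite invr_ge0 expR_ge0.
  apply: itg_ge0 => r /andP[r0 _]; apply: mulr_ge0; first exact: exprn_ge0.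
  by apply: mulr_ge0; exact: sqr_ge0.
set c := decr_const * _.
have i1 : mu.-integrable `[x0 - 1, x0] (EFin \o (fun=> c)).
  by apply: within_integrable; apply: contW => ?; exact: cvg_cst.
have i2 : mu.-integrable `[x0 - 1, x0] (EFin \o dropr_energy N sg F (cut beta (t ^+ 2))).
  exact: (integrableS measurableT _ _ iB).
apply: le_trans (itg_le_Rintegral (x0 - 1) x0 B0 iB).
apply: (@le_trans _ _ (itg (x0 - 1) x0 (fun=> c))).
  by rewrite itg_cst; [rewrite opprB addrC subrK mulr1|rewrite gerBl].
apply: le_Rintegral; [by []|exact: i1|exact: i2|].
by move=> x /=; rewrite in_itv/=; exact: energy_low.
Qed.

End decrement.

End power_bound.

(** * Translation invariance on the line *)

Section translation.
Variable R : realType.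
Local Notation mu := (@lebesgue_measure R).

Lemma integral_translation (G : R -> R) c : continuous G -> (forall x, 0 <= G x) ->
  (\int[mu]_x (G x)%:E = \int[mu]_x (G (x + c))%:E)%E.
Proof.
move=> cG G0; have dF (x : R) : is_derive x (1 : R) (fun x : R => x + c) 1.
  by have := is_derive1D (is_derive_id x 1) (is_derive_cst c x 1); rewrite addr0.
have F1 : derive1 (fun x : R => x + c) = cst 1.
  by apply/funext => x; rewrite derive1E; have h := dF x; rewrite derive_val.
rewrite (@increasing_ge0_integration_by_substitutionT _ (fun x => x + c) G)//.
- by apply: eq_integral => x _; rewrite F1 /= mulr1.
- by move=> x y xy; rewrite ltrD2r.
- by rewrite F1 => ?; exact: cvg_cst.
- by rewrite F1; exact: is_cvg_cst.
- by rewrite F1; exact: is_cvg_cst.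
- apply/cvgrNyPle => A; near=> x; rewrite -lerBrDr; near: x; exact: (nbhs_ninfty_le (num_real _)).
- apply/cvgryPge => A; near=> x; rewrite -lerBlDr; near: x; exact: (nbhs_pinfty_ge (num_real _)).
Unshelve. all: by end_near.
Qed.

Lemma Rintegral_translation (G : R -> R) c : continuous G -> (forall x, 0 <= G x) ->
  \int[mu]_x G x = \int[mu]_x G (x + c).
Proof. by move=> cG G0; congr fine; exact: integral_translation. Qed.

Lemma integrable_translation (G : R -> R) c : continuous G -> (forall x, 0 <= G x) ->
  mu.-integrable setT (EFin \o G) -> mu.-integrable setT (EFin \o (fun x => G (x + c))).
Proof.
move=> cG G0 /integrableP[_ iG]; apply/integrableP; split.
  apply/measurable_EFinP; apply: continuous_measurable_fun.
  apply: (@cont_comp _ _ _ (fun x : R => x + c) G) => //.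
  by apply: contD => x; [exact: cvg_id|exact: cvg_cst].
have eqn (H : R -> R) : (forall x, 0 <= H x) ->
    (\int[mu]_x `|(EFin \o H) x| = \int[mu]_x (H x)%:E)%E.
  by move=> H0; apply: eq_integral => x _ /=; rewrite ger0_norm.
rewrite (eqn (fun x => G (x + c)))// -integral_translation//.
by rewrite -(eqn G).
Qed.

End translation.

(** * The power bound for F and its consequences for U *)

Section conclusions.
Variables (R : realType) (N : nat).
Hypothesis N_gt0 : (0 < N)%N.
Variable sg : R.
Hypothesis sg01 : 0 < sg < 1.
Local Notation mu := (@lebesgue_measure R).
Let e0 (x : R) : 0 < expR x := expR_gt0 x.
Local Notation kap beta := ((N%:R - 1) / 2 + sg - beta).

Lemma sqr_le_le (y z : R) : y ^+ 2 <= z -> y <= z + 1.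
Proof. by move=> yz; nra. Qed.

Lemma half_mass_bound (C0 : R) : exists2 H, 0 <= H & forall F, admissible N sg F ->
  frac_inv N sg F 2^-1 <= C0 -> half_mass N F <= H.
Proof.
have c0 : 0 <= 2 * J0 N 1 ^+ 2 * expR 1 :> R by rewrite mulr_ge0 ?expR_ge0// mulr_ge0// sqr_ge0.
exists (Num.max 0 (2 * J0 N 1 ^+ 2 * expR 1 * C0)); first by rewrite le_max lexx.
move=> F [cF F_ge0 _ _] h; rewrite le_max; apply/orP; right.
exact: (le_trans (half_mass_le N_gt0 sg01 cF F_ge0) (ler_wpM2l c0 h)).
Qed.

(** Everything is bounded through U(1/2): the mass by H, F(r2/2) by k3 H, the fractional inverse at
    r2 by V2. D depends neither on F nor on t, since [energy_le] is uniform in e = t^2. *)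
Lemma decrement_bound (beta C0 : R) : 0 <= beta -> beta ^+ 2 < N%:R ->
  exists2 D, 0 <= D & forall F, admissible N sg F -> frac_inv N sg F 2^-1 <= C0 ->
  forall t, 0 < t <= 8^-1 -> t `^ (kap beta) * (F t - F (2 * t)) <= D.
Proof.
move=> beta0 betaN; have [H H0 hH] := half_mass_bound C0.
have sN0 : 0 <= Num.sqrt (N%:R : R) by exact: sqrtr_ge0.
have bs : beta < Num.sqrt N%:R.
  by rewrite -(ger0_norm beta0) -sqrtr_sqr ltr_sqrt// ltr0n.
(* The midpoint between beta and sqrt N leaves room both for [dcut_near] and for N - b'^2 > 0. *)
pose b' := (beta + Num.sqrt N%:R) / 2; pose d := b' - beta.
have d0 : 0 < d by rewrite /d /b'; lra.
have bb : beta <= b' by rewrite -subr_ge0 ltW.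
have b'N : b' ^+ 2 < N%:R.
  rewrite -(sqr_sqrtr (ler0n R N)); apply: ltr_wpXn2r => //; rewrite ?nnegrE ?divr_ge0 ?addr_ge0//.
  by rewrite /b'; lra.
(* (2 + d) q = d and q < 1 give (2 + d) q^2 <= d, which is the condition of [dcut_near] at r2 =
   q/2. *)
pose q := d / (2 + d); have q0 : 0 < q by rewrite divr_gt0//; lra.
have q1 : q < 1 by rewrite ltr_pdivrMr; lra.
pose r2 := q / 2; have r2I : 0 < r2 <= 2^-1 by rewrite /r2; apply/andP; split; lra.
have small : 2 * r2 ^+ 2 <= d * (4^-1 - r2 ^+ 2).
  have h : (2 + d) * q = d by rewrite mulrC mulfVK// gt_eqF//; lra.
  have : (2 + d) * (q * q) <= (2 + d) * q by apply: ler_wpM2l; [lra|rewrite ler_piMr ?ltW].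
  by rewrite h /r2; lra.
pose C := ((r2 ^+ 2) `^ (- (beta / 2)) * (beta + 2)) ^+ 2 / r2 ^+ 2 / r2 ^+ N.
have /andP[r20 r21] := r2I.
have C_ge0 : 0 <= C by rewrite !divr_ge0 ?sqr_ge0 ?exprn_ge0// ltW.
pose k3 := N.+1%:R * ((r2 / 2) ^+ N.+1)^-1.
have k30 : 0 <= k3 by rewrite mulr_ge0// invr_ge0 exprn_ge0// divr_ge0// ltW.
pose k2 := (2 / r2) ^+ N.+1 + (r2 ^+ N)^-1.
have k20 : 0 <= k2.
  apply: addr_ge0; last by rewrite invr_ge0 exprn_ge0// ltW.
  by apply: exprn_ge0; rewrite divr_ge0// ltW.
pose V2 := Num.max 0 C0 + (k3 * H + k2 * H) * mass sg.
have m0 : 0 <= mass sg := mass_ge0 sg.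
have V20 : 0 <= V2 by rewrite addr_ge0 ?le_max ?lexx// mulr_ge0// addr_ge0// mulr_ge0.
pose E := C * H * V2 / (N%:R - b' ^+ 2).
have E0 : 0 <= E by rewrite divr_ge0 ?subr_ge0 ?(ltW b'N)// mulr_ge0// mulr_ge0.
have dc := decr_const_gt0 N sg beta.
exists (E / decr_const N sg beta + 1); first by rewrite addr_ge0// divr_ge0// ltW.
move=> F aF h t tI; have [cF F_ge0 F_ni wF] := aF; have /andP[t0 t8] := tI.
have t2 : 0 < t ^+ 2 by exact: exprn_gt0.
have hm := hH F aF h; have hm0 := half_mass_ge0 N F_ge0.
have Vle : frac_inv N sg F r2 <= V2.
  apply: (le_trans (frac_inv_le_mass N_gt0 sg01 cF F_ge0 F_ni r2I)).
  apply: lerD; first by rewrite le_max h orbT.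
  apply: ler_wpM2r => //; apply: lerD; last exact: ler_wpM2l.
  apply: (le_trans (le_half_mass N cF F_ge0 F_ni _)); last exact: ler_wpM2l.
  by apply/andP; split; lra.
have h1 := energy_le N_gt0 sg01 aF beta0 bb t2 r2I small.
have h2 := decrement N_gt0 sg01 aF beta0 tI.
have h3 : \int[mu]_x dropr_energy N sg F (cut beta (t ^+ 2)) x <= E.
  rewrite ler_pdivlMr ?subr_gt0// mulrC; apply: (le_trans h1).
  apply: ler_pM; [exact: mulr_ge0| |exact: ler_wpM2l|exact: Vle].
  exact: frac_inv_ge0.
have h4 : (t `^ (kap beta) * (F t - F (2 * t))) ^+ 2 <= E / decr_const N sg beta.
  by rewrite ler_pdivlMr// mulrC; exact: le_trans h3.
exact: sqr_le_le.
Qed.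

(** Dyadic summation: F(p) <= F(2p) + D p^(-k) <= (K 2^(-k) + D) p^(-k), which is at most K p^(-k)
    once K (1 - 2^(-k)) >= D; here k > 0 is essential. The induction on n covers p >= 2^(-n)/8, and
    on [1/8, 1] the mass bounds F directly. *)
Lemma power_bound (beta C0 : R) : 0 <= beta -> beta ^+ 2 < N%:R -> 0 < kap beta ->
  exists2 K, 0 <= K & forall F, admissible N sg F -> frac_inv N sg F 2^-1 <= C0 ->
  forall p, 0 < p <= 1 -> F p <= K * p `^ (- kap beta).
Proof.
move=> beta0 betaN kap0; have [H H0 hH] := half_mass_bound C0.
have [D D0 hD] := decrement_bound C0 beta0 betaN.
set k := kap beta in kap0 hD *.
have k2 : 2 `^ (- k) < 1 by rewrite powRN invf_lt1 ?powR_gt0// /powR pnatr_eq0/= expR_gt1 mulr_gt0// ln_gt0// ltr1n.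
pose k3 := N.+1%:R * ((8^-1 : R) ^+ N.+1)^-1.
pose K := Num.max (k3 * H) (D / (1 - 2 `^ (- k))).
have K0 : 0 <= K by rewrite le_max; apply/orP; right; rewrite divr_ge0// subr_ge0 ltW.
exists K => // F aF h; have [cF F_ge0 F_ni _] := aF; have hm := hH F aF h.
have base p : 8^-1 <= p <= 1 -> F p <= K * p `^ (- k).
  move=> /andP[p8 p1]; have p0 : 0 < p by lra.
  apply: (@le_trans _ _ (F 8^-1)); first by apply: F_ni; lra.
  apply: (@le_trans _ _ K).
    rewrite le_max; apply/orP; left; apply: (le_trans (le_half_mass N cF F_ge0 F_ni _)).
      by apply/andP; split; lra.
    apply: ler_wpM2l => //; rewrite mulr_ge0// invr_ge0 exprn_ge0//.
  rewrite ler_peMr// powRN -[leLHS]invr1 lef_pV2 ?posrE ?powR_gt0//.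
  rewrite -[leRHS](_ : 1 `^ k = 1); last by rewrite powR1.
  by apply: ge0_ler_powR => //; rewrite ?nnegrE; lra.
suff ind n p : 8^-1 / 2 ^+ n <= p -> p <= 1 -> 0 < p -> F p <= K * p `^ (- k).
  move=> p /andP[p0 p1]; have [n hn] : exists n, 8^-1 / 2 ^+ n <= p.
    exists (Num.bound p^-1).
    have ip0 : 0 <= p^-1 by rewrite invr_ge0 ltW.
    have h1 := archi_boundP ip0; set n := Num.bound _ in h1 *.
    have h2 : n%:R <= 2 ^+ n :> R by rewrite -natrX ler_nat ltnW// ltn_expl.
    have h3 : p^-1 < 2 ^+ n by exact: lt_le_trans h2.
    rewrite ler_pdivrMr ?exprn_gt0//.
    have : 1 <= p * 2 ^+ n by rewrite -ler_pdivrMl// mulr1 ltW.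
    by lra.
  exact: ind hn p1 p0.
elim: n p => [|n IH] p hp p1 p0.
  by apply: base; rewrite p1 andbT; move: hp; rewrite expr0 divr1.
have [p8|p8] := leP 8^-1 p; first by apply: base; rewrite p8.
have pI : 0 < p <= 8^-1 by rewrite p0 ltW.
have h1 : F (2 * p) <= K * (2 * p) `^ (- k).
  apply: IH; [|lra|lra].
  move: hp; rewrite exprSr invfM mulrA ler_pdivrMr// mulrC; lra.
have h2 : F p - F (2 * p) <= D * p `^ (- k).
  by rewrite powRN ler_pdivlMr ?powR_gt0// mulrC; exact: hD.
have hK : D <= K * (1 - 2 `^ (- k)).
  by rewrite -ler_pdivrMr ?subr_gt0// le_max lexx orbT.
have P0 : 0 <= p `^ (- k) by exact: powR_ge0.
move: h1; rewrite powRM//; last exact: ltW.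
have := ler_wpM2r P0 hK; move: h2; move: (p `^ _) (2 `^ _) (F p) (F (2 * p)) => *; lra.
Qed.

(** [resolvent0_pow] is integrated in s. For s >= 1, convergence at infinity requires a > 1 - sg and
    convergence at the origin of space requires a < 1 - k/2; such an a exists because k < 2 sg. For
    s < 1, a = 0 is taken. *)
Lemma frac_inv_center_bound (k K : R) : 0 < k -> k < 2 * sg -> 0 <= K ->
  exists C, forall F : R -> R, continuous F -> (forall p, 0 <= p <= 1 -> 0 <= F p) ->
  (forall p, 0 < p <= 1 -> F p <= K * p `^ (- k)) -> frac_inv N sg F 0 <= C.
Proof.
move=> k0 k2 K0; have /andP[s0 s1] := sg01.
have N1 : 2 <= N.+1%:R :> R by rewrite (ler_nat R 2).
pose a := ((1 - sg) + (1 - k / 2)) / 2.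
have a01 : 0 <= a <= 1 by rewrite /a; apply/andP; split; lra.
have z01 : 0 <= (0 : R) <= 1 by rewrite lexx ler01.
(* [weight] sg times s^(1-a) is [weight] s', so the part s >= 1 is controlled by [mass] s'. *)
pose s' := a - (1 - sg); have s'01 : 0 < s' < 1 by rewrite /s' /a; apply/andP; split; lra.
have kN : k < N.+1%:R by lra.
have ka : 0 < 2 - k - 2 * a by rewrite /a; lra.
have kz : 0 < 2 - k - 2 * 0 by lra.
pose c1 := pow_const N K k a / (2 - k - 2 * a).
pose c2 := pow_const N K k 0 / (2 - k - 2 * 0).
have pc b : 0 <= pow_const N K k b by rewrite /pow_const mulr_ge0 ?powR_ge0// divr_ge0// subr_ge0 ltW.
have c10 : 0 <= c1 by rewrite divr_ge0// ltW.
have c20 : 0 <= c2 by rewrite divr_ge0// ltW.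
exists (c1 * mass s' + c2 * mass sg) => F cF F_ge0 hF.
have [M hM] := F_bounded cF.
have iV := integrable_resolvent N_gt0 sg01 cF F_ge0 hM 0.
have i1 := integrable_dom s'01; have i2 := integrable_dom sg01.
have i12 := integrableD measurableT (integrableZ c1 i1) (integrableZ c2 i2).
have key x : weight sg x * resolvent N (expR x) F 0 <= c1 * dom s' x + c2 * dom sg x.
  have w0 := weight_gt0 sg x; have d1 := dom_ge0 s' x; have d2 := dom_ge0 sg x.
  have [h|h] := leP 1 (expR x).
    rewrite -[leLHS]addr0; apply: lerD; last exact: mulr_ge0.
    have hr := resolvent0_pow N_gt0 (e0 x) cF F_ge0 kN a01 hF ka.
    apply: (le_trans (ler_wpM2l (ltW w0) hr)).
    rewrite /dom (min_idPl h) mulr1.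
    have -> : weight s' x = weight sg x * expR x `^ (1 - a).
      by rewrite /powR gt_eqF// expRK /weight -expRD /s'; congr expR; ring.
    by rewrite /c1; move: (weight sg x) (expR x `^ _) (pow_const _ _ _ _) => *; apply: eq_leW; field; rewrite gt_eqF.
  rewrite -[leLHS]add0r; apply: lerD; first exact: mulr_ge0.
  have hr := resolvent0_pow N_gt0 (e0 x) cF F_ge0 kN z01 hF kz.
  apply: (le_trans (ler_wpM2l (ltW w0) hr)).
  rewrite /dom (min_idPr (ltW h)) subr0 powRr1 ?expR_ge0//.
  rewrite /c2 le_eqVlt; apply/orP; left; apply/eqP.
  by move: (weight sg x) (expR x) (pow_const _ _ _ _) (_^-1) => *; ring.
rewrite /frac_inv; apply: (le_trans (le_Rintegral measurableT iV i12 (fun x _ => key x))).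
rewrite (RintegralD measurableT (integrableZ c1 i1) (integrableZ c2 i2)).
by rewrite (RintegralZl _ measurableT i1) (RintegralZl _ measurableT i2).
Qed.

(** Two regimes meet at s = r^(-2): below it [resolvent_pow], above it [resolvent_split]. In the
    variable x both bounds decay exponentially away from x0 = -2 ln r, so after translation the
    integral is a constant times the common value r^(2 sg - k) at x0. *)
Lemma frac_inv_pow_bound (k K : R) : 2 * sg < k -> k < N.+1%:R -> 0 <= K ->
  exists C, forall F : R -> R, continuous F -> (forall p, 0 <= p <= 1 -> 0 <= F p) ->
  (forall p q, 0 <= p -> p <= q -> q <= 1 -> F q <= F p) ->
  (forall p, 0 < p <= 1 -> F p <= K * p `^ (- k)) ->
  forall r, 0 < r <= 1 -> frac_inv N sg F r <= C * r `^ (2 * sg - k).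
Proof.
move=> k2 kN K0; have /andP[s0 s1] := sg01.
(* Between 1 - k/2, which makes the space integral diverge at 0 and be governed by r, and 1 - sg,
   which gives decay as s tends to 0. *)
pose a := (Num.max 0 (1 - k / 2) + (1 - sg)) / 2.
have [m0 m1 m2] : [/\ 0 <= Num.max 0 (1 - k / 2), 1 - k / 2 <= Num.max 0 (1 - k / 2) & Num.max 0 (1 - k / 2) < 1 - sg].
  by split; rewrite ?le_max ?lexx ?orbT// gt_max; apply/andP; split; lra.
have a01 : 0 <= a <= 1 by rewrite /a; apply/andP; split; lra.
have ka : 0 < k + 2 * a - 2 by rewrite /a; lra.
have as1 : 0 < 1 - a - sg by rewrite /a; lra.
(* Common decay rate of the two regimes: sg beyond x0, and 1 - a - sg before it. *)
pose c := Num.min sg (1 - a - sg).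
have c0 : 0 < c by rewrite lt_min s0.
have c1 : c <= sg by rewrite ge_min lexx.
have c2 : c <= 1 - a - sg by rewrite ge_min lexx orbT.
have J1 : 0 <= J0 N 1 :> R by rewrite (le_trans ler01)// (@J0_ge1 _ N 1 ler01).
have pc : 0 <= pow_const N K k a by rewrite /pow_const mulr_ge0 ?powR_ge0// divr_ge0// subr_ge0 ltW.
pose A1 := J0 N 1 * (pow_const N K k a / (k + 2 * a - 2)).
have A10 : 0 <= A1 by rewrite mulr_ge0// divr_ge0// ltW.
have kN' : 0 < N.+1%:R - k by rewrite subr_gt0.
pose A2 := K * 2 `^ k + K / (N.+1%:R - k) * 2 `^ k.
have A20 : 0 <= A2 by rewrite addr_ge0 ?mulr_ge0 ?powR_ge0// invr_ge0 ltW.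
exists ((A1 + A2) * \int[mu]_x expR (- c * `|x|)) => F cF F_ge0 F_ni hF r /andP[r0 r1].
have [M hM] := F_bounded cF.
have iV := integrable_resolvent N_gt0 sg01 cF F_ge0 hM r.
pose x0 := - 2 * ln r; set P := r `^ (2 * sg - k).
have P0 : 0 <= P by exact: powR_ge0.
have rE e : r `^ e = expR (e * ln r) by rewrite /powR gt_eqF.
pose h x := expR (- c * `|x - x0|).
have ch : continuous h.
  move=> x; apply: continuous_comp; last exact: continuous_expR.
  apply: cvgM; first exact: cvg_cst.
  by apply: cvg_norm; apply: cvgB; [exact: cvg_id|exact: cvg_cst].
have ce : continuous (fun x : R => expR (- c * `|x|)).
  move=> x; apply: continuous_comp; last exact: continuous_expR.
  by apply: cvgM; [exact: cvg_cst|apply: cvg_norm; exact: cvg_id].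
have hint : \int[mu]_x h x = \int[mu]_x expR (- c * `|x|).
  by rewrite (Rintegral_translation (- x0) ce) // => x; exact: expR_ge0.
have key x : weight sg x * resolvent N (expR x) F r <= (A1 + A2) * P * h x.
  have h0 : 0 <= h x by exact: expR_ge0.
  have w0 := ltW (weight_gt0 sg x).
  have [xx|xx] := leP x x0.
    have sr : expR x * r ^+ 2 <= 1.
      rewrite -(powR_mulrn 2 (ltW r0)) rE -expRD -[leRHS]expR0 ler_expR.
      by rewrite -lerBrDr sub0r -mulNr.
    have hr := resolvent_pow N_gt0 (e0 x) cF F_ge0 K0 kN a01 hF r0 r1 sr ka.
    apply: (le_trans (ler_wpM2l w0 hr)).
    have -> : weight sg x * (J0 N 1 * (pow_const N K k a * expR x `^ (1 - a) / (k + 2 * a - 2) *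
        r `^ (2 - k - 2 * a))) = A1 * (weight sg x * expR x `^ (1 - a) * r `^ (2 - k - 2 * a)).
      by rewrite /A1; move: (weight _ _) (J0 _ _) (pow_const _ _ _ _) (_ `^ _) (_ `^ _) => *; field; rewrite gt_eqF.
    rewrite -(mulrA (A1 + A2)); apply: ler_pM => //.
    - by rewrite mulr_ge0 ?powR_ge0// mulr_ge0 ?powR_ge0.
    - by rewrite lerDl.
    rewrite /P /h !rE /powR gt_eqF// expRK /weight -!expRD ler_expR.
    rewrite ler0_norm ?subr_le0// opprB.
    have : 0 <= (1 - a - sg - c) * (x0 - x) by rewrite mulr_ge0// subr_ge0.
    by rewrite /x0; move: (ln r) => y; lra.
  have hs := resolvent_split N_gt0 (e0 x) cF F_ge0 r0 r1 F_ni.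
  have r20 : 0 < r / 2 by exact: divr_gt0.
  have r21 : r / 2 <= 1 by rewrite ler_pdivrMr// mul1r (le_trans r1)// ler1n.
  have hk : (2^-1 : R) `^ (- k) = 2 `^ k by rewrite -powR_inv1// -powRrM mulN1r opprK.
  have f1 : F (r / 2) <= K * 2 `^ k * r `^ (- k).
    apply: (le_trans (hF _ _)); first by rewrite r20.
    rewrite powRM; [|exact: ltW|by rewrite invr_ge0]; rewrite hk le_eqVlt; apply/orP; left; apply/eqP.
    by move: (r `^ _) (2 `^ _) => *; ring.
  have f2 : itg 0 (r / 2) (fun p => p ^+ N * F p) <= K / (N.+1%:R - k) * (r / 2) `^ (N.+1%:R - k).
    apply: itg_le_pow => //.
      apply: contW.
      by apply: (@contM _ _ (fun p : R => p ^+ N)); [exact: contX|exact: cF].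
    move=> p /andP[p0 pr]; rewrite mulrC.
    have pI : 0 < p <= 1 by rewrite p0 (le_trans (ltW pr)).
    apply: (le_trans (ler_wpM2r (exprn_ge0 N (ltW p0)) (hF p pI))).
    rewrite -mulrA -(powR_mulrn N (ltW p0)) -powRD; last by apply/implyP => _; rewrite gt_eqF.
    by rewrite -natr1 (_ : N%:R + 1 - k - 1 = - k + N%:R)//; ring.
  have hV : resolvent N (expR x) F r <= A2 * r `^ (- k).
    apply: (le_trans hs); rewrite /A2 [leRHS]mulrDl; apply: lerD => //.
    have q0 : 0 <= (2 / r) ^+ N.+1 by rewrite exprn_ge0// divr_ge0// ltW.
    apply: (le_trans (ler_wpM2l q0 f2)).
    have -> : (2 / r) ^+ N.+1 = (r / 2) `^ (- N.+1%:R).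
      rewrite powRN powR_mulrn ?ltW// -exprVn; congr (_ ^+ _); field.
      by rewrite gt_eqF.
    rewrite mulrCA -powRD; last by apply/implyP => _; rewrite gt_eqF.
    have -> : - N.+1%:R + (N.+1%:R - k) = - k by ring.
    rewrite powRM; [|exact: ltW|by rewrite invr_ge0]; rewrite hk le_eqVlt; apply/orP; left; apply/eqP.
    by move: (r `^ _) (2 `^ _) (_^-1) => *; ring.
  apply: (le_trans (ler_wpM2l w0 hV)).
  rewrite [leLHS]mulrCA -(mulrA (A1 + A2)); apply: ler_pM => //; first by rewrite mulr_ge0 ?powR_ge0.
    by rewrite lerDr.
  rewrite /P /h !rE /weight -!expRD ler_expR gtr0_norm ?subr_gt0//.
  have : 0 <= (sg - c) * (x - x0) by rewrite mulr_ge0 ?subr_ge0// ltW.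
  by rewrite /x0; move: (ln r) => y; lra.
have ih : mu.-integrable setT (EFin \o h).
  apply: (@integrable_translation _ (fun x => expR (- c * `|x|)) (- x0) ce).
    by move=> x; exact: expR_ge0.
  exact: integrable_exp_norm.
rewrite /frac_inv; apply: (le_trans (le_Rintegral measurableT iV (integrableZ _ ih) (fun x _ => key x))).
by rewrite (RintegralZl _ measurableT ih) hint mulrAC.
Qed.

End conclusions.

(** * Calculus and integration on row vectors *)

Section rV_calculus.
Variable R : realType.
Local Notation mu := (@lebesgue_measure R).

(** A directional derivative depends only on the restriction to a line, so it can be carried to the
    real line or to a slice of lower dimension. *)
Lemma is_derive_line (V V' : normedModType R) (g : V -> R) (g' : V' -> R) x v x' v' d :
  (forall h, g (h *: v + x) = g' (h *: v' + x')) -> is_derive x v g d -> is_derive x' v' g' d.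
Proof.
move=> H; have H0 : g x = g' x' by have := H 0; rewrite !scale0r !add0r.
have E : (fun h => h^-1 *: ((g \o shift x) (h *: v) - g x)) =
    (fun h => h^-1 *: ((g' \o shift x') (h *: v') - g' x')).
  by apply/funext => h /=; rewrite H H0.
case=> dg <-; split; first by move: dg; rewrite /derivable E.
by rewrite /derive E.
Qed.

Lemma cont_rV (T : topologicalType) n (f : T -> 'rV[R]_n) :
  (forall i, continuous (fun t => f t ord0 i)) -> continuous f.
Proof.
move=> cf t S /nbhs_ballP[e /= e0 eS].
suff h : \forall u \near t, forall i, ball (f t ord0 i) e (f u ord0 i).
  apply: filterS h => u hu; apply: eS; split=> // i j.
  by rewrite !ord1; exact: hu.
apply: filter_forall => i; apply: (cf i t); exact: nbhsx_ballx.
Qed.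

Lemma cont_coord n (i : 'I_n) : continuous (fun x : 'rV[R]_n => x ord0 i).
Proof. exact: coord_continuous. Qed.

Lemma cons_rVE n (t : R) (v : 'rV[R]_n) i :
  cons_rV (t, v) ord0 i = if unlift ord0 i is Some j then v ord0 j else t.
Proof. by rewrite mxE; case: (unlift ord0 i). Qed.

Lemma cont_cons_l n (v : 'rV[R]_n) : continuous (fun t : R => cons_rV (t, v)).
Proof.
apply: cont_rV => i; under eq_fun do rewrite cons_rVE.
by case: (unlift ord0 i) => [j|] t; [exact: cvg_cst|exact: cvg_id].
Qed.

Lemma cont_cons_r n (t : R) : continuous (fun v : 'rV[R]_n => cons_rV (t, v)).
Proof.
apply: cont_rV => i; under eq_fun do rewrite cons_rVE.
by case: (unlift ord0 i) => [j|]; [exact: cont_coord|exact: cst_continuous].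
Qed.

Lemma uncons_rVK n (x : 'rV[R]_n.+1) : cons_rV (uncons_rV x) = x.
Proof.
apply/rowP => i; rewrite cons_rVE.
by case: unliftP => [j ->|->] //=; rewrite mxE.
Qed.

(** The sigma-algebra is generated by the coordinates, so the proof is an induction on the
    dimension: the first coordinate is split off and [measurable_caratheodory] applies. *)
Lemma cont_measurable_rV n (g : 'rV[R]_n -> R) : continuous g -> measurable_fun setT g.
Proof.
elim: n g => [|n IH] g cg.
  rewrite (_ : g = cst (g 0)); first exact: measurable_cst.
  by apply/funext => x; congr g; apply/rowP => -[].
have mg : measurable_fun setT (fun p : measurableTypeR R * 'rV[R]_n => g (cons_rV p)).
  apply: measurable_caratheodory => [v|t].
    exact: (@cont_comp _ _ _ (fun t : R => cons_rV (t, v)) g (@cont_cons_l _ v) cg).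
  apply: IH.
  exact: (@cont_comp _ _ _ (fun v : 'rV[R]_n => cons_rV (t, v)) g (@cont_cons_r _ t) cg).
rewrite (_ : g = (fun p => g (cons_rV p)) \o @uncons_rV R n).
  exact: (measurableT_comp mg (@measurable_uncons_rV R n)).
by apply/funext => x /=; rewrite uncons_rVK.
Qed.

Definition cube n (A : R) : set 'rV[R]_n := [set x | forall i, `[- A, A]%classic (x ord0 i)].
Arguments cube : clear implicits.

Lemma measurable_cube n A : measurable (cube n A).
Proof.
rewrite (_ : cube n A = \bigcap_(i in [set: 'I_n]) ((fun x : 'rV[R]_n => x ord0 i) @^-1` `[- A, A])).
  apply: fin_bigcap_measurable; first exact: finite_finset.
  by move=> i _; rewrite -[X in measurable X]setTI; exact: measurable_rV_coord.
by apply/seteqP; split => x h i; [move=> _; exact: h|exact: h].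
Qed.

Lemma cube_lty n A : (lebesgue_rV R n (cube n A) < +oo)%E.
Proof.
rewrite (lebesgue_rV_box (a := fun=> `[- A, A]%classic))//.
pose c := mu `[- A, A]%classic; suff h : (\prod_(i < n) c)%E \is a fin_num.
  by rewrite -(fineK h) ltry.
elim/big_ind: _ => //; first exact: fin_numM.
by move=> i _; rewrite /c lebesgue_measure_itv/=; case: ifP.
Qed.

Lemma integrable_cube n A (g : 'rV[R]_n -> R) M : measurable_fun setT g ->
  (forall x, `|g x| <= M) -> (forall x, ~ cube n A x -> g x = 0) ->
  (lebesgue_rV R n).-integrable setT (EFin \o g).
Proof.
move=> mg gM g0; have mC := @measurable_cube n A.
have iC : (lebesgue_rV R n).-integrable (cube n A) (EFin \o g).
  apply: (@integrable_fin_mul _ _ _ _ _ _ M) => //; first exact: cube_lty.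
  exact: measurable_funTS.
have := (integrable_mkcond (EFin \o g) mC).1 iC.
rewrite (_ : (EFin \o g) \_ (cube n A) = EFin \o g)//.
apply/funext => x; rewrite /patch; case: ifPn => //= xC.
by rewrite g0//; move/negP: xC; rewrite inE.
Qed.

Lemma cube_cons n A t (v : 'rV[R]_n) : cube n.+1 A (cons_rV (t, v)) <-> `[- A, A]%classic t /\ cube n A v.
Proof.
split=> [h|[ht hv] i].
  split=> [|i]; first by have := h ord0; rewrite cons_rVE unlift_none.
  by have := h (lift ord0 i); rewrite cons_rVE liftK.
by rewrite cons_rVE; case: (unlift ord0 i).
Qed.

(** Both orders are recorded: [integral_partial0] integrates first in whichever block contains the
    direction of derivation. *)
Lemma integral_cons n A (g : 'rV[R]_n.+1 -> R) M : measurable_fun setT g ->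
  (forall x, `|g x| <= M) -> (forall x, ~ cube n.+1 A x -> g x = 0) ->
  (\int[lebesgue_rV R n.+1]_x (g x)%:E =
    \int[mu]_t \int[lebesgue_rV R n]_v (g (cons_rV (t, v)))%:E /\
   \int[lebesgue_rV R n.+1]_x (g x)%:E =
    \int[lebesgue_rV R n]_v \int[mu]_t (g (cons_rV (t, v)))%:E)%E.
Proof.
move=> mg gM g0; have ig := integrable_cube mg gM g0.
have mc := @measurable_cons_rV R n.
have mgc : measurable_fun setT (EFin \o g \o @cons_rV R n).
  by apply: (measurableT_comp _ mc); exact/measurable_EFinP.
have igc : (mu \x lebesgue_rV R n)%E.-integrable setT (EFin \o g \o @cons_rV R n).
  apply/integrableP; split => //; have /integrableP[_] := ig.
  rewrite /= /lebesgue_rV_step ge0_integral_pushforward//.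
    by apply/measurable_EFinP; exact: measurableT_comp.
have E : (\int[lebesgue_rV R n.+1]_x (g x)%:E =
    \int[mu \x lebesgue_rV R n]_p (EFin \o g \o @cons_rV R n) p)%E.
  by rewrite /= /lebesgue_rV_step (integral_pushforward mc _ igc)//; exact/measurable_EFinP.
rewrite E; split; first by rewrite -(integral12_prod_meas1 igc).
by rewrite -(integral21_prod_meas1 igc).
Qed.

(** Fubini reduces to slices. In the first direction the fundamental theorem applies on each line;
    in any other direction the induction hypothesis applies on each hyperplane. *)
Lemma integral_partial0 n (i : 'I_n) A (G : 'rV[R]_n -> R) : 0 <= A ->
  (forall x, ~ cube n A x -> G x = 0) ->
  (forall x, derivable G x (delta_mx ord0 i)) -> continuous (partial i G) ->
  (\int[lebesgue_rV R n]_x (partial i G x)%:E = 0)%E.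
Proof.
elim: n i G => [[]//|n IH] i G A0 G0 dG cG.
have mg := cont_measurable_rV cG.
have ddG x : is_derive x (delta_mx ord0 i) G (partial i G x).
  by apply: DeriveDef => //; exact: dG.
have line0 t (v : 'rV[R]_n) h : h *: delta_mx ord0 ord0 + cons_rV (t, v) = cons_rV (h *: 1 + t, v).
  apply/rowP => j; rewrite mxE cons_rVE !mxE; case: unliftP => [k ->|->] /=.
    by rewrite mulr0 add0r.
  by [].
have linej (j : 'I_n) t (v : 'rV[R]_n) h : h *: delta_mx ord0 (lift ord0 j) + cons_rV (t, v) =
    cons_rV (t, h *: delta_mx ord0 j + v).
  apply/rowP => k; rewrite mxE cons_rVE !mxE; case: unliftP => [l ->|->] /=.
    by rewrite !mxE (inj_eq lift_inj).
  by rewrite mulr0 add0r.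
(* Outside the cube some coordinate exceeds A in absolute value, an open condition, so G vanishes
   along the line near x. *)
have g0 x : ~ cube n.+1 A x -> partial i G x = 0.
  move=> xC; have [k kA] : exists k, ~ `[- A, A]%classic (x ord0 k) by apply/existsNP.
  have kA' : A < `|x ord0 k|.
    by rewrite ltNge; apply/negP => h; apply: kA; rewrite /= in_itv/= -ler_norml.
  have near0 : \forall h \near (0 : R), G (h *: delta_mx ord0 i + x) = 0.
    have c : continuous (fun h : R => `|(h *: delta_mx ord0 i + x) ord0 k|).
      have c' : continuous (fun h : R => h * (delta_mx ord0 i : 'rV[R]_n.+1) ord0 k + x ord0 k).
        apply: (@contD _ _ (fun h : R => h * (delta_mx ord0 i : 'rV[R]_n.+1) ord0 k) (cst (x ord0 k))).
          apply: (@contM _ _ (fun h : R => h) (cst ((delta_mx ord0 i : 'rV[R]_n.+1) ord0 k))).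
            by move=> ?; exact: cvg_id.
          by exact: contC.
        by exact: contC.
      rewrite (_ : (fun h : R => _) = (fun h : R => `|h * (delta_mx ord0 i : 'rV[R]_n.+1) ord0 k + x ord0 k|)).
        by move=> h; apply: cvg_norm; exact: (c' h).
      by apply/funext => u; rewrite !mxE.
    have c0 := c 0; rewrite /continuous_at scale0r add0r in c0.
    have h0 : \forall h \near (0 : R), A < `|(h *: delta_mx ord0 i + x) ord0 k| by exact: (cvgr_gt _ c0 _ kA').
    apply: filterS h0 => h hA; apply: G0 => hC.
    by have := hC k; rewrite /= in_itv/= -ler_norml leNgt hA.
  have d := ddG x; have dz : is_derive (0 : R) (1 : R) (fun h : R => G (h *: delta_mx ord0 i + x)) 0.
    have e : \forall h \near (0 : R), cst 0 h = G (h *: delta_mx ord0 i + x).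
      by apply: filterS near0 => h ->.
    exact: (is_derive_near e (is_derive_cst (0 : R) (0 : R) 1)).
  have h2 : is_derive x (delta_mx ord0 i) G 0.
    apply: (is_derive_line _ dz) => h.
    by rewrite addr0 /GRing.scale/= mulr1.
  by rewrite /partial; have := @derive_val _ _ _ _ _ _ _ h2.
have [M hM] : exists M, forall x, `|partial i G x| <= M.
  have kC : compact (cube n.+1 A).
    rewrite (_ : cube n.+1 A = [set v : 'rV[R]_n.+1 | forall i, `[- A, A]%classic (v ord0 i)])//.
    by apply: (rV_compact (A := fun=> `[- A, A]%classic)) => _; exact: segment_compact.
  have C0 : cube n.+1 A !=set0.
    by exists 0 => j; rewrite /= in_itv/= mxE oppr_le0 A0.
  have cn : {within cube n.+1 A, continuous (fun x => `|partial i G x|)}.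
    apply: contW.
    by apply: (@cont_comp _ _ _ (partial i G) (fun y : R => `|y|) cG); exact: norm_continuous.
  have [c _ hc] := compact_EVT_max C0 kC cn; exists `|partial i G c| => x.
  have [xC|xC] := pselect (cube n.+1 A x); first by apply: hc; rewrite inE.
  by rewrite g0// normr0.
have [E1 E2] := integral_cons mg hM g0.
case: (unliftP ord0 i) => [j ij|i0].
  rewrite E1; apply: integral0_eq => t _.
  have d2 v : is_derive v (delta_mx ord0 j) (fun v => G (cons_rV (t, v))) (partial i G (cons_rV (t, v))).
    by apply: (is_derive_line _ (ddG (cons_rV (t, v)))) => h; rewrite ij linej.
  have pE : partial j (fun v => G (cons_rV (t, v))) = fun v => partial i G (cons_rV (t, v)).
    by apply/funext => v; rewrite /partial; have := @derive_val _ _ _ _ _ _ _ (d2 v).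
  have := IH j (fun v => G (cons_rV (t, v))) A0; rewrite pE; apply.
  - by move=> v vC; apply: G0 => /cube_cons[].
  - by move=> v; case: (d2 v).
  - exact: (@cont_comp _ _ _ (fun v : 'rV[R]_n => cons_rV (t, v)) _ (@cont_cons_r _ t) cG).
rewrite E2; apply: integral0_eq => v _.
pose L t := G (cons_rV (t, v)); pose l t := partial i G (cons_rV (t, v)).
have dL t : is_derive t (1 : R) L (l t).
  by apply: (is_derive_line _ (ddG (cons_rV (t, v)))) => h; rewrite i0 line0.
have cl : continuous l.
  exact: (@cont_comp _ _ _ (fun t : R => cons_rV (t, v)) _ (@cont_cons_l _ v) cG).
have cL : continuous L by move=> t; exact: derive_cont (dL t).
pose B := A + 1; have BB : - B <= B by rewrite /B; lra.
have Lout t : A < `|t| -> L t = 0.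
  by move=> tA; apply: G0 => /cube_cons[]; rewrite /= in_itv/= -ler_norml leNgt tA.
have I0 : itg (- B) B l = 0.
  rewrite (itg_FTC (F := L) BB); try by apply: contW.
    by rewrite !Lout ?subrr// ?normrN ger0_norm /B; lra.
have lout t : t \notin `[- B, B]%classic -> l t = 0.
  move=> tB; apply: g0 => /cube_cons[]; rewrite /= in_itv/= => /andP[h1 h2] _.
  by move/negP: tB; apply; rewrite inE/= in_itv/=; apply/andP; split; rewrite /B; lra.
have il : mu.-integrable `[- B, B] (EFin \o l) by apply: within_integrable; exact: contW.
transitivity (\int[mu]_(t in `[(- B)%R, B]) (l t)%:E)%E.
  rewrite [RHS]integral_mkcond; apply: eq_integral => t _.
  by rewrite /patch; case: ifPn => // /lout; rewrite /l => ->.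
rewrite -(fineK (integrable_fin_num _ il))//.
by move: I0; rewrite /itg /Rintegral => ->.
Qed.

End rV_calculus.

(** * Continuity at a point *)

Section continuity_at.
Variables (R : realType) (T : topologicalType).
Implicit Types (f g : T -> R).

Lemma for_add f g x : {for x, continuous f} -> {for x, continuous g} ->
  {for x, continuous (fun y => f y + g y)}.
Proof. by move=> cf cg; apply: cvgD; [exact: cf|exact: cg]. Qed.

Lemma for_opp f x : {for x, continuous f} -> {for x, continuous (fun y => - f y)}.
Proof. by move=> cf; apply: cvgN; exact: cf. Qed.

Lemma for_mul f g x : {for x, continuous f} -> {for x, continuous g} ->
  {for x, continuous (fun y => f y * g y)}.
Proof. by move=> cf cg; apply: cvgM; [exact: cf|exact: cg]. Qed.

Lemma for_comp g (f : R -> R) x : {for x, continuous g} -> {for g x, continuous f} ->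
  {for x, continuous (fun y => f (g y))}.
Proof. by move=> cg cf; apply: (@continuous_comp _ _ _ g f). Qed.

Lemma for_sum (I : Type) (r : seq I) (f : I -> T -> R) x :
  (forall i, {for x, continuous (f i)}) -> {for x, continuous (fun y => \sum_(i <- r) f i y)}.
Proof.
move=> cf; elim: r => [|i r IH].
  rewrite (_ : (fun y => _) = cst 0); first exact: cst_continuous.
  by apply/funext => y; rewrite big_nil.
rewrite (_ : (fun y => _) = (fun y => f i y + \sum_(j <- r) f j y)); first exact: (for_add (cf i) IH).
by apply/funext => y; rewrite big_cons.
Qed.

Lemma for_near f g x : (\near x, f x = g x) -> {for x, continuous f} -> {for x, continuous g}.
Proof.
move=> fg cf; have fgx := nbhs_singleton fg; rewrite /prop_for /continuous_at -fgx.
exact: (cvg_trans (near_eq_cvg fg) cf).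
Qed.

End continuity_at.

(** * Directional derivatives *)

Section directional.
Variable R : realType.

Lemma is_deriveV_add (V : normedModType R) (f g : V -> R) (x v : V) a b : is_derive x v f a -> is_derive x v g b ->
  is_derive x v (fun y => f y + g y) (a + b).
Proof. by move=> fa gb; exact: is_deriveD. Qed.

Lemma is_deriveV_opp (V : normedModType R) (f : V -> R) (x v : V) a : is_derive x v f a ->
  is_derive x v (fun y => - f y) (- a).
Proof. by move=> fa; exact: is_deriveN. Qed.

Lemma is_deriveV_mul (V : normedModType R) (f g : V -> R) (x v : V) a b : is_derive x v f a -> is_derive x v g b ->
  is_derive x v (fun y => f y * g y) (a * g x + f x * b).
Proof.
move=> fa gb; have h := is_deriveM fa gb; apply: is_derive_eq h _.
by rewrite /GRing.scale/= addrC; congr +%R; rewrite mulrC.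
Qed.

Lemma is_deriveV_sum (V : normedModType R) (I : Type) (r : seq I) (f : I -> V -> R) (df : I -> R) x v :
  (forall i, is_derive x v (f i) (df i)) ->
  is_derive x v (fun y => \sum_(i <- r) f i y) (\sum_(i <- r) df i).
Proof.
move=> h; elim: r => [|i r IH].
  rewrite big_nil (_ : (fun y => _) = cst 0); first exact: is_derive_cst.
  by apply/funext => y; rewrite big_nil.
rewrite big_cons (_ : (fun y => _) = (fun y => f i y + \sum_(j <- r) f j y)).
  exact: is_deriveV_add.
by apply/funext => y; rewrite big_cons.
Qed.

Lemma is_derive_toline (V : normedModType R) (g : V -> R) (x v : V) d :
  is_derive x v g d <-> is_derive (0 : R) (1 : R) (fun h : R => g (h *: v + x)) d.
Proof.
by split; apply: is_derive_line => h; rewrite addr0 /GRing.scale/= mulr1.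
Qed.

Lemma is_deriveV_comp (V : normedModType R) (f : R -> R) (g : V -> R) (x v : V) a b :
  is_derive (g x) (1 : R) f a -> is_derive x v g b ->
  is_derive x v (fun y => f (g y)) (a * b).
Proof.
move=> fa /is_derive_toline gb; apply/is_derive_toline.
have fa' : is_derive (g (0 *: v + x)) (1 : R) f a by rewrite scale0r add0r.
exact: (is_derive1_compE fa' gb).
Qed.

Lemma is_derive0E (f : R -> R) d : (forall e, 0 < e -> exists2 b, 0 < b &
    forall h, `|h| < b -> `|f h - f 0 - d * h| <= e * `|h|) -> is_derive (0 : R) (1 : R) f d.
Proof.
move=> H.
have c : h^-1 *: ((f \o shift 0) (h *: 1) - f 0) @[h --> 0^'] --> d.
  apply/cvgrPdist_le => e e0; have [b b0 hb] := H e e0.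
  near=> h; have h0 : h != 0 by near: h; exact: nbhs_dnbhs_neq.
  have hb' : `|h| < b by near: h; apply: dnbhs0_lt.
  rewrite /= addr0 /GRing.scale/= mulr1 distrC -(ler_pM2r (x := `|h|)) ?normr_gt0// -normrM.
  by rewrite mulrBl mulrAC mulVf// mul1r; exact: hb.
split; first by apply/cvg_ex; exists d.
exact: cvg_lim c.
Unshelve. all: by end_near. Qed.

End directional.

(** * The Euclidean ball and radial functions *)

Section ball.
Variables (R : realType) (n : nat).
Local Notation leb := (lebesgue_rV R n).
Local Notation B1 := (@B1 R n).
Local Notation cB1 := (@cB1 R n).
Local Notation enorm := (@enorm R n).
Implicit Types (x : 'rV[R]_n) (i : 'I_n).

Lemma enorm_ge0 x : 0 <= enorm x. Proof. exact: sqrtr_ge0. Qed.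

Lemma sqr_enorm x : enorm x ^+ 2 = \sum_i x ord0 i ^+ 2.
Proof. by rewrite sqr_sqrtr// sumr_ge0// => i _; exact: sqr_ge0. Qed.

Lemma coord_le_enorm x i : `|x ord0 i| <= enorm x.
Proof.
rewrite -(ler_pXn2r (n := 2))// ?nnegrE ?enorm_ge0// sqr_enorm real_normK ?num_real//.
by rewrite (bigD1 i)//= lerDl sumr_ge0// => j _; exact: sqr_ge0.
Qed.

Lemma enormZ a x : enorm (a *: x) = `|a| * enorm x.
Proof.
rewrite /Defs.enorm -sqrtr_sqr -sqrtrM ?sqr_ge0//; congr Num.sqrt.
by rewrite mulr_sumr; apply: eq_bigr => i _; rewrite mxE exprMn.
Qed.

Lemma enorm0 : enorm 0 = 0.
Proof. by have := enormZ 0 0; rewrite scale0r normr0 mul0r. Qed.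

Lemma enorm_eq0 x : (enorm x == 0) = (x == 0).
Proof.
apply/idP/idP => [/eqP h|/eqP ->]; last by rewrite enorm0.
apply/eqP/rowP => i; rewrite mxE; apply/eqP; rewrite -normr_le0 -h; exact: coord_le_enorm.
Qed.

Lemma enorm_gt0 x : (0 < enorm x) = (x != 0).
Proof. by rewrite lt_neqAle enorm_ge0 andbT eq_sym enorm_eq0. Qed.

Lemma cont_enorm : continuous enorm.
Proof.
move=> x; apply: (@for_comp R _ (fun x => \sum_i x ord0 i ^+ 2) Num.sqrt); last exact: sqrt_continuous.
apply: for_sum => i; have c := @cont_coord R n i x.
exact: (for_mul c c).
Qed.

Lemma open_B1 : open B1.
Proof.
apply: (@open_comp _ _ enorm [set y | y < 1]) => [x _|]; first exact: cont_enorm.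
exact: open_lt.
Qed.

Lemma nbhs_B1 x : B1 x -> \forall y \near x, B1 y.
Proof. by move=> xB; have := open_B1; rewrite openE; exact. Qed.

Lemma B1_cB1 x : B1 x -> cB1 x. Proof. exact: ltW. Qed.

Lemma cB1_cube x : cB1 x -> @cube R n 1 x.
Proof.
by move=> x1 i; rewrite /= in_itv/= -ler_norml; exact: le_trans (coord_le_enorm x i) x1.
Qed.

Lemma B1_lty : (leb B1 < +oo)%E.
Proof.
apply: (@le_lt_trans _ _ (leb (@cube R n 1))); last exact: cube_lty.
apply: le_measure; rewrite ?inE.
- exact: measurable_B1.
- exact: measurable_cube.
- by move=> x /B1_cB1; exact: cB1_cube.
Qed.

Lemma compact_cB1 : compact cB1.
Proof.
apply: bounded_closed_compact.
  exists 1; split=> [|M M1 x /cB1_cube h]; first exact: num_real.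
  rewrite /= [leLHS]/Num.norm/= mx_normrE; apply/bigmax_leP; split; first lra.
  by move=> -[i j] _ /=; rewrite ord1; have := h j; rewrite /= in_itv/= -ler_norml; lra.
apply: (@closed_comp _ _ enorm [set y | y <= 1]) => [x _|]; first exact: cont_enorm.
exact: closed_le.
Qed.

(** Composition with the radial retraction onto the closed ball. The extension gives access to
    measurability and integrability of globally continuous functions. *)
Lemma extend_cB1 (g : 'rV[R]_n -> R) : {within cB1, continuous g} ->
  exists2 g' : 'rV[R]_n -> R, continuous g' & forall x, cB1 x -> g' x = g x.
Proof.
move=> cg; pose q x := (Num.max 1 (enorm x))^-1 *: x.
have m1 x : 0 < Num.max 1 (enorm x) by rewrite lt_max ltr01.
have qB x : cB1 (q x).
  have i0 : 0 <= (Num.max 1 (enorm x))^-1 by rewrite invr_ge0; exact: ltW.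
  rewrite /Defs.cB1 /= /q enormZ (ger0_norm i0).
  by rewrite mulrC ler_pdivrMr// mul1r le_max lexx orbT.
have cq : continuous q.
  apply: cont_rV => i; under eq_fun do rewrite mxE.
  move=> x; apply: (@for_mul R _ (fun x => (Num.max 1 (enorm x))^-1) (fun x => x ord0 i)); last exact: cont_coord.
  apply: (@for_comp R _ enorm (fun y => (Num.max 1 y)^-1)); first exact: cont_enorm.
  have cmax : continuous (fun y : R => Num.max 1 y).
    by move=> y; apply: (@continuous_max _ _ (cst 1) id) => [?|?]; [exact: cvg_cst|exact: cvg_id].
  apply: (@contV R _ (fun y : R => Num.max 1 y)) => // y.
  by rewrite gt_eqF// lt_max ltr01.
exists (fun x => g (q x)) => [x|x xB]; last first.
  by rewrite /q (max_idPl xB) invr1 scale1r.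
have /subspace_continuousP/(_ _ (qB x)) cgx := cg.
apply: (@cvg_comp _ _ _ q g _ (within cB1 (nbhs (q x)))); last exact: cgx.
move=> V hV; have h : nbhs (q x) (fun y => cB1 y -> V y) := hV.
have h2 : nbhs x (fun t => cB1 (q t) -> V (q t)) := cq x _ h.
suff : nbhs x (fun t => V (q t)) by [].
by apply: filterS h2 => t; exact.
Qed.

Lemma compact_level (g : 'rV[R]_n -> R) c : continuous g -> compact (cB1 `&` [set x | c <= g x]).
Proof.
move=> cg; apply: compact_closedI compact_cB1 _.
apply: (@closed_comp _ _ g [set y | c <= y]) => [x _|]; first exact: cg.
exact: closed_ge.
Qed.

Lemma bounded_cB1 (g : 'rV[R]_n -> R) : continuous g -> exists2 M, 0 < M & forall x, cB1 x -> `|g x| <= M.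
Proof.
move=> cg; have c0 : cB1 !=set0 by exists 0; rewrite /Defs.cB1 /= enorm0 ler01.
have cn : {within cB1, continuous (fun x => `|g x|)}.
  apply: contW.
  by apply: (@cont_comp _ _ _ g (fun y : R => `|y|) cg); exact: norm_continuous.
have [c _ hc] := compact_EVT_max c0 compact_cB1 cn; exists (`|g c| + 1) => [|x xB].
  by rewrite ltr_wpDl.
by apply: (@le_trans _ _ `|g c|); [apply: hc; rewrite inE|rewrite lerDl].
Qed.

(** Off K, G vanishes on a neighbourhood and so does its derivative; the extensions by zero
    therefore satisfy the hypotheses of [integral_partial0]. *)
Lemma integral_partial_compact i (K : set 'rV[R]_n) (G d : 'rV[R]_n -> R) :
  compact K -> K `<=` B1 ->
  (forall x, B1 x -> is_derive x (delta_mx ord0 i) G (d x)) ->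
  (forall x, B1 x -> {for x, continuous d}) ->
  (forall x, B1 x -> ~ K x -> G x = 0) ->
  leb.-integrable B1 (EFin \o d) /\ \int[leb]_(x in B1) d x = 0.
Proof.
move=> kK KB dG cd G0.
have oK : open (~` K).
  by rewrite openC; apply: compact_closed kK; exact: norm_hausdorff.
have nK x : ~ K x -> \forall y \near x, ~ K y.
  by move: oK; rewrite openE => h xK; exact: h.
pose G' x := if x \in K then G x else 0.
pose d' := (d \_ B1).
have d0 x : B1 x -> ~ K x -> d x = 0.
  move=> xB xK; have h : \forall y \near x, cst 0 y = G y.
    by near=> y; rewrite /= G0//; near: y; [exact: nbhs_B1|exact: nK].
  have h1 := near_eq_is_derive h (is_derive_cst (0 : R) x (delta_mx ord0 i)).
  have h2 := dG x xB; rewrite -(@derive_val _ _ _ _ _ _ _ h2).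
  exact: (@derive_val _ _ _ _ _ _ _ h1).
have nKc x : ~ K x -> x \notin K by move=> h; apply/negP; rewrite inE.
have dG' x : is_derive x (delta_mx ord0 i) G' (d' x).
  rewrite /d' /patch; case: ifPn => [|/negP]; rewrite inE => xB.
    apply: near_eq_is_derive (dG x xB); near=> y.
    rewrite /G'; case: ifPn => // /negP; rewrite inE => yK; rewrite G0//.
    by near: y; exact: nbhs_B1.
  have xK : ~ K x by move=> /KB.
  apply: near_eq_is_derive (is_derive_cst (0 : R) x (delta_mx ord0 i)).
  by near=> y; rewrite /G' ifN//; apply: nKc; near: y; exact: nK.
have cd' : continuous d'.
  move=> x; have [xB|xB] := pselect (B1 x).
    apply: for_near (cd x xB); near=> y; rewrite /d' /patch ifT// inE.
    by near: y; exact: nbhs_B1.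
  have xK : ~ K x by move=> /KB.
  have c0 : {for x, continuous (fun _ : 'rV[R]_n => 0 : R)} by exact: cst_continuous.
  apply: for_near c0; near=> y; rewrite /d' /patch; case: ifPn => //; rewrite inE => yB.
  by rewrite d0//; near: y; exact: nK.
have G'0 x : ~ @cube R n 1 x -> G' x = 0.
  move=> xC; rewrite /G' ifN//; apply: nKc => /KB/B1_cB1 xB; apply: xC.
  exact: cB1_cube.
have pE : partial i G' = d'.
  by apply/funext => x; rewrite /partial; exact: (@derive_val _ _ _ _ _ _ _ (dG' x)).
have I0 : (\int[leb]_x (d' x)%:E = 0)%E.
  rewrite -pE; apply: (@integral_partial0 R n i 1 G') => //.
  by rewrite pE.
have [M _ hM] := bounded_cB1 cd'.
have idT : leb.-integrable B1 (EFin \o d).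
  apply: (@integrable_fin_mul _ _ _ _ _ _ M).
  - exact: measurable_B1.
  - exact: B1_lty.
  - apply: (eq_measurable_fun d').
      by move=> x xB; rewrite /d' /patch xB.
    by apply: measurable_funTS; exact: cont_measurable_rV.
  - move=> x xB; have := hM x (B1_cB1 xB); rewrite /d' /patch ifT// inE//.
split=> //; rewrite /Rintegral integral_mkcond (_ : (fun x => (d x)%:E) \_ B1 = fun x => (d' x)%:E) ?I0//.
by apply/funext => x; rewrite /d' /patch; case: ifP.
Unshelve. all: by end_near. Qed.

Lemma is_derive_enorm x i : x != 0 -> is_derive x (delta_mx ord0 i) enorm (x ord0 i / enorm x).
Proof.
move=> x0; have e0 : 0 < enorm x by rewrite enorm_gt0.
apply/is_derive_toline.
have E h : enorm (h *: delta_mx ord0 i + x) =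
    Num.sqrt (h * h + (2 * x ord0 i * h + enorm x ^+ 2)).
  rewrite sqr_enorm /Defs.enorm; congr Num.sqrt.
  rewrite (bigD1 i)//= [in RHS](bigD1 i)//= !mxE !eqxx mulr1.
  rewrite (eq_bigr (fun j => x ord0 j ^+ 2)) => [|j ji]; last first.
    by rewrite !mxE eqxx (negPf ji)/= mulr0 add0r.
  ring.
rewrite (_ : (fun h => _) = (fun h => Num.sqrt (h * h + (2 * x ord0 i * h + enorm x ^+ 2)))); last exact/funext.
have dI := is_derive_id (0 : R) (1 : R).
have d1 := is_derive1D (is_derive1M dI dI) (is_derive1D (is_derive1Z (2 * x ord0 i) dI) (is_derive_cst (enorm x ^+ 2) (0 : R) (1 : R))).
have p0 : 0 < (0 : R) * 0 + (2 * x ord0 i * 0 + enorm x ^+ 2) by rewrite !mulr0 !add0r exprn_gt0.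
have h := @is_derive1_compE R Num.sqrt (fun y : R => y * y + (2 * x ord0 i * y + enorm x ^+ 2)) 0 _ _ (is_derive1_sqrt p0) d1; apply: is_derive_eq h _.
transitivity ((2 * Num.sqrt (enorm x ^+ 2))^-1 * (2 * x ord0 i)).
  by congr ((2 * Num.sqrt _)^-1 * _); ring.
rewrite sqrtr_sqr ger0_norm ?enorm_ge0//.
by move: e0; move: (enorm x) (x ord0 i) => e y e0; field; rewrite gt_eqF.
Qed.

Lemma is_derive_radial (w : R -> R) a x i : x != 0 -> is_derive (enorm x) (1 : R) w a ->
  is_derive x (delta_mx ord0 i) (fun y => w (enorm y)) (a * (x ord0 i / enorm x)).
Proof. by move=> x0 dw; exact: (is_deriveV_comp dw (is_derive_enorm i x0)). Qed.

Lemma enorm_delta h i : enorm (h *: delta_mx ord0 i + 0) = `|h|.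
Proof.
rewrite addr0 enormZ /Defs.enorm (bigD1 i)//= mxE !eqxx expr1n big1 ?addr0 ?sqrtr1 ?mulr1// => j ji.
by rewrite mxE (negPf ji) andbF expr0n.
Qed.

Lemma is_derive_radial0 (w : R -> R) i : (forall h, w `|h| = w h) -> is_derive (0 : R) (1 : R) w 0 ->
  is_derive (0 : 'rV[R]_n) (delta_mx ord0 i) (fun y => w (enorm y)) 0.
Proof.
move=> ew dw; apply/is_derive_toline.
by rewrite (_ : (fun h : R => _) = w)//; apply/funext => h; rewrite enorm_delta.
Qed.

Lemma is_derive_radial_coord0 (e : R -> R) i : {for 0, continuous (fun h : R => e `|h|)} ->
  is_derive (0 : 'rV[R]_n) (delta_mx ord0 i) (fun y => e (enorm y) * y ord0 i) (e 0).
Proof.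
move=> ce; apply/is_derive_toline.
rewrite (_ : (fun h : R => _) = (fun h => e `|h| * h)); last first.
  by apply/funext => h; rewrite enorm_delta !mxE !eqxx mulr1 addr0.
apply: is_derive0E => eps eps0.
have /cvgrPdist_le/(_ _ eps0) := ce; rewrite normr0 => /nbhs_ballP[b b0 hb].
exists b => // h hb'; rewrite mulr0 subr0 -mulrBl normrM ler_wpM2r//.
rewrite distrC; apply: (hb h); by rewrite /ball/= sub0r normrN.
Qed.

Lemma cont_radial (e : R -> R) x : (forall b, b < 1 -> {within `[0, b], continuous e}) ->
  B1 x -> {for x, continuous (fun y => e (enorm y))}.
Proof.
move=> ce x1; have x0 := enorm_ge0 x; pose b := (enorm x + 1) / 2.
have [b0 b1 xb] : [/\ 0 <= b, b < 1 & enorm x < b] by rewrite /b; move: x1 x0; rewrite /Defs.B1 /=; split; lra.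
have cc := cont_comp_clamp b0 (ce b b1).
have cx : {for x, continuous (fun y => e (clamp b (enorm y)))}.
  exact: (@for_comp R _ enorm (fun r => e (clamp b r)) x (@cont_enorm x) (cc (enorm x))).
apply: for_near cx; near=> y; rewrite clampE// enorm_ge0/=.
apply: ltW; near: y; exact: (cvgr_lt _ (@cont_enorm x) _ xb).
Unshelve. all: by end_near. Qed.

End ball.

(** * Composition with the positive part *)

Section positive_part.
Variable R : realType.

Lemma is_derive_pos (h h1 : R -> R) (y : R) : h 0 = 0 -> h1 0 = 0 ->
  (forall y : R, 0 <= y -> is_derive y (1 : R) h (h1 y)) ->
  is_derive (y : R) (1 : R) (fun y : R => h (Num.max y 0)) (h1 (Num.max y 0)).
Proof.
move=> h0 h10 dh; have [y0|y0|y0] := ltgtP y 0.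
- rewrite h10; apply: near_eq_is_derive (is_derive_cst (0 : R) y (1 : R)).
  by near=> z; rewrite (max_idPr _) ?h0// ltW//; near: z; exact: lt_nbhsl.
- apply: near_eq_is_derive (dh _ (ltW y0)).
  by near=> z; rewrite (max_idPl _)// ltW//; near: z; exact: lt_nbhsr.
rewrite y0 h10; apply: is_derive0E => e e0.
have [/cvg_ex[/= l dl] ld] := dh 0 (lexx 0); rewrite h10 /derive in ld.
have {ld}l0 : l = 0 by rewrite -ld; apply/esym; exact: cvg_lim dl.
rewrite l0 in dl; have /cvgrPdist_le/(_ _ e0)/nbhs_ballP[b b0 hb] := dl.
exists b => // z zb; rewrite maxxx h0 mul0r !subr0.
have [z0|z0] := leP z 0; first by rewrite ?h0 normr0 mulr_ge0// ltW.
have /(_ _)/= := hb z; rewrite /ball/= sub0r normrN => /(_ zb).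
rewrite gt_eqF// => /(_ isT); rewrite sub0r normrN /GRing.scale/= addr0 mulr1 h0 subr0 normrM normfV.
by rewrite mulrC ler_pdivrMr// normr_gt0 gt_eqF.
Unshelve. all: by end_near. Qed.

Lemma for_squeeze (T : topologicalType) (f g : T -> R) x : (forall y, `|f y| <= g y) -> g x = 0 ->
  {for x, continuous g} -> {for x, continuous f}.
Proof.
move=> fg g0 cg; have f0 : f x = 0 by apply/eqP; rewrite -normr_le0 -g0.
rewrite /prop_for /continuous_at f0; apply/cvgrPdist_le => e e0.
have /cvgrPdist_le/(_ _ e0) := cg; rewrite g0; apply: filterS => y.
rewrite !sub0r !normrN; move=> gy; apply: le_trans (fg y) _.
exact: le_trans (ler_norm _) gy.
Qed.

Lemma for_inv (T : topologicalType) (f : T -> R) x : f x != 0 -> {for x, continuous f} ->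
  {for x, continuous (fun y => (f y)^-1)}.
Proof. by move=> f0 cf; apply: cvgV => //; exact: cf. Qed.

End positive_part.

(** * Smooth truncations of the identity *)

Section truncation.
Variable R : realType.
Implicit Types (del v : R).

(* [trunc del] is a C^2 convex approximation, as [del] tends to 0, of the
   identity on the positive reals; it vanishes below [del]. *)
Definition trunc del v := Num.max (v - del) 0 ^+ 3 / v ^+ 2.
Definition trunc1 del v := Num.max (v - del) 0 ^+ 2 * (v + 2 * del) / v ^+ 3.
Definition trunc2 del v := 6 * del ^+ 2 * Num.max (v - del) 0 / v ^+ 4.

Lemma is_derive_maxX k del v : is_derive v (1 : R) (fun v => Num.max (v - del) 0 ^+ k.+2)
  (k.+2%:R * Num.max (v - del) 0 ^+ k.+1).
Proof.
have h y : is_derive (y : R) (1 : R) (fun y : R => Num.max y 0 ^+ k.+2) (k.+2%:R * Num.max y 0 ^+ k.+1).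
  apply: (@is_derive_pos R (fun y => y ^+ k.+2) (fun y => k.+2%:R * y ^+ k.+1)); rewrite ?expr0n ?mulr0//.
  by move=> z _; exact: is_derive1X.
have hd : is_derive v (1 : R) (fun v => v - del) 1.
  by have := is_derive1D (is_derive_id v (1 : R)) (is_derive_cst (- del) v (1 : R)); rewrite addr0.
by have := @is_derive1_compE R (fun y => Num.max y 0 ^+ k.+2) (fun v => v - del) v _ _ (h (v - del)) hd; rewrite mulr1.
Qed.

Lemma trunc_le0 del v : v <= del -> trunc del v = 0 /\ trunc1 del v = 0.
Proof.
move=> vd; have m0 : Num.max (v - del) 0 = 0 by apply/max_idPr; lra.
by rewrite /trunc /trunc1 m0 !expr0n/= !mul0r.
Qed.

Lemma maxBr_lt del v : 0 < v -> v < del \/ Num.max (v - del) 0 = v - del.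
Proof. by move=> v0; case: (ltP v del) => h; [left|right; apply/max_idPl; lra]. Qed.

Lemma is_derive_trunc del v : 0 < v -> is_derive v (1 : R) (trunc del) (trunc1 del v).
Proof.
move=> v0; have vn : v ^+ 2 != 0 by rewrite expf_neq0// gt_eqF.
have h := is_derive1M (is_derive_maxX 1 del v) (@is_derive1V R (fun v => v ^+ 2) v _ vn (is_derive1X v 2)).
apply: is_derive_eq h _; rewrite /trunc1.
case: (maxBr_lt del v0) => [vd|->].
  have -> : Num.max (v - del) 0 = 0 by apply/max_idPr; lra.
  by rewrite !expr0n/= mulr0 !mul0r addr0.
by field; rewrite gt_eqF.
Qed.

Lemma is_derive_trunc1 del v : 0 < v -> is_derive v (1 : R) (trunc1 del) (trunc2 del v).
Proof.
move=> v0; have vn : v ^+ 3 != 0 by rewrite expf_neq0// gt_eqF.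
have h1 := is_derive1D (is_derive_id v (1 : R)) (is_derive_cst (2 * del) v (1 : R)).
have h := is_derive1M (is_derive1M (is_derive_maxX 0 del v) h1) (@is_derive1V R (fun v => v ^+ 3) v _ vn (is_derive1X v 3)).
apply: is_derive_eq h _; rewrite /trunc2 /cst.
case: (maxBr_lt del v0) => [vd|->].
  have -> : Num.max (v - del) 0 = 0 by apply/max_idPr; lra.
  by ring.
by field; rewrite gt_eqF.
Qed.

Lemma cont_max0 del : continuous (fun v => Num.max (v - del) 0).
Proof.
move=> v; apply: (@continuous_max _ _ (fun v : R => v - del) (cst 0)) => [x|x]; last exact: cvg_cst.
by apply: cvgB; [exact: cvg_id|exact: cvg_cst].
Qed.

Lemma cont_trunc2 del v : 0 < v -> {for v, continuous (trunc2 del)}.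
Proof.
move=> v0; apply: (@for_mul R _ (fun v => 6 * del ^+ 2 * Num.max (v - del) 0) (fun v => (v ^+ 4)^-1)).
  by apply: (@for_mul R _ (cst (6 * del ^+ 2)) (fun v => Num.max (v - del) 0)); [exact: cvg_cst|exact: cont_max0].
apply: (@for_inv R _ (fun v => v ^+ 4)); first by rewrite expf_neq0// gt_eqF.
exact: derive_cont (is_derive1X v 4).
Qed.

Lemma cont_of_pos (h dh : R -> R) del : 0 < del -> (forall v, v <= del -> h v = 0) ->
  (forall v : R, 0 < v -> is_derive v (1 : R) h (dh v)) -> continuous h.
Proof.
move=> del0 h0 hd v; have [v0|v0] := ltP 0 v; first exact: derive_cont (hd v v0).
have c0 : {for v, continuous (fun _ : R => 0 : R)} by exact: cvg_cst.
have vd : v < del by lra.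
by apply: (for_near _ c0); near=> y; rewrite h0// ltW//; near: y; exact: lt_nbhsl.
Unshelve. all: by end_near. Qed.

Lemma cont_trunc del : 0 < del -> continuous (trunc del).
Proof.
move=> d0; apply: (@cont_of_pos _ (trunc1 del) del) => // v; first by case/trunc_le0.
exact: is_derive_trunc.
Qed.

Lemma cont_trunc1 del : 0 < del -> continuous (trunc1 del).
Proof.
move=> d0; apply: (@cont_of_pos _ (trunc2 del) del) => // v; first by case/trunc_le0.
exact: is_derive_trunc1.
Qed.

Lemma trunc_itv del v : 0 < del -> 0 <= v -> 0 <= trunc del v <= v.
Proof.
move=> d0 v0; case: (ltP v del) => vd; first by have [-> _] := trunc_le0 (ltW vd); rewrite lexx.
have m : Num.max (v - del) 0 = v - del by apply/max_idPl; lra.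
have v1 : 0 < v by lra.
rewrite /trunc m; apply/andP; split; first by rewrite divr_ge0// exprn_ge0//; lra.
rewrite ler_pdivrMr ?exprn_gt0// -exprS lerXn2r// ?nnegrE; lra.
Qed.

Lemma trunc1_itv del v : 0 < del -> 0 <= v -> 0 <= trunc1 del v <= 1.
Proof.
move=> d0 v0; case: (ltP v del) => vd; first by have [_ ->] := trunc_le0 (ltW vd); rewrite lexx ler01.
have m : Num.max (v - del) 0 = v - del by apply/max_idPl; lra.
have v1 : 0 < v by lra.
rewrite /trunc1 m; apply/andP; split.
  by rewrite divr_ge0 ?exprn_ge0// mulr_ge0 ?exprn_ge0//; lra.
rewrite ler_pdivrMr ?exprn_gt0// mul1r -subr_ge0.
have -> : v ^+ 3 - (v - del) ^+ 2 * (v + 2 * del) = del ^+ 2 * (3 * v - 2 * del) by ring.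
by rewrite mulr_ge0 ?exprn_ge0//; lra.
Qed.

Lemma trunc2_ge0 del v : 0 <= trunc2 del v.
Proof.
have v4 : 0 <= v ^+ 4 by rewrite (exprM v 2 2); exact: sqr_ge0.
have m0 : 0 <= Num.max (v - del) 0 by rewrite le_max lexx orbT.
by rewrite /trunc2; apply: (divr_ge0 _ v4); apply: mulr_ge0 m0; apply: mulr_ge0 (sqr_ge0 _).
Qed.

(** Away from v = 0 the second derivative is of order del^2: in the limit it acts only where the
    resolvent is small, that is near the sphere. *)
Lemma trunc2_le del v eta : 0 < del -> 0 < eta -> eta <= v -> trunc2 del v <= 6 * del ^+ 2 / eta ^+ 3.
Proof.
move=> d0 e0 ev; have v0 : 0 < v by lra.
apply: (@le_trans _ _ (6 * del ^+ 2 / v ^+ 3)).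
  rewrite /trunc2; have -> : 6 * del ^+ 2 / v ^+ 3 = 6 * del ^+ 2 * v / v ^+ 4 by field; rewrite gt_eqF.
  rewrite ler_pM2r ?invr_gt0 ?exprn_gt0// ler_wpM2l//; first by rewrite mulr_ge0// exprn_ge0// ltW.
  by rewrite ge_max; apply/andP; split; lra.
rewrite ler_wpM2l//; first by rewrite mulr_ge0// exprn_ge0// ltW.
by rewrite lef_pV2 ?posrE ?exprn_gt0// lerXn2r// nnegrE ltW.
Qed.

Lemma trunc_cvg v : 0 < v -> (fun j => trunc (harmonic j) v) @ \oo --> v /\ (fun j => trunc1 (harmonic j) v) @ \oo --> (1 : R).
Proof.
move=> v0; have c : (fun j => Num.max (v - harmonic j) 0) @ \oo --> v.
  have cm : continuous (fun d : R => Num.max (v - d) 0).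
    move=> d; apply: (@continuous_max _ _ (fun d : R => v - d) (cst 0)) => [x|x]; last exact: cvg_cst.
    by apply: cvgB; [exact: cvg_cst|exact: cvg_id].
  have := cvg_comp _ _ (@cvg_harmonic R) (cm 0).
  by rewrite subr0 (max_idPl (ltW v0)).
have vn : v != 0 by rewrite gt_eqF.
split.
  have e : v = (v * (v * v)) / v ^+ 2 by field.
  rewrite [X in _ --> X]e.
  apply: cvgM; last exact: cvg_cst.
  by under eq_fun do rewrite exprS expr2; apply: cvgM => //; exact: cvgM.
have e : 1 = (v * v) * (v + 2 * 0) / v ^+ 3 by field.
rewrite [X in _ --> X]e.
apply: cvgM; last exact: cvg_cst.
apply: cvgM; first by under eq_fun do rewrite expr2; exact: cvgM.
apply: cvgD; first exact: cvg_cst.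
apply: cvgM; [exact: cvg_cst|exact: cvg_harmonic].
Qed.

End truncation.

Lemma integrable_B1 (R : realType) n (g : 'rV[R]_n -> R) : continuous g ->
  (lebesgue_rV R n).-integrable (@B1 R n) (EFin \o g).
Proof.
move=> cg; have [M _ hM] := bounded_cB1 cg.
apply: (@integrable_fin_mul _ _ _ _ _ _ M).
- exact: measurable_B1.
- exact: B1_lty.
- by apply: measurable_funTS; exact: cont_measurable_rV.
- by move=> x /B1_cB1; exact: hM.
Qed.

(** * Green's formula and the eigencoefficients of a resolvent *)

Section green.
Variables (R : realType) (N : nat).
Hypothesis N_gt0 : (0 < N)%N.
Variable s : R.
Hypothesis s_gt0 : 0 < s.
Variable F : R -> R.
Hypothesis cF : continuous F.
Hypothesis F_gt0 : forall p, 0 <= p <= 1 -> 0 < F p.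
Hypothesis F_ni : forall p q, 0 <= p -> p <= q -> q <= 1 -> F q <= F p.
Local Notation leb := (lebesgue_rV R N.+1).
Local Notation B1 := (@B1 R N.+1).
Local Notation cB1 := (@cB1 R N.+1).
Local Notation enorm := (@enorm R N.+1).
Local Notation V := (resolvent N s F).
Local Notation e_ i := (delta_mx ord0 i : 'rV[R]_N.+1).

Let F_ge0 p : 0 <= p <= 1 -> 0 <= F p. Proof. by move=> /F_gt0/ltW. Qed.

(** V(0) - V(r) is at most M s r^2, by the linear bound on [drop]. *)
Lemma is_derive_resolvent0 : is_derive (0 : R) (1 : R) V 0.
Proof.
have [M hM] := F_bounded cF.
have M0 : 0 <= M by apply: le_trans (F_ge0 _) (hM 0 _); rewrite lexx ler01.
pose C := M * s; have C0 : 0 <= C by rewrite mulr_ge0// ltW.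
have cV := cont_resolvent N_gt0 s_gt0 cF.
have dV (t : R) : 0 < t < 1 -> is_derive t (1 : R) V (- drop N s F t) := is_derive_resolvent N_gt0 s_gt0 cF (r := t).
have bnd r : 0 <= r -> r < 1 -> `|V r - V 0| <= C * r ^+ 2.
  move=> r0 r1; have lo : V 0 + C * 0 ^+ 2 <= V r + C * r ^+ 2.
    apply: (@mono_derive _ 0 r (fun t => V t + C * t ^+ 2) (fun t => - drop N s F t + C * (2%:R * t ^+ 1))) => //.
    - apply: contW; apply: (@contD _ _ V (fun t : R => C * t ^+ 2)) => //.
      apply: (@contM _ _ (cst C) (fun t : R => t ^+ 2)); first by exact: contC.
      exact: contX.
    - move=> t /andP[t0 tr]; apply: is_derive1D; first by apply: dV; rewrite t0; lra.
      by apply: is_derive1Z; exact: is_derive1X.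
    - move=> t /andP[t0 tr]; have t01 : 0 <= t <= 1 by apply/andP; split; lra.
      have := drop_le N_gt0 s_gt0 cF F_ge0 hM t01; rewrite expr1 -/C => h.
      have := mulr_ge0 C0 (ltW t0); lra.
  have hi : - V 0 <= - V r.
    apply: (@mono_derive _ 0 r (fun t => - V t) (fun t => drop N s F t)) => //.
    - by apply: contW; apply: (@contN _ _ V).
    - by move=> t /andP[t0 tr]; rewrite -[drop _ _ _ _]opprK; apply: is_derive1N; apply: dV; rewrite t0; lra.
    - by move=> t /andP[t0 tr]; apply: drop_ge0 => //; apply/andP; split; lra.
  by rewrite ler_norml; move: lo hi; rewrite expr0n/= mulr0; lra.
apply: is_derive0E => e e0; exists (Num.min 1 (e / (C + 1))) => [|h].
  by rewrite lt_min ltr01 divr_gt0//; lra.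
rewrite lt_min => /andP[h1 h2]; rewrite mul0r subr0.
rewrite -(resolvent_norm N s F h); apply: le_trans (bnd _ (normr_ge0 h) h1) _.
rewrite expr2 mulrA ler_wpM2r//.
move: h2; rewrite ltr_pdivlMr; last lra.
by have := normr_ge0 h; nra.
Qed.

(** This is r times the derivative of [dropr]. It vanishes at 0, so its product with x_i^2/|x|^2 is
    continuous there although the quotient alone is not. *)
Definition dropr_slope r := s * (F r - V r) - N.+1%:R * dropr N s F r.

Lemma dropr_slope0 : dropr_slope 0 = 0.
Proof.
rewrite /dropr_slope /dropr eqxx.
have n0 : N.+1%:R != 0 :> R by rewrite pnatr_eq0.
by move: n0; move: (F 0) (V 0) (N.+1%:R : R) => a b c c0; field.
Qed.

Lemma is_derive_dropr (r : R) : 0 < r < 1 -> is_derive r (1 : R) (dropr N s F) (dropr_slope r / r).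
Proof.
move=> /andP[r0 r1]; have r01 : 0 < r < 1 by rewrite r0.
have dI : is_derive r (1 : R) (fun y : R => y) 1 := is_derive_id r (1 : R).
have rn : r != 0 by rewrite gt_eqF.
have h := is_derive1M (is_derive_drop N_gt0 s_gt0 cF r01) (is_derive1V rn dI).
have h2 : is_derive r (1 : R) (dropr N s F) ((s * (F r - V r) - N%:R * drop N s F r / r) / r + drop N s F r * (- 1 / r ^+ 2)).
  apply: near_eq_is_derive h; near=> y; rewrite /dropr ifN// gt_eqF//.
  by near: y; exact: lt_nbhsr.
apply: is_derive_eq h2 _; rewrite /dropr_slope (dropE N s F r).
rewrite -[N.+1]addn1 natrD; move: rn; move: (dropr N s F r) (F r) (V r) (N%:R : R) => a b c d rn.
by field.
Unshelve. all: by end_near. Qed.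

Lemma is_derive_V_enorm x i : B1 x ->
  is_derive x (e_ i) (fun y => V (enorm y)) (- (dropr N s F (enorm x) * x ord0 i)).
Proof.
move=> xB; have [->|x0] := eqVneq x 0.
  rewrite mxE mulr0 oppr0; apply: is_derive_radial0; last exact: is_derive_resolvent0.
  by move=> h; rewrite resolvent_norm.
have r01 : 0 < enorm x < 1 by rewrite enorm_gt0 x0.
have h := is_derive_radial i x0 (is_derive_resolvent N_gt0 s_gt0 cF r01).
apply: is_derive_eq h _; rewrite (dropE N s F).
move: r01 => /andP[+ _]; move: (enorm x) (x ord0 i) => r y r0.
by rewrite mulNr; congr (- _); field; rewrite gt_eqF.
Qed.

Let cdropr b : b < 1 -> {within `[0, b], continuous (dropr N s F)}.
Proof. exact: dropr_continuous. Qed.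

Lemma is_derive_dropr_coord x i : B1 x ->
  is_derive x (e_ i) (fun y => dropr N s F (enorm y) * y ord0 i)
    (dropr N s F (enorm x) + x ord0 i ^+ 2 / enorm x ^+ 2 * dropr_slope (enorm x)).
Proof.
move=> xB; have [->|x0] := eqVneq x 0.
  rewrite mxE expr0n/= !mul0r addr0 enorm0.
  apply: is_derive_radial_coord0.
  have h0 : 0 <= 2^-1 :> R by lra.
  have h1 : 2^-1 < 1 :> R by lra.
  have cc := cont_comp_clamp h0 (cdropr h1).
  have cn : {for 0, continuous (fun h : R => dropr N s F (clamp 2^-1 `|h|))}.
    by apply: (@for_comp R _ (fun h : R => `|h|) (fun r => dropr N s F (clamp 2^-1 r))); [exact: norm_continuous|exact: cc].
  have h2 : 0 < 2^-1 :> R by lra.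
    by apply: for_near cn; apply: filterS (nbhs0_lt h2) => h hh; rewrite clampE// normr_ge0 ltW.
have r01 : 0 < enorm x < 1 by rewrite enorm_gt0 x0.
have h1 := is_derive_radial i x0 (is_derive_dropr r01).
have h2 : is_derive x (e_ i) (fun y : 'rV[R]_N.+1 => y ord0 i) 1.
  apply/is_derive_toline; rewrite (_ : (fun h : R => _) = (fun h => h + x ord0 i)); last first.
    by apply/funext => h; rewrite !mxE !eqxx mulr1.
  have := is_derive1D (is_derive_id (0 : R) (1 : R)) (is_derive_cst (x ord0 i) (0 : R) (1 : R)).
  by rewrite addr0.
have h := is_deriveV_mul h1 h2.
apply: is_derive_eq h _; move: r01 => /andP[+ _].
move: (enorm x) (x ord0 i) => r y r0.
by rewrite mulr1 addrC; congr (_ + _); field; rewrite gt_eqF.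
Qed.

Let cV : continuous V. Proof. exact: cont_resolvent. Qed.
Let cVe : continuous (fun y => V (enorm y)).
Proof. exact: (@cont_comp _ _ _ enorm V (@cont_enorm R N.+1) cV). Qed.
Let cFe : continuous (fun y => F (enorm y)).
Proof. exact: (@cont_comp _ _ _ enorm F (@cont_enorm R N.+1) cF). Qed.

Let cdrope x : B1 x -> {for x, continuous (fun y => dropr N s F (enorm y))}.
Proof. by move=> xB; apply: cont_radial => //; exact: cdropr. Qed.

Lemma cont_dropr_slope x : B1 x -> {for x, continuous (fun y => dropr_slope (enorm y))}.
Proof.
move=> xB; rewrite /dropr_slope.
apply: (@for_add R _ (fun y => s * (F (enorm y) - V (enorm y))) (fun y => - (N.+1%:R * dropr N s F (enorm y)))).
  apply: (@for_mul R _ (cst s) (fun y => F (enorm y) - V (enorm y))); first exact: cst_continuous.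
  by apply: (@for_add R _ (fun y => F (enorm y)) (fun y => - V (enorm y))); [exact: cFe|apply: for_opp; exact: cVe].
apply: for_opp; apply: (@for_mul R _ (cst N.+1%:R) (fun y => dropr N s F (enorm y))); first exact: cst_continuous.
exact: cdrope.
Qed.

Lemma cont_dropr_slope_coord x i : B1 x ->
  {for x, continuous (fun y : 'rV[R]_N.+1 => y ord0 i ^+ 2 / enorm y ^+ 2 * dropr_slope (enorm y))}.
Proof.
move=> xB; have cs := cont_dropr_slope xB; have [x0|x0] := eqVneq x 0; last first.
  apply: (@for_mul R _ (fun y : 'rV[R]_N.+1 => y ord0 i ^+ 2 / enorm y ^+ 2) (fun y => dropr_slope (enorm y))) => //.
  have ce : {for x, continuous enorm} by exact: cont_enorm.
  apply: (@for_mul R _ (fun y : 'rV[R]_N.+1 => y ord0 i ^+ 2) (fun y => (enorm y ^+ 2)^-1)).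
    by apply: (@for_mul R _ (fun y : 'rV[R]_N.+1 => y ord0 i) (fun y : 'rV[R]_N.+1 => y ord0 i)); exact: cont_coord.
  apply: (@for_inv R _ (fun y => enorm y ^+ 2)); last exact: (for_mul ce ce).
  by rewrite expf_neq0// enorm_eq0.
apply: (@for_squeeze R _ _ (fun y => `|dropr_slope (enorm y)|)) => [y||].
- rewrite normrM ler_piMl//.
  have [->|y0] := eqVneq y 0; first by rewrite mxE expr0n/= mul0r normr0.
  have e0 : 0 < enorm y by rewrite enorm_gt0.
  rewrite normrM normfV !normrX ler_pdivrMr ?mul1r; last by rewrite exprn_gt0// normr_gt0 gt_eqF.
  rewrite lerXn2r ?nnegrE ?normr_ge0// (ger0_norm (ltW e0)).
  exact: coord_le_enorm.
- by rewrite x0 enorm0 dropr_slope0 normr0.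
- by apply: (@for_comp R _ (fun y => dropr_slope (enorm y)) (fun z : R => `|z|)) => //; exact: norm_continuous.
Qed.

(** g is phi times the Laplacian of T(V) minus T(V) times the Laplacian of phi, a divergence. T
    vanishes on small values, hence T(V) vanishes near the sphere, where phi is only known to be
    continuous. *)
Lemma green (phi : 'rV[R]_N.+1 -> R) (mu : R) (T T1 T2 : R -> R) del :
  Ck 2 B1 phi -> (forall x, B1 x -> - laplacian phi x = mu * phi x) -> 0 < del ->
  (forall v : R, 0 < v -> is_derive v (1 : R) T (T1 v)) ->
  (forall v : R, 0 < v -> is_derive v (1 : R) T1 (T2 v)) ->
  (forall v : R, 0 < v -> {for v, continuous T2}) ->
  (forall v, v <= del -> T v = 0 /\ T1 v = 0) ->
  let g x := phi x * (T2 (V (enorm x)) * drop N s F (enorm x) ^+ 2 +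
      T1 (V (enorm x)) * (s * (V (enorm x) - F (enorm x)))) + mu * T (V (enorm x)) * phi x in
  leb.-integrable B1 (EFin \o g) /\ \int[leb]_(x in B1) g x = 0.
Proof.
move=> phi2 lap_phi del0 dT dT1 cT2 T0 g.
pose K := cB1 `&` [set x | del <= V (enorm x)].
have kK : compact K by exact: compact_level.
have KB : K `<=` B1.
  move=> x [/= x1 xV]; rewrite /Defs.B1/= lt_neqAle x1 andbT; apply/eqP => e1.
  move: xV; rewrite e1 resolvent_ge1; last by rewrite normr1.
  by rewrite leNgt del0.
have V0 x : B1 x -> 0 < V (enorm x) by move=> xB; apply: resolvent_gt0 => //; rewrite enorm_ge0.
pose d i x := phi x * (T2 (V (enorm x)) * (dropr N s F (enorm x) * x ord0 i) ^+ 2 -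
   T1 (V (enorm x)) * (dropr N s F (enorm x) + x ord0 i ^+ 2 / enorm x ^+ 2 * dropr_slope (enorm x))) -
   T (V (enorm x)) * partial i (partial i phi) x.
pose G i x := phi x * (T1 (V (enorm x)) * - (dropr N s F (enorm x) * x ord0 i)) +
   - (T (V (enorm x)) * partial i phi x).
have cT v : 0 < v -> {for v, continuous T} by move=> v0; exact: derive_cont (dT v v0).
have cT1 v : 0 < v -> {for v, continuous T1} by move=> v0; exact: derive_cont (dT1 v v0).
have [cphi0 phi1] := phi2.
have D i : leb.-integrable B1 (EFin \o d i) /\ \int[leb]_(x in B1) d i x = 0.
  have [dphi [_ ddphi]] := phi1 i; have [d2phi [c2phi _]] := ddphi i.
  have Dphi x : B1 x -> is_derive x (e_ i) phi (partial i phi x).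
    by move=> xB; apply: DeriveDef => //; exact: dphi.
  have DDphi x : B1 x -> is_derive x (e_ i) (partial i phi) (partial i (partial i phi) x).
    by move=> xB; apply: DeriveDef => //; exact: d2phi.
  apply: (@integral_partial_compact R N.+1 i K (G i) (d i)) => // x xB.
  - have v0 := V0 x xB; have dV := is_derive_V_enorm i xB.
    have a := is_deriveV_mul (@is_deriveV_comp R _ T1 (fun y => V (enorm y)) x (e_ i) _ _ (dT1 _ v0) dV) (is_deriveV_opp (is_derive_dropr_coord i xB)).
    have b := is_deriveV_mul (@is_deriveV_comp R _ T (fun y => V (enorm y)) x (e_ i) _ _ (dT _ v0) dV) (DDphi x xB).
    have c := is_deriveV_add (is_deriveV_mul (Dphi x xB) a) (is_deriveV_opp b).
    apply: is_derive_eq c _; rewrite /d.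
    move: (x ord0 i ^+ 2 / enorm x ^+ 2) (dropr_slope (enorm x)) => q q'.
    move: (T2 _) (T1 _) (T _) (dropr N s F _) (phi x) (partial i phi x) (partial i _ x) (x ord0 i).
    by move=> *; ring.
  - have v0 := V0 x xB; have cx : {for x, continuous (fun y => V (enorm y))} := @cVe x.
    have cD : {for x, continuous (fun y : 'rV[R]_N.+1 => dropr N s F (enorm y) * y ord0 i)}.
      by apply: (@for_mul R _ (fun y => dropr N s F (enorm y)) (fun y => y ord0 i)); [exact: cdrope|exact: cont_coord].
    have cphi := cphi0 x xB; have c2 := c2phi x xB.
    have k2 := @for_comp R _ (fun y => V (enorm y)) T2 x cx (cT2 _ v0); have k1 := @for_comp R _ (fun y => V (enorm y)) T1 x cx (cT1 _ v0); have k0 := @for_comp R _ (fun y => V (enorm y)) T x cx (cT _ v0).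
    have ks := for_add (cdrope xB) (@cont_dropr_slope_coord x i xB).
    exact: (for_add (for_mul cphi (for_add (for_mul k2 (for_mul cD cD)) (for_opp (for_mul k1 ks)))) (for_opp (for_mul k0 c2))).
  - move=> xK; have vd : V (enorm x) <= del.
      by rewrite leNgt; apply/negP => h; apply: xK; split; [exact: B1_cB1|exact: ltW].
    by have [t0 t1] := T0 _ vd; rewrite /G t0 t1 !mul0r mulr0 oppr0 addr0.
have gE x : B1 x -> g x = \sum_i d i x.
  move=> xB; rewrite /g /d big_split /= -mulr_sumr sumrN -mulr_sumr big_split /= -mulr_sumr sumrN -mulr_sumr big_split/=.
  rewrite -mulr_suml -mulr_suml sumr_const card_ord.
  under [\sum_i (_ * _) ^+ 2]eq_bigr do rewrite exprMn.
  rewrite -mulr_sumr -sqr_enorm (dropE N s F).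
  have L : \sum_i partial i (partial i phi) x = - (mu * phi x) by rewrite -lap_phi// opprK.
  rewrite L.
  have -> : enorm x ^+ 2 / enorm x ^+ 2 * dropr_slope (enorm x) = dropr_slope (enorm x).
    have [->|x0] := eqVneq x 0; first by rewrite enorm0 dropr_slope0 mulr0.
    by rewrite mulfV ?mul1r// expf_neq0// enorm_eq0.
  rewrite /dropr_slope -[_ *+ N.+1]mulr_natl.
  move: (enorm x) (N.+1%:R : R) (phi x) (F (enorm x)) (V (enorm x)) (dropr N s F (enorm x)) (T (V (enorm x))) (T1 (V (enorm x))) (T2 (V (enorm x))).
  by move=> *; ring.
have isum : leb.-integrable B1 (fun x => (\sum_i d i x)%:E).
  under eq_fun do rewrite -sumEFin.
  apply: (@integrable_sum _ _ _ leb B1 (@measurable_B1 R N.+1) _ _ xpredT (fun i x => (d i x)%:E)).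
  by move=> i _; case: (D i).
split.
  apply: (eq_integrable (@measurable_B1 R N.+1) _ _ _ isum) => x; rewrite inE => xB.
  by rewrite /= gE.
transitivity (\int[leb]_(x in B1) \sum_i d i x).
  by apply: eq_Rintegral => x; rewrite inE; exact: gE.
rewrite /Rintegral; under eq_integral do rewrite -sumEFin.
have mB := @measurable_B1 R N.+1.
rewrite integral_sum//; last by move=> i; case: (D i).
rewrite big1// => i _; have [i1 i2] := D i.
by rewrite -(fineK (integrable_fin_num mB i1)); congr EFin.
Qed.

Lemma Ck_one : Ck 2 B1 (fun _ : 'rV[R]_N.+1 => 1 : R) /\ forall x, laplacian (fun _ : 'rV[R]_N.+1 => 1 : R) x = 0.
Proof.
have p (c : R) i : partial i (fun _ : 'rV[R]_N.+1 => c) = fun _ => 0.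
  by apply/funext => x; exact: (@derive_val _ _ _ _ _ _ _ (is_derive_cst c x (delta_mx ord0 i))).
have d (c : R) i (x : 'rV[R]_N.+1) : derivable (fun _ : 'rV[R]_N.+1 => c) x (delta_mx ord0 i).
  exact: derivable_cst.
have k (c : R) (x : 'rV[R]_N.+1) : {for x, continuous (fun _ : 'rV[R]_N.+1 => c)} by exact: cst_continuous.
split; last by move=> x; rewrite /laplacian big1// => i _; rewrite !p.
split=> // i; split=> //; rewrite p; split=> // j; split=> //; rewrite p; split=> //.
Qed.

(** Green's formula with truncations at level 1/(j+1). The extra term E_j, the product of [trunc2]
    at V with the squared gradient of V, need not vanish in the mean; but it is nonnegative, has
    bounded integral and concentrates at the sphere, where phi vanishes. *)
Lemma resolvent_coef (phi : 'rV[R]_N.+1 -> R) mu : dirichlet_eigenfun phi mu ->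
  (s + mu) * \int[leb]_(x in B1) (V (enorm x) * phi x) = s * \int[leb]_(x in B1) (F (enorm x) * phi x).
Proof.
move=> [phi2 cphi phi0 lap].
have [p cp pE] := extend_cB1 cphi.
have mB := @measurable_B1 R N.+1.
have pB x : x \in B1 -> phi x = p x by rewrite inE => /B1_cB1/pE.
have -> : \int[leb]_(x in B1) (V (enorm x) * phi x) = \int[leb]_(x in B1) (V (enorm x) * p x).
  by apply: eq_Rintegral => x /pB ->.
have -> : \int[leb]_(x in B1) (F (enorm x) * phi x) = \int[leb]_(x in B1) (F (enorm x) * p x).
  by apply: eq_Rintegral => x /pB ->.
have F_pos q : 0 <= q <= 1 -> 0 <= F q by move=> /F_gt0/ltW.
have [M hM] := F_bounded cF.
have M0 : 0 <= M by apply: le_trans (F_pos 0 _) (hM 0 _); rewrite lexx ler01.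
have V0 x : B1 x -> 0 < V (enorm x) by move=> xB; apply: resolvent_gt0 => //; rewrite enorm_ge0.
have Vge0 r : 0 <= V r by exact: resolvent_ge0.
have VM r : V r <= M by exact: resolvent_le.
have dropM x : B1 x -> 0 <= drop N s F (enorm x) ^+ 2 <= (M * s) ^+ 2.
  move=> xB; have r01 : 0 <= enorm x <= 1 by rewrite enorm_ge0; exact: B1_cB1.
  have d0 := drop_ge0 N_gt0 s_gt0 cF F_pos F_ni r01.
  have d1 := drop_le N_gt0 s_gt0 cF F_pos hM r01.
  rewrite sqr_ge0 lerXn2r// ?nnegrE// ?mulr_ge0// ?(ltW s_gt0)//.
  apply: le_trans d1 _; rewrite ler_piMr// ?mulr_ge0// ?(ltW s_gt0)//.
  by case/andP: r01.
pose b := fine (leb B1).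
have b0 : 0 <= b by apply: fine_ge0.
have intc (c : R) : \int[leb]_(x in B1) c = c * b by rewrite Rintegral_cst.
pose A (j : nat) x := trunc1 (harmonic j) (V (enorm x)) * (s * (V (enorm x) - F (enorm x))).
pose E (j : nat) x := trunc2 (harmonic j) (V (enorm x)) * drop N s F (enorm x) ^+ 2.
pose B (j : nat) x := A j x * p x + mu * trunc (harmonic j) (V (enorm x)) * p x.
have h0 j : 0 < harmonic j :> R by rewrite /harmonic/= invr_gt0 ltr0n.
have cA j : continuous (A j).
  apply: (@contM _ _ (fun x => trunc1 (harmonic j) (V (enorm x))) (fun x => s * (V (enorm x) - F (enorm x)))).
    exact: (@cont_comp _ _ _ (fun y => V (enorm y)) (trunc1 (harmonic j)) cVe (cont_trunc1 (h0 j))).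
  apply: (@contM _ _ (cst s) (fun x => V (enorm x) - F (enorm x))); first exact: cst_continuous.
  exact: (@contB _ _ (fun x => V (enorm x)) (fun x => F (enorm x))).
have cB j : continuous (B j).
  apply: (@contD _ _ (fun x => A j x * p x) (fun x => mu * trunc (harmonic j) (V (enorm x)) * p x)).
    exact: (@contM _ _ (A j) p).
  apply: (@contM _ _ (fun x => mu * trunc (harmonic j) (V (enorm x))) p) => //.
  apply: (@contM _ _ (cst mu) (fun x => trunc (harmonic j) (V (enorm x)))); first exact: cst_continuous.
  exact: (@cont_comp _ _ _ (fun y => V (enorm y)) (trunc (harmonic j)) cVe (cont_trunc (h0 j))).
have AC j x : B1 x -> `|A j x| <= s * M.
  move=> xB; have /andP[t0 t1] := trunc1_itv (h0 j) (Vge0 (enorm x)).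
  have r01 : 0 <= enorm x <= 1 by rewrite enorm_ge0; exact: B1_cB1.
  rewrite /A normrM (ger0_norm t0); apply: (@le_trans _ _ (1 * `|s * (V (enorm x) - F (enorm x))|)).
    by rewrite ler_wpM2r.
  rewrite mul1r normrM (ger0_norm (ltW s_gt0)) ler_wpM2l ?(ltW s_gt0)//.
  have := Vge0 (enorm x); have := VM (enorm x); have := F_pos _ r01; have := hM _ r01.
  by rewrite ler_norml; move: (V _) (F _) => u v *; apply/andP; split; lra.
have G (f : 'rV[R]_N.+1 -> R) nu : Ck 2 B1 f -> (forall x, B1 x -> - laplacian f x = nu * f x) -> forall j,
    let g x := f x * (E j x + A j x) + nu * trunc (harmonic j) (V (enorm x)) * f x in
    leb.-integrable B1 (EFin \o g) /\ \int[leb]_(x in B1) g x = 0.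
  move=> f2 lf j.
  exact: (@green f nu (trunc (harmonic j)) (trunc1 (harmonic j)) (trunc2 (harmonic j)) (harmonic j) f2 lf (h0 j)
    (fun v => @is_derive_trunc R (harmonic j) v) (fun v => @is_derive_trunc1 R (harmonic j) v)
    (fun v => @cont_trunc2 R (harmonic j) v) (fun v => @trunc_le0 R (harmonic j) v)).
have [one2 lap1] := Ck_one.
have lap1' x : B1 x -> - laplacian (fun _ : 'rV[R]_N.+1 => 1 : R) x = 0 * 1 by move=> _; rewrite lap1 oppr0 mul0r.
(* Green's formula with the constant 1 in place of phi, whose Laplacian is 0, bounds the integral of
   E_j uniformly in j. *)
have EI j : leb.-integrable B1 (EFin \o E j) /\ \int[leb]_(x in B1) E j x <= s * M * b.
  have [i1 I1] := G _ _ one2 lap1' j.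
  have iA := integrable_B1 (cA j).
  have iE : leb.-integrable B1 (EFin \o E j).
    apply: (eq_integrable mB _ _ _ (integrableB mB i1 iA)) => x _ /=.
    by rewrite -EFinB; congr EFin; ring.
  split=> //; have : \int[leb]_(x in B1) E j x + \int[leb]_(x in B1) A j x = 0.
    by rewrite -I1 -(RintegralD mB iE iA); apply: eq_Rintegral => x _; ring.
  move=> /eqP; rewrite addr_eq0 => /eqP ->; rewrite -intc.
  rewrite -mulN1r -(RintegralZl (-1) mB iA).
  apply: le_Rintegral => //.
  - by apply: (eq_integrable mB _ _ _ (integrableZl mB (-1) iA)) => x _.
  - by apply: integrable_B1; exact: cst_continuous.
  - by move=> x xB; have := AC j x xB; rewrite ler_norml mulN1r => /andP[]; lra.
have IB j : (\int[leb]_(x in B1) B j x = - (\int[leb]_(x in B1) (E j x * p x))) /\ leb.-integrable B1 (fun x => (E j x * p x)%:E).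
  have [i1 I1] := G _ _ phi2 lap j; have iB := integrable_B1 (cB j).
  have iE : leb.-integrable B1 (fun x => (E j x * p x)%:E).
    apply: (eq_integrable mB _ _ _ (integrableB mB i1 iB)) => x /pB h /=.
    by rewrite -EFinB h /B; congr EFin; ring.
  split=> //; apply/eqP; rewrite -addr_eq0; apply/eqP; rewrite -I1 -(RintegralD mB iB iE).
  by apply: eq_Rintegral => x /pB ->; rewrite /B; ring.
pose L x := s * (V (enorm x) - F (enorm x)) * p x + mu * V (enorm x) * p x.
have [P P0 hP] := bounded_cB1 cp.
have cvgB : (fun j => \int[leb]_(x in B1) B j x) @ \oo --> \int[leb]_(x in B1) L x.
  apply: (@cvg_Rintegral _ _ _ leb B1 _ _ (fun=> s * M * P + `|mu| * M * P)) => //.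
  - by move=> j; apply: measurable_funTS; exact: cont_measurable_rV.
  - move=> x xB; have [t0 t1] := trunc_cvg (V0 x xB); rewrite /B /A /L.
    apply: cvgD; apply: cvgM; try exact: cvg_cst.
      rewrite -[X in _ --> X]mul1r; apply: cvgM => //; exact: cvg_cst.
    by apply: cvgM => //; exact: cvg_cst.
  - by apply: integrable_B1; exact: cst_continuous.
  - move=> j x xB; rewrite /B (le_trans (ler_normD _ _))// lerD//.
      by rewrite normrM ler_pM// ?AC// hP//; exact: B1_cB1.
    have /andP[t0 t1] := trunc_itv (h0 j) (Vge0 (enorm x)).
    have t2 : `|trunc (harmonic j) (V (enorm x))| <= M by rewrite (ger0_norm t0); exact: le_trans t1 (VM _).
    rewrite (normrM _ (p x)) (normrM mu); apply: ler_pM => //.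
      by rewrite ler_wpM2l.
    by apply: hP; exact: B1_cB1.
(* Where V < eta, |p| is at most w; where V >= eta, E_j is of order 1/(j+1)^2 by [trunc2_le]. *)
have small w : 0 < w -> `|\int[leb]_(x in B1) L x| <= w * (s * M * b).
  move=> w0.
  have [eta eta0 heta] : exists2 eta, 0 < eta & forall x, B1 x -> V (enorm x) < eta -> `|p x| <= w.
    pose Kw := cB1 `&` [set x | w <= `|p x|].
    have cnp : continuous (fun x => `|p x|).
      by apply: (@cont_comp _ _ _ p (fun y : R => `|y|) cp); exact: norm_continuous.
    have kK : compact Kw by exact: compact_level.
    have [K0|/set0P/negP/negPn/eqP K0] := pselect (Kw !=set0).
      have [c cK hc] := compact_EVT_min K0 kK (contW cVe).
      rewrite inE in cK; case: cK => c1 cw.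
      have cB1' : B1 c.
        rewrite /Defs.B1/= lt_neqAle c1 andbT; apply/eqP => e1.
        by move: cw; rewrite /= pE// phi0// normr0; lra.
      exists (V (enorm c)) => [|x xB xV]; first exact: V0.
      rewrite leNgt; apply/negP => wx; move: xV; rewrite ltNge => /negP; apply.
      by apply: hc; rewrite inE; split; [exact: B1_cB1|exact: ltW].
    exists 1 => // x xB _; rewrite leNgt; apply/negP => wx.
    suff : Kw x by rewrite K0.
    by split; [exact: B1_cB1|exact: ltW].
  have cl : (fun j => w * (s * M * b) + P * (6 * (harmonic j * harmonic j) / eta ^+ 3 * (M * s) ^+ 2) * b) @ \oo --> w * (s * M * b).
    rewrite -[X in _ --> X]addr0; apply: cvgD; first exact: cvg_cst.
    rewrite (_ : 0 = P * (6 * (0 * 0) / eta ^+ 3 * (M * s) ^+ 2) * b); last by rewrite !(mulr0, mul0r).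
    do ! (apply: cvgM; try exact: cvg_cst); exact: cvg_harmonic.
  have cn : (fun j => `|\int[leb]_(x in B1) B j x|) @ \oo --> `|\int[leb]_(x in B1) L x| by exact: cvg_norm cvgB.
  apply: (ler_cvg_to cn cl); near=> j.
  have [-> iEp] := IB j; have [iE IE] := EI j; rewrite normrN.
  apply: (@le_trans _ _ (\int[leb]_(x in B1) (w * E j x + P * (6 * (harmonic j * harmonic j) / eta ^+ 3 * (M * s) ^+ 2)))).
    have iR : leb.-integrable B1 (fun x => (w * E j x + P * (6 * (harmonic j * harmonic j) / eta ^+ 3 * (M * s) ^+ 2))%:E).
      have ic : leb.-integrable B1 (EFin \o cst (P * (6 * (harmonic j * harmonic j) / eta ^+ 3 * (M * s) ^+ 2))).
        by apply: integrable_B1; exact: cst_continuous.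
      by apply: (eq_integrable mB _ _ _ (integrableD mB (integrableZl mB w iE) ic)) => x _.
    apply: le_trans (le_normr_Rintegral mB iEp) _; apply: le_Rintegral => //.
      by apply: (eq_integrable mB _ _ _ (integrable_norm iEp)) => x _.
    move=> x xB; have e0 : 0 <= E j x by apply: mulr_ge0; [exact: trunc2_ge0|case/andP: (dropM x xB)].
    rewrite normrM (ger0_norm e0).
    have c0 : 0 <= 6 * (harmonic j * harmonic j) / eta ^+ 3 * (M * s) ^+ 2.
      apply: mulr_ge0; last exact: sqr_ge0.
      by rewrite divr_ge0 ?exprn_ge0 ?(ltW eta0)// !mulr_ge0// ltW.
    have [ve|ve] := ltP (V (enorm x)) eta.
      have := heta x xB ve => hw; apply: (@le_trans _ _ (w * E j x)); last by rewrite lerDl; exact: mulr_ge0 (ltW P0) c0.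
      by rewrite mulrC ler_wpM2r.
    apply: (@le_trans _ _ (P * (6 * (harmonic j * harmonic j) / eta ^+ 3 * (M * s) ^+ 2))); last first.
      by rewrite lerDr; apply: mulr_ge0 => //; exact: ltW.
    rewrite mulrC; apply: ler_pM => //; first by apply: hP; exact: B1_cB1.
    have /andP[d0 d1] := dropM x xB.
    by apply: ler_pM => //; [exact: trunc2_ge0|rewrite -expr2; exact: trunc2_le].
  rewrite RintegralD//; last 2 first.
  - exact: (integrableZl mB w iE).
  - by apply: integrable_B1; exact: cst_continuous.
  by rewrite RintegralZl// intc lerD2r ler_wpM2l// ltW.
have L0 : \int[leb]_(x in B1) L x = 0.
  apply/eqP; rewrite -normr_le0; apply/ler_addgt0Pr => e e0; rewrite add0r.
  have c0 : 0 <= s * M * b by rewrite !mulr_ge0// ltW.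
  apply: le_trans (small (e / (s * M * b + 1)) _) _; first by rewrite divr_gt0//; lra.
  rewrite mulrAC ler_pdivrMr; last lra.
  by rewrite ler_pM2l//; lra.
have cVp : continuous (fun x => V (enorm x) * p x) by exact: (@contM _ _ (fun x => V (enorm x)) p).
have cFp : continuous (fun x => F (enorm x) * p x) by exact: (@contM _ _ (fun x => F (enorm x)) p).
have iV := integrable_B1 cVp; have iF := integrable_B1 cFp.
apply/eqP; rewrite -subr_eq0; apply/eqP; rewrite -L0.
rewrite -(RintegralZl (s + mu) mB iV) -(RintegralZl s mB iF).
rewrite -(RintegralB mB (integrableZl mB (s + mu) iV) (integrableZl mB s iF)).
by apply: eq_Rintegral => x _; rewrite /L; ring.
Unshelve. all: by end_near. Qed.

End green.

(** * Square-integrable functions and eigenfunction expansions *)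

Section square_integrable.
Variables (R : realType) (n : nat).
Local Notation leb := (lebesgue_rV R n).
Local Notation B1 := (@B1 R n).
Local Notation "'I[' u ]" := (\int[leb]_(x in B1) u x) (at level 0, u at level 200).
Implicit Types (u v : 'rV[R]_n -> R).

Let mB : measurable B1 := @measurable_B1 R n.

Lemma L2_measurable u : L2 u -> measurable_fun B1 u. Proof. by case. Qed.

Lemma L2_integrable_sqr u : L2 u -> leb.-integrable B1 (fun x => (u x ^+ 2)%:E).
Proof.
move=> [mu iu]; apply/integrableP; split.
  by apply/measurable_EFinP; exact: (measurable_funX 2).
apply: le_lt_trans iu; apply: eq_leW.
by apply: eq_integral => x _; rewrite /= ger0_norm// sqr_ge0.
Qed.

Lemma integrable_sqr_L2 u : measurable_fun B1 u -> leb.-integrable B1 (fun x => (u x ^+ 2)%:E) -> L2 u.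
Proof.
move=> mu /integrableP[_ iu]; split=> //.
apply: le_lt_trans iu; apply: eq_leW.
by apply: eq_integral => x _; rewrite /= ger0_norm// sqr_ge0.
Qed.

Lemma L2_mul u v : L2 u -> L2 v -> leb.-integrable B1 (fun x => (u x * v x)%:E).
Proof.
move=> hu hv; have mu := L2_measurable hu; have mv := L2_measurable hv.
apply: (le_integrable mB _ _ (integrableD mB (L2_integrable_sqr hu) (L2_integrable_sqr hv))).
  by apply/measurable_EFinP; exact: measurable_funM.
move=> x _; rewrite -EFinD /= lee_fin normrM [leRHS]ger0_norm ?addr_ge0 ?sqr_ge0//.
by rewrite -(real_normK (num_real (u x))) -(real_normK (num_real (v x))); nra.
Qed.

Lemma L2_lin a b u v : L2 u -> L2 v -> L2 (fun x => a * u x + b * v x).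
Proof.
move=> hu hv; have mu := L2_measurable hu; have mv := L2_measurable hv.
have m : measurable_fun B1 (fun x => a * u x + b * v x).
  by apply: measurable_funD; apply: measurable_funM => //; exact: measurable_cst.
apply: integrable_sqr_L2 => //.
have i1 := integrableZl mB (a ^+ 2) (L2_integrable_sqr hu).
have i2 := integrableZl mB (b ^+ 2) (L2_integrable_sqr hv).
have i3 := integrableZl mB (2 * a * b) (L2_mul hu hv).
apply: (eq_integrable mB _ _ _ (integrableD mB (integrableD mB i1 i2) i3)) => x _ /=.
by rewrite -!EFinM -!EFinD; congr EFin; ring.
Qed.

Lemma L2_bounded u M : measurable_fun B1 u -> (forall x, B1 x -> `|u x| <= M) -> L2 u.
Proof.
move=> mu hM; apply: integrable_sqr_L2 => //.
apply: (@integrable_fin_mul _ _ _ _ _ (fun x => u x ^+ 2) (M ^+ 2)) => //.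
- exact: B1_lty.
- exact: (measurable_funX 2).
- by move=> x xB; rewrite normrX lerXn2r// ?nnegrE// ?hM// (le_trans (normr_ge0 _) (hM x xB)).
Qed.

Lemma L2_continuous u : continuous u -> L2 u.
Proof.
move=> cu; have [M _ hM] := bounded_cB1 cu; apply: (@L2_bounded _ M).
  by apply: measurable_funTS; exact: cont_measurable_rV.
by move=> x /B1_cB1; exact: hM.
Qed.

Lemma L2_sum (c : nat -> R) (e : nat -> 'rV[R]_n -> R) (r : seq nat) : (forall k, L2 (e k)) ->
  L2 (fun x => \sum_(k <- r) c k * e k x).
Proof.
move=> he; elim: r => [|k r IH].
  by under eq_fun do rewrite big_nil; apply: L2_continuous; exact: cst_continuous.
rewrite (_ : (fun x => _) = (fun x => c k * e k x + 1 * \sum_(j <- r) c j * e j x)).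
  exact: L2_lin.
by apply/funext => x; rewrite big_cons mul1r.
Qed.

Lemma Rintegral_lin a b u v : leb.-integrable B1 (EFin \o u) -> leb.-integrable B1 (EFin \o v) ->
  \int[leb]_(x in B1) (a * u x + b * v x) = a * I[u] + b * I[v].
Proof.
move=> iu iv; rewrite RintegralD//; try by [exact: (integrableZl mB a iu)|exact: (integrableZl mB b iv)].
by rewrite !RintegralZl.
Qed.

Lemma L2_inner_sum (c : nat -> R) (e : nat -> 'rV[R]_n -> R) (r : seq nat) v : (forall k, L2 (e k)) -> L2 v ->
  \int[leb]_(x in B1) ((\sum_(k <- r) c k * e k x) * v x) = \sum_(k <- r) c k * \int[leb]_(x in B1) (e k x * v x).
Proof.
move=> he hv; elim: r => [|k r IH].
  by rewrite big_nil; under eq_Rintegral do rewrite big_nil mul0r; rewrite Rintegral_cst// mul0r.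
rewrite big_cons -IH -[X in _ + X]mul1r.
rewrite -(@Rintegral_lin _ _ (fun x => e k x * v x) (fun x => (\sum_(j <- r) c j * e j x) * v x)).
- by apply: eq_Rintegral => x _; rewrite big_cons; ring.
- exact: L2_mul.
- by apply: L2_mul => //; exact: L2_sum.
Qed.

Lemma L2_young t u v : 0 < t -> L2 u -> L2 v ->
  `|\int[leb]_(x in B1) (u x * v x)| <= t * \int[leb]_(x in B1) (u x ^+ 2) + t^-1 * \int[leb]_(x in B1) (v x ^+ 2).
Proof.
move=> t0 hu hv; have iuv := L2_mul hu hv.
rewrite -(@Rintegral_lin _ _ (fun x => u x ^+ 2) (fun x => v x ^+ 2)); [|exact: L2_integrable_sqr|exact: L2_integrable_sqr].
apply: le_trans (le_normr_Rintegral mB iuv) _; apply: le_Rintegral => //.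
- by apply: (eq_integrable mB _ _ _ (integrable_norm iuv)) => x _.
- apply: (eq_integrable mB _ _ _ (integrableD mB (integrableZl mB t (L2_integrable_sqr hu)) (integrableZl mB t^-1 (L2_integrable_sqr hv)))) => x _ /=.
  by rewrite -!EFinM -EFinD.
move=> x _; rewrite normrM -(real_normK (num_real (u x))) -(real_normK (num_real (v x))).
move: (normr_ge0 (u x)) (normr_ge0 (v x)); move: (`|u x|) (`|v x|) => a b a0 b0.
rewrite -(ler_pM2l t0) mulrDr [leRHS](_ : _ = (t * a) ^+ 2 + b ^+ 2); last by field; rewrite gt_eqF.
by have := mulr_ge0 a0 b0; have := mulr_ge0 (ltW t0) a0; nra.
Qed.

Lemma L2_sqr_ge0 u : 0 <= \int[leb]_(x in B1) (u x ^+ 2).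
Proof. by apply: Rintegral_ge0 => x _; exact: sqr_ge0. Qed.

Section basis.
Variable phi : nat -> 'rV[R]_n -> R.
Hypothesis onb : orthonormal_basis phi.
Local Notation coef := (coef phi).
Local Notation L2 := (@L2 R n).

Let L2phi k : L2 (phi k). Proof. by case: onb. Qed.

Definition eigen_sum N u x := \sum_(0 <= k < N) coef u k * phi k x.

Lemma L2_eigen_sum N u : L2 (eigen_sum N u). Proof. exact: L2_sum. Qed.

Lemma coef_lin a b u v k : L2 u -> L2 v -> coef (fun x => a * u x + b * v x) k = a * coef u k + b * coef v k.
Proof.
move=> hu hv; rewrite /Defs.coef -(@Rintegral_lin _ _ (fun x => u x * phi k x) (fun x => v x * phi k x)).
- by apply: eq_Rintegral => x _; ring.
- exact: L2_mul.
- exact: L2_mul.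
Qed.

Lemma coef_sum (c : nat -> R) N k :
  coef (fun x => \sum_(0 <= j < N) c j * phi j x) k = if (k < N)%N then c k else 0.
Proof.
rewrite /Defs.coef L2_inner_sum//; case: onb => _ o _.
under eq_bigr do rewrite -/(Defs.coef phi _ k) o.
case: ifPn => kN.
  rewrite (big_rem k) ?mem_index_iota//= eqxx mulr1 big_seq big1 ?addr0// => j.
  by rewrite mem_rem_uniq ?iota_uniq// inE => /andP[/negPf -> _]; rewrite mulr0.
rewrite big_seq big1// => j; rewrite mem_index_iota /= => jN.
by have [jk|] := eqVneq j k; rewrite ?mulr0//; move: kN; rewrite -jk jN.
Qed.

Lemma cvg_eigen_sum u : L2 u -> (fun N => \int[leb]_(x in B1) ((u x - eigen_sum N u x) ^+ 2)) @ \oo --> (0 : R).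
Proof.
move=> hu; case: onb => _ _ /(_ _ hu) h; rewrite -[X in _ --> X]/(fine 0%E).
have e N : \int[leb]_(x in B1) ((u x - eigen_sum N u x) ^+ 2) =
    fine (\int[leb]_(x in B1) ((u x - \sum_(k < N) coef u k * phi k x) ^+ 2)%:E).
  by rewrite /Rintegral; congr fine; apply: eq_integral => x _; rewrite /eigen_sum big_mkord.
by under eq_fun do rewrite e; apply: fine_cvg.
Qed.

(** A substitute for Cauchy-Schwarz: t is taken large according to the tolerance, and only then does
    a tend to 0. *)
Lemma cvg_young (a b : nat -> R) (c : R) : (forall j t, 0 < t -> `|b j| <= t * a j + t^-1 * c) -> 0 <= c ->
  a @ \oo --> (0 : R) -> b @ \oo --> (0 : R).
Proof.
move=> h c0 ca; apply/cvgrPdist_le => e e0.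
pose t := 2 * (c + 1) / e; have t0 : 0 < t by rewrite divr_gt0//; lra.
have et : 0 < e / (2 * t) by rewrite divr_gt0//; lra.
have /cvgrPdist_le/(_ _ et) := ca; apply: filterS => j; rewrite !sub0r !normrN => aj.
apply: le_trans (h j t t0) _.
have h1 : t * a j <= e / 2.
  apply: (@le_trans _ _ (t * (e / (2 * t)))); first by rewrite ler_wpM2l ?(ltW t0)//; exact: le_trans (ler_norm _) aj.
  by apply: eq_leW; field; rewrite gt_eqF.
have h2 : t^-1 * c <= e / 2.
  rewrite /t invf_div mulrAC ler_pdivrMr; last lra.
  by nra.
lra.
Qed.

Lemma parseval u v : L2 u -> L2 v ->
  (fun N => \sum_(0 <= k < N) coef u k * coef v k) @ \oo --> \int[leb]_(x in B1) (u x * v x).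
Proof.
move=> hu hv; have hd N : L2 (fun x => u x - eigen_sum N u x).
  rewrite (_ : (fun x => _) = (fun x => 1 * u x + (- 1) * eigen_sum N u x)).
    by apply: L2_lin => //; exact: L2_eigen_sum.
  by apply/funext => x; rewrite mul1r mulN1r.
have E N : \int[leb]_(x in B1) (u x * v x) - \sum_(0 <= k < N) coef u k * coef v k =
    \int[leb]_(x in B1) ((u x - eigen_sum N u x) * v x).
  transitivity (\int[leb]_(x in B1) (1 * (u x * v x) + (- 1) * (eigen_sum N u x * v x))); last first.
    by apply: eq_Rintegral => x _; ring.
  rewrite Rintegral_lin; [|exact: L2_mul|by apply: L2_mul => //; exact: L2_eigen_sum].
  rewrite mul1r mulN1r; congr (_ - _); rewrite /eigen_sum L2_inner_sum//.
  by apply: eq_bigr => k _; congr (_ * _); rewrite /Defs.coef; apply: eq_Rintegral => x _; rewrite mulrC.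
rewrite -[X in _ --> X]subr0.
rewrite (_ : (fun N => \sum_(0 <= k < N) coef u k * coef v k) =
  (fun N => \int[leb]_(x in B1) (u x * v x) - \int[leb]_(x in B1) ((u x - eigen_sum N u x) * v x))); last first.
  by apply/funext => N; rewrite -E; ring.
apply: cvgB; first exact: cvg_cst.
apply: (@cvg_young (fun N => \int[leb]_(x in B1) ((u x - eigen_sum N u x) ^+ 2)) _ (\int[leb]_(x in B1) (v x ^+ 2))).
- by move=> N t t0; exact: (L2_young t0 (hd N) hv).
- exact: L2_sqr_ge0.
- exact: cvg_eigen_sum.
Qed.

Lemma bessel u N : L2 u -> \sum_(0 <= k < N) coef u k ^+ 2 <= \int[leb]_(x in B1) (u x ^+ 2).
Proof.
move=> hu.
have c : (fun N => \sum_(0 <= k < N) coef u k ^+ 2) @ \oo --> \int[leb]_(x in B1) (u x ^+ 2).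
  by have := parseval hu hu; under eq_fun do under eq_bigr do rewrite -expr2; under eq_Rintegral do rewrite -expr2.
have nd : {homo (fun N => \sum_(0 <= k < N) coef u k ^+ 2) : i j / (i <= j)%N >-> i <= j}.
  move=> i j ij; rewrite [leRHS](@big_cat_nat _ _ _ i)//= lerDl sumr_ge0// => k _; exact: sqr_ge0.
by have := nondecreasing_cvgn_le nd (cvgP _ c) N; rewrite (cvg_lim _ c).
Qed.

End basis.

End square_integrable.

(** * Eigencoefficients of the fractional inverse *)

Section fractional_coefficient.
Variables (R : realType) (N : nat).
Hypothesis N_gt0 : (0 < N)%N.
Variable sg : R.
Hypothesis sg01 : 0 < sg < 1.
Local Notation mu := (@lebesgue_measure R).
Local Notation leb := (lebesgue_rV R N.+1).
Local Notation B1 := (@B1 R N.+1).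
Local Notation enorm := (@enorm R N.+1).

(** With s = e^x, this is the beta integral of s^(-sg)/(s + 1) over s > 0. *)
Definition frac_const := \int[mu]_x (weight sg x * (expR x / (expR x + 1))).

Let kern m x := weight sg x * (expR x / (expR x + m)).

Let kern_ge0 m x : 0 <= m -> 0 <= kern m x.
Proof.
move=> m0; apply: mulr_ge0; first exact/ltW/weight_gt0.
by rewrite divr_ge0 ?expR_ge0// addr_ge0 ?expR_ge0.
Qed.

Let ckern m : 0 <= m -> continuous (kern m).
Proof.
move=> m0; apply: (@contM _ _ (weight sg) (fun x => expR x / (expR x + m))); first exact: cont_weight.
apply: (@contM _ _ expR (fun x => (expR x + m)^-1)); first exact: continuous_expR.
apply: (@contV _ _ (fun x => expR x + m)) => [x|]; first by rewrite gt_eqF// ltr_wpDr// expR_gt0.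
by apply: (@contD _ _ expR (cst m)); [exact: continuous_expR|move=> ?; exact: cvg_cst].
Qed.

(** Scaling s by m is translation of x by ln m; this is where the power m^(-sg) comes from. *)
Lemma kern_translation m x : 0 < m -> kern m (x + ln m) = m `^ (- sg) * kern 1 x.
Proof.
move=> m0; rewrite /kern /weight /powR gt_eqF// expRD lnK ?posrE//.
rewrite mulrDr expRD; move: (expR_gt0 x); move: (expR x) (expR (- sg * x)) (expR (- sg * ln m)) => e a b e0.
have h1 : e + 1 != 0 by rewrite gt_eqF// addr_gt0.
have h2 : e * m + m != 0 by rewrite gt_eqF// addr_gt0// mulr_gt0.
by field; rewrite ?h1 ?h2.
Qed.

Lemma integrable_kern m : 0 < m -> mu.-integrable setT (EFin \o kern m).
Proof.
move=> m0; apply: (@integrable_dominated R (kern m) (fun x => (1 + m^-1) * dom sg x)).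
- exact/ckern/ltW.
- exact: (integrableZ _ (integrable_dom sg01)).
move=> x; rewrite (ger0_norm (kern_ge0 _ (ltW m0))) /kern /dom [leRHS]mulrCA ler_wpM2l ?(ltW (weight_gt0 _ _))//.
have e0 := expR_gt0 x; rewrite ler_pdivrMr; last lra.
have mi : m * m^-1 = 1 by rewrite mulfV// gt_eqF.
have mi0 : 0 < m^-1 by rewrite invr_gt0.
rewrite /Num.min; case: ifP => h; first by nra.
by move: mi mi0; move: (m^-1) => k mi k0; have := mulr_gt0 m0 e0; have := mulr_gt0 k0 e0; have := mulr_gt0 (mulr_gt0 k0 e0) e0; nra.
Qed.

Lemma frac_constE m : 0 < m -> \int[mu]_x kern m x = m `^ (- sg) * frac_const.
Proof.
move=> m0; rewrite (@Rintegral_translation R (kern m) (ln m)).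
- under eq_Rintegral do rewrite kern_translation//.
  by rewrite RintegralZl//; exact: integrable_kern.
- exact/ckern/ltW.
- by move=> x; exact/kern_ge0/ltW.
Qed.

Lemma frac_const_gt0 : 0 < frac_const.
Proof.
apply: (@lt_le_trans _ _ (itg 0 1 (kern 1))).
  apply: itg_gt0; first exact: ltr01.
    by apply: contW; exact: ckern.
  move=> x _; apply: mulr_gt0; first exact: weight_gt0.
  by rewrite divr_gt0 ?expR_gt0// addr_gt0 ?expR_gt0.
apply: itg_le_Rintegral.
- by move=> x; exact: kern_ge0.
- exact: integrable_kern.
Qed.

Variable F : R -> R.
Hypothesis cF : continuous F.
Hypothesis F_gt0 : forall p, 0 <= p <= 1 -> 0 < F p.
Hypothesis F_ni : forall p q, 0 <= p -> p <= q -> q <= 1 -> F q <= F p.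

(** Fubini and [resolvent_coef]: against an eigenfunction of eigenvalue m the resolvent acts as
    e^x/(e^x + m), whose weighted integral is [frac_constE]. This identifies [frac_inv] with
    [frac_const] times the fractional inverse. *)
Lemma frac_inv_coef (phi : 'rV[R]_N.+1 -> R) m : 0 < m -> dirichlet_eigenfun phi m ->
  \int[leb]_(x in B1) (frac_inv N sg F (enorm x) * phi x) =
  frac_const * m `^ (- sg) * \int[leb]_(x in B1) (F (enorm x) * phi x).
Proof.
move=> m0 ephi; have [_ cphi _ _] := ephi; have [p cp pE] := extend_cB1 cphi.
have mB := @measurable_B1 R N.+1.
have pB x : x \in B1 -> phi x = p x by rewrite inE => /B1_cB1/pE.
have F_ge0 q : 0 <= q <= 1 -> 0 <= F q by move=> /F_gt0/ltW.
have [M hM] := F_bounded cF.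
have [P P0 hP] := bounded_cB1 cp.
have M0 : 0 <= M by apply: le_trans (F_ge0 0 _) (hM 0 _); rewrite lexx ler01.
set IF := \int[leb]_(x in B1) (F (enorm x) * phi x).
pose f x y := weight sg x * resolvent N (expR x) F (enorm y) * p y.
have mf : measurable_fun setT (fun q : measurableTypeR R * 'rV[R]_N.+1 => f q.1 q.2).
  apply: measurable_funM.
    apply: measurable_funM.
      have mw : measurable_fun setT (weight sg : measurableTypeR R -> R).
        by exact: (@continuous_measurable_fun R _ (@cont_weight R sg)).
      exact: (measurableT_comp mw measurable_fst).
    have mr := measurable_resolvent_exp N_gt0 cF.
    have mq : measurable_fun setT (fun q : measurableTypeR R * 'rV[R]_N.+1 => (q.1, enorm q.2) : measurableTypeR R * measurableTypeR R).
      apply: measurable_fun_pair; first exact: measurable_fst.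
      exact: (measurableT_comp (@measurable_enorm R N.+1) measurable_snd).
    exact: (measurableT_comp mr mq).
  exact: (measurableT_comp (cont_measurable_rV cp) measurable_snd).
have := @fubini_dominated R _ _ leb B1 f (dom sg) (M * P) mB (B1_lty R N.+1) mf (integrable_dom sg01).
move=> /(_ (mulr_ge0 M0 (ltW P0)) (fun x => mulr_ge0 (ltW (weight_gt0 sg x)) _)) fub.
have {}fub : \int[mu]_x \int[leb]_(y in B1) f x y = \int[leb]_(y in B1) \int[mu]_x f x y.
  apply: fub => [x|x y yB]; first by rewrite le_min ler01 expR_ge0.
  rewrite /f normrM mulrAC; apply: ler_pM => //; first exact: resolvent_dom.
  by apply: hP; exact: B1_cB1.
transitivity (\int[leb]_(y in B1) \int[mu]_x f x y).
  apply: eq_Rintegral => y /pB ->; rewrite /f /frac_inv [RHS](_ : _ = \int[mu]_x (p y * (weight sg x * resolvent N (expR x) F (enorm y)))).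
    by rewrite RintegralZl// 1?mulrC//; exact: (integrable_resolvent N_gt0 sg01 cF F_ge0 hM).
  by apply: eq_Rintegral => x _; rewrite mulrC.
rewrite -fub -mulrA (mulrC frac_const) -mulrAC -(frac_constE m0) mulrC.
rewrite -(RintegralZl IF measurableT (integrable_kern m0)).
apply: eq_Rintegral => x _.
have e0 := expR_gt0 x.
have h := resolvent_coef N_gt0 e0 cF F_gt0 F_ni ephi.
have em : expR x + m != 0 by rewrite gt_eqF// addr_gt0.
have -> : \int[leb]_(y in B1) f x y = weight sg x * \int[leb]_(y in B1) (resolvent N (expR x) F (enorm y) * phi y).
  rewrite -RintegralZl//.
    by apply: eq_Rintegral => y /pB ->; rewrite /f mulrA.
  have cVp : continuous (fun y => resolvent N (expR x) F (enorm y) * p y).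
    apply: (@contM _ _ (fun y => resolvent N (expR x) F (enorm y)) p) => //.
    exact: (@cont_comp _ _ _ enorm _ (@cont_enorm R N.+1) (@cont_resolvent R N N_gt0 _ e0 F cF)).
  by apply: (eq_integrable mB _ _ _ (integrable_B1 cVp)) => y /pB hy /=; rewrite hy.
rewrite /kern mulrCA; congr (_ * _).
by apply: (mulfI em); rewrite h -/IF; field.
Qed.

End fractional_coefficient.

(** * The Riesz-Fischer theorem for bounded eigenfunctions *)

Section riesz_fischer.
Variables (R : realType) (n : nat).
Local Notation leb := (lebesgue_rV R n).
Local Notation B1 := (@B1 R n).
Variable phi : nat -> 'rV[R]_n -> R.
Hypothesis onb : orthonormal_basis phi.
Hypothesis phi_bounded : forall k, exists M, forall x, B1 x -> `|phi k x| <= M.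
Local Notation coef := (coef phi).
Local Notation L2 := (@L2 R n).

Let mB : measurable B1 := @measurable_B1 R n.
Let L2phi k : L2 (phi k). Proof. by case: onb. Qed.

Variables (c : nat -> R) (C : R).
Hypothesis cC : forall N, \sum_(0 <= k < N) c k ^+ 2 <= C.

Let S N x := \sum_(0 <= k < N) c k * phi k x.
Let s N := \sum_(0 <= k < N) c k ^+ 2.

Let L2S N : L2 (S N). Proof. exact: L2_sum. Qed.

Let S_split N M x : (N <= M)%N -> S M x - S N x = \sum_(N <= k < M) c k * phi k x.
Proof. by move=> NM; rewrite /S (@big_cat_nat _ _ _ N)//= addrAC subrr add0r. Qed.

Let normS N M : (N <= M)%N -> \int[leb]_(x in B1) ((S M x - S N x) ^+ 2) = s M - s N.
Proof.
move=> NM; have L2d : L2 (fun x => S M x - S N x).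
  rewrite (_ : (fun x => _) = (fun x => 1 * S M x + (- 1) * S N x)); first exact: L2_lin.
  by apply/funext => x; rewrite mul1r mulN1r.
transitivity (\int[leb]_(x in B1) ((\sum_(N <= k < M) c k * phi k x) * (S M x - S N x))).
  by apply: eq_Rintegral => x _; rewrite -S_split// expr2.
rewrite L2_inner_sum// /s (@big_cat_nat _ _ _ N 0 M)//= addrAC subrr add0r.
apply: eq_big_nat => k /andP[Nk kM]; rewrite expr2; congr (_ * _).
transitivity (coef (fun x => 1 * S M x + (- 1) * S N x) k).
  by apply: eq_Rintegral => x _; ring.
by rewrite coef_lin// !coef_sum// kM ltnNge Nk/= mulr0 addr0 mul1r.
Qed.

Let s_nd : {homo s : i j / (i <= j)%N >-> i <= j}.
Proof.
move=> i j ij; rewrite -subr_ge0 -normS//; exact: L2_sqr_ge0.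
Qed.

(** The rate 8^(-i) leaves room for the factors 2^i used in [riesz_fischer]; i < K i ensures that
    every fixed coefficient is eventually present. *)
Let subsequence : exists K : nat -> nat, [/\ {homo K : i j / (i <= j)%N}, forall i, (i < K i)%N &
  forall i, s (K i.+1) - s (K i) <= (8^-1) ^+ i].
Proof.
have scvg : cvgn s.
  apply: nondecreasing_is_cvgn; first exact: s_nd.
  by exists C => _ [N _ <-]; exact: cC.
have sl N : s N <= limn s by exact: nondecreasing_cvgn_le.
have /choice[K hK] : forall i, exists N, limn s - s N <= (8^-1) ^+ i.
  move=> i; have e0 : 0 < (8^-1) ^+ i :> R by rewrite exprn_gt0.
  have /cvgrPdist_le/(_ _ e0)[N _ hN] := scvg.
  by exists N; apply: le_trans (ler_norm _) _; apply: hN => /=.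
pose K' i := \sum_(0 <= j < i.+1) (K j).+1.
exists K'; split.
- by move=> i j ij; rewrite /K' (@big_cat_nat _ _ _ i.+1 0 j.+1)//= leq_addr.
- move=> i; rewrite /K' -[X in (X < _)%N]muln1 -[X in (X * _ < _)%N]subn0.
  rewrite -sum_nat_const_nat big_nat_recr//= -addn1 leq_add//.
  by rewrite leq_sum.
- move=> i; apply: le_trans (hK i); apply: lerB; first exact: sl.
  by apply: s_nd; rewrite /K' big_nat_recr//=; exact: leq_trans (leqnSn _) (leq_addl _ _).
Qed.

(** The sum T of 2^i D_i^2 is integrable, hence finite almost everywhere, and |D_i| <= 2^(-i) + 2^i
    D_i^2 then makes the partial sums converge. The same majorant, times a bound of phi k, dominates
    the integrals giving the coefficients; square integrability of the limit is Fatou's lemma. *)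
Lemma riesz_fischer : exists2 g, L2 g & forall k, coef g k = c k.
Proof.
have [K [K_nd K_gt K_s]] := subsequence.
pose D i x := S (K i.+1) x - S (K i) x.
have L2D i : L2 (D i).
  rewrite (_ : D i = (fun x => 1 * S (K i.+1) x + (- 1) * S (K i) x)); first exact: L2_lin.
  by apply/funext => x; rewrite mul1r mulN1r.
pose t i x : \bar R := (2 ^+ i * D i x ^+ 2)%:E.
have t0 i x : (0 <= t i x)%E by rewrite lee_fin; apply: mulr_ge0; [exact: exprn_ge0|exact: sqr_ge0].
have mt i : measurable_fun B1 (t i).
  apply/measurable_EFinP; apply: measurable_funM; first exact: measurable_cst.
  by apply: (measurable_funX 2); exact: L2_measurable.
have It i : (\int[leb]_(x in B1) t i x <= ((4^-1) ^+ i)%:E)%E.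
  have iD := L2_integrable_sqr (L2D i).
  rewrite /t; under eq_integral do rewrite EFinM.
  rewrite integralZl// -(fineK (integrable_fin_num mB iD)) -EFinM lee_fin.
  rewrite -/(Rintegral _ _ _) normS; last exact: K_nd.
  apply: (@le_trans _ _ (2 ^+ i * (8^-1) ^+ i)); first by rewrite ler_wpM2l ?exprn_ge0.
  by rewrite -exprMn le_eqVlt; apply/orP; left; apply/eqP; congr (_ ^+ i); field.
pose T x := (\sum_(0 <= i <oo) t i x)%E.
have T0 x : (0 <= T x)%E by apply: nneseries_ge0.
have mT : measurable_fun B1 T by apply: ge0_emeasurable_sum.
have geo (q : R) m : 0 <= q <= 2^-1 -> \sum_(0 <= i < m) q ^+ i <= 2.
  move=> /andP[q0 q1]; apply: (@le_trans _ _ (\sum_(0 <= i < m) (2^-1) ^+ i)).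
    by apply: ler_sum => i _; rewrite lerXn2r// nnegrE//; lra.
  have h : \sum_(0 <= i < m) (2^-1) ^+ i = 2 - 2 * (2^-1) ^+ m :> R.
    elim: m => [|m IH]; first by rewrite big_nil expr0; ring.
    by rewrite big_nat_recr//= IH exprS; field.
  by rewrite h; have : 0 <= (2^-1) ^+ m :> R by [rewrite exprn_ge0; lra]; lra.
have IT : (\int[leb]_(x in B1) T x < +oo)%E.
  rewrite /T integral_nneseries//; apply: (@le_lt_trans _ _ 2%:E); last exact: ltry.
  apply: lime_le; first by apply: is_cvg_nneseries => i _ _; apply: integral_ge0.
  apply: nearW => m; apply: (@le_trans _ _ (\sum_(0 <= i < m) ((4^-1) ^+ i)%:E)%E).
    by apply: lee_sum => i _.
  by rewrite sumEFin lee_fin; apply: geo; lra.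
have iT : leb.-integrable B1 T.
  apply/integrableP; split=> //; apply: le_lt_trans IT; apply: eq_leW.
  by apply: eq_integral => x _; rewrite gee0_abs.
have partial_T m x : T x \is a fin_num -> \sum_(0 <= i < m) (2 ^+ i * D i x ^+ 2) <= fine (T x).
  move=> fT; rewrite -lee_fin fineK// -sumEFin.
  by apply: nneseries_lim_ge => i _ _; exact: t0.
have amgm i x : `|D i x| <= (2^-1) ^+ i + 2 ^+ i * D i x ^+ 2.
  rewrite exprVn -(real_normK (num_real (D i x))); have q0 : 0 < 2 ^+ i :> R by rewrite exprn_gt0.
  move: q0 (normr_ge0 (D i x)); move: (2 ^+ i : R) (`|D i x|) => q a q0 a0.
  have -> : q^-1 + q * a ^+ 2 = (q^-1) * (1 + (q * a) ^+ 2) by field; rewrite gt_eqF.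
  rewrite mulrC ler_pdivlMr// mulrC.
  by have := mulr_ge0 (ltW q0) a0; move: (q * a) => w w0; nra.
have sumD m x : T x \is a fin_num -> \sum_(0 <= i < m) `|D i x| <= 2 + fine (T x).
  move=> fT; apply: (@le_trans _ _ (\sum_(0 <= i < m) ((2^-1) ^+ i + 2 ^+ i * D i x ^+ 2))).
    exact: ler_sum.
  by rewrite big_split/= lerD// ?partial_T// geo//; lra.
have SK i x : S (K i) x = S (K 0) x + \sum_(0 <= j < i) D j x.
  by rewrite /D telescope_sumr// addrC subrK.
have SKb i x : T x \is a fin_num -> `|S (K i) x| <= `|S (K 0) x| + (2 + fine (T x)).
  move=> fT; rewrite SK; apply: le_trans (ler_normD _ _) _; rewrite lerD2l.
  exact: le_trans (ler_norm_sum _ _ _) (sumD i x fT).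
have SKc x : T x \is a fin_num -> cvgn (fun i => S (K i) x).
  move=> fT; have /normed_cvg cD : cvgn [normed series (D^~ x)].
    apply: nondecreasing_is_cvgn.
      by move=> i j ij; rewrite /= /series/= (@big_cat_nat _ _ _ i 0 j)//= lerDl sumr_ge0.
    by exists (2 + fine (T x)) => _ [m _ <-]; rewrite /= /series/=; exact: sumD.
  have cc : (fun i => S (K 0) x + series (D^~ x) i) @ \oo --> S (K 0) x + limn (series (D^~ x)).
    by apply: cvgD; [exact: cvg_cst|exact: cD].
  by under eq_fun do rewrite SK; exact: (cvgP _ cc).
(* The set where the majorant is finite; the sums are replaced by 0 elsewhere, so that the limit
   exists everywhere in the ball and is measurable. *)
pose A := B1 `&` [set x | T x \is a fin_num].
have mA : measurable A by exact: emeasurable_fin_num.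
pose h i x := S (K i) x * \1_A x.
pose g x := limn (fun i => h i x).
have hE x i : A x -> h i x = S (K i) x by move=> Ax; rewrite /h indicE mem_set// mulr1.
have hN x i : ~ A x -> h i x = 0 by move=> Ax; rewrite /h indicE memNset// mulr0.
have hg x : B1 x -> (fun i => h i x) @ \oo --> g x.
  move=> xB; have [Ax|Ax] := pselect (A x).
    have := SKc x Ax.2; rewrite /g; under eq_fun do rewrite -(hE x _ Ax).
    by [].
  rewrite /g; under eq_fun do rewrite (hN x _ Ax).
  by rewrite lim_cst//; exact: cvg_cst.
have mh i : measurable_fun B1 (h i).
  apply: measurable_funM; first exact: L2_measurable.
  by apply: measurable_funTS; exact: measurable_indic.
have mg : measurable_fun B1 g by apply: (measurable_fun_cvg (h := h)).
have L2g : L2 g.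
  split=> //; apply: (@le_lt_trans _ _ C%:E); last exact: ltry.
  have := @fatou _ _ _ leb _ mB (fun i x => (h i x ^+ 2)%:E).
  have -> : (\int[leb]_(x in B1) (g x ^+ 2)%:E = \int[leb]_(x in B1) limn_einf ((fun i x => (h i x ^+ 2)%:E)^~ x))%E.
    apply: eq_integral => x; rewrite inE => xB; apply/esym.
    have c2 : (fun i => (h i x ^+ 2)%:E) @ \oo --> (g x ^+ 2)%:E.
      by apply: cvg_EFin; [exact: nearW|under eq_fun do rewrite expr2; rewrite expr2; apply: cvgM; exact: hg].
    by rewrite is_cvg_limn_einfE; [exact: cvg_lim c2|exact: cvgP c2].
  move=> F; apply: le_trans (F _ _) _.
  - by move=> i; apply/measurable_EFinP; exact: (measurable_funX 2).
  - by move=> i x _; rewrite lee_fin sqr_ge0.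
  rewrite limn_einf_lim; apply: lime_le; first exact: is_cvg_einfs.
  apply: nearW => i; apply: (@le_trans _ _ (\int[leb]_(x in B1) (h i x ^+ 2)%:E)%E).
    by apply: ereal_inf_lbound; exists i => /=.
  apply: (@le_trans _ _ (\int[leb]_(x in B1) (S (K i) x ^+ 2)%:E)%E).
    apply: ge0_le_integral => //.
    - by move=> x _; rewrite lee_fin sqr_ge0.
    - by apply/measurable_EFinP; exact: (measurable_funX 2).
    - by apply/measurable_EFinP; apply: (measurable_funX 2); exact: L2_measurable.
    - move=> x _; rewrite lee_fin; have [Ax|Ax] := pselect (A x); first by rewrite hE.
      by rewrite hN// expr0n/= sqr_ge0.
  have iS := L2_integrable_sqr (L2S (K i)).
  rewrite -(fineK (integrable_fin_num mB iS)) lee_fin.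
  rewrite (_ : fine _ = s (K i)); first exact: cC.
  have := @normS 0 (K i) (leq0n _); rewrite [s 0]big_nil subr0 => <-.
  by rewrite -/(Rintegral _ _ _); apply: eq_Rintegral => x _; rewrite [S 0 x]big_nil subr0.
exists g => // k; have [P hP] := phi_bounded k.
have aeT : {ae leb, forall x, B1 x -> T x \is a fin_num} := integrable_ae mB iT.
have L2abs : leb.-integrable B1 (fun x => (`|S (K 0) x|)%:E).
  have one : L2 (fun _ => 1) by apply: L2_continuous; exact: cst_continuous.
  have := integrable_norm (L2_mul (L2S (K 0)) one); apply: eq_integrable => // x _ /=.
  by rewrite mulr1.
have ic (a : R) : leb.-integrable B1 (fun _ => a%:E).
  have h1 : continuous (fun _ : 'rV[R]_n => a) by exact: cst_continuous.
  exact: (integrable_B1 h1).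
have [] := @dominated_convergence _ _ _ leb B1 mB (fun i x => (S (K i) x * phi k x)%:E) (fun x => (g x * phi k x)%:E)
    (fun x => (P%:E * ((`|S (K 0) x|)%:E + (2%:E + T x)))%E).
- by move=> i; apply/measurable_EFinP; apply: measurable_funM; exact: L2_measurable.
- by apply/measurable_EFinP; apply: measurable_funM; [exact: mg|exact: L2_measurable].
- apply: filterS aeT => x fT xB; have Ax : A x by split => //; exact: fT.
  apply: cvg_EFin; first exact: nearW.
  by apply: cvgM; [have := hg x xB; under eq_fun do rewrite (hE x _ Ax)|exact: cvg_cst].
- apply: integrableZl => //; apply: integrableD => //; apply: integrableD => //.
- apply: filterS aeT => x fT i xB; have := SKb i x (fT xB).
  rewrite -(fineK (fT xB)) -!EFinD -EFinM /= lee_fin normrM mulrC => hb.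
  by apply: ler_pM => //; exact: hP.
move=> _ _ cI; have iI : leb.-integrable B1 (fun x => (g x * phi k x)%:E) by exact: L2_mul.
apply: EFin_inj; rewrite {1}/Defs.coef /Rintegral fineK; last exact: (integrable_fin_num mB iI).
have cI2 : (fun i => (\int[leb]_(x in B1) (S (K i) x * phi k x)%:E)%E) @ \oo --> (c k)%:E.
  apply: cvg_near_cst; near=> i.
  have iS : leb.-integrable B1 (fun x => (S (K i) x * phi k x)%:E) by exact: L2_mul.
  rewrite -(fineK (integrable_fin_num mB iS)); congr EFin.
  have := coef_sum onb c (K i) k; rewrite /Defs.coef /Rintegral => ->.
  rewrite ifT//; apply: ltn_trans (K_gt i).
  by near: i; exact: nbhs_infty_gt.
exact: (cvg_unique _ cI cI2).
Unshelve. all: by end_near. Qed.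

End riesz_fischer.

(** * Existence and positivity of the fractional inverse on the ball *)

Section dirichlet_basis_theory.
Variables (R : realType) (n : nat).
Local Notation leb := (lebesgue_rV R n).
Local Notation B1 := (@B1 R n).
Local Notation cB1 := (@cB1 R n).
Local Notation mu := (@lebesgue_measure R).
Variables (phi : nat -> 'rV[R]_n -> R) (m : nat -> R).
Hypothesis hphi : dirichlet_basis phi m.
Variable sg : R.
Hypothesis sg01 : 0 < sg < 1.
Local Notation coef := (coef phi).
Local Notation L2 := (@L2 R n).

Let mB : measurable B1 := @measurable_B1 R n.

Lemma onb : orthonormal_basis phi. Proof. by case: hphi. Qed.

Lemma eigen k : dirichlet_eigenfun (phi k) (m k). Proof. by case: hphi. Qed.

Let L2phi k : L2 (phi k). Proof. by case: onb. Qed.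

Lemma eigenvalue_ge k : m 0%N <= m k.
Proof.
case: hphi => _ _ [m0 m01 mS _] _; elim: k => // -[|k] IH; first exact: ltW.
exact: le_trans IH (mS _ _).
Qed.

Lemma eigenvalue0_gt0 : 0 < m 0%N. Proof. by case: hphi => _ _ []. Qed.

Lemma eigenvalue_gt0 k : 0 < m k.
Proof. exact: lt_le_trans eigenvalue0_gt0 (eigenvalue_ge k). Qed.

Lemma eigenfun_ext k : exists2 p : 'rV[R]_n -> R, continuous p & forall x, cB1 x -> p x = phi k x.
Proof. by case: (eigen k) => _ c _ _; exact: extend_cB1. Qed.

Lemma eigenfun_bounded k : exists M, forall x, B1 x -> `|phi k x| <= M.
Proof.
have [p cp pE] := eigenfun_ext k; have [M _ hM] := bounded_cB1 cp.
by exists M => x /B1_cB1 xB; rewrite -pE// hM.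
Qed.

Lemma coef_inv_frac_lap psi g k : inv_frac_lap phi m sg psi g -> coef g k = m k `^ (- sg) * coef psi k.
Proof.
move=> [_ <-]; rewrite /frac_lap powRN mulrA mulVf ?mul1r//.
by rewrite gt_eqF// powR_gt0// eigenvalue_gt0.
Qed.

Let powm k : m k `^ (- sg) <= m 0%N `^ (- sg).
Proof.
have /andP[s0 _] := sg01.
have h := eigenvalue_gt0 k; have h0 := eigenvalue0_gt0.
rewrite !powRN lef_pV2 ?posrE ?powR_gt0//; apply: ge0_ler_powR; rewrite ?nnegrE ?(ltW h) ?(ltW h0) ?(ltW s0)//.
exact: eigenvalue_ge.
Qed.

(** Riesz-Fischer with the coefficients m_k^(-sg) coef psi k, square summable by Bessel's inequality
    because m_k >= m_0 > 0. *)
Lemma inv_frac_lap_exists psi : L2 psi -> exists g, inv_frac_lap phi m sg psi g.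
Proof.
move=> hpsi; pose a := m 0%N `^ (- sg); have a0 : 0 <= a by exact: powR_ge0.
pose c k := m k `^ (- sg) * coef psi k.
have ca k : c k ^+ 2 <= a ^+ 2 * coef psi k ^+ 2.
  rewrite /c exprMn ler_wpM2r ?sqr_ge0// lerXn2r// ?nnegrE ?powR_ge0//; exact: powm.
have b N := bessel onb N hpsi.
have cC N : \sum_(0 <= k < N) c k ^+ 2 <= a ^+ 2 * \int[leb]_(x in B1) (psi x ^+ 2).
  apply: (@le_trans _ _ (\sum_(0 <= k < N) a ^+ 2 * coef psi k ^+ 2)); first exact: ler_sum.
  by rewrite -mulr_sumr ler_wpM2l ?sqr_ge0.
have [g L2g gc] := riesz_fischer onb eigenfun_bounded cC.
exists g; split; last first.
  apply/funext => k; rewrite /frac_lap gc /c powRN mulrA mulfV ?mul1r//.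
  by rewrite gt_eqF// powR_gt0// eigenvalue_gt0.
split=> //; apply: (@le_lt_trans _ _ (a * \int[leb]_(x in B1) (psi x ^+ 2))%:E); last exact: ltry.
apply: lime_le.
  by apply: is_cvg_nneseries => k _ _; rewrite lee_fin mulr_ge0 ?powR_ge0 ?sqr_ge0.
apply: nearW => N; rewrite sumEFin lee_fin.
apply: (@le_trans _ _ (\sum_(0 <= k < N) a * coef psi k ^+ 2)).
  apply: ler_sum => k _; rewrite gc /c exprMn mulrA ler_wpM2r ?sqr_ge0//.
  rewrite expr2 mulrA powRN mulfV ?mul1r -?powRN ?powm//.
  by rewrite gt_eqF// powR_gt0// eigenvalue_gt0.
by rewrite -mulr_sumr ler_wpM2l.
Qed.

Section comparison.
Variables (psi : 'rV[R]_n -> R).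
Hypothesis L2psi : L2 psi.
Hypothesis psi_ge0 : forall x, B1 x -> 0 <= psi x.

(** A C^1 regularisation of the positive part, within eps of it from below. Composed with -v - eps,
    where v vanishes on the sphere, it has compact support in the ball. *)
Let h (eps y : R) : R := Num.max y 0 ^+ 2 / (Num.max y 0 + eps).
Let dh (eps y : R) : R := (Num.max y 0 ^+ 2 + 2 * eps * Num.max y 0) / (Num.max y 0 + eps) ^+ 2.

Let is_derive_h eps y : 0 < eps -> is_derive y (1 : R) (h eps) (dh eps y).
Proof.
move=> e0; apply: (@is_derive_pos R (fun y => y ^+ 2 / (y + eps)) (fun y => (y ^+ 2 + 2 * eps * y) / (y + eps) ^+ 2)).
- by rewrite expr0n/= mul0r.
- by rewrite expr0n/= mulr0 addr0 mul0r.
move=> z z0; have zn : z + eps != 0 by rewrite gt_eqF// ltr_wpDl.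
have d1 := is_derive1D (is_derive_id z (1 : R)) (is_derive_cst eps z (1 : R)).
have d := is_derive1M (is_derive1X z 2) (@is_derive1V R (fun z => z + eps) z _ zn d1).
apply: is_derive_eq d _; rewrite addr0 /=.
by field.
Qed.

Let cont_max_0 : continuous (fun y : R => Num.max y 0).
Proof. by move=> y; apply: (@continuous_max _ _ id (cst 0)) => [x|x]; [exact: cvg_id|exact: cvg_cst]. Qed.

Let cont_dh eps : 0 < eps -> continuous (dh eps).
Proof.
move=> e0; have c := cont_max_0; have c2 := @contM R R _ _ c c.
apply: (@contM _ _ (fun y : R => Num.max y 0 ^+ 2 + 2 * eps * Num.max y 0) (fun y : R => ((Num.max y 0 + eps) ^+ 2)^-1)).
  apply: (@contD _ _ (fun y : R => Num.max y 0 ^+ 2) (fun y : R => 2 * eps * Num.max y 0)) => //.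
  by apply: (@contM _ _ (cst (2 * eps)) (fun y : R => Num.max y 0)) => // ?; exact: cvg_cst.
apply: (@contV _ _ (fun y : R => (Num.max y 0 + eps) ^+ 2)) => [y|].
  by rewrite expf_neq0// gt_eqF// ltr_wpDl// le_max lexx orbT.
have c3 : continuous (fun y : R => Num.max y 0 + eps).
  by apply: (@contD _ _ (fun y : R => Num.max y 0) (cst eps)) => // ?; exact: cvg_cst.
exact: (@contM R R _ _ c3 c3).
Qed.

Let h_itv eps y : 0 < eps -> 0 <= h eps y /\ (0 < y -> h eps y <= y /\ y <= h eps y + eps) /\ (y <= 0 -> h eps y = 0).
Proof.
move=> e0; split; first by rewrite divr_ge0 ?exprn_ge0 ?addr_ge0 ?(ltW e0)// le_max lexx orbT.
split=> y0; last by rewrite /h (max_idPr y0) expr0n/= mul0r.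
have d : 0 < y + eps by exact: addr_gt0.
rewrite /h (max_idPl (ltW y0)); split; first by rewrite ler_pdivrMr//; nra.
by rewrite -lerBlDr ler_pdivlMr//; nra.
Qed.

Let dh_ge0 eps y : 0 < eps -> 0 <= dh eps y.
Proof.
move=> e0; have q0 : 0 <= Num.max y 0 by rewrite le_max lexx orbT.
by rewrite /dh divr_ge0 ?sqr_ge0// addr_ge0 ?sqr_ge0// !mulr_ge0// ltW.
Qed.

Section truncated.
Variables (s eps : R) (N : nat).
Hypotheses (s_gt0 : 0 < s) (eps_gt0 : 0 < eps).

Let c k := s / (s + m k) * coef psi k.
(** A finite sum is twice differentiable inside and vanishes on the sphere. It solves the resolvent
    equation with source [eigen_sum], which may be negative; its distance to psi is the error in
    [hv_le]. *)
Definition resolvent_sum x := \sum_(0 <= k < N) c k * phi k x.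
Local Notation v := resolvent_sum.

Let sm k : s + m k != 0. Proof. by rewrite gt_eqF// addr_gt0// eigenvalue_gt0. Qed.

Let dv i x : B1 x -> is_derive x (delta_mx ord0 i) v (\sum_(0 <= k < N) c k * partial i (phi k) x) /\
  is_derive x (delta_mx ord0 i) (fun x => \sum_(0 <= k < N) c k * partial i (phi k) x)
   (\sum_(0 <= k < N) c k * partial i (partial i (phi k)) x).
Proof.
move=> xB; split; apply: is_deriveV_sum => k; have [[_ k2] _ _ _] := eigen k; have [d1 [_ k1]] := k2 i.
  have dk : is_derive x (delta_mx ord0 i) (phi k) (partial i (phi k) x).
    by apply: DeriveDef => //; exact: d1.
  have := is_deriveV_mul (is_derive_cst (c k) x (delta_mx ord0 i)) dk.
  by rewrite mul0r add0r.
have [d2 _] := k1 i.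
have dk : is_derive x (delta_mx ord0 i) (partial i (phi k)) (partial i (partial i (phi k)) x).
  by apply: DeriveDef => //; exact: d2.
have := is_deriveV_mul (is_derive_cst (c k) x (delta_mx ord0 i)) dk.
by rewrite mul0r add0r.
Qed.

Let lap_v x : B1 x -> \sum_i \sum_(0 <= k < N) c k * partial i (partial i (phi k)) x =
  - s * (eigen_sum phi N psi x - v x).
Proof.
move=> xB; rewrite exchange_big /= /eigen_sum /resolvent_sum -sumrB mulr_sumr; apply: eq_bigr => k _.
rewrite -mulr_sumr; have [_ _ _ /(_ x xB)] := eigen k.
rewrite /laplacian => /eqP; rewrite eqr_oppLR => /eqP ->; rewrite /c.
by have := sm k; move: (m k) (coef psi k) (phi k x) => a b d ne; field.
Qed.

Let v_ext : exists2 w : 'rV[R]_n -> R, continuous w & forall x, cB1 x -> w x = v x.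
Proof.
have /choice[p hp] : forall k, exists p : 'rV[R]_n -> R, continuous p /\ forall x, cB1 x -> p x = phi k x.
  by move=> k; have [p cp pE] := eigenfun_ext k; exists p.
exists (fun x => \sum_(0 <= k < N) c k * p k x) => [x|x xB].
  apply: for_sum => k; apply: (@for_mul R _ (cst (c k)) (p k)); first exact: cst_continuous.
  by case: (hp k) => cp _; exact: cp.
by apply: eq_bigr => k _; case: (hp k) => _ ->.
Qed.

Let hv x := h eps (- v x - eps).

Let L2v : L2 v. Proof. exact: L2_sum. Qed.

Let hv_cont : exists2 w : 'rV[R]_n -> R, continuous w & forall x, B1 x -> hv x = w x.
Proof.
have [w cw wE] := v_ext; exists (fun x => h eps (- w x - eps)) => [|x /B1_cB1 xB]; last by rewrite /hv wE.
apply: (@cont_comp _ _ _ (fun x => - w x - eps) (h eps)).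
  by apply: (@contB _ _ (fun x => - w x) (cst eps)); [exact: (@contN _ _ w)|exact: cst_continuous].
by move=> y; exact: derive_cont (@is_derive_h eps y eps_gt0).
Qed.

Let L2hv : L2 hv.
Proof.
have [w cw wE] := hv_cont; have [M _ hM] := bounded_cB1 cw.
apply: (@L2_bounded _ _ _ M) => [|x xB]; last by rewrite wE// hM//; exact: B1_cB1.
apply: (eq_measurable_fun w) => [x|]; first by rewrite inE => xB; rewrite wE.
by apply: measurable_funTS; exact: cont_measurable_rV.
Qed.

Let L2d : L2 (fun x => psi x - eigen_sum phi N psi x).
Proof.
rewrite (_ : (fun x => _) = (fun x => 1 * psi x + (- 1) * eigen_sum phi N psi x)).
  by apply: L2_lin => //; exact: L2_eigen_sum onb _ _.
by apply/funext => x; rewrite mul1r mulN1r.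
Qed.

(** The second factor is the Laplacian of v ([lap_v]), and hv is a nonincreasing function of v with
    compact support: integration by parts leaves the integral of dh times the squared gradient of
    v. *)
Let energy : 0 <= \int[leb]_(x in B1) (hv x * (- s * (eigen_sum phi N psi x - v x))).
Proof.
have [w cw wE] := v_ext.
pose K := cB1 `&` [set x | eps <= - w x].
have kK : compact K by apply: compact_level; exact: (@contN _ _ w).
have KB : K `<=` B1.
  move=> x [/= x1 xV]; rewrite /Defs.B1/= lt_neqAle x1 andbT; apply/eqP => e1.
  move: xV; rewrite wE// /resolvent_sum big1 ?oppr0 ?leNgt ?eps_gt0// => k _.
  by have [_ _ h0 _] := eigen k; rewrite h0// mulr0.
pose D1 i x := \sum_(0 <= k < N) c k * partial i (phi k) x.
pose D2 i x := \sum_(0 <= k < N) c k * partial i (partial i (phi k)) x.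
pose d i x := dh eps (- v x - eps) * - D1 i x * D1 i x + hv x * D2 i x.
have D i : leb.-integrable B1 (EFin \o d i) /\ \int[leb]_(x in B1) d i x = 0.
  apply: (@integral_partial_compact R n i K (fun x => hv x * D1 i x) (d i)) => // x xB.
  - have [h1 h2] := dv i xB.
    have h3 := is_deriveV_add (is_deriveV_opp h1) (is_derive_cst (- eps) x (delta_mx ord0 i)).
    rewrite addr0 in h3.
    have h4 := @is_deriveV_comp R _ (h eps) (fun x => - v x - eps) x _ _ _ (@is_derive_h eps _ eps_gt0) h3.
    exact: is_deriveV_mul h4 h2.
  - have cv : {for x, continuous v}.
      apply: (for_near _ (cw x)); near=> y; rewrite wE//; apply: B1_cB1.
      by near: y; exact: nbhs_B1.
    have cve : {for x, continuous (fun x => - v x - eps)}.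
      by apply: (@for_add R _ (fun x => - v x) (cst (- eps))); [exact: for_opp|exact: cst_continuous].
    have ch : {for - v x - eps, continuous (h eps)} by exact: derive_cont (@is_derive_h eps _ eps_gt0).
    have c1 : {for x, continuous (D1 i)}.
      apply: for_sum => k; apply: (@for_mul R _ (cst (c k)) (partial i (phi k))); first exact: cst_continuous.
      by have [[_ k2] _ _ _] := eigen k; have [_ [k1 _]] := k2 i; exact: k1.
    have c2 : {for x, continuous (D2 i)}.
      apply: for_sum => k; apply: (@for_mul R _ (cst (c k)) (partial i (partial i (phi k)))); first exact: cst_continuous.
      by have [[_ k2] _ _ _] := eigen k; have [_ [_ k1]] := k2 i; have [_ [k0 _]] := k1 i; exact: k0.
    have k1 := @for_comp R _ (fun x => - v x - eps) (dh eps) x cve (@cont_dh eps eps_gt0 _).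
    have k2 := @for_comp R _ (fun x => - v x - eps) (h eps) x cve ch.
    exact: (for_add (for_mul (for_mul k1 (for_opp c1)) c1) (for_mul k2 c2)).
  - move=> xK; have [_ [_ h0]] := @h_itv eps (- v x - eps) eps_gt0.
    rewrite /hv h0 ?mul0r// leNgt; apply/negP => v0; apply: xK; split; first exact: B1_cB1.
    by rewrite /= wE; [lra|exact: B1_cB1].
have [q cq qE] := hv_cont.
have iR : leb.-integrable B1 (fun x => (hv x * (- s * (eigen_sum phi N psi x - v x)))%:E).
  have l : L2 (fun x => - s * eigen_sum phi N psi x + s * v x) by apply: L2_lin => //; exact: L2_eigen_sum onb _ _.
  apply: (eq_integrable mB _ _ _ (L2_mul L2hv l)) => x _ /=.
  by congr EFin; ring.
have isum : leb.-integrable B1 (fun x => (\sum_i d i x)%:E).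
  under eq_fun do rewrite -sumEFin.
  apply: (@integrable_sum _ _ _ leb B1 mB _ _ xpredT (fun i x => (d i x)%:E)).
  by move=> i _; case: (D i).
have I0 : \int[leb]_(x in B1) (\sum_i d i x) = 0.
  rewrite /Rintegral; under eq_integral do rewrite -sumEFin.
  rewrite integral_sum//; last by move=> i; case: (D i).
  rewrite big1// => i _; have [i1 i2] := D i.
  by rewrite -(fineK (integrable_fin_num mB i1)); congr EFin.
rewrite -I0; apply: le_Rintegral => // x xB.
rewrite -lap_v// mulr_sumr; apply: ler_sum => i _; rewrite /d.
rewrite gerDr mulrN mulNr oppr_le0 -mulrA -expr2 mulr_ge0 ?sqr_ge0//.
exact: dh_ge0.
Unshelve. all: by end_near. Qed.

(** From hv^2 <= -hv v, psi >= 0 and [energy], the left side is at most the integral of hv (psi -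
    eigen_sum); Young's inequality with t = 1/2 absorbs half of it. This is the maximum principle
    with a quantified error. *)
Let hv_le : \int[leb]_(x in B1) (hv x ^+ 2) <= 4 * \int[leb]_(x in B1) ((psi x - eigen_sum phi N psi x) ^+ 2).
Proof.
have l : L2 (fun x => - s * eigen_sum phi N psi x + s * v x) by apply: L2_lin => //; exact: L2_eigen_sum onb _ _.
have h1 : \int[leb]_(x in B1) (hv x ^+ 2) <= \int[leb]_(x in B1) (1 * (hv x * (psi x - eigen_sum phi N psi x)) + (- s^-1) * (hv x * (- s * eigen_sum phi N psi x + s * v x))).
  apply: le_Rintegral => //.
  - exact: L2_integrable_sqr.
  - apply: (eq_integrable mB _ _ _ (integrableD mB (L2_mul L2hv L2d) (integrableZl mB (- s^-1) (L2_mul L2hv l)))) => x _ /=.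
    by rewrite mul1r.
  move=> x xB; have [h0 [hp hz]] := @h_itv eps (- v x - eps) eps_gt0.
  rewrite -/(hv x) in h0 hp hz.
  have sn : s != 0 by rewrite gt_eqF.
  rewrite [leRHS](_ : _ = hv x * psi x + hv x * - v x); last by move: sn; move: (hv x) (psi x) (eigen_sum _ _ _ x) (v x) s => *; field.
  apply: (@le_trans _ _ (hv x * - v x)); last by rewrite lerDr; apply: mulr_ge0 => //; exact: psi_ge0.
  have [y0|y0] := ltP 0 (- v x - eps); last by rewrite hz// expr0n/= mul0r.
  have [h3 _] := hp y0; rewrite expr2; apply: ler_wpM2l => //; lra.
have i1 := L2_mul L2hv L2d; have i2 := L2_mul L2hv l.
rewrite (Rintegral_lin _ _ i1 i2) in h1.
have h2 : 0 <= \int[leb]_(x in B1) (hv x * (- s * eigen_sum phi N psi x + s * v x)).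
  have := energy; rewrite (_ : \int[leb]_(x in B1) _ = \int[leb]_(x in B1) (hv x * (- s * eigen_sum phi N psi x + s * v x)))//.
  by apply: eq_Rintegral => x _; ring.
have t0 : 0 < 2^-1 :> R by lra.
have h3 := L2_young t0 L2hv L2d; rewrite invrK in h3.
have h4 := ler_norm (\int[leb]_(x in B1) (hv x * (psi x - eigen_sum phi N psi x))).
have h5 : 0 <= s^-1 * \int[leb]_(x in B1) (hv x * (- s * eigen_sum phi N psi x + s * v x)).
  by apply: mulr_ge0 => //; rewrite invr_ge0 ltW.
rewrite mul1r mulNr in h1.
by move: h1 h3 h4 h5; lra.
Qed.

(** The sum is the integral of v H, and v >= -(hv + 2 eps). The free parameters t and eps make the
    error small once the sum is long enough. *)
Lemma resolvent_sum_ge (H : 'rV[R]_n -> R) (Hm t : R) : measurable_fun B1 H -> (forall x, B1 x -> 0 <= H x <= Hm) -> 0 < t ->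
  - (Hm * (t * (4 * \int[leb]_(x in B1) ((psi x - eigen_sum phi N psi x) ^+ 2)) + t^-1 * fine (leb B1) + 2 * eps * fine (leb B1))) <=
  \sum_(0 <= k < N) s / (s + m k) * (coef H k * coef psi k).
Proof.
move=> mH H0 t0; have Hb x : B1 x -> `|H x| <= Hm.
  by move=> xB; have /andP[h0 h1] := H0 x xB; rewrite ger0_norm.
have L2H : L2 H by exact: L2_bounded mH Hb.
have -> : \sum_(0 <= k < N) s / (s + m k) * (coef H k * coef psi k) = \int[leb]_(x in B1) (v x * H x).
  rewrite L2_inner_sum//; apply: eq_bigr => k _; rewrite /c.
  have -> : \int[leb]_(x in B1) (phi k x * H x) = coef H k by apply: eq_Rintegral => x _; rewrite mulrC.
  by move: (s / _) (coef _ _) (coef _ _) => *; ring.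
have one : L2 (fun _ => 1) by apply: L2_continuous; exact: cst_continuous.
have Hm0 : 0 <= Hm.
  have b0 : B1 0 by rewrite /Defs.B1/= enorm0 ltr01.
  by have /andP[a b] := H0 0 b0; exact: le_trans a b.
have i1 := L2_mul L2hv one; have i2 := L2_mul one one.
apply: (@le_trans _ _ (\int[leb]_(x in B1) ((- Hm) * (hv x * 1) + (- Hm * (2 * eps)) * (1 * 1)))).
  rewrite (Rintegral_lin _ _ i1 i2) -[leRHS]opprK lerN2.
  have y := L2_young t0 L2hv one; have y2 := ler_norm (\int[leb]_(x in B1) (hv x * 1)).
  have c1 : \int[leb]_(x in B1) ((1 : R) ^+ 2) = fine (leb B1) by under eq_Rintegral do rewrite expr1n; rewrite Rintegral_cst// mul1r.
  have c2 : \int[leb]_(x in B1) ((1 : R) * 1) = fine (leb B1) by under eq_Rintegral do rewrite mulr1; rewrite Rintegral_cst// mul1r.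
  rewrite c1 in y; rewrite c2.
  have y3 := le_trans y2 (le_trans y (lerD (ler_wpM2l (ltW t0) hv_le) (lexx _))).
  have := ler_wpM2l Hm0 y3.
  move: (\int[leb]_(x in B1) (hv x * 1)) (\int[leb]_(x in B1) _) (fine _) (t^-1) => a b d t'; lra.
apply: le_Rintegral => //.
- apply: (eq_integrable mB _ _ _ (integrableD mB (integrableZl mB (- Hm) i1) (integrableZl mB (- Hm * (2 * eps)) i2))) => x _ //=.
- exact: L2_mul.
move=> x xB; have /andP[h0 h1] := H0 x xB.
have [hv0 [hp hz]] := @h_itv eps (- v x - eps) eps_gt0; rewrite -/(hv x) in hv0 hp hz.
have vb : - (hv x + 2 * eps) <= v x.
  have e0 := eps_gt0; have [y0|y0] := ltP 0 (- v x - eps); last by lra.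
  by have [_ h3] := hp y0; lra.
rewrite !mulr1; have e0 := eps_gt0; apply: (@le_trans _ _ (- (hv x + 2 * eps) * H x)); last by rewrite ler_wpM2r.
have : (hv x + 2 * eps) * H x <= (hv x + 2 * eps) * Hm by rewrite ler_wpM2l//; lra.
by move: (H x) (hv x) => a b; lra.
Qed.

End truncated.

Section positivity.
Variables (H : 'rV[R]_n -> R) (Hm : R).
Hypothesis mH : measurable_fun B1 H.
Hypothesis H_itv : forall x, B1 x -> 0 <= H x <= Hm.

Let L2H : L2 H.
Proof.
apply: (L2_bounded mH (M := Hm)) => x xB.
by have /andP[h0 h1] := H_itv xB; rewrite ger0_norm.
Qed.

Let rest N := (\int[leb]_(x in B1) (H x ^+ 2) - \sum_(0 <= k < N) coef H k ^+ 2) +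
  (\int[leb]_(x in B1) (psi x ^+ 2) - \sum_(0 <= k < N) coef psi k ^+ 2).

Let rest_cvg : rest @ \oo --> (0 : R).
Proof.
have c u : L2 u -> (fun N => \int[leb]_(x in B1) (u x ^+ 2) - \sum_(0 <= k < N) coef u k ^+ 2) @ \oo --> (0 : R).
  move=> hu; rewrite -[X in _ --> X](subrr (\int[leb]_(x in B1) (u x ^+ 2))); apply: cvgB; first exact: cvg_cst.
  by have := parseval onb hu hu; under eq_fun do under eq_bigr do rewrite -expr2; under eq_Rintegral do rewrite -expr2.
by rewrite -(addr0 0); apply: cvgD; exact: c.
Qed.

Let tail_le N M : (N <= M)%N -> \sum_(N <= k < M) `|coef H k * coef psi k| <= rest N.
Proof.
move=> NM; have b1 := bessel onb M L2H; have b2 := bessel onb M L2psi.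
rewrite (@big_cat_nat _ _ _ N 0 M)//= in b1; rewrite (@big_cat_nat _ _ _ N 0 M)//= in b2.
apply: (@le_trans _ _ (\sum_(N <= k < M) (coef H k ^+ 2 + coef psi k ^+ 2))).
  apply: ler_sum => k _; rewrite normrM -(real_normK (num_real (coef H k))) -(real_normK (num_real (coef psi k))).
  move: (normr_ge0 (coef H k)) (normr_ge0 (coef psi k)); move: (`|coef H k|) (`|coef psi k|) => a b a0 b0.
  by nra.
by rewrite big_split/= /rest; lra.
Qed.

(** For M large the sum up to M is nearly nonnegative by [resolvent_sum_ge], and the terms between N
    and M amount to at most s/(s + m_0) [rest] N. Keeping the factor s/(s + m_0) makes the error
    integrable in s. *)
Let sum_ge s N : 0 < s -> - (s / (s + m 0%N) * rest N) <= \sum_(0 <= k < N) s / (s + m k) * (coef H k * coef psi k).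
Proof.
move=> s0; pose A M := \sum_(0 <= k < M) s / (s + m k) * (coef H k * coef psi k).
have sm k : 0 < s + m k by rewrite addr_gt0// eigenvalue_gt0.
have Hm0 : 0 <= Hm.
  have b0 : B1 0 by rewrite /Defs.B1/= enorm0 ltr01.
  by have /andP[a b] := H_itv b0; exact: le_trans a b.
have b0 : 0 <= fine (leb B1) by apply: fine_ge0.
apply/ler_addgt0Pr => del del0.
(* t and eps are fixed from del, then M, so that each of the three error terms is at most del/4. *)
pose C := Hm * fine (leb B1) + 1; have C0 : 0 < C by rewrite ltr_wpDl// mulr_ge0.
pose t := 4 * C / del; have t0 : 0 < t by rewrite divr_gt0// mulr_gt0.
pose eps := del / (8 * C); have e0 : 0 < eps by rewrite divr_gt0// mulr_gt0.
pose Q := 4 * t * (Hm + 1); have Q0 : 0 < Q by rewrite /Q; apply: mulr_gt0; [exact: mulr_gt0|lra].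
have d0 : 0 < del / (4 * Q) by rewrite divr_gt0// mulr_gt0.
have /cvgrPdist_le/(_ _ d0)[M1 _ hM1] := cvg_eigen_sum onb L2psi.
pose M := maxn M1 N.
have := hM1 M (leq_maxl _ _); rewrite sub0r normrN => hE.
have {}hE := le_trans (ler_norm _) hE.
have := resolvent_sum_ge M s0 e0 mH H_itv t0.
set E := \int[leb]_(x in B1) _ in hE *; rewrite -/(A M) => hA.
have E0 : 0 <= E by exact: L2_sqr_ge0.
have hA2 : - del <= A M.
  apply: le_trans hA; rewrite lerN2.
  have u1 : Hm * (t * (4 * E)) <= del / 4.
    apply: (@le_trans _ _ (Q * E)).
      have : 0 <= t * E by rewrite mulr_ge0// ltW.
      by rewrite /Q; nra.
    apply: (@le_trans _ _ (Q * (del / (4 * Q)))); first by rewrite ler_wpM2l// ltW.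
    by apply: eq_leW; field; rewrite gt_eqF.
  have u2 : Hm * (t^-1 * fine (leb B1)) <= del / 4.
    rewrite /t invf_div mulrCA -/(Hm * _); apply: (@le_trans _ _ (del / (4 * C) * C)).
      by rewrite ler_wpM2l ?divr_ge0 ?mulr_ge0 ?(ltW del0) ?(ltW C0)// /C; lra.
    by apply: eq_leW; field; rewrite gt_eqF.
  have u3 : Hm * (2 * eps * fine (leb B1)) <= del / 4.
    rewrite mulrCA; apply: (@le_trans _ _ (2 * eps * C)).
      by apply: ler_wpM2l; [apply: mulr_ge0; [lra|exact: ltW]|rewrite /C; lra].
    by apply: eq_leW; rewrite /eps; field; rewrite gt_eqF.
  rewrite !mulrDr; lra.
have AN : A M = A N + \sum_(N <= k < M) s / (s + m k) * (coef H k * coef psi k).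
  by rewrite /A (@big_cat_nat _ _ _ N 0 M)//= leq_maxr.
have tl : \sum_(N <= k < M) s / (s + m k) * (coef H k * coef psi k) <= s / (s + m 0%N) * rest N.
  apply: (@le_trans _ _ (s / (s + m 0%N) * \sum_(N <= k < M) `|coef H k * coef psi k|)); last first.
    by rewrite ler_wpM2l ?divr_ge0 ?(ltW s0) ?(ltW (sm 0%N))//; apply: tail_le; exact: leq_maxr.
  rewrite mulr_sumr; apply: ler_sum => k _; apply: (le_trans (ler_norm _)).
  rewrite normrM ler_wpM2r// ger0_norm ?divr_ge0 ?(ltW s0) ?(ltW (sm k))//.
  by rewrite ler_wpM2l ?(ltW s0)// lef_pV2 ?posrE// lerD2l eigenvalue_ge.
by rewrite -/(A N); lra.
Qed.

(** [sum_ge] is integrated against [weight]: the factors s/(s + m_k) become multiples of m_k^(-sg),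
    the error becomes m_0^(-sg) [rest] N, and N tends to infinity. Positivity is thus inherited from
    the resolvents. *)
Lemma frac_positivity g : inv_frac_lap phi m sg psi g -> 0 <= \int[leb]_(x in B1) (H x * g x).
Proof.
move=> hg; have [[L2g _] _] := hg.
pose kern a x := weight sg x * (expR x / (expR x + a)).
have ik a : 0 < a -> mu.-integrable setT (EFin \o kern a) by exact: integrable_kern.
have Ik a : 0 < a -> \int[mu]_x kern a x = a `^ (- sg) * frac_const sg by exact: frac_constE.
have K0 := frac_const_gt0 sg01.
have key N : - (m 0%N `^ (- sg) * rest N) <= \sum_(0 <= k < N) coef H k * coef g k.
  rewrite -(ler_pM2r K0) mulr_suml.
  have S M : mu.-integrable setT (fun x => (\sum_(0 <= k < M) (coef H k * coef psi k) * kern (m k) x)%:E) /\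
      \int[mu]_x (\sum_(0 <= k < M) (coef H k * coef psi k) * kern (m k) x) = \sum_(0 <= k < M) coef H k * coef g k * frac_const sg.
    elim: M => [|M [iM IM]].
      split; first by under eq_fun do rewrite big_nil; exact: integrable0.
      by rewrite big_nil /Rintegral integral0_eq// => x _; rewrite big_nil.
    have iZ := integrableZl measurableT (coef H M * coef psi M) (ik _ (eigenvalue_gt0 M)).
    split.
      apply: (eq_integrable measurableT _ _ _ (integrableD measurableT iM iZ)) => x _ /=.
      by rewrite big_nat_recr//= EFinD.
    under eq_Rintegral do rewrite big_nat_recr//=.
    rewrite RintegralD// IM big_nat_recr//= RintegralZl//; last exact: ik (eigenvalue_gt0 M).
    by rewrite (Ik _ (eigenvalue_gt0 M)) (coef_inv_frac_lap M hg); ring.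
  have [iN <-] := S N.
  rewrite mulNr -mulrA (mulrC (rest N)) mulrA -(Ik _ eigenvalue0_gt0) mulrC -mulNr.
  rewrite -(RintegralZl (- rest N) measurableT (ik _ eigenvalue0_gt0)).
  apply: le_Rintegral => //.
    by apply: (eq_integrable measurableT _ _ _ (integrableZl measurableT (- rest N) (ik _ eigenvalue0_gt0))) => x _.
  move=> x _; have h1 := sum_ge N (expR_gt0 x); have w0 := ltW (weight_gt0 sg x).
  have := ler_wpM2l w0 h1; rewrite mulr_sumr => h2.
  rewrite /kern; apply: (@le_trans _ _ (weight sg x * - (expR x / (expR x + m 0%N) * rest N))).
    by apply: eq_leW; move: (expR x / _) (weight _ _) (rest _) => *; ring.
  by apply: le_trans h2 _; apply: eq_leW; apply: eq_bigr => k _; move: (expR x / _) (weight _ _) (coef H k) (coef psi k) => *; ring.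
have c2 : (fun N => - (m 0%N `^ (- sg) * rest N)) @ \oo --> (0 : R).
  rewrite -[X in _ --> X]oppr0 -(mulr0 (m 0%N `^ (- sg))).
  by apply: cvgN; apply: cvgM; [exact: cvg_cst|exact: rest_cvg].
by apply: (ler_cvg_to c2 (parseval onb L2H L2g)); exact: nearW.
Qed.

End positivity.

End comparison.

End dirichlet_basis_theory.

(** * Flat functions *)

Section flat_functions.
Variable R : realType.

(** The derivatives of e^(-1/t), extended by 0, stay in the span of this family, see
    [is_derive_flat]. *)
Definition flat j (t : R) : R := if 0 < t then t^-1 ^+ j * expR (- t^-1) else 0.

Lemma flat_ge0 j t : 0 <= flat j t.
Proof.
rewrite /flat; case: ifP => // t0; apply: mulr_ge0; last exact: expR_ge0.
by rewrite exprn_ge0// invr_ge0 ltW.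
Qed.

Lemma flat_gt0 j t : 0 < t -> 0 < flat j t.
Proof. by move=> t0; rewrite /flat t0 mulr_gt0 ?expR_gt0// exprn_gt0// invr_gt0. Qed.

Lemma flat_le0 j t : t <= 0 -> flat j t = 0.
Proof. by move=> t0; rewrite /flat ltNge t0. Qed.

Lemma flat_le j t : flat j t <= j.+2%:R ^+ j.+2 * t ^+ 2.
Proof.
have [t0|t0] := ltP 0 t; last by rewrite flat_le0//; apply: mulr_ge0; [exact: exprn_ge0|exact: sqr_ge0].
rewrite /flat t0; set u := t^-1; have u0 : 0 < u by rewrite invr_gt0.
have k0 : 0 < j.+2%:R :> R by rewrite ltr0n.
have h : u ^+ j.+2 <= j.+2%:R ^+ j.+2 * expR u.
  have e : expR u = expR (u / j.+2%:R) ^+ j.+2.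
    by rewrite -expRM_natl; congr expR; rewrite mulrCA mulfV ?mulr1// gt_eqF.
  rewrite e -exprMn lerXn2r// ?nnegrE ?mulr_ge0 ?expR_ge0 ?(ltW u0)// ?(ltW k0)//.
  rewrite mulrC -ler_pdivrMr//; apply: le_trans (expR_ge1Dx (u / j.+2%:R)).
  by rewrite lerDr ler01.
have ut : u * t = 1 by rewrite mulVf// gt_eqF.
have e0 := expR_gt0 u.
apply: (@le_trans _ _ (u ^+ j.+2 / expR u * t ^+ 2)); last first.
  by rewrite ler_wpM2r ?sqr_ge0// ler_pdivrMr.
have -> : u ^+ j.+2 / expR u * t ^+ 2 = u ^+ j / expR u * (u * t) ^+ 2 by rewrite !exprS; ring.
by rewrite ut expr1n mulr1 expRN.
Qed.

Lemma is_derive_flat j t : is_derive (t : R) (1 : R) (flat j) (- j%:R * flat j.+1 t + flat j.+2 t).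
Proof.
have [t0|t0|t0] := ltgtP t 0.
- rewrite !flat_le0 ?(ltW t0)// mulr0 addr0.
  apply: near_eq_is_derive (is_derive_cst (0 : R) t (1 : R)); near=> y.
  by rewrite flat_le0// ltW//; near: y; exact: lt_nbhsl.
- have tn : t != 0 by rewrite gt_eqF.
  have di := @is_derive1V R id t _ tn (is_derive_id t (1 : R)).
  have de := @is_derive1_compE R expR (fun y => - y^-1) t _ _ (is_derive_expR _) (is_derive1N di).
  have dp := @is_derive1_compE R (fun y => y ^+ j) (fun y => y^-1) t _ _ (is_derive1X _ j) di.
  have d := is_derive1M dp de.
  have d2 : is_derive t (1 : R) (flat j) (- j%:R * flat j.+1 t + flat j.+2 t).
    apply: near_eq_is_derive (is_derive_eq d _).
      by near=> y; rewrite /flat ifT//; near: y; exact: lt_nbhsr.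
    rewrite /flat t0; case: j {de dp d} => [|j] /=.
      by rewrite expr0; move: (expR _) => e; field.
    rewrite !exprS; move: (t^-1 ^+ j) (expR _) (j.+1%:R : R) => p e q; field.
    by [].
  by [].
rewrite t0 !flat_le0// mulr0 addr0; apply: is_derive0E => e e0.
pose C := j.+2%:R ^+ j.+2 + 1 : R; have C0 : 0 < C by rewrite ltr_wpDl// exprn_ge0.
exists (e / C); first exact: divr_gt0.
move=> h; rewrite ltr_pdivlMr// => hC; rewrite (flat_le0 _ (lexx 0)) mul0r !subr0 ger0_norm ?flat_ge0//.
apply: le_trans (flat_le j h) _; rewrite -(real_normK (num_real h)).
have n0 := normr_ge0 h; rewrite expr2 mulrA ler_wpM2r//; apply: le_trans (ltW hC).
by rewrite mulrC ler_wpM2l// /C; lra.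
Unshelve. all: by end_near. Qed.

End flat_functions.

(** * Bump functions, and pointwise signs from integrals *)

Section bump.
Variables (R : realType) (n : nat).
Local Notation leb := (lebesgue_rV R n).
Local Notation B1 := (@B1 R n).
Local Notation cB1 := (@cB1 R n).
Local Notation enorm := (@enorm R n).

(** A syntactic class closed under partial derivatives, so that smoothness of its members reduces to
    their continuity. *)
Inductive flat_expr : ('rV[R]_n -> R) -> Prop :=
| flat_cst c : flat_expr (fun=> c)
| flat_coord i : flat_expr (fun x => x ord0 i)
| flat_add f g : flat_expr f -> flat_expr g -> flat_expr (fun x => f x + g x)
| flat_mul f g : flat_expr f -> flat_expr g -> flat_expr (fun x => f x * g x)
| flat_comp j g : flat_expr g -> flat_expr (fun x => flat j (g x)).

Lemma flat_expr_continuous g : flat_expr g -> continuous g.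
Proof.
elim=> [c|i|f h _ cf _ ch|f h _ cf _ ch|j h _ ch].
- exact: cst_continuous.
- exact: cont_coord.
- exact: (@contD _ _ f h).
- exact: (@contM _ _ f h).
- apply: (@cont_comp _ _ _ h (flat j)) => // t.
  exact: derive_cont (is_derive_flat j t).
Qed.

Lemma flat_expr_derive g i : flat_expr g ->
  exists2 g', flat_expr g' & forall x, is_derive x (delta_mx ord0 i) g (g' x).
Proof.
elim=> [c|k|f h hf [f' ef df] hh [h' eh dh]|f h hf [f' ef df] hh [h' eh dh]|j h hh [h' eh dh]].
- by exists (fun=> 0); [exact: flat_cst|move=> x; exact: is_derive_cst].
- exists (fun=> (k == i)%:R) => [|x]; first exact: flat_cst.
  apply/is_derive_toline; rewrite (_ : (fun t : R => _) = (fun t => (k == i)%:R * t + x ord0 k)); last first.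
    by apply/funext => t; rewrite !mxE eqxx/= mulrC.
  have := is_derive1D (is_derive1Z (k == i)%:R (is_derive_id (0 : R) (1 : R))) (is_derive_cst (x ord0 k) (0 : R) (1 : R)).
  by rewrite addr0 mulr1.
- by exists (fun x => f' x + h' x) => [|x]; [exact: flat_add|exact: is_deriveV_add].
- exists (fun x => f' x * h x + f x * h' x) => [|x]; last exact: is_deriveV_mul.
  by apply: flat_add; exact: flat_mul.
- exists (fun x => (- j%:R * flat j.+1 (h x) + flat j.+2 (h x)) * h' x) => [|x].
    apply: flat_mul => //; apply: flat_add; last exact: flat_comp.
    by apply: flat_mul; [exact: flat_cst|exact: flat_comp].
  exact: (is_deriveV_comp (is_derive_flat j (h x)) (dh x)).
Qed.

Lemma flat_expr_smooth g : flat_expr g -> smooth setT g.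
Proof.
move=> eg k; elim: k g eg => [|k IH] g eg.
  by split=> // x _; exact: flat_expr_continuous.
split=> [x _|i]; first exact: flat_expr_continuous.
have [g' eg' dg] := flat_expr_derive i eg.
split=> [x _|]; first by case: (dg x).
rewrite (_ : partial i g = g'); first exact: IH.
by apply/funext => x; exact: (@derive_val _ _ _ _ _ _ _ (dg x)).
Qed.

Lemma ball_enorm (a x : 'rV[R]_n) b : 0 < b -> enorm (x - a) <= b / 2 -> ball a b x.
Proof.
move=> b0 h; split=> // i j; rewrite ord1 /ball/= distrC.
have := coord_le_enorm (x - a) j; rewrite !mxE; lra.
Qed.

Lemma bump_exists (a : 'rV[R]_n) (U : set 'rV[R]_n) : B1 a -> nbhs a U ->
  exists psi, [/\ test_fun psi, forall x, 0 <= psi x, 0 < psi a & forall x, psi x != 0 -> U x].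
Proof.
move=> aB aU; have /nbhs_ballP[b /= b0 hb] : nbhs a (U `&` B1) by apply: filterI => //; exact: nbhs_B1.
pose q (x : 'rV[R]_n) := (b / 2) ^+ 2 + - 1 * \sum_i (x ord0 i + - a ord0 i) * (x ord0 i + - a ord0 i).
have qE x : q x = (b / 2) ^+ 2 - enorm (x - a) ^+ 2.
  by rewrite /q sqr_enorm mulN1r; congr (_ - _); apply: eq_bigr => i _; rewrite !mxE expr2.
have fq : flat_expr q.
  apply: flat_add; first exact: flat_cst.
  apply: flat_mul; first exact: flat_cst.
  elim: (index_enum _) => [|i r IH].
    rewrite (_ : (fun x => _) = fun=> 0); first exact: flat_cst.
    by apply/funext => x; rewrite big_nil.
  rewrite (_ : (fun x => _) = (fun x : 'rV[R]_n => (x ord0 i + - a ord0 i) * (x ord0 i + - a ord0 i) +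
      \sum_(j <- r) (x ord0 j + - a ord0 j) * (x ord0 j + - a ord0 j))).
    apply: flat_add => //.
    by apply: flat_mul; apply: flat_add; [exact: flat_coord|exact: flat_cst|exact: flat_coord|exact: flat_cst].
  by apply/funext => x; rewrite big_cons.
have b2 : 0 <= b / 2 by lra.
have qball x : 0 <= q x -> (U `&` B1) x.
  rewrite qE subr_ge0 => h; apply: hb; apply: ball_enorm => //.
  by rewrite -(ler_pXn2r (n := 2))// nnegrE ?enorm_ge0.
exists (fun x => flat 0 (q x)); split.
- split; first by apply: flat_expr_smooth; exact: flat_comp.
  exists (cB1 `&` [set x | 0 <= q x]); split.
  + by apply: compact_level; exact: flat_expr_continuous.
  + by move=> x [_ /qball[]].
  + move=> x xK; apply: flat_le0; rewrite leNgt; apply/negP => q0; apply: xK.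
    by split; [apply: B1_cB1; case: (qball x (ltW q0))|exact: ltW].
- by move=> x; exact: flat_ge0.
- by apply: flat_gt0; rewrite qE subrr enorm0 expr0n/= subr0 exprn_gt0//; lra.
- move=> x px; suff : 0 <= q x by case/qball.
  by rewrite leNgt; apply/negP => q0; move: px; rewrite flat_le0 ?eqxx// ltW.
Qed.

Lemma Rintegral_B1_gt0 (h : 'rV[R]_n -> R) a : B1 a -> leb.-integrable B1 (EFin \o h) ->
  (forall x, B1 x -> 0 <= h x) -> {for a, continuous h} -> 0 < h a -> 0 < \int[leb]_(x in B1) h x.
Proof.
move=> aB ih h0 ch ha; have mB := @measurable_B1 R n.
have ha2 : h a / 2 < h a by lra.
have hn : \forall x \near a, h a / 2 < h x by exact: (cvgr_gt _ ch _ ha2).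
have /nbhs_ballP[b /= b0 hb] : nbhs a ([set x | h a / 2 < h x] `&` B1) by apply: filterI => //; exact: nbhs_B1.
pose Q : set 'rV[R]_n := [set x | forall i, `](a ord0 i - b), (a ord0 i + b)[%classic (x ord0 i)].
have Qb x : Q x -> h a / 2 < h x /\ B1 x.
  move=> xQ; apply: hb; split=> // i j; rewrite ord1 /ball/=.
  by have := xQ j; rewrite /= in_itv/= => /andP[h1 h2]; rewrite ltr_norml; lra.
have mQ : measurable Q.
  rewrite (_ : Q = \bigcap_(i in [set: 'I_n]) ((fun x : 'rV[R]_n => x ord0 i) @^-1` `](a ord0 i - b), (a ord0 i + b)[)).
    apply: fin_bigcap_measurable; first exact: finite_finset.
    by move=> i _; rewrite -[X in measurable X]setTI; exact: measurable_rV_coord.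
  by apply/seteqP; split => x hx i; [move=> _; exact: hx|exact: hx].
have lQ : (0 < leb Q)%E.
  rewrite (lebesgue_rV_box (a := fun i => `](a ord0 i - b), (a ord0 i + b)[%classic))//.
  elim/big_ind: _ => //; first by move=> x y; exact: mule_gt0.
  move=> i _; rewrite lebesgue_measure_itv/= lte_fin ifT; last lra.
  by rewrite -EFinB lte_fin; lra.
have QB : Q `<=` B1 by move=> x /Qb[].
have c0 : 0 < h a / 2 by lra.
rewrite -lte_fin /Rintegral fineK; last exact: integrable_fin_num.
have mh : measurable_fun B1 (EFin \o h) by case/integrableP: ih.
apply: (@lt_le_trans _ _ ((h a / 2)%:E * leb Q)%E); first by rewrite mule_gt0.
rewrite -(integral_cst leb mQ).
apply: (@le_trans _ _ (\int[leb]_(x in Q) (h x)%:E)%E).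
  apply: ge0_le_integral => //.
  - by move=> x _; rewrite lee_fin ltW.
  - exact: measurable_funS mh.
  - by move=> x /Qb[h1 _]; rewrite lee_fin ltW.
by apply: ge0_subset_integral => // x xB; rewrite lee_fin h0.
Qed.

Lemma ge0_of_test (w : 'rV[R]_n -> R) : continuous w ->
  (forall psi, test_fun psi -> (forall x, 0 <= psi x) -> 0 <= \int[leb]_(x in B1) (w x * psi x)) ->
  forall x, B1 x -> 0 <= w x.
Proof.
move=> cw hw a aB; rewrite leNgt; apply/negP => wa.
have wn : nbhs a [set x | w x < 0] by exact: (cvgr_lt _ (cw a) _ wa).
have [psi [tpsi psi0 psia psiU]] := bump_exists aB wn.
have cpsi : continuous psi by move=> x; case: tpsi => /(_ 0%N)[c _] _; exact: c.
have cwp : continuous (fun x => - (w x * psi x)).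
  by apply: (@contN _ _ (fun x => w x * psi x)); exact: (@contM _ _ w psi).
have : 0 < \int[leb]_(x in B1) (- (w x * psi x)).
  apply: (@Rintegral_B1_gt0 _ a) => //; first exact: integrable_B1.
  - move=> x _; have [p0|/psiU p0] := eqVneq (psi x) 0; first by rewrite p0 mulr0 oppr0.
    by rewrite -mulNr mulr_ge0// oppr_ge0 ltW.
  - exact: cwp.
  - by rewrite -mulNr mulr_gt0// oppr_gt0.
under eq_Rintegral do rewrite -mulN1r.
rewrite RintegralZl; [|exact: measurable_B1|].
  by have := hw psi tpsi psi0; lra.
by apply: integrable_B1; exact: (@contM _ _ w psi).
Qed.

Lemma ge0_of_ae (w : 'rV[R]_n -> R) : continuous w -> {ae leb, forall x, B1 x -> 0 <= w x} ->
  forall x, B1 x -> 0 <= w x.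
Proof.
move=> cw hw a aB; rewrite leNgt; apply/negP => wa.
pose h x := Num.max (- w x) 0.
have ch : continuous h.
  apply: (@cont_comp _ _ _ (fun x => - w x) (fun y : R => Num.max y 0)); first exact: (@contN _ _ w).
  by move=> y; apply: (@continuous_max _ _ id (cst 0)) => [z|z]; [exact: cvg_id|exact: cvg_cst].
have h0 x : 0 <= h x by rewrite le_max lexx orbT.
have : 0 < \int[leb]_(x in B1) h x.
  apply: (@Rintegral_B1_gt0 _ a) => //; first exact: integrable_B1.
  - exact: ch.
  - by rewrite lt_max oppr_gt0 wa.
suff -> : \int[leb]_(x in B1) h x = 0 by rewrite ltxx.
rewrite /Rintegral (_ : (\int[leb]_(x in B1) (h x)%:E = 0)%E)//.
have mh : measurable_fun B1 (EFin \o h).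
  by apply/measurable_EFinP; apply: measurable_funTS; exact: cont_measurable_rV.
rewrite (@ae_eq_integral _ _ _ _ _ (cst 0%E) (EFin \o h) (@measurable_B1 R n) mh)//; first exact: integral0.
apply: filterS hw => x wx xB; congr EFin; apply/max_idPr.
by rewrite oppr_le0 wx.
Qed.

End bump.

(** * The nonlinearity, and admissibility of the limit of the iteration *)

Lemma superlinear_minorant (R : realType) (f : R -> R) A : (forall t, 0 < f t) ->
  f t / t @[t --> +oo] --> +oo -> 0 <= A -> exists2 B, 0 <= B & forall t, 0 <= t -> A * t - B <= f t.
Proof.
move=> f0 /cvgryPge/(_ A)[M [_ hM]] A0; pose T := Num.max M 0 + 1.
have T0 : 0 < T by rewrite /T ltr_wpDl// le_max lexx orbT.
exists (A * T) => [|t t0]; first by rewrite mulr_ge0// ltW.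
have [tT|tT] := ltP t T.
  apply: le_trans (ltW (f0 t)); rewrite -mulrBr mulr_ge0_le0//; lra.
have t1 : 0 < t by lra.
have Mt : M < t by apply: lt_le_trans tT; rewrite /T ltr_pwDr// le_max lexx.
have := hM t Mt; rewrite /= ler_pdivlMr// => h; have := mulr_ge0 A0 (ltW T0); lra.
Qed.

Lemma nondecreasing_derive_ge0 (R : realType) (f : R -> R) t d : {homo f : x y / x <= y} ->
  is_derive t (1 : R) f d -> 0 <= d.
Proof.
move=> f_nd [df <-]; apply: (cvgr_to_ge df); near=> h.
have hn : h != 0 by near: h; exact: nbhs_dnbhs_neq.
rewrite /= /GRing.scale/= mulr1; have [h0|h0] := leP 0 h.
  by rewrite mulr_ge0 ?invr_ge0// subr_ge0 f_nd// lerDr.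
by rewrite mulr_le0// ?invr_le0 ?(ltW h0)// subr_le0 f_nd// gerDr ltW.
Unshelve. all: by end_near. Qed.

Section picard_admissible.
Variables (R : realType) (N : nat).
Hypothesis N_gt0 : (0 < N)%N.
Variable sg : R.
Hypothesis sg01 : 0 < sg < 1.
Variables (f df : R -> R).
Hypothesis f_gt0 : forall t, 0 < f t.
Hypothesis f_nd : {homo f : x y / x <= y}.
Hypothesis f_df : forall t : R, is_derive t (1 : R) f (df t).
Hypothesis cdf : continuous df.

Let cf : continuous f. Proof. by move=> t; exact: derive_cont (f_df t). Qed.

Lemma lipschitz_below Mu : exists2 Lf, 0 <= Lf &
  forall a b : R, 0 <= a -> a <= b -> b <= Mu -> f b - f a <= Lf * (b - a).
Proof.
have [M0|M0] := leP 0 Mu; last by exists 0 => // a b *; lra.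
have [c _ hc] := EVT_max M0 (contW cdf).
have d0 : 0 <= df c by exact: nondecreasing_derive_ge0 f_nd (f_df c).
exists (df c) => // a b a0 ab bM.
have : df c * a - f a <= df c * b - f b.
  apply: (@mono_derive _ a b (fun t => df c * t - f t) (fun t => df c * 1 - df t)) => //.
  - apply: contW; apply: (@contB _ _ (fun t : R => df c * t) f) => //.
    by apply: (@contM _ _ (cst (df c)) (fun t : R => t)) => ?; [exact: cvg_cst|exact: cvg_id].
  - by move=> t /andP[at_ tb]; rewrite mulr1 subr_ge0; apply: hc; rewrite in_itv/=; apply/andP; split; lra.
by rewrite mulrBr; lra.
Qed.

Variables (lam : nat -> R) (Lam : R).
Hypothesis lam_gt0 : forall k, 0 < lam k.
Hypothesis lam_lt : forall k, lam k < lam k.+1.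
Hypothesis lam_ltL : forall k, lam k < Lam.
Hypothesis lam_cvg : lam @ \oo --> Lam.
Variable Mu : R.
Hypothesis picard_le : forall k r, picard N sg f lam k r <= Mu.

Local Notation U := (picard_lim N sg f lam).

Lemma picard_lim_facts : [/\ continuous U, forall r, U r = Lam * frac_inv N sg (f \o U) r,
  forall r, 0 <= U r & forall p q, 0 <= p -> p <= q -> U q <= U p].
Proof.
have [Lf Lf0 f_lip] := lipschitz_below Mu; split.
- exact: (@cont_picard_lim R N N_gt0 sg sg01 f cf f_gt0 f_nd lam Lam lam_gt0 lam_lt lam_ltL Mu Lf Lf0 f_lip picard_le).
- exact: (@picard_limE R N N_gt0 sg sg01 f cf f_gt0 f_nd lam Lam lam_gt0 lam_lt Mu picard_le lam_cvg).
- exact: (@picard_lim_ge0 R N N_gt0 sg sg01 f cf f_gt0 f_nd lam lam_gt0 lam_lt Mu picard_le).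
- exact: (@picard_lim_ni R N N_gt0 sg sg01 f cf f_gt0 f_nd lam lam_gt0 lam_lt Mu picard_le).
Qed.

Lemma picard_lim_admissible : admissible N sg (fun r => Lam * f (U r)) /\
  forall r, U r = frac_inv N sg (fun r => Lam * f (U r)) r.
Proof.
have [Lf Lf0 f_lip] := lipschitz_below Mu.
have [cU UE U0 Uni] := picard_lim_facts.
have L0 : 0 < Lam := lt_trans (lam_gt0 0%N) (lam_ltL 0%N).
have cfU : continuous (f \o U) by exact: (@cont_comp _ _ _ U f cU cf).
have scale c (G : R -> R) r : continuous G -> (forall p, 0 <= p <= 1 -> 0 <= G p) ->
    frac_inv N sg (fun p => c * G p) r = c * frac_inv N sg G r.
  move=> cG G0; have := @frac_inv_lin R N N_gt0 sg sg01 c 0 G G r cG cG G0 G0.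
  rewrite mul0r addr0 => <-; congr (frac_inv N sg _ r).
  by apply/funext => p; rewrite mul0r addr0.
pose g t := Lam * f t; pose dg t := Lam * df t.
have cg : continuous g by apply: (@contM _ _ (cst Lam) f) => // ?; exact: cvg_cst.
have cdg : continuous dg by apply: (@contM _ _ (cst Lam) df) => // ?; exact: cvg_cst.
have g_dg (t : R) : is_derive t (1 : R) g (dg t) by exact: is_derive1Z.
have dg0 t : 0 <= dg t by apply: mulr_ge0; [exact: ltW|exact: nondecreasing_derive_ge0 f_nd (f_df t)].
have g_nd : {homo g : x y / x <= y} by move=> x y xy; apply: ler_wpM2l; [exact: ltW|exact: f_nd].
have gU0 p : 0 <= p <= 1 -> 0 <= (g \o U) p by move=> _; apply: mulr_ge0; exact: ltW.
have gUni p q : 0 <= p -> p <= q -> q <= 1 -> (g \o U) q <= (g \o U) p.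
  by move=> p0 pq _; apply: g_nd; exact: Uni.
have UgE r : U r = frac_inv N sg (g \o U) r.
  have fU0 p : 0 <= p <= 1 -> 0 <= (f \o U) p by move=> _; exact: (ltW (f_gt0 (U p))).
  by rewrite UE -(scale Lam _ r cfU fU0).
have [A A0 hA] := f_lim_lip N_gt0 sg01 cf f_gt0 f_nd lam_gt0 lam_lt lam_ltL Lf0 f_lip picard_le.
have LA0 : 0 <= Lam * A by apply: mulr_ge0 => //; exact: ltW.
have gUlip (r1 p q : R) : r1 < 1 -> 0 <= p -> p <= q -> q <= r1 ->
    (g \o U) p - (g \o U) q <= Lam * A / (1 - r1) ^+ 2 * (q - p).
  move=> h1 h2 h3 h4; have := ler_wpM2l (ltW L0) (hA r1 p q h1 h2 h3 h4).
  rewrite mulrBr !mulrA; exact.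
have b01 : 0 < (2^-1 : R) < 1 by apply/andP; split; lra.
have PL k r : picard N sg f lam k r <= U r := @picard_le_lim R N N_gt0 sg sg01 f cf f_gt0 f_nd lam lam_gt0 lam_lt Mu picard_le k r.
have UM r : U r <= Mu.
  have c := @picard_cvg R N N_gt0 sg sg01 f cf f_gt0 f_nd lam lam_gt0 lam_lt Mu picard_le r.
  by apply: (cvgr_to_le c); exact: nearW.
have P0 k r : 0 <= picard N sg f lam k r := picard_ge0 N sg f_gt0 lam_gt0 k r.
have cP k : continuous (picard N sg f lam k) := @cont_picard R N N_gt0 sg sg01 f cf f_gt0 lam k.
have stable (eta : R -> R) : continuous eta -> (forall r, 0 <= r <= 1 -> 0 <= eta r) ->
    (forall r, 2^-1 <= r <= 1 -> eta r = 0) ->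
    \int[lebesgue_measure]_x (weight sg x * pairing N (fun r => dg (U (clamp 2^-1 r)) * eta r) (fun r => dg (U (clamp 2^-1 r)) * eta r) x) <=
    itg 0 1 (fun r => r ^+ N * (dg (U (clamp 2^-1 r)) * eta r ^+ 2)).
  move=> ceta eta0 etab; rewrite -[leLHS]mul1r.
  (* Applied to g = Lam f, with parameters lam k / Lam tending to 1. The iterates are shifted by
     one, since [picard_lt_lim] and [picard_gap] concern k.+1. *)
  apply: (@stability R N N_gt0 sg sg01 g dg (fun k => picard N sg f lam k.+1) U (fun k => lam k / Lam) 1 (Lam * Lf) 2^-1) => //.
  - move=> k r r1; exact: (@picard_lt_lim R N N_gt0 sg sg01 f cf f_gt0 f_nd lam Lam lam_gt0 lam_lt lam_ltL Mu Lf Lf0 f_lip picard_le lam_cvg).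
  - move=> r; rewrite (cvg_shiftS (fun k => picard N sg f lam k r)).
    exact: (@picard_cvg R N N_gt0 sg sg01 f cf f_gt0 f_nd lam lam_gt0 lam_lt Mu picard_le).
  - by move=> k; exact: divr_gt0.
  - rewrite -(divff (x := Lam)) ?gt_eqF//; apply: cvgM => //; exact: cvg_cst.
  - move=> k r; rewrite /g -mulrBr -mulrA ler_wpM2l ?(ltW L0)//; exact: f_lip.
  - move=> k r; rewrite /g.
    have c1 : continuous (fun p => f (U p) - f (picard N sg f lam k.+1 p)).
      apply: (@contB _ _ (fun p => f (U p)) (fun p => f (picard N sg f lam k.+1 p))) => //.
      exact: (@cont_comp _ _ _ (picard N sg f lam k.+1) f).
    have c2 p : 0 <= p <= 1 -> 0 <= f (U p) - f (picard N sg f lam k.+1 p).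
      by move=> _; rewrite subr_ge0; exact: f_nd.
    rewrite (_ : (fun p => _) = (fun p => Lam * (f (U p) - f (picard N sg f lam k.+1 p)))); last first.
      by apply/funext => p; rewrite mulrBr.
    rewrite (scale Lam _ r c1 c2) mulrA divfK ?gt_eqF//.
    exact: (@picard_gap R N N_gt0 sg sg01 f cf f_gt0 f_nd lam Lam lam_gt0 lam_lt lam_ltL Mu Lf Lf0 f_lip picard_le lam_cvg).
split; last exact: UgE.
split => //; first exact: (@cont_comp _ _ _ U g cU cg).
move=> zeta dzeta cz cdz dz zb z0.
have [i1 i2] := @weighted_inequality R N N_gt0 sg sg01 g dg U cg g_dg cdg dg0 cU gU0 gUni (Lam * A) LA0 gUlip UgE 2^-1 b01 stable zeta dzeta cz cdz dz zb z0.
split; [exact: i1| |exact: i2].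
exact: (@integrable_drop_energy R N N_gt0 sg sg01 g U cg cU gU0 gUni (Lam * A) LA0 gUlip 2^-1 b01 dzeta cdz).
Qed.

End picard_admissible.

(** * Comparison of the minimal solution with the radial one *)

Section radial_solution.
Variables (R : realType) (N : nat).
Hypothesis N_gt0 : (0 < N)%N.
Variable sg : R.
Hypothesis sg01 : 0 < sg < 1.
Local Notation leb := (lebesgue_rV R N.+1).
Local Notation B1 := (@B1 R N.+1).
Local Notation cB1 := (@cB1 R N.+1).
Local Notation enorm := (@enorm R N.+1).
Variables (phi : nat -> 'rV[R]_N.+1 -> R) (m : nat -> R).
Hypothesis hphi : dirichlet_basis phi m.
Local Notation coef := (coef phi).
Local Notation K := (frac_const sg).

Let mB : measurable B1 := @measurable_B1 R N.+1.
Let K0 : 0 < K := frac_const_gt0 sg01.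

Lemma radial_continuous (F : R -> R) : continuous F -> continuous (fun x => F (enorm x)).
Proof. by move=> cF; exact: (@cont_comp _ _ _ enorm F (@cont_enorm R N.+1) cF). Qed.

(** Parseval on both sides: the factor K m_k^(-sg) may be placed on the coefficient of F or on that
    of psi. *)
Lemma frac_dual (F : R -> R) (psi g : 'rV[R]_N.+1 -> R) : continuous F ->
  (forall p, 0 <= p <= 1 -> 0 < F p) -> (forall p q, 0 <= p -> p <= q -> q <= 1 -> F q <= F p) ->
  L2 psi -> inv_frac_lap phi m sg psi g ->
  \int[leb]_(x in B1) (frac_inv N sg F (enorm x) * psi x) = K * \int[leb]_(x in B1) (F (enorm x) * g x).
Proof.
move=> cF F0 Fni hpsi hg; have [[L2g _] _] := hg.
have F0' p : 0 <= p <= 1 -> 0 <= F p by move=> /F0/ltW.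
have [MF hMF] := F_bounded cF.
have cI : continuous (frac_inv N sg F) := @cont_frac_inv R N N_gt0 sg sg01 F cF F0' MF hMF.
have LI := L2_continuous (radial_continuous cI); have LF := L2_continuous (radial_continuous cF).
have p1 := parseval (onb hphi) LI hpsi.
have p2 : (fun M => K * \sum_(0 <= k < M) coef (fun x => F (enorm x)) k * coef g k) @ \oo -->
    K * \int[leb]_(x in B1) (F (enorm x) * g x).
  by apply: cvgM; [exact: cvg_cst|exact: (parseval (onb hphi) LF L2g)].
rewrite (_ : (fun M => _) = (fun M => \sum_(0 <= k < M) coef (fun x => frac_inv N sg F (enorm x)) k * coef psi k)) in p2.
  exact: (cvg_unique _ p1 p2).
apply/funext => M; rewrite mulr_sumr; apply: eq_bigr => k _.
rewrite [in RHS]/Defs.coef (frac_inv_coef N_gt0 sg01 cF F0 Fni (eigenvalue_gt0 hphi k) (eigen hphi k)).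
by rewrite (coef_inv_frac_lap hphi k hg) /Defs.coef; ring.
Qed.

Variables (f : R -> R).
Hypothesis f_gt0 : forall t, 0 < f t.
Hypothesis f_nd : {homo f : x y / x <= y}.
Hypothesis cf : continuous f.

Lemma test_fun_continuous (psi : 'rV[R]_N.+1 -> R) : test_fun psi -> continuous psi.
Proof. by move=> [/(_ 0%N)[c _] _] x; exact: c. Qed.

Section comparison.
Variables (lambda : R) (u : 'rV[R]_N.+1 -> R).
Hypothesis lambda_gt0 : 0 < lambda.
Hypothesis hu : minimal_solution phi m sg f lambda u.

Lemma minimal_ext : exists2 w : 'rV[R]_N.+1 -> R, continuous w & forall x, B1 x -> w x = u x.
Proof. by case: hu => _ cu _; have [w cw wE] := extend_cB1 cu; exists w => // x /B1_cB1/wE. Qed.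

Lemma weak_equation w psi g : (forall x, B1 x -> w x = u x) -> test_fun psi -> inv_frac_lap phi m sg psi g ->
  \int[leb]_(x in B1) (w x * psi x) = lambda * \int[leb]_(x in B1) (f (w x) * g x).
Proof.
move=> wE tpsi hg; case: hu => -[_ _ [_ _ _ weak]] _ _.
transitivity (\int[leb]_(x in B1) (u x * psi x)).
  by apply: eq_Rintegral => x; rewrite inE => xB; rewrite wE.
rewrite (weak psi g tpsi hg); congr (_ * _).
by apply: eq_Rintegral => x; rewrite inE => xB; rewrite wE.
Qed.

(** Weak comparison: tested with psi >= 0, the difference becomes the integral of the nonnegative
    function lambda f(w) - c K F against the fractional inverse of psi, so [frac_positivity] gives
    the sign and [ge0_of_test] makes it pointwise. *)
Lemma minimal_ge (F : R -> R) w c : continuous w -> (forall x, B1 x -> w x = u x) -> 0 <= c ->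
  continuous F -> (forall p, 0 <= p <= 1 -> 0 < F p) -> (forall p q, 0 <= p -> p <= q -> q <= 1 -> F q <= F p) ->
  (forall x, B1 x -> c * K * F (enorm x) <= lambda * f (w x)) ->
  forall x, B1 x -> c * frac_inv N sg F (enorm x) <= w x.
Proof.
move=> cw wE c0 cF F0 Fni H0.
have F0' p : 0 <= p <= 1 -> 0 <= F p by move=> /F0/ltW.
have [MF hMF] := F_bounded cF.
have cI : continuous (frac_inv N sg F) := @cont_frac_inv R N N_gt0 sg sg01 F cF F0' MF hMF.
have cIe := radial_continuous cI; have cFe := radial_continuous cF.
have cfw : continuous (fun x => f (w x)) by exact: (@cont_comp _ _ _ w f).
have cD : continuous (fun x => w x - c * frac_inv N sg F (enorm x)).
  apply: (@contB _ _ w (fun x => c * frac_inv N sg F (enorm x))) => //.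
  by apply: (@contM _ _ (cst c) (fun x => frac_inv N sg F (enorm x))) => //; exact: cst_continuous.
have cH : continuous (fun x => lambda * f (w x) - c * K * F (enorm x)).
  apply: (@contB _ _ (fun x => lambda * f (w x)) (fun x => c * K * F (enorm x))).
    by apply: (@contM _ _ (cst lambda) (fun x => f (w x))) => //; exact: cst_continuous.
  by apply: (@contM _ _ (cst (c * K)) (fun x => F (enorm x))) => //; exact: cst_continuous.
suff h : forall x, B1 x -> 0 <= w x - c * frac_inv N sg F (enorm x) by move=> x xB; rewrite -subr_ge0 h.
apply: ge0_of_test => // psi tpsi psi0.
have cpsi := test_fun_continuous tpsi; have L2psi := L2_continuous cpsi.
have [g hg] := inv_frac_lap_exists hphi sg01 L2psi; have [[L2g _] _] := hg.
have Lw := L2_continuous cw; have LI := L2_continuous cIe; have LF := L2_continuous cFe; have Lf := L2_continuous cfw.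
have -> : \int[leb]_(x in B1) ((w x - c * frac_inv N sg F (enorm x)) * psi x) =
    \int[leb]_(x in B1) ((lambda * f (w x) - c * K * F (enorm x)) * g x).
  transitivity (\int[leb]_(x in B1) (1 * (w x * psi x) + - c * (frac_inv N sg F (enorm x) * psi x))).
    by apply: eq_Rintegral => x _; ring.
  rewrite (Rintegral_lin _ _ (L2_mul Lw L2psi) (L2_mul LI L2psi)) (weak_equation wE tpsi hg) (frac_dual cF F0 Fni L2psi hg).
  rewrite mul1r mulrA mulNr -(Rintegral_lin lambda (- (c * K)) (L2_mul Lf L2g) (L2_mul LF L2g)).
  by apply: eq_Rintegral => x _; ring.
have [M _ hM] := bounded_cB1 cH.
apply: (@frac_positivity R N.+1 phi m hphi sg sg01 psi L2psi (fun x _ => psi0 x) _ M) => //.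
  by apply: measurable_funTS; exact: cont_measurable_rV.
move=> x xB; rewrite subr_ge0 H0//=; apply: le_trans (ler_norm _) _; apply: hM; exact: B1_cB1.
Qed.

(** Strictly increasing to lambda/K; the division by K compensates for [frac_inv] being K times the
    fractional inverse. *)
Let lam (k : nat) : R := lambda / K * (1 - (k.+2%:R)^-1).

Let LK0 : 0 < lambda / K. Proof. exact: divr_gt0. Qed.

Lemma radial_parameter : [/\ forall k, 0 < lam k, forall k, lam k < lam k.+1,
  forall k, lam k < lambda / K & lam @ \oo --> lambda / K].
Proof.
have p k : 0 < (k.+2%:R)^-1 :> R by rewrite invr_gt0 ltr0n.
split=> [k|k|k|].
- rewrite /lam mulr_gt0// subr_gt0 invf_lt1 ?ltr0n// ltr1n//.
- by rewrite /lam ltr_pM2l// ltrD2l ltrN2 ltf_pV2 ?posrE ?ltr0n// ltr_nat.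
- by rewrite /lam -[ltRHS]mulr1 ltr_pM2l//; have := p k; lra.
- rewrite -[X in _ --> X]mulr1 -[X in _ * X]subr0; apply: cvgM; first exact: cvg_cst.
  apply: cvgB; first exact: cvg_cst.
  have := @cvg_harmonic R; rewrite -(cvg_shiftS (@harmonic R)); exact.
Qed.

Lemma picard_le_minimal w k x : continuous w -> (forall x, B1 x -> w x = u x) -> B1 x ->
  picard N sg f lam k (enorm x) <= w x.
Proof.
move=> cw wE; have [l0 _ lL _] := radial_parameter.
have w0 y : B1 y -> 0 <= w y.
  (* Comparison with c = 0 gives w >= 0, the start of the induction. *)
  have h := @minimal_ge (fun=> 1) w 0 cw wE (lexx 0).
  have c1 : continuous (fun _ : R => 1 : R) by exact: contC.
  move=> yB; have := h c1 (fun _ _ => ltr01) (fun _ _ _ _ _ => lexx _); rewrite mul0r.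
  move=> hh; rewrite -(mul0r (frac_inv N sg (fun=> 1) (enorm y))); apply: hh => // z zB.
  by rewrite !mul0r mulr_ge0// ltW.
elim: k x => [|k IH] x xB; first exact: w0.
rewrite picardS; apply: minimal_ge => //.
- exact: ltW.
- exact: (@cont_comp _ _ _ (picard N sg f lam k) f (@cont_picard R N N_gt0 sg sg01 f cf f_gt0 lam k) cf).
- by move=> p _; exact: f_gt0.
- by move=> p q p0 pq _; apply: f_nd; exact: (@picard_ni R N N_gt0 sg sg01 f cf f_gt0 f_nd lam l0).
- move=> y yB; have : lam k * K <= lambda by rewrite -ler_pdivlMr//; exact: ltW.
  move=> lk; apply: ler_pM => //; first by apply: mulr_ge0; exact: ltW.
  + exact: (ltW (f_gt0 _)).
  + by apply: f_nd; exact: IH.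
Qed.

Lemma picard_bounded : exists Mu, forall k r, picard N sg f lam k r <= Mu.
Proof.
have [w cw wE] := minimal_ext; have [M M0 hM] := bounded_cB1 cw.
exists M => k r; have [r1|r1] := ltP `|r| 1; last by rewrite picard_ge1// ltW.
have xr : enorm (r *: delta_mx ord0 ord0 + 0) = `|r| by exact: enorm_delta.
rewrite -picard_norm -xr; have xB : B1 (r *: delta_mx ord0 ord0 + 0) by rewrite /Defs.B1/= xr.
apply: le_trans (picard_le_minimal k cw wE xB) _.
by apply: le_trans (ler_norm _) (hM _ (B1_cB1 xB)).
Qed.

Variable df : R -> R.
Hypothesis f_df : forall t : R, is_derive t (1 : R) f (df t).
Hypothesis cdf : continuous df.

(** [frac_dual] turns the fixed-point equation of U into the weak formulation. Minimality then
    compares u with U almost everywhere only, and the continuous extension w of u carries the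
    inequality to every point. *)
Lemma minimal_solution_radial : exists U : R -> R, exists F : R -> R,
  [/\ admissible N sg F, forall r, U r = frac_inv N sg F r, forall r, F r = lambda / K * f (U r),
    continuous U & (forall r, 0 <= U r) /\ (forall p q, 0 <= p -> p <= q -> U q <= U p)] /\
  forall x, B1 x -> 0 <= u x <= U (enorm x).
Proof.
have [l0 l1 lL lc] := radial_parameter; have [Mu hMu] := picard_bounded.
set U := picard_lim N sg f lam.
have [cU UE U0 Uni] := @picard_lim_facts R N N_gt0 sg sg01 f df f_gt0 f_nd f_df cdf lam (lambda / K) l0 l1 lL lc Mu hMu.
have [adm UF] := @picard_lim_admissible R N N_gt0 sg sg01 f df f_gt0 f_nd f_df cdf lam (lambda / K) l0 l1 lL lc Mu hMu.
exists U, (fun r => lambda / K * f (U r)); split; first by split.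
have [w cw wE] := minimal_ext.
have cUe := radial_continuous cU; have cfU : continuous (f \o U) by exact: (@cont_comp _ _ _ U f cU cf).
have cfUe := radial_continuous cfU.
have [p0 cp0 p0E] := eigenfun_ext hphi 0.
have fin (G : 'rV[R]_N.+1 -> R) : continuous G -> (forall x, B1 x -> 0 <= G x) ->
    (\int[leb]_(x in B1) (G x * phi 0%N x)%:E < +oo)%E.
  move=> cG G0; have cGp : continuous (fun x => G x * p0 x) by exact: (@contM _ _ G p0).
  have /integrableP[_] := integrable_B1 cGp; apply: le_lt_trans; apply: eq_leW.
  apply: eq_integral => x; rewrite inE => xB; rewrite /= p0E; last exact: B1_cB1.
  rewrite ger0_norm// mulr_ge0 ?G0//; case: hphi => _ _ _ /(_ x xB); exact: ltW.
have weak : weak_solution phi m sg f lambda (fun x => U (enorm x)).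
  split.
  - by apply: measurable_funTS; exact: cont_measurable_rV.
  - apply: le_lt_trans (fin _ cUe (fun x _ => U0 (enorm x))); apply: eq_leW.
    by apply: eq_integral => x _; rewrite ger0_norm ?U0.
  - by apply: (fin _ cfUe) => x _; exact: (ltW (f_gt0 _)).
  - move=> psi g tpsi hg; have L2psi := L2_continuous (test_fun_continuous tpsi).
    have fUni p q : 0 <= p -> p <= q -> q <= 1 -> (f \o U) q <= (f \o U) p.
      by move=> a b _; apply: f_nd; exact: Uni.
    have h := frac_dual cfU (fun p _ => f_gt0 (U p)) fUni L2psi hg.
    transitivity (lambda / K * \int[leb]_(x in B1) (frac_inv N sg (f \o U) (enorm x) * psi x)).
      rewrite -RintegralZl//; first by apply: eq_Rintegral => x _; rewrite {1}/U UE mulrA.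
      have cI : continuous (frac_inv N sg (f \o U)).
        have [MF hMF] := F_bounded cfU.
        by apply: (@cont_frac_inv R N N_gt0 sg sg01 (f \o U) cfU _ MF hMF) => p _; exact: (ltW (f_gt0 _)).
      exact: (L2_mul (L2_continuous (radial_continuous cI)) L2psi).
    by rewrite h mulrA divfK// gt_eqF.
case: hu => _ _ /(_ _ weak) hmin x xB; apply/andP; split.
  rewrite -wE//; have := picard_le_minimal 0 cw wE xB; exact.
rewrite -wE// -subr_ge0; apply: (@ge0_of_ae R N.+1 (fun x => U (enorm x) - w x)) => //.
  exact: (@contB _ _ (fun x => U (enorm x)) w).
by apply: filterS hmin => y hy yB; rewrite subr_ge0 wE// hy.
Qed.

End comparison.

(** Testing with the first eigenfunction gives iU = lambda a iF. As lambda a >= q0, the minorant of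
    f with slope 2/q0 makes the right side at least 2 iU minus a constant, so iU is bounded
    uniformly for lambda above lams/2. Monotonicity of U then bounds U(1/2), through a tent function
    supported in |x| <= 1/2. *)
Lemma half_radius_bound lams : f t / t @[t --> +oo] --> +oo -> 0 < lams -> exists C0, forall (lambda : R) (U F : R -> R), lams / 2 < lambda < lams ->
  admissible N sg F -> (forall r, U r = frac_inv N sg F r) -> (forall r, F r = lambda / K * f (U r)) ->
  continuous U -> (forall r, 0 <= U r) -> (forall p q, 0 <= p -> p <= q -> U q <= U p) -> U 2^-1 <= C0.
Proof.
move=> f_superlinear lams0; have m0 := eigenvalue0_gt0 hphi; pose a := m 0%N `^ (- sg); have a0 : 0 < a by exact: powR_gt0.
pose q0 := lams / 2 * a; have q00 : 0 < q0 by rewrite mulr_gt0// divr_gt0.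
have q20 : 0 <= 2 / q0 by rewrite divr_ge0// ltW.
have [B B0 hB] := superlinear_minorant f_gt0 f_superlinear q20.
have [p cp pE] := eigenfun_ext hphi 0.
have phi0 x : B1 x -> 0 < p x by move=> xB; rewrite pE; [case: hphi => _ _ _; exact|exact: B1_cB1].
pose ip := \int[leb]_(x in B1) (1 * p x).
pose c x := Num.max (2^-1 - enorm x) 0.
have cc : continuous c.
  apply: (@radial_continuous (fun r => Num.max (2^-1 - r) 0)) => y.
  apply: (@continuous_max _ _ (fun r : R => 2^-1 - r) (cst 0)) => [z|z]; last exact: cvg_cst.
  by apply: cvgB; [exact: cvg_cst|exact: cvg_id].
have c0 x : 0 <= c x by rewrite le_max lexx orbT.
have ccp : continuous (fun x => c x * p x) by exact: (@contM _ _ c p).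
pose ic := \int[leb]_(x in B1) (c x * p x).
have b0 : B1 0 by rewrite /Defs.B1/= enorm0 ltr01.
have ic0 : 0 < ic.
  apply: (@Rintegral_B1_gt0 R N.+1 _ 0) => //; first exact: integrable_B1.
  - by move=> x xB; rewrite mulr_ge0// ltW// phi0.
  - exact: ccp.
  - by rewrite mulr_gt0 ?phi0// /c enorm0 subr0 lt_max invr_gt0 ltr0n.
exists (2 * q0 * B * ip / ic) => lambda U F /andP[l1 l2] [cF F0 Fni _] UF FE cU U0 Uni.
have l0 : 0 < lambda by apply: lt_trans l1; rewrite divr_gt0.
have F1 r : 0 < F r by rewrite FE mulr_gt0// divr_gt0.
have cUe := @radial_continuous U cU; have cfU : continuous (f \o U) by exact: (@cont_comp _ _ _ U f cU cf).
have cfUe := @radial_continuous (f \o U) cfU.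
have L1 : L2 (fun _ : 'rV[R]_N.+1 => 1 : R) by apply: L2_continuous; exact: cst_continuous.
have Lp := L2_continuous cp; have LU := L2_continuous cUe; have Lf := L2_continuous cfUe; have Lc := L2_continuous cc.
pose iU := \int[leb]_(x in B1) (U (enorm x) * p x).
pose iF := \int[leb]_(x in B1) (f (U (enorm x)) * p x).
have ip0 : 0 <= ip by apply: Rintegral_ge0 => x xB; rewrite mul1r ltW// phi0.
have iU0 : 0 <= iU by apply: Rintegral_ge0 => x xB; rewrite mulr_ge0// ltW// phi0.
have e1 : iU = lambda * a * iF.
  transitivity (\int[leb]_(x in B1) (frac_inv N sg F (enorm x) * phi 0%N x)).
    by apply: eq_Rintegral => x; rewrite inE => xB; rewrite UF pE//; exact: B1_cB1.
  rewrite (frac_inv_coef N_gt0 sg01 cF (fun r _ => F1 r) Fni m0 (eigen hphi 0)).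
  transitivity (K * a * \int[leb]_(x in B1) (lambda / K * (f (U (enorm x)) * p x))).
    congr (_ * _); apply: eq_Rintegral => x; rewrite inE => xB.
    by rewrite FE pE; [ring|exact: B1_cB1].
  rewrite RintegralZl//; last exact: (L2_mul Lf Lp).
  have Kn : K != 0 by rewrite gt_eqF.
  by rewrite -/iF; field.
have e2 : 2 / q0 * iU - B * ip <= iF.
  rewrite -mulNr -(Rintegral_lin (2 / q0) (- B) (L2_mul LU Lp) (L2_mul L1 Lp)).
  apply: le_Rintegral => //.
  - apply: (eq_integrable mB _ _ _ (integrableD mB (integrableZl mB (2 / q0) (L2_mul LU Lp)) (integrableZl mB (- B) (L2_mul L1 Lp)))) => x _ //=.
  - exact: (L2_mul Lf Lp).
  - move=> x xB; have := hB _ (U0 (enorm x)); have := phi0 x xB => p0 h.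
    by have := ler_wpM2r (ltW p0) h; rewrite mul1r; move: (2 / q0) => z; rewrite mulrBl mulNr mulrA.
have q1 : q0 <= lambda * a by rewrite /q0 ler_pM2r// ltW.
have q2 : lambda * a <= 2 * q0 by rewrite /q0 mulrA ler_pM2r//; lra.
have e3 : iU <= 2 * q0 * B * ip.
  have h1 : 2 * iU <= lambda * a * (2 / q0 * iU).
    rewrite mulrA; apply: ler_wpM2r => //; rewrite mulrCA ler_peMr//.
    by rewrite ler_pdivlMr ?mul1r.
  have h2 : lambda * a * (2 / q0 * iU - B * ip) <= iU by rewrite [leRHS]e1; apply: ler_wpM2l => //; apply: mulr_ge0; exact: ltW.
  have h3 : lambda * a * (B * ip) <= 2 * q0 * (B * ip) by rewrite ler_wpM2r// mulr_ge0.
  by move: h1 h2 h3; rewrite mulrBr !mulrA; lra.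
have e4 : U 2^-1 * ic <= iU.
  rewrite /ic -(RintegralZl _ mB (L2_mul Lc Lp)); apply: le_Rintegral => //.
  - by apply: (eq_integrable mB _ _ _ (integrableZl mB (U 2^-1) (L2_mul Lc Lp))) => x _.
  - exact: (L2_mul LU Lp).
  - move=> x xB; rewrite mulrA ler_wpM2r ?(ltW (phi0 x xB))//.
    have e0 := enorm_ge0 x; have [xh|xh] := leP (enorm x) 2^-1.
      rewrite -[leRHS]mulr1; apply: ler_pM => //; first exact: Uni.
      by rewrite /c ge_max ler01 andbT; lra.
    by rewrite /c (max_idPr _) ?mulr0// subr_le0 ltW.
by rewrite ler_pdivlMr//; exact: le_trans e4 e3.
Qed.

End radial_solution.

(** * The extremal solution *)

Section main_estimate.
Variables (R : realType) (N : nat).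
Hypothesis N_gt0 : (0 < N)%N.
Variable s : R.
Hypothesis s01 : 0 < s < 1.
Variable f : R -> R.
Variables (phi : nat -> 'rV[R]_N.+1 -> R) (m : nat -> R) (us : 'rV[R]_N.+1 -> \bar R).
Hypothesis f_gt0 : forall t, 0 < f t.
Hypothesis f_smooth : smooth_fun f.
Hypothesis f_nd : {homo f : x y / x <= y}.
Hypothesis f_superlinear : f t / t @[t --> +oo] --> +oo.
Hypothesis hphi : dirichlet_basis phi m.
Hypothesis hus : extremal_solution phi m s f us.
Local Notation leb := (lebesgue_rV R N.+1).
Local Notation B1 := (@B1 R N.+1).
Local Notation enorm := (@enorm R N.+1).

Let f_df (t : R) : is_derive t (1 : R) f (derive1 f t).
Proof.
by apply: DeriveDef; [have := @f_smooth 0%N t; rewrite derive1n0|rewrite derive1E].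
Qed.

Let cdf : continuous (derive1 f).
Proof.
move=> t; have dt : is_derive t (1 : R) (derive1 f) ('D_1 (derive1 f) t).
  by apply: DeriveDef => //; have := @f_smooth 1%N t; rewrite derive1n1.
exact: derive_cont dt.
Qed.

Let cf : continuous f. Proof. by move=> t; exact: derive_cont (f_df t). Qed.

(** A bound valid for every admissible pair (U, F) with U(1/2) controlled passes to us(x) along a
    sequence of parameters tending to lams from below. The regularity proof then only deals with an
    abstract admissible F. *)
Lemma extremal_bound : measurable_fun B1 us /\ exists C0, forall x C, B1 x ->
  (forall U F, admissible N s F -> (forall r, U r = frac_inv N s F r) -> frac_inv N s F 2^-1 <= C0 ->
     (forall p, 0 <= p -> U p <= U 0) -> U (enorm x) <= C) -> (0 <= us x <= C%:E)%E.
Proof.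
have [lams [ul [hlams hul hlim]]] := hus.
have lams0 : 0 < lams.
  have [[lam [lam0 hl]]|h] := pselect (exists lam, 0 < lam /\ exists u, bounded_solution phi m s f lam u).
    apply: (lt_le_trans lam0); rewrite -lee_fin hlams; apply: ereal_sup_ubound.
    by exists lam.
  move: hlams; rewrite /extremal_parameter (_ : [set lam%:E | lam in _] = set0) ?ereal_sup0//.
  by apply/seteqP; split=> // y [lam hl _]; apply: h; exists lam.
(* The factor 1/3 keeps every l j above lams/2, as [half_radius_bound] requires. *)
pose l (j : nat) : R := lams * (1 - harmonic j / 3).
have lE j : lams / 2 < l j < lams.
  have h0 : 0 < harmonic j :> R by rewrite /harmonic/= invr_gt0 ltr0n.
  have h1 : harmonic j <= 1 :> R by rewrite /harmonic/= invf_le1 ?ler1n ?ltr0n.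
  by rewrite /l; apply/andP; split; nra.
have lcvg : l @ \oo --> lams^'-.
  have c : l @ \oo --> lams.
    rewrite -[X in _ --> X]mulr1 -[X in _ * X]subr0 -[X in _ - X](mul0r 3^-1).
    apply: cvgM; first exact: cvg_cst.
    apply: cvgB; first exact: cvg_cst.
    by apply: cvgM; [exact: cvg_harmonic|exact: cvg_cst].
  move=> V hV; have hV' : nbhs lams (fun t => t < lams -> V t) := hV.
  have h : \forall j \near \oo, l j < lams -> V (l j) := c _ hV'.
  suff : \forall j \near \oo, V (l j) by [].
  by apply: filterS h => j; apply; case/andP: (lE j).
have ucvg x : B1 x -> (fun j => (ul (l j) x)%:E) @ \oo --> us x.
  by move=> xB; exact: (cvg_comp _ _ lcvg (hlim x xB)).
have l0 j : 0 < l j < lams by have /andP[a b] := lE j; rewrite b andbT; apply: lt_trans a; rewrite divr_gt0.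
split.
  apply: (@emeasurable_fun_cvg _ _ _ B1 (fun j x => (ul (l j) x)%:E)) => [j|x xB]; last exact: ucvg.
  have [[_ _ [mu _ _ _]] _ _] := hul _ (l0 j).
  exact/measurable_EFinP.
have [C0 hC0] := half_radius_bound N_gt0 s01 hphi f_gt0 cf f_superlinear lams0.
exists C0 => x C xB hC.
have bnd j : 0 <= ul (l j) x <= C.
  have /andP[lj0 _] := l0 j.
  have [U [F [[adm UF FE cU [U0 Uni]] hu]]] := minimal_solution_radial N_gt0 s01 hphi f_gt0 f_nd cf lj0 (hul _ (l0 j)) f_df cdf.
  have /andP[u0 u1] := hu x xB; rewrite u0; apply: le_trans u1 _.
  apply: (hC U F adm UF) => [|p p0]; last exact: Uni.
  by rewrite -UF; apply: (hC0 (l j) U F (lE j) adm UF FE cU U0 Uni).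
have e := cvg_lim _ (ucvg x xB); rewrite -e//; apply/andP; split.
  apply: lime_ge; first exact: cvgP (ucvg x xB).
  by apply: nearW => j; rewrite lee_fin; case/andP: (bnd j).
apply: lime_le; first exact: cvgP (ucvg x xB).
by apply: nearW => j; rewrite lee_fin; case/andP: (bnd j).
Qed.

Let q := Num.sqrt (N%:R : R).
Let w := Num.sqrt (2 * (s + 1)).

Let q2 : q ^+ 2 = N%:R. Proof. by rewrite sqr_sqrtr. Qed.
Let q1 : 1 <= q.
Proof. by rewrite -(sqrtr1 R) ler_wsqrtr// ler1n. Qed.
Let w2 : w ^+ 2 = 2 * (s + 1).
Proof. by rewrite sqr_sqrtr//; have /andP[a b] := s01; lra. Qed.
Let w0 : 0 <= w. Proof. exact: sqrtr_ge0. Qed.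

Lemma extremal_Linf : N.+1%:R < 2 * (s + 2 + w) -> Linf us.
Proof.
rewrite -natr1 -q2 => hn; have /andP[s0 s1] := s01.
have [mus [C0 hC0]] := extremal_bound; split=> //.
(* Since n = q^2 + 1 and 2(s + 2 + w) = (w + 1)^2 + 1, the dimension condition reads q < w + 1. *)
have qw : q < w + 1 by have := q1; have := w0; have := w2; have := hn; nra.
(* The limit exponent for beta = q; the inequality k0 < 2s says (q - 1)^2 < w^2, again q < w + 1. *)
pose k0 := (q ^+ 2 - 1) / 2 + s - q.
have k02 : k0 < 2 * s by rewrite /k0; have := q1; have := w0; have := w2; nra.
(* An exponent strictly between k0 and 2s; the maximum with s keeps it positive, as [power_bound]
   requires. *)
pose k := Num.max s ((k0 + 2 * s) / 2).
have ks : s <= k by rewrite le_max lexx.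
have kk : (k0 + 2 * s) / 2 <= k by rewrite le_max lexx orbT.
have k2 : k < 2 * s by rewrite gt_max; apply/andP; split; lra.
pose beta := (N%:R - 1) / 2 + s - k.
have be : (N%:R - 1) / 2 + s - beta = k by rewrite /beta; ring.
have bq : beta < q by rewrite /beta -q2; move: kk k02; rewrite /k0; lra.
have b0 : 0 <= beta.
  rewrite subr_ge0 ge_max -q2; have := q1 => h; apply/andP; split; first by nra.
  by rewrite /k0; nra.
have b2 : beta ^+ 2 < N%:R by rewrite -q2; nra.
have kp : 0 < (N%:R - 1) / 2 + s - beta by rewrite be; lra.
have [K K0 hK] := power_bound N_gt0 s01 C0 b0 b2 kp.
rewrite be in hK.
have k0' : 0 < k by lra.
have [C hC] := frac_inv_center_bound N_gt0 s01 k0' k2 K0.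
exists C; apply: aeW => x xB.
have /andP[u0 u1] : (0 <= us x <= C%:E)%E.
  apply: hC0 => // U F adm UF h12 Um.
  apply: (le_trans (Um _ (enorm_ge0 x))); rewrite UF.
  have [cF F0 _ _] := adm; apply: hC => // p p01; exact: hK.
by rewrite gee0_abs.
Qed.

Lemma extremal_pow_bound nu : 2 * (s + 2 + w) <= N.+1%:R -> N.+1%:R / 2 - 1 - q - s < nu ->
  exists C : R, 0 < C /\ forall x, B1 x -> (us x <= if x == 0%R then +oo else (C * enorm x `^ (- nu))%:E)%E.
Proof.
have Nq : N.+1%:R = q ^+ 2 + 1 :> R by rewrite q2 natr1.
rewrite Nq => hn hnu; have /andP[s0 s1] := s01.
have [mus [C0 hC0]] := extremal_bound.
have qw : w + 1 <= q by rewrite leNgt; apply/negP => h; have := q1; have := w0; have := w2; have := hn; nra.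
(* The critical exponent. With beta = q - del one gets k - 2s = mu0 + del, which is at most nu;
   capping del by q keeps beta nonnegative. *)
pose mu0 := (q ^+ 2 + 1) / 2 - 1 - q - s.
have mu00 : 0 <= mu0 by rewrite /mu0; have := q1; have := w0; have := w2; nra.
pose del := Num.min (nu - mu0) q.
have d0 : 0 < del by rewrite lt_min; have := q1; move: hnu; rewrite -/mu0; lra.
have d1 : del <= nu - mu0 by rewrite ge_min lexx.
have d2 : del <= q by rewrite ge_min lexx orbT.
pose beta := q - del.
have b0 : 0 <= beta by rewrite /beta; lra.
have b2 : beta ^+ 2 < N%:R by rewrite -q2 /beta; have := q1; nra.
pose k := (N%:R - 1) / 2 + s - beta.
have kE : k = mu0 + del + 2 * s by rewrite /k /beta /mu0 -q2; field.
have k2 : 2 * s < k by rewrite kE; lra.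
have kp : 0 < (N%:R - 1) / 2 + s - beta by rewrite -/k; lra.
have [K K0 hK] := power_bound N_gt0 s01 C0 b0 b2 kp.
rewrite -/k in hK.
have kN : k < N.+1%:R by rewrite /k Nq -q2; have := sqr_ge0 q; lra.
have [C hC] := frac_inv_pow_bound N_gt0 s01 k2 kN K0.
exists (Num.max C 1); split=> [|x xB]; first by rewrite lt_max ltr01 orbT.
case: ifPn => [_|x0]; first exact: leey.
have e0 : 0 < enorm x by rewrite enorm_gt0.
have e1 : enorm x <= 1 by exact: B1_cB1.
suff /andP[] : (0 <= us x <= (Num.max C 1 * enorm x `^ (- nu))%:E)%E by [].
apply: hC0 => // U F adm UF h12 Um; rewrite UF.
have [cF F0 Fni _] := adm.
have h := hC F cF F0 Fni (fun p p01 => hK F adm h12 p p01) (enorm x).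
apply: le_trans (h _) _; first by rewrite e0.
apply: (@le_trans _ _ (Num.max C 1 * enorm x `^ (2 * s - k))).
  by rewrite ler_wpM2r ?powR_ge0// le_max lexx.
rewrite ler_wpM2l ?le_max ?ler01 ?orbT//.
have -> : 2 * s - k = - nu + (nu - mu0 - del) by rewrite kE; ring.
rewrite powRD; last by apply/implyP => _; rewrite gt_eqF.
rewrite ler_piMr ?powR_ge0//.
have p0 : 0 <= nu - mu0 - del by rewrite subr_ge0.
have := ge0_ler_powR p0; move=> /(_ (enorm x) 1); rewrite powR1 !nnegrE.
by apply=> //; exact: ltW.
Qed.

End main_estimate.

Theorem theorem1p4 (R : realType) (n : nat) (s : R) (f : R -> R)
    (phi : nat -> 'rV[R]_n -> R) (m : nat -> R) (us : 'rV[R]_n -> \bar R)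
    (hn : (2 <= n)%N) (hs : 0 < s < 1)
    (f_gt0 : forall t, 0 < f t) (f_smooth : smooth_fun f)
    (f_nd : {homo f : x y / x <= y})
    (f_superlinear : f t / t @[t --> +oo] --> +oo)
    (hphi : dirichlet_basis phi m)
    (hus : extremal_solution phi m s f us) :
  (n%:R < 2 * (s + 2 + Num.sqrt (2 * (s + 1))) -> Linf us) /\
  (2 * (s + 2 + Num.sqrt (2 * (s + 1))) <= n%:R ->
   forall mu : R, n%:R / 2 - 1 - Num.sqrt (n%:R - 1) - s < mu ->
   exists C : R, 0 < C /\
     forall x, B1 x ->
       (us x <= if x == 0%R then +oo else (C * enorm x `^ (- mu))%:E)%E).
Proof.
case: n hn phi us hphi hus => [//|N] N0 phi us hphi hus; rewrite ltnS in N0.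
split; first exact: (extremal_Linf N0 hs f_gt0 f_smooth f_nd f_superlinear hphi hus).
have e : N.+1%:R - 1 = N%:R :> R by rewrite -natr1 addrK.
move=> h nu; rewrite e => hnu.
exact: (extremal_pow_bound N0 hs f_gt0 f_smooth f_nd f_superlinear hphi hus h hnu).
Qed.
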